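(* Consider local holomorphic surfaces $S\subset\mathbb{C}^3_{x,y,u}$ with nowhere vanishing Hessian lying in branch $B_{2\cdot1}$, i.e. with $G_{3,0}\neq0\equiv G_{0,3}$ and $G_{4,0}\neq0$ (see context). Then the following hold. **(1)** The graphed equation normalizes, under $A(3)$, as $$u=xy+\frac{x^3}{6}+\frac{x^4}{24}+I_{3,1}\frac{x^3y}{6}+I_{2,2}\frac{x^2y^2}{4}+I_{1,3}\frac{xy^3}{6}+I_{0,4}\frac{y^4}{24}+\sum_{j+k\geqslant5}I_{j,k}\frac{x^j}{j!}\frac{y^k}{k!},$$ where all $I_{j,k}$ are differential invariants. **(2)** The algebra of differential invariants is generated by $I_{3,1}, I_{2,2}, I_{5,0}$ and all their invariant derivatives $\mathcal{D}_x^{\alpha_1}\mathcal{D}_y^{\alpha_2}(\cdot)$ with $\alpha_1,\alpha_2\in\mathbb{N}$. In particular, $I_{4,1}$ can be solved: $$I_{4,1}=-8I_{3,1}^2+2I_{5,0}I_{3,1}+\mathcal{D}_xI_{3,1}+\tfrac72I_{2,2}-2I_{3,1}.$$ **(3)** The moduli space of all possible homogeneous models in branch $B_{2\cdot1}$ is exactly described, in the space $\mathbb{C}^5\ni(I_{3,1},I_{2,2},I_{5,0},I_{4,1},I_{3,2})$, by the complex algebraic variety of dimension $1$ defined by the $4+3$ equations $$\begin{aligned} (E41)\quad 0&=I_{4,1}+8I_{3,1}^2-\tfrac72I_{2,2}+2I_{3,1}-2I_{5,0}I_{3,1},\\ (E42)\quad 0&=4I_{3,1}I_{2,2}+2I_{3,1}^2-2I_{4,1}I_{3,1}+I_{3,2},\\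 (E43)\quad 0&=12I_{3,1}I_{2,2}-3I_{5,0}I_{2,2}+4I_{2,2}+I_{3,2},\\ (E44)\quad 0&=6I_{2,2}^2+4I_{3,1}I_{2,2}-3I_{4,1}I_{2,2},\\ (F51)\quad 0&=24I_{3,1}^2I_{5,0}-2I_{5,0}^2I_{3,1}-\tfrac{15}{2}I_{2,2}I_{5,0}+7I_{5,0}I_{3,1}+\tfrac{21}{2}I_{2,2}-64I_{3,1}^3+36I_{2,2}I_{3,1}-40I_{3,1}^2-6I_{3,1},\\ (F52)\quad 0&=30I_{2,2}I_{3,1}+72I_{2,2}I_{3,1}^2-18I_{2,2}I_{5,0}I_{3,1}-\tfrac{63}{4}I_{2,2}^2+56I_{3,1}^3-14I_{3,1}^2I_{5,0}+12I_{3,1}^2\\ &\quad+64I_{3,1}^4-32I_{3,1}^3I_{5,0}+4I_{5,0}^2I_{3,1}^2,\\ (F53)\quad 0&=-I_{3,1}\big(-16I_{3,1}^2+4I_{3,1}I_{5,0}+3I_{2,2}-6I_{3,1}\big)\big(-32I_{3,1}^2+8I_{3,1}I_{5,0}+6I_{2,2}-13I_{3,1}\big). \end{aligned}$$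
   Context: $A(3)$ is the group of affine transformations $w\mapsto Mw+b$ of $\mathbb{C}^3_{x,y,u}$, $M\in GL(3,\mathbb{C})$, $b\in\mathbb{C}^3$. All surfaces are local holomorphic graphs $S=\{u=F(x,y)\}$ with $F_{xx}F_{yy}-F_{xy}^2$ nowhere zero, and equivalence is local equivalence (of germs) under $A(3)$. $S$ is homogeneous if, at each point, the affine vector fields tangent to $S$ span the tangent plane of $S$. Branch $B_{2\cdot1}$: for each $p\in S$ some affine map sends $p$ to $0$ and the germ of $S$ at $p$ to a graph $u=xy+G_{3,0}\frac{x^3}{6}+G_{0,3}\frac{y^3}{6}+\sum_{j+k\ge4}G_{j,k}\frac{x^j}{j!}\frac{y^k}{k!}$, unique up to bi-dilations $(x,y,u)\mapsto(\mu x,\lambda y,\mu\lambda u)$, $\lambda,\mu\in\mathbb{C}^*$, and the swap $x\leftrightarrow y$. Branch $B_2$ consists of the surfaces for which (up to the swap) $G_{3,0}\neq0$ at every point and $G_{0,3}\equiv0$ identically on $S$. In branch $B_2$ one further normalizes $G_{3,0}=1$ at each point, giving $u=xy+\frac{x^3}{6}+\sum_{j+k\ge4}G_{j,k}\frac{x^j}{j!}\frac{y^k}{k!}$, unique up to $(x,y,u)\mapsto(\mu x,\mu^2y,\mu^3u)$, $\mu\in\mathbb{C}^*$, under which each $G_{j,k}$ is only rescaled. Branch $B_{2\cdot1}$ is the set of surfaces in $B_2$ with $G_{4,0}\neq0$ at every point; there one normalizes $G_{4,0}=1$. Invariants and invariant derivatives: for $p\in S$ let $\varphi_p\in A(3)$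 be the affine map with $\varphi_p(p)=0$ bringing the germ of $S$ at $p$ to the normal form of (1). $I_{j,k}(p)$ is the corresponding coefficient. For a function $f$ on $S$, $(\mathcal{D}_xf)(p)$ and $(\mathcal{D}_yf)(p)$ denote the partial derivatives at $(x,y)=(0,0)$ with respect to $x$, $y$ of $f\circ\varphi_p^{-1}$, viewed as a function of the coordinates $(x,y)$ parametrizing the normalized graph $\varphi_p(S)$. A differential invariant (of this branch) is a function of the jets of surfaces in the branch unchanged under (the prolonged action of) $A(3)$. ''Generated'' is meant in the sense of Fels–Olver: every differential invariant can locally be expressed as a function of the generators and finitely many of their invariant derivatives. That the moduli space is described by a variety means that $A(3)$-equivalence classes of homogeneous surfaces of the branch correspond one-to-one, through their (constant) invariants, to the points of the variety. *)

(* Defs.v *)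
From HB Require Import structures.
From mathcomp Require Import all_boot all_order all_algebra.
From mathcomp Require Import all_classical all_reals all_analysis.
From mathcomp Require Import complex.
(* Not imported: the notations of mpoly clash with those of analysis. *)
From mathcomp Require mpoly.

Set Implicit Arguments.
Unset Strict Implicit.
Unset Printing Implicit Defensive.

Import Order.TTheory GRing.Theory Num.Theory.
Import numFieldNormedType.Exports.

Local Open Scope classical_set_scope.
Local Open Scope ring_scope.

(* The complex numbers.  The cast makes the metric topology that analysis puts
   on every numFieldType available on R[i] and on its matrices. *)
Definition Cx (R : realType) : numClosedFieldType := R[i]%C.

Section Surfaces.
Variable R : realType.
Notation C := (Cx R).

(* The partial sum, over the multi-indices with all entries < N, of
   the series of the c_m h^m / m!. *)
Definition taylor_sum n (c : {ffun 'I_n -> nat} -> C) (h : 'cV[C]_n)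
    (N : nat) : C :=
  \sum_(m : {ffun 'I_n -> 'I_N})
    c [ffun i => m i : nat] * \prod_i (h i 0 ^+ m i / (m i)`!%:R).

(* f (a + h) is the sum of the c_m h^m / m! for h in a polydisc.  The bound on
   the coefficients is the one of Abel's lemma: it makes the convergence
   absolute on the open polydisc. *)
Definition taylor_at n (f : 'cV[C]_n -> C) (a : 'cV[C]_n)
    (c : {ffun 'I_n -> nat} -> C) : Prop :=
  exists r M : C, 0 < r /\
    (forall m, `|c m| * \prod_i (r ^+ m i / (m i)`!%:R) <= M) /\
    (forall h : 'cV[C]_n, (forall i, `|h i 0| < r) ->
       taylor_sum c h @ \oo --> f (a + h)).

(* Holomorphic functions are those that expand in convergent power series. *)
Definition holomorphic_at n (f : 'cV[C]_n -> C) (a : 'cV[C]_n) : Prop :=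
  exists c, taylor_at f a c.

Definition partial n (i : 'I_n) (f : 'cV[C]_n -> C) (a : 'cV[C]_n) : C :=
  'D_(delta_mx i 0) f a.

Definition double (G : nat -> nat -> C) (m : {ffun 'I_2 -> nat}) : C :=
  G (m 0) (m 1).

Definition partials (F : 'cV[C]_2 -> C) (j k : nat) : 'cV[C]_2 -> C :=
  iter j (partial 0) (iter k (partial 1) F).

Definition point (h : 'cV[C]_2) (u : C) : 'cV[C]_3 :=
  \col_i tnth [tuple h 0 0; h 1 0; u] i.

Definition coord_xy (w : 'cV[C]_3) : 'cV[C]_2 :=
  \col_i tnth [tuple w 0 0; w 1 0] i.

Definition coord_u (w : 'cV[C]_3) : C := w ord_max 0.

(* (M, b) stands for w |-> M w + b, an element of A(3) when M is invertible;
   arbitrary pairs also serve as affine vector fields. *)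
Definition affine : Type := ('M[C]_3 * 'cV[C]_3)%type.

Definition A3 : set affine := [set g | g.1 \in unitmx].

Definition aff (g : affine) (w : 'cV[C]_3) : 'cV[C]_3 := g.1 *m w + g.2.

Definition aff_inv (g : affine) (w : 'cV[C]_3) : 'cV[C]_3 :=
  invmx g.1 *m (w - g.2).

Record graphed := Graphed { dom : set 'cV[C]_2; fn : 'cV[C]_2 -> C }.

Definition graph (S : graphed) : set 'cV[C]_3 :=
  [set w | dom S (coord_xy w) /\ coord_u w = fn S (coord_xy w)].

Definition hessian (F : 'cV[C]_2 -> C) (a : 'cV[C]_2) : C :=
  partials F 2 0 a * partials F 0 2 a - partials F 1 1 a ^+ 2.

(* Connectedness makes S a single local graph: homogeneous surfaces then have
   constant invariants. *)
Definition surface (S : graphed) : Prop :=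
  [/\ open (dom S), connected (dom S), dom S !=set0,
      (forall a, dom S a -> holomorphic_at (fn S) a) &
      (forall a, dom S a -> hessian (fn S) a != 0)].

(* g maps the germ of S at p onto the germ of S' at p' *)
Definition germ_map (g : affine) (S : graphed) (p : 'cV[C]_3)
    (S' : graphed) (p' : 'cV[C]_3) : Prop :=
  aff g p = p' /\ \forall w \near p, graph S w <-> graph S' (aff g w).

Definition germ_equiv (S : graphed) (p : 'cV[C]_3)
    (S' : graphed) (p' : 'cV[C]_3) : Prop :=
  exists2 g, A3 g & germ_map g S p S' p'.

(* g maps p to 0, and the germ of S at p to the germ at 0 of the graph of
   u = \sum_{j,k} G_{j,k} x^j/j! y^k/k! *)
Definition graphs_as (S : graphed) (p : 'cV[C]_3) (g : affine)
    (G : nat -> nat -> C) : Prop :=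
  [/\ A3 g, aff g p = 0 &
   exists2 F : 'cV[C]_2 -> C, taylor_at F 0 (double G) &
     \forall w \near p,
       graph S w <-> coord_u (aff g w) = F (coord_xy (aff g w))].

(* u = xy + G_{3,0} x^3/6 + G_{0,3} y^3/6 + O(4) *)
Definition normal2 (S : graphed) (p : 'cV[C]_3) (g : affine)
    (G : nat -> nat -> C) : Prop :=
  graphs_as S p g G /\
  [/\ [/\ G 0%N 0%N = 0, G 1%N 0%N = 0 & G 0%N 1%N = 0],
      [/\ G 2%N 0%N = 0, G 1%N 1%N = 1 & G 0%N 2%N = 0] &
      G 2%N 1%N = 0 /\ G 1%N 2%N = 0].

(* The swap of x and y being an admissible change of normal form, asking for
   some normal form is asking for the condition up to the swap. *)
Definition in_B2 (S : graphed) : Prop :=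
  surface S /\
  forall p, graph S p ->
    exists g G, [/\ normal2 S p g G, G 3%N 0%N != 0 & G 0%N 3%N = 0].

(* u = xy + x^3/6 + O(4) *)
Definition normal3 (S : graphed) (p : 'cV[C]_3) (g : affine)
    (G : nat -> nat -> C) : Prop :=
  [/\ normal2 S p g G, G 3%N 0%N = 1 & G 0%N 3%N = 0].

Definition in_B21 (S : graphed) : Prop :=
  in_B2 S /\
  forall p, graph S p -> exists g G, normal3 S p g G /\ G 4%N 0%N != 0.

(* u = xy + x^3/6 + x^4/24 + ..., the remaining terms of order 4 being those
   in x^3y, x^2y^2, xy^3, y^4 *)
Definition normal4 (S : graphed) (p : 'cV[C]_3) (g : affine)
    (G : nat -> nat -> C) : Prop :=
  normal3 S p g G /\ G 4%N 0%N = 1.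

(* The pair of phi_p and of the normalized coefficients; a default value is
   taken if there is no normal form. *)
Definition normalization (S : graphed) (p : 'cV[C]_3)
    : affine * (nat -> nat -> C) :=
  xget ((0, 0), fun _ _ => 0) [set gG | normal4 S p gG.1 gG.2].

Definition phi (S : graphed) (p : 'cV[C]_3) : affine := (normalization S p).1.

Definition Icoef (j k : nat) (S : graphed) (p : 'cV[C]_3) : C :=
  (normalization S p).2 j k.

(* The function whose graph near 0 is phi_p(S) *)
Definition normal_fn (S : graphed) (p : 'cV[C]_3) (h : 'cV[C]_2) : C :=
  lim (taylor_sum (double (fun j k => Icoef j k S p)) h @ \oo).

(* i = 0 gives D_x and i = 1 gives D_y. *)
Definition inv_deriv (i : 'I_2) (S : graphed) (f : 'cV[C]_3 -> C)
    (p : 'cV[C]_3) : C :=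
  partial i (fun h => f (aff_inv (phi S p) (point h (normal_fn S p h)))) 0.

Definition jet_index (n : nat) : finType :=
  {jk : 'I_n.+1 * 'I_n.+1 | (jk.1 + jk.2 <= n)%N}.

(* The coordinates are x, y and the u_{j,k} with j + k <= n; the point of
   the surface under (x, y) has u = u_{0,0}. *)
Notation jet_space n := 'cV[C]_(2 + #|jet_index n|).

Definition jet (n : nat) (S : graphed) (p : 'cV[C]_3) : jet_space n :=
  col_mx (coord_xy p)
    (\col_i let jk := val (enum_val i : jet_index n) in
            partials (fn S) jk.1 jk.2 (coord_xy p)).

Definition branch_jets (n : nat) : set (jet_space n) :=
  [set z | exists S p, [/\ in_B21 S, graph S p & z = jet n S p]].

(* J is a differential invariant of order n, defined on the part D of the
   jets of surfaces of the branch.  These jets form a proper subset of the jet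
   space, on which holomorphy means to be locally the restriction of a
   holomorphic function of the jet coordinates.  The prolonged action sends the
   jet of S at p to the jet of g(S) at g(p), where defined. *)
Definition diff_invariant (n : nat) (D : set (jet_space n))
    (J : jet_space n -> C) : Prop :=
  [/\ D `<=` @branch_jets n,
      (forall z, D z -> exists2 f, holomorphic_at f z &
         \forall z' \near z, branch_jets z' -> D z' /\ J z' = f z') &
      (forall g S p S' p', A3 g -> in_B21 S -> in_B21 S' ->
         graph S p -> graph S' p' -> germ_map g S p S' p' ->
         D (jet n S p) ->
         D (jet n S' p') /\ J (jet n S' p') = J (jet n S p))].

(* A function of the pointed surfaces of the branch is a differential
   invariant when it factors through the jets of some order. *)
Definition is_diff_invariant (f : graphed -> 'cV[C]_3 -> C) : Prop :=
  exists n (J : jet_space n -> C), diff_invariant (@branch_jets n) J /\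
    forall S p, in_B21 S -> graph S p -> f S p = J (jet n S p).

Definition generator (i : 'I_3) : graphed -> 'cV[C]_3 -> C :=
  tnth [tuple Icoef 3 1; Icoef 2 2; Icoef 5 0] i.

(* D_x^a1 D_y^a2 applied to the i-th generator, for s = (i, a1, a2) *)
Definition derived_generator (s : 'I_3 * nat * nat) (S : graphed)
    : 'cV[C]_3 -> C :=
  iter s.1.2 (inv_deriv 0 S) (iter s.2 (inv_deriv 1 S) (generator s.1.1 S)).

(* J is, near each jet of its domain, a holomorphic function H of finitely
   many derived generators. *)
Definition locally_generated (n : nat) (D : set (jet_space n))
    (J : jet_space n -> C) : Prop :=
  forall z0, D z0 ->
  exists (K : nat) (s : 'I_K -> 'I_3 * nat * nat)
         (W : set 'cV[C]_K) (H : 'cV[C]_K -> C),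
    [/\ open W, (forall v, W v -> holomorphic_at H v) &
     \forall z \near z0, forall S p, in_B21 S -> graph S p -> jet n S p = z ->
       let v := \col_i derived_generator (s i) S p in W v /\ J z = H v].

Definition tangent_plane (S : graphed) (p : 'cV[C]_3) : set 'cV[C]_3 :=
  [set t | coord_u t = partial 0 (fn S) (coord_xy p) * t 0 0
                       + partial 1 (fn S) (coord_xy p) * t 1 0].

Definition tangent_field (S : graphed) (X : affine) : Prop :=
  forall p, graph S p -> tangent_plane S p (aff X p).

(* The affine vector fields tangent to S form a vector space, so that their
   values at p span the tangent plane when each tangent vector is a value. *)
Definition homogeneous (S : graphed) : Prop :=
  forall p, graph S p -> forall t, tangent_plane S p t ->
    exists2 X, tangent_field S X & aff X p = t.

Definition moduli_point (S : graphed) (p : 'cV[C]_3) : 'cV[C]_5 :=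
  \col_i tnth [tuple Icoef 3 1 S p; Icoef 2 2 S p; Icoef 5 0 S p; Icoef 4 1 S p; Icoef 3 2 S p] i.

Definition moduli_equations (I31 I22 I50 I41 I32 : C) : Prop :=
  [/\ 0 = I41 + 8 * I31 ^+ 2 - 7 / 2 * I22 + 2 * I31 - 2 * I50 * I31,
      0 = 4 * I31 * I22 + 2 * I31 ^+ 2 - 2 * I41 * I31 + I32,
      0 = 12 * I31 * I22 - 3 * I50 * I22 + 4 * I22 + I32 &
      0 = 6 * I22 ^+ 2 + 4 * I31 * I22 - 3 * I41 * I22] /\
  [/\ 0 = 24 * I31 ^+ 2 * I50 - 2 * I50 ^+ 2 * I31 - 15 / 2 * I22 * I50
        + 7 * I50 * I31 + 21 / 2 * I22 - 64 * I31 ^+ 3 + 36 * I22 * I31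
        - 40 * I31 ^+ 2 - 6 * I31,
      0 = 30 * I22 * I31 + 72 * I22 * I31 ^+ 2 - 18 * I22 * I50 * I31
        - 63 / 4 * I22 ^+ 2 + 56 * I31 ^+ 3 - 14 * I31 ^+ 2 * I50
        + 12 * I31 ^+ 2 + 64 * I31 ^+ 4 - 32 * I31 ^+ 3 * I50
        + 4 * I50 ^+ 2 * I31 ^+ 2 &
      0 = - I31
        * (- 16 * I31 ^+ 2 + 4 * I31 * I50 + 3 * I22 - 6 * I31)
        * (- 32 * I31 ^+ 2 + 8 * I31 * I50 + 6 * I22 - 13 * I31)].

Definition moduli_variety : set 'cV[C]_5 :=
  [set v | exists I31 I22 I50 I41 I32 : C,
     v = \col_i tnth [tuple I31; I22; I50; I41; I32] i /\
     moduli_equations I31 I22 I50 I41 I32].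

Definition zariski_closed n (Z : set 'cV[C]_n) : Prop :=
  exists P : set (mpoly.mpoly n C),
    Z = [set v | forall q, P q -> mpoly.meval (fun i => v i 0) q = 0].

Definition zariski_irreducible n (Z : set 'cV[C]_n) : Prop :=
  Z !=set0 /\
  forall A B, zariski_closed A -> zariski_closed B ->
    Z `<=` A `|` B -> Z `<=` A \/ Z `<=` B.

(* Z 0, ..., Z d is a strictly increasing chain of irreducible closed subsets
   of V. *)
Definition irreducible_chain n (V : set 'cV[C]_n) (d : nat)
    (Z : nat -> set 'cV[C]_n) : Prop :=
  (forall i, (i <= d)%N ->
     [/\ zariski_closed (Z i), zariski_irreducible (Z i) & Z i `<=` V]) /\
  (forall i, (i < d)%N -> Z i `<` Z i.+1).

Definition variety_of_dim n (V : set 'cV[C]_n) (d : nat) : Prop :=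
  [/\ zariski_closed V, (exists Z, irreducible_chain V d Z) &
      ~ exists Z, irreducible_chain V d.+1 Z].

End Surfaces.

Notation jet_space R n := 'cV[Cx R]_(2 + #|jet_index n|).

(* Main.v *)
Require Import Defs.
From HB Require Import structures.
From mathcomp Require Import all_boot all_order all_algebra.
From mathcomp Require Import all_classical all_reals all_analysis.
From mathcomp Require Import complex ring lra zify.
From mathcomp Require mpoly.
Import -(notations) mpoly.

Set Implicit Arguments.
Unset Strict Implicit.
Unset Printing Implicit Defensive.

Import Order.TTheory GRing.Theory Num.Theory.
Import numFieldNormedType.Exports.

Local Open Scope classical_set_scope.
Local Open Scope ring_scope.

(** Everything rests on one equation between power series.  Let W be the part of order at
least two of the function of S at p, in linear coordinates (x, y) of the plane in which the
tangent map of the normalizing map g is the identity.  Then g sends the point (x, y, W) of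
S to (x + p3 W, y + q3 W, kap W), where p3, q3, kap are entries of g, and so
<<
  kap W(x, y) = G(x + p3 W(x, y), y + q3 W(x, y)),
>>
G being the series of the normal form ([star]).  This equation is triangular in the
orders ([star_tri]).  In orders two to four, where G is prescribed, it determines the linear
coordinates, p3, q3 and kap as rational functions of the four-jet ([frameE]): subtracting a
suitable multiple of the quadratic part from the cubic part leaves the cube of a linear
form, whose kernel and the other isotropic direction of the quadratic part are the
coordinate axes, and the quartic part fixes the scale.  Hence the normal form is unique
([normal4_unique]), and its coefficients are holomorphic functions of the jet ([jholo_Icoef]),
invariant under affine maps.

Differentiating the equation along S at a point where g is the identity gives a linear
recurrence ([recurrence], made explicit in [inv_deriv_x] and [inv_deriv_y]): an invariant
derivative of a coefficient is the next coefficient plus a polynomial in coefficients of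
lower order and in a few of orders four and five.  The recurrence in the direction y gives, by induction on n, that the coefficients
of the powers of y vanish ([Icoef_0n]); the one in the direction x then expresses every
coefficient through the three generators and their derivatives ([gen_Icoef]).  Since an invariant
takes the same value at a surface and at its normal form, whose jet consists of these
coefficients, it is a function of the derived generators ([diff_invariant_generated]).

On a homogeneous surface an affine field tangent to S satisfies the same recurrence without
the derivatives ([homogeneous_recurs]), as the surface does not change along the field.  So
the derivatives of all coefficients vanish, the coefficients are constant, and three of
them determine all others, hence the germ ([moduli_equiv]).  In orders four and five the
recurrence becomes algebraic equations, which together with the equality of the two
expressions of the coefficient of exponents (5, 1) leave only two lines
([homogeneous_moduli]), the solutions of the equations of the moduli space
([moduli_equations_lines]); this also gives its dimension ([moduli_dim]).

Each point of the two lines is realized by a ruled surface u = alpha(x) + y beta(x)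
([moduli_models]): beta(x) = x with alpha the solution of a linear equation, and
alpha(x) = (beta(x) - x) / a with beta the solution of a Riccati equation, obtained as a
quotient of solutions of a linear system, that is of explicit power series.  These equations say
exactly that two explicit affine fields are tangent to the surface, and ruled surfaces
have explicit normal forms at all points ([ruled_normal]), so that membership in the branch
is a matter of finitely many functions being nonzero near the origin ([ruled_model]).

Holomorphic functions are handled as limits of polynomials for a weighted l1 norm of the
coefficients on a polydisc ([anal], [holoP]), for which sums, products, inverses,
derivatives and compositions reduce to polynomials, and jets as polynomials approximating
to a given order ([jeq]), which are unique. *)

(** * The norm of complex numbers as a real number *)
Section Norm.
Variable R : realType.
Notation C := (Cx R).

(** The metric on complex numbers takes complex values; estimates are easier with real
    ones, where the order is total. *)
Definition nrm (z : C) : R := complex.Re `|z|.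

Lemma nrmE (z : C) : `|z| = (nrm z)%:C%C.
Proof. by rewrite /nrm; apply/esym/RRe_real/normr_real. Qed.

Lemma rc_le (x y : R) : ((x%:C%C : C) <= y%:C%C) = (x <= y).
Proof. exact: lecR. Qed.
Lemma rc_lt (x y : R) : ((x%:C%C : C) < y%:C%C) = (x < y).
Proof. exact: ltcR. Qed.
Lemma rc_inj (x y : R) : (x%:C%C : C) = y%:C%C -> x = y.
Proof. by move=> h; apply/eqP; rewrite eq_le -!rc_le h lexx. Qed.

Lemma nrm_ge0 z : 0 <= nrm z.
Proof. by rewrite -rc_le -nrmE normr_ge0. Qed.
Lemma nrm0 : nrm 0 = 0.
Proof. by apply: rc_inj; rewrite -nrmE normr0. Qed.
Lemma nrm1 : nrm 1 = 1.
Proof. by apply: rc_inj; rewrite -nrmE normr1. Qed.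
Lemma nrmM x y : nrm (x * y) = nrm x * nrm y.
Proof. by apply: rc_inj; rewrite rmorphM /= -!nrmE normrM. Qed.
Lemma nrmN x : nrm (- x) = nrm x.
Proof. by apply: rc_inj; rewrite -!nrmE normrN. Qed.
Lemma nrmD x y : nrm (x + y) <= nrm x + nrm y.
Proof. by rewrite -rc_le rmorphD /= -!nrmE ler_normD. Qed.
Lemma nrmB x y : nrm (x - y) = nrm (y - x).
Proof. by rewrite -nrmN opprB. Qed.
Lemma nrm_triB x y z : nrm (x - z) <= nrm (x - y) + nrm (y - z).
Proof. by apply: le_trans (nrmD _ _); rewrite addrA subrK. Qed.
Lemma nrm_eq0 z : (nrm z == 0) = (z == 0).
Proof.
apply/eqP/eqP => [h|->]; last exact: nrm0.
by apply/eqP; rewrite -normr_eq0 nrmE h.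
Qed.
Lemma nrm_gt0 z : (0 < nrm z) = (z != 0).
Proof. by rewrite lt_def nrm_eq0 nrm_ge0 andbT. Qed.
Lemma nrmX z n : nrm (z ^+ n) = nrm z ^+ n.
Proof. by elim: n => [|n IH]; rewrite ?expr0 ?nrm1 // !exprS nrmM IH. Qed.
Lemma nrmV z : nrm z^-1 = (nrm z)^-1.
Proof.
have [->|z0] := eqVneq z 0; first by rewrite !(invr0, nrm0).
have n0 : nrm z != 0 by rewrite nrm_eq0.
by apply: (mulfI n0); rewrite -nrmM divff // nrm1 divff.
Qed.
Lemma nrm_sum I (s : seq I) (P : pred I) (F : I -> C) :
  nrm (\sum_(i <- s | P i) F i) <= \sum_(i <- s | P i) nrm (F i).
Proof.
elim/big_ind2 : _ => [|x1 x2 y1 y2 h1 h2|//]; first by rewrite nrm0.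
exact: le_trans (nrmD _ _) (lerD h1 h2).
Qed.
Lemma nrm_prod I (s : seq I) (P : pred I) (F : I -> C) :
  nrm (\prod_(i <- s | P i) F i) = \prod_(i <- s | P i) nrm (F i).
Proof. by apply: (big_morph nrm nrmM nrm1). Qed.
Lemma nrmR (x : R) : 0 <= x -> nrm (x%:C%C) = x.
Proof. by move=> x0; apply: rc_inj; rewrite -nrmE ger0_norm // ler0c. Qed.
Lemma nrm_nat n : nrm n%:R = n%:R.
Proof. by rewrite -[RHS]nrmR ?ler0n // rmorph_nat. Qed.

Lemma pos_real (e : C) : 0 < e -> exists2 r : R, 0 < r & e = r%:C%C.
Proof.
move=> e0; exists (nrm e); first by rewrite nrm_gt0 gt_eqF.
by rewrite -nrmE gtr0_norm.
Qed.
Lemma nrm_ltP (z : C) (r : R) : (`|z| < r%:C%C) = (nrm z < r).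
Proof. by rewrite nrmE rc_lt. Qed.

Lemma nbhsC (a : C) (P : C -> Prop) : nbhs a P <->
  exists2 e : R, 0 < e & forall w, nrm (w - a) < e -> P w.
Proof.
rewrite -nbhs_ballE; split=> [[e /= e0 H]|[e e0 H]].
  have [r r0 er] := pos_real e0; exists r => // w h; apply: H.
  by rewrite /ball /= er nrm_ltP nrmB.
exists (e%:C%C : C); first by rewrite /= (rc_lt 0).
by move=> w; rewrite /ball /= nrm_ltP nrmB; apply: H.
Qed.

Lemma nbhsV n (a : 'cV[C]_n) (P : 'cV[C]_n -> Prop) : nbhs a P <->
  exists2 e : R, 0 < e & forall w : 'cV[C]_n,
    (forall i, nrm (w i 0 - a i 0) < e) -> P w.
Proof.
rewrite -nbhs_ballE; split=> [[e /= e0 H]|[e e0 H]].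
  have [r r0 er] := pos_real e0; exists r => // w h; apply: H; split=> // i j.
  by rewrite (ord1 j) /ball /= er nrm_ltP nrmB.
exists (e%:C%C : C); first by rewrite /= (rc_lt 0).
move=> w [_ h]; apply: H => i; have := h i 0.
by rewrite /ball /= nrm_ltP nrmB.
Qed.

Lemma cvgC (u : nat -> C) (l : C) : u @ \oo --> l <->
  forall e : R, 0 < e -> exists N, forall n, (N <= n)%N -> nrm (u n - l) < e.
Proof.
split=> [h e e0|h A /= /nbhsC[e e0 H]].
  have /h : nbhs l (fun w => nrm (w - l) < e) by apply/nbhsC; exists e.
  by rewrite /= nbhs_filterE => -[N _ HN]; exists N => n Nn; apply: HN.
have [N HN] := h e e0; exists N => // n /= Nn; exact/H/HN.
Qed.

Definition cauchy (u : nat -> C) : Prop :=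
  forall e : R, 0 < e -> exists N, forall m n, (N <= m)%N -> (N <= n)%N -> nrm (u m - u n) < e.

Lemma nrm_re (z : C) : `|complex.Re z| <= nrm z.
Proof. by rewrite -rc_le -nrmE; exact: normc_ge_Re. Qed.
Lemma nrm_im (z : C) : `|complex.Im z| <= nrm z.
Proof.
have := nrm_re (z * 'i%C); rewrite nrmM.
have -> : nrm 'i%C = 1.
  by rewrite /nrm normc_def /= expr0n /= expr1n add0r sqrtr1.
by rewrite mulr1; case: z => a b /=; rewrite !mulr0 !mulr1 sub0r normrN.
Qed.
Lemma nrm_reim (z : C) : nrm z <= `|complex.Re z| + `|complex.Im z|.
Proof.
rewrite {1}(complexE z) (le_trans (nrmD _ _)) // nrmM.
have nc (x : R) : nrm x%:C%C = `|x|.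
  by apply: rc_inj; rewrite -nrmE normc_def /= expr0n /= addr0 sqrtr_sqr.
have -> : nrm 'i%C = 1.
  by rewrite /nrm normc_def /= expr0n /= expr1n add0r sqrtr1.
by rewrite mul1r !nc.
Qed.

Lemma cauchy_real (u : nat -> R) :
  (forall e : R, 0 < e -> exists N, forall m n, (N <= m)%N -> (N <= n)%N -> `|u m - u n| < e) ->
  exists l, forall e : R, 0 < e -> exists N, forall n, (N <= n)%N -> `|u n - l| < e.
Proof.
move=> h.
have cu : cvgn u.
  apply/cauchy_cvgP/cauchy_exP => e e0.
  have [N HN] := h e e0; exists (u N), N => // n /= Nn.
  by rewrite /ball /=; apply: HN.
exists (limn u) => e e0.
have := (@cvgrPdist_lt _ _ _ _ _ _ _).1 cu e e0 => -[N _ HN].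
by exists N => n Nn; rewrite distrC; apply: HN.
Qed.

(** Completeness holds because the real and imaginary parts are Cauchy sequences of
    reals. *)
Lemma cauchyC (u : nat -> C) : cauchy u ->
  exists l, forall e : R, 0 < e -> exists N, forall n, (N <= n)%N -> nrm (u n - l) < e.
Proof.
move=> h.
have [x hx] : exists l, forall e : R, 0 < e ->
    exists N, forall n, (N <= n)%N -> `|complex.Re (u n) - l| < e.
  apply: cauchy_real => e e0; have [N HN] := h e e0; exists N => m n Nm Nn.
  by apply: le_lt_trans (HN m n Nm Nn); have := nrm_re (u m - u n); rewrite raddfB.
have [y hy] : exists l, forall e : R, 0 < e ->
    exists N, forall n, (N <= n)%N -> `|complex.Im (u n) - l| < e.
  apply: cauchy_real => e e0; have [N HN] := h e e0; exists N => m n Nm Nn.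
  by apply: le_lt_trans (HN m n Nm Nn); have := nrm_im (u m - u n); rewrite raddfB.
exists (x +i* y)%C => e e0; have e2 : 0 < e / 2 by rewrite divr_gt0.
have [N1 H1] := hx _ e2; have [N2 H2] := hy _ e2.
exists (maxn N1 N2) => n; rewrite geq_max => /andP[n1 n2].
apply: le_lt_trans (nrm_reim _) _; rewrite !raddfB /= (splitr e).
by apply: ltrD; [apply: H1|apply: H2].
Qed.

Definition nlim (u : nat -> C) (l : C) : Prop :=
  forall e : R, 0 < e -> exists N, forall n, (N <= n)%N -> nrm (u n - l) < e.

Lemma nlim_unique u l l' : nlim u l -> nlim u l' -> l = l'.
Proof.
move=> h h'; apply/eqP; rewrite -subr_eq0 -nrm_eq0; apply/eqP.
apply/le_anti; rewrite nrm_ge0 andbT; apply/ler_addgt0Pl => e e0; rewrite addr0.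
have e2 : 0 < e / 2 by rewrite divr_gt0.
have [N HN] := h _ e2; have [N' HN'] := h' _ e2.
apply: le_trans (nrm_triB _ (u (maxn N N')) _) _; rewrite (splitr e) lerD //.
  by rewrite nrmB ltW // HN // leq_maxl.
by rewrite ltW // HN' // leq_maxr.
Qed.

Lemma nlim_le u l (b : R) N : nlim u l -> (forall n, (N <= n)%N -> nrm (u n) <= b) ->
  nrm l <= b.
Proof.
move=> h hb; apply/ler_addgt0Pl => e e0; have [N' HN'] := h e e0.
have := nrmD (l - u (maxn N N')) (u (maxn N N')); rewrite subrK => /le_trans; apply.
by rewrite lerD // ?hb ?leq_maxl // nrmB ltW // HN' // leq_maxr.
Qed.

Lemma nlimD u v l k : nlim u l -> nlim v k -> nlim (fun n => u n + v n) (l + k).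
Proof.
move=> hu hv e e0; have e2 : 0 < e / 2 by rewrite divr_gt0.
have [N HN] := hu _ e2; have [N' HN'] := hv _ e2.
exists (maxn N N') => n; rewrite geq_max => /andP[n1 n2].
rewrite opprD addrACA (splitr e); apply: le_lt_trans (nrmD _ _) _.
by apply: ltrD; [apply: HN|apply: HN'].
Qed.

Lemma nlim_cst l : nlim (fun=> l) l.
Proof. by move=> e e0; exists 0%N => n _; rewrite subrr nrm0. Qed.

Lemma nlimZ c u l : nlim u l -> nlim (fun n => c * u n) (c * l).
Proof.
move=> hu e e0; have c0 : 0 < nrm c + 1 by rewrite ltr_wpDl ?nrm_ge0.
have [N HN] := hu (e / (nrm c + 1)) (divr_gt0 e0 c0); exists N => n /HN.
rewrite -mulrBr nrmM ltr_pdivlMr // => h; apply: le_lt_trans h.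
by rewrite mulrC ler_wpM2l ?nrm_ge0 // lerDl.
Qed.

Lemma nlimB u v l k : nlim u l -> nlim v k -> nlim (fun n => u n - v n) (l - k).
Proof.
move=> hu hv; rewrite -mulN1r; have := nlimD hu (nlimZ (-1) hv).
by under [X in nlim X]eq_fun do rewrite mulN1r.
Qed.

Lemma nlim_sum I (s : seq I) (P : pred I) (u : I -> nat -> C) l :
  (forall i, nlim (u i) (l i)) ->
  nlim (fun n => \sum_(i <- s | P i) u i n) (\sum_(i <- s | P i) l i).
Proof.
move=> h; elim: s => [|i s IH].
  by under [X in nlim X]eq_fun do rewrite big_nil; rewrite big_nil; apply: nlim_cst.
under [X in nlim X]eq_fun do rewrite big_cons; rewrite big_cons.
by case: (P i) => //; apply: nlimD.
Qed.

(** All derivatives are computed from expansions with a quadratic error: dividing the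
    error by the increment leaves a linear bound. *)
Lemma quad_derive n (f : 'cV[C]_n -> C) (a v : 'cV[C]_n) (d : C) (K r : R) : 0 < r ->
  (forall t : C, nrm t <= r -> nrm (f (a + t *: v) - f a - t * d) <= K * nrm t ^+ 2) ->
  'D_v f a = d.
Proof.
move=> r0 h; rewrite /derive; apply: cvg_lim; first exact: norm_hausdorff.
move=> A /= /nbhsC[e e0 HA].
have K0 : 0 < `|K| + 1 by rewrite ltr_wpDl.
apply/nbhs_ballP; exists (Num.min r (e / (`|K| + 1)))%:C%C => /=.
  by rewrite (rc_lt 0) lt_min r0 divr_gt0.
move=> t; rewrite /ball /= sub0r normrN nrm_ltP lt_min => /andP[tr te] t0.
apply: HA; have nt : 0 < nrm t by rewrite nrm_gt0.
have -> : t^-1 *: (f (t *: v + a) - f a) - d = t^-1 * (f (a + t *: v) - f a - t * d).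
  by rewrite (addrC a) [RHS]mulrBr [X in _ = _ - X]mulrA mulVf // mul1r.
rewrite nrmM nrmV mulrC ltr_pdivrMr //; apply: le_lt_trans (h t (ltW tr)) _.
rewrite expr2 mulrA ltr_pM2r //; move: te; rewrite ltr_pdivlMr // mulrC.
apply: le_lt_trans; rewrite ler_wpM2r ?nrm_ge0 //.
by apply: le_trans (ler_norm K) _; rewrite lerDl.
Qed.

End Norm.

(** * A norm on polynomials *)
Section PolyNorm.
Variable R : realType.
Notation C := (Cx R).
Notation mp n := (mpoly n C).
Local Notation "p @_ m" := (mcoeff m p) (at level 3, m at level 2).

Definition ev n (p : mp n) (h : 'cV[C]_n) : C := meval (fun i => h i 0) p.

(** The sum of the moduli of the terms on the polydisc of radius r. It dominates the sup
    norm there, is submultiplicative, and controls every coefficient, which makes power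
    series accessible through polynomials. *)
Definition pnorm n (r : R) (p : mp n) : R :=
  \sum_(m <- msupp p) nrm p@_m * r ^+ mdeg m.

Section Fixed.
Variable n : nat.
Implicit Types (p q : mp n) (r : R) (h : 'cV[C]_n).

Lemma evD p q h : ev (p + q) h = ev p h + ev q h. Proof. exact: mevalD. Qed.
Lemma evB p q h : ev (p - q) h = ev p h - ev q h. Proof. exact: mevalB. Qed.
Lemma evM p q h : ev (p * q) h = ev p h * ev q h. Proof. exact: mevalM. Qed.
Lemma ev_sum I (s : seq I) (P : pred I) (F : I -> mp n) h :
  ev (\sum_(i <- s | P i) F i) h = \sum_(i <- s | P i) ev (F i) h.
Proof. by rewrite /ev raddf_sum. Qed.

Lemma pnormw r p (s : seq (multinom n)) : uniq s -> {subset msupp p <= s} ->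
  pnorm r p = \sum_(m <- s) nrm p@_m * r ^+ mdeg m.
Proof.
move=> us sub; rewrite /pnorm [RHS](bigID (mem (msupp p))) /=.
rewrite [X in _ + X]big1 ?addr0; last first.
  by move=> m /memN_msupp_eq0 ->; rewrite nrm0 mul0r.
rewrite -[RHS]big_filter; apply/perm_big/uniq_perm => //.
- exact: filter_uniq.
by move=> m; rewrite mem_filter; case: (boolP (m \in msupp p)) => //= /sub.
Qed.

Lemma pnorm_ge0 r p : 0 <= r -> 0 <= pnorm r p.
Proof.
by move=> r0; apply: sumr_ge0 => m _; rewrite mulr_ge0 ?nrm_ge0 ?exprn_ge0.
Qed.

Lemma pnorm0 r : pnorm r (0 : mp n) = 0.
Proof. by rewrite /pnorm msupp0 big_nil. Qed.

Lemma pnormD r p q : 0 <= r -> pnorm r (p + q) <= pnorm r p + pnorm r q.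
Proof.
move=> r0; pose s := undup (msupp p ++ msupp q ++ msupp (p + q)).
have us : uniq s by rewrite undup_uniq.
rewrite !(@pnormw _ _ s) //; try by move=> m hm; rewrite mem_undup !mem_cat hm ?orbT.
rewrite -big_split /=; apply: ler_sum => m _; rewrite mcoeffD -mulrDl.
by rewrite ler_wpM2r ?exprn_ge0 // nrmD.
Qed.

Lemma pnormN r p : pnorm r (- p) = pnorm r p.
Proof.
pose s := undup (msupp p ++ msupp (- p)); have us : uniq s by rewrite undup_uniq.
rewrite !(@pnormw _ _ s) //; try by move=> m hm; rewrite mem_undup !mem_cat hm ?orbT.
by apply: eq_bigr => m _; rewrite mcoeffN nrmN.
Qed.

Lemma pnormB r p q : pnorm r (p - q) = pnorm r (q - p).
Proof. by rewrite -pnormN opprB. Qed.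

Lemma pnormZ r c p : pnorm r (c *: p) = nrm c * pnorm r p.
Proof.
pose s := undup (msupp p ++ msupp (c *: p)); have us : uniq s by rewrite undup_uniq.
rewrite !(@pnormw _ _ s) //; try by move=> m hm; rewrite mem_undup !mem_cat hm ?orbT.
by rewrite mulr_sumr; apply: eq_bigr => m _; rewrite mcoeffZ nrmM mulrA.
Qed.

Lemma pnormX r (m : multinom n) : pnorm r (mpolyX C m) = r ^+ mdeg m.
Proof. by rewrite /pnorm msuppX big_seq1 mcoeffX eqxx nrm1 mul1r. Qed.

Lemma pnorm1 r : pnorm r (1 : mp n) = 1.
Proof. by rewrite /pnorm msupp1 big_seq1 mcoeff1 eqxx nrm1 mul1r mdeg0. Qed.

Lemma pnorm_sum r I (s : seq I) (P : pred I) (F : I -> mp n) : 0 <= r ->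
  pnorm r (\sum_(i <- s | P i) F i) <= \sum_(i <- s | P i) pnorm r (F i).
Proof.
move=> r0; elim/big_ind2 : _ => [|x1 x2 y1 y2 h1 h2|//]; first by rewrite pnorm0.
exact: le_trans (pnormD _ _ r0) (lerD h1 h2).
Qed.

Lemma pnormM r p q : 0 <= r -> pnorm r (p * q) <= pnorm r p * pnorm r q.
Proof.
move=> r0; rewrite mpolyME; apply: le_trans (pnorm_sum _ _ _ r0) _.
rewrite big_allpairs /= [pnorm r p]/pnorm mulr_suml; apply: ler_sum => m _.
rewrite [pnorm r q]/pnorm mulr_sumr; apply: ler_sum => k _.
by rewrite pnormZ pnormX nrmM mdegD exprD mulrACA.
Qed.

Lemma pnorm_exp r p k : 0 <= r -> pnorm r (p ^+ k) <= pnorm r p ^+ k.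
Proof.
move=> r0; elim: k => [|k IH]; first by rewrite !expr0 pnorm1.
rewrite !exprS; apply: le_trans (pnormM _ _ r0) _.
by rewrite ler_wpM2l ?pnorm_ge0.
Qed.

Lemma pnorm_coef r p (m : multinom n) : 0 <= r -> nrm p@_m * r ^+ mdeg m <= pnorm r p.
Proof.
move=> r0; have [hm|/memN_msupp_eq0 ->] := boolP (m \in msupp p); last first.
  by rewrite nrm0 mul0r pnorm_ge0.
rewrite /pnorm (big_rem m) //= lerDl; apply: sumr_ge0 => k _.
by rewrite mulr_ge0 ?nrm_ge0 ?exprn_ge0.
Qed.

Lemma pnorm_inj r p (T : finType) (phi : T -> multinom n) : 0 <= r -> injective phi ->
  \sum_x nrm p@_(phi x) * r ^+ mdeg (phi x) <= pnorm r p.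
Proof.
move=> r0 inj; pose s := map phi (enum T).
have us : uniq s by rewrite map_inj_uniq ?enum_uniq.
pose s' := undup (s ++ msupp p).
rewrite (@pnormw _ _ s') ?undup_uniq //; last first.
  by move=> m hm; rewrite mem_undup mem_cat hm orbT.
rewrite [X in _ <= X](bigID (mem s)) /= -[X in _ <= X + _]big_filter.
have -> : \sum_x nrm p@_(phi x) * r ^+ mdeg (phi x)
   = \sum_(m <- [seq m <- s' | m \in s]) nrm p@_m * r ^+ mdeg m.
  rewrite -big_enum /= -(big_map phi xpredT (fun m => nrm p@_m * r ^+ mdeg m)).
  apply/perm_big/uniq_perm => //; first by rewrite filter_uniq ?undup_uniq.
  by move=> m; rewrite mem_filter mem_undup mem_cat -/s; case: (m \in s).
by rewrite lerDl; apply: sumr_ge0 => m _; rewrite mulr_ge0 ?nrm_ge0 ?exprn_ge0.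
Qed.

Lemma pnorm_le r r' p : 0 <= r -> r <= r' -> pnorm r p <= pnorm r' p.
Proof.
move=> r0 rr; apply: ler_sum => m _; rewrite ler_wpM2l ?nrm_ge0 //.
by apply: lerXn2r => //; rewrite nnegrE // (le_trans r0).
Qed.

Lemma monom_bound r (m : multinom n) h : (forall i, nrm (h i 0) <= r) ->
  nrm (\prod_i h i 0 ^+ m i) <= r ^+ mdeg m.
Proof.
move=> hr; rewrite nrm_prod mdegE -prodrXr; apply: ler_prod => i _.
by rewrite nrm_ge0 /= nrmX lerXn2r // nnegrE ?nrm_ge0 // (le_trans (nrm_ge0 _) (hr i)).
Qed.

Lemma ev_bound r p h : (forall i, nrm (h i 0) <= r) -> nrm (ev p h) <= pnorm r p.
Proof.
move=> hr; rewrite /ev mevalE; apply: le_trans (nrm_sum _ _ _) _.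
by apply: ler_sum => m _; rewrite nrmM ler_wpM2l ?nrm_ge0 ?monom_bound.
Qed.

Definition mtrunc N p : mp n :=
  \sum_(m <- msupp p | (mdeg m <= N)%N) p@_m *: mpolyX C m.

(** On a smaller polydisc the terms of degree above N have gained a factor (rho / r) to
    the power N.+1. *)
Lemma pnorm_trunc N rho r p : 0 <= rho -> rho <= r -> 0 < r ->
  pnorm rho (p - mtrunc N p) <= (rho / r) ^+ N.+1 * pnorm r p.
Proof.
move=> rho0 rr r0.
have -> : p - mtrunc N p = \sum_(m <- msupp p | (N < mdeg m)%N) p@_m *: mpolyX C m.
  rewrite {1}[p]mpolyE (bigID (fun m => (mdeg m <= N)%N)) /= /mtrunc addrAC subrr add0r.
  by apply: eq_bigl => m; rewrite ltnNge.
apply: le_trans (pnorm_sum _ _ _ rho0) _.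
rewrite {2}/pnorm [X in _ * X](bigID (fun m => (N < mdeg m)%N)) /= mulrDr.
rewrite -[X in X <= _]addr0 lerD //; last first.
  by rewrite mulr_ge0 ?exprn_ge0 ?divr_ge0 ?(ltW r0) // sumr_ge0 // => m _;
     rewrite mulr_ge0 ?nrm_ge0 ?exprn_ge0 ?(ltW r0).
rewrite mulr_sumr; apply: ler_sum => m hm; rewrite pnormZ pnormX mulrCA.
rewrite ler_wpM2l ?nrm_ge0 // -(subnK hm) !exprD mulrCA expr_div_n divfK; last first.
  by rewrite expf_neq0 ?gt_eqF.
by rewrite ler_wpM2r ?exprn_ge0 // lerXn2r // nnegrE // ltW.
Qed.

End Fixed.

Lemma pnorm_prod n r I (s : seq I) (P : pred I) (F : I -> mp n) : 0 <= r ->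
  pnorm r (\prod_(i <- s | P i) F i) <= \prod_(i <- s | P i) pnorm r (F i).
Proof.
move=> r0; elim: s => [|i s IH]; first by rewrite !big_nil pnorm1.
rewrite !big_cons; case: (P i) => //; apply: le_trans (pnormM _ _ r0) _.
by rewrite ler_wpM2l ?pnorm_ge0.
Qed.

Lemma pnorm_comp n k r rho (p : mp n) (lq : n.-tuple (mp k)) : 0 <= r ->
  (forall i, pnorm r (tnth lq i) <= rho) -> pnorm r (comp_mpoly lq p) <= pnorm rho p.
Proof.
move=> r0 h; rewrite comp_mpolyE; apply: le_trans (pnorm_sum _ _ _ r0) _.
apply: ler_sum => m _; rewrite pnormZ ler_wpM2l ?nrm_ge0 //.
apply: le_trans (pnorm_prod _ _ _ r0) _; rewrite mdegE -prodrXr.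
apply: ler_prod => i _; rewrite pnorm_ge0 //=.
apply: le_trans (pnorm_exp _ _ r0) _; rewrite lerXn2r // nnegrE ?pnorm_ge0 //.
exact: le_trans (pnorm_ge0 _ r0) (h i).
Qed.

Lemma ev_comp n k (p : mp n) (lq : n.-tuple (mp k)) (h : 'cV[C]_k) :
  ev (comp_mpoly lq p) h = ev p (\col_i ev (tnth lq i) h).
Proof. by rewrite /ev comp_mpoly_meval; apply: meval_eq => i; rewrite mxE. Qed.

(** The right-hand side is the part of degree at least two in t of the binomial
    expansion, with all quantities replaced by their bounds; induction on the exponent. *)
Lemma monom_taylor (x t : C) (rho : R) a : nrm x <= rho -> nrm t <= rho -> 0 <= rho ->
  nrm ((x + t) ^+ a - x ^+ a - t * (a%:R * x ^+ a.-1)) * rho ^+ 2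
    <= nrm t ^+ 2 * ((2 ^ a)%:R - a%:R - 1) * rho ^+ a.
Proof.
move=> hx ht r0; elim: a => [|a IH].
  by rewrite !expr0 expn0 subrr !mul0r mulr0 sub0r oppr0 nrm0 subr0 subrr mulr0 !mul0r.
set E := _ - _ in IH.
have -> : (x + t) ^+ a.+1 - x ^+ a.+1 - t * (a.+1%:R * x ^+ a.+1.-1)
   = (x + t) * E + t ^+ 2 * (a%:R * x ^+ a.-1).
  rewrite /E !exprS /= -[a.+1%:R]natr1; case: a {IH E} => [|a] /=; first by rewrite !expr0; ring.
  by rewrite !exprS expr0; ring.
apply: (@le_trans _ _ ((2 * rho) * (nrm t ^+ 2 * ((2 ^ a)%:R - a%:R - 1) * rho ^+ a)
    + nrm t ^+ 2 * (a%:R * rho ^+ a.-1) * rho ^+ 2)).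
  apply: le_trans (ler_wpM2r (exprn_ge0 _ r0) (nrmD _ _)) _.
  rewrite mulrDl !nrmM -[X in X + _]mulrA; apply: lerD.
    apply: ler_pM => //; rewrite ?nrm_ge0 ?mulr_ge0 ?nrm_ge0 ?exprn_ge0 //.
    by apply: le_trans (nrmD _ _) _; lra.
  rewrite !nrmX nrm_nat -!mulrA; do 3!(rewrite ler_wpM2l ?nrm_ge0 ?ler0n //).
  by rewrite ler_wpM2r ?exprn_ge0 // lerXn2r ?nnegrE ?nrm_ge0.
rewrite expnS natrM -[a.+1%:R]natr1 exprS.
case: a {IH E} => [|a] /=; first by rewrite !expr0; nra.
rewrite -natr1 !exprS expr0 le_eqVlt; apply/orP; left; apply/eqP; ring.
Qed.

Lemma remD (a b c d e f t : C) :
  a + b - (c + d) - t * (e + f) = a - c - t * e + (b - d - t * f).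
Proof. ring. Qed.

Lemma remZ (a b c d t : C) : d * a - d * b - t * (d * c) = d * (a - b - t * c).
Proof. ring. Qed.

(** By linearity the estimate reduces to monomials, where only the variable that moves
    matters. *)
Lemma poly_taylor n (p : mp n) (rho : R) (h : 'cV[C]_n) (i : 'I_n) (t : C) :
  0 <= rho -> (forall j, nrm (h j 0) <= rho) -> nrm t <= rho ->
  nrm (ev p (h + t *: delta_mx i 0) - ev p h - t * ev (mderiv i p) h) * rho ^+ 2
    <= nrm t ^+ 2 * pnorm (2 * rho) p.
Proof.
move=> r0 hh ht.
pose E p := ev p (h + t *: delta_mx i 0) - ev p h - t * ev (mderiv i p) h.
have EX (m : multinom n) : nrm (E (mpolyX C m)) * rho ^+ 2 <=
    nrm t ^+ 2 * (2 * rho) ^+ mdeg m.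
  pose P : C := \prod_(j < n | j != i) h j 0 ^+ m j.
  have -> : E (mpolyX C m) = ((h i 0 + t) ^+ m i - h i 0 ^+ m i
      - t * ((m i)%:R * h i 0 ^+ (m i).-1)) * P.
    have HX (k : multinom n) g :
        meval g (mpolyX C k) = g i ^+ k i * \prod_(j < n | j != i) g j ^+ k j.
      by rewrite mevalX (bigD1 i).
    rewrite /E mderivX /ev mevalZ !HX !mxE !eqxx mulr1.
    have -> : \prod_(j < n | j != i) (h + t *: delta_mx i 0) j 0 ^+ m j = P.
      by apply: eq_bigr => j /negbTE ji; rewrite !mxE ji mulr0 addr0.
    have -> : \prod_(j < n | j != i) h j 0 ^+ (mnm_sub m (mnm1 i)) j = P.
      by apply: eq_bigr => j ji; rewrite mnmBE mnm1E eq_sym (negbTE ji) subn0.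
    by rewrite -/P mnmBE mnm1E eqxx subn1 !mulrBl -!mulrA.
  have HP : nrm P <= rho ^+ (mdeg m - m i).
    have -> : (mdeg m - m i = \sum_(j < n | j != i) m j)%N.
      by rewrite mdegE (bigD1 i) //= addKn.
    rewrite -prodrXr /P nrm_prod.
    apply: ler_prod => j _; rewrite nrm_ge0 nrmX lerXn2r // nnegrE ?nrm_ge0 //.
  rewrite nrmM mulrAC.
  have le_m : (m i <= mdeg m)%N by rewrite mdegE (bigD1 i) //= leq_addr.
  apply: le_trans (ler_pM _ _ (monom_taylor (m i) (hh i) ht r0) HP) _;
    rewrite ?mulr_ge0 ?nrm_ge0 ?exprn_ge0 //.
  rewrite -!mulrA -exprD subnKC // exprMn; do 2!(rewrite ler_wpM2l ?nrm_ge0 //).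
  rewrite ler_wpM2r ?exprn_ge0 // -natrX -[X in X <= _]addrA -opprD.
  apply: (@le_trans _ _ (2 ^ m i)%:R); first by rewrite gerBl addr_ge0.
  by rewrite ler_nat leq_pexp2l.
rewrite -/(E p) {1}[p]mpolyE.
have ED p1 p2 : E (p1 + p2) = E p1 + E p2 by rewrite /E !evD mderivD evD remD.
have EZ c p1 : E (c *: p1) = c * E p1 by rewrite /E mderivZ /ev !mevalZ remZ.
have E0 : E 0 = 0 by rewrite /E mderiv0 /ev !meval0 mulr0 !subr0.
rewrite (big_morph E ED E0) (eq_bigr (fun m => p@_m * E (mpolyX C m))) //.
apply: le_trans (ler_wpM2r (exprn_ge0 _ r0) (nrm_sum _ _ _)) _.
rewrite mulr_suml /pnorm mulr_sumr; apply: ler_sum => m _.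
by rewrite nrmM -mulrA [X in _ <= X]mulrCA ler_wpM2l ?nrm_ge0.
Qed.

(** The exponent brought down by the derivative is at most a power of two, absorbed by
    doubling the radius. *)
Lemma pnorm_deriv n (p : mp n) (r : R) i : 0 <= r ->
  pnorm r (mderiv i p) * r <= pnorm (2 * r) p.
Proof.
move=> r0; rewrite {1}[p]mpolyE raddf_sum /=.
apply: le_trans (ler_wpM2r r0 (pnorm_sum _ _ _ r0)) _.
rewrite mulr_suml; apply: ler_sum => m _.
rewrite mderivZ mderivX scalerA pnormZ pnormX nrmM nrm_nat -!mulrA.
rewrite ler_wpM2l ?nrm_ge0 //.
have [->|m0] := posnP (m i); first by rewrite mul0r exprn_ge0 // mulr_ge0.
have def_m : m = mnm_add (mnm1 i) (mnm_sub m (mnm1 i)).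
  by apply/mnmP => j; rewrite mnmDE mnmBE mnm1E; case: eqP => [<-|_]; rewrite ?subnKC ?add0n ?subn0.
have -> : mdeg (mnm_sub m (mnm1 i)) = (mdeg m).-1.
  by rewrite [in RHS]def_m mdegD mdeg1.
have dm : (0 < mdeg m)%N by rewrite mdegE (bigD1 i) //= addn_gt0 m0.
rewrite -exprSr prednK // exprMn ler_wpM2r ?exprn_ge0 // -natrX ler_nat.
apply: (@leq_trans (2 ^ m i)); first by rewrite ltnW // ltn_expl.
by rewrite leq_pexp2l // mdegE (bigD1 i) //= leq_addr.
Qed.

End PolyNorm.

(** * Analytic functions as limits of polynomials *)
Section Analytic.
Variable R : realType.
Notation C := (Cx R).
Notation mp n := (mpoly n C).
Local Notation "p @_ m" := (mcoeff m p) (at level 3, m at level 2).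

Definition inbox n (r : R) (h : 'cV[C]_n) : Prop := forall i, nrm (h i 0) <= r.

(** Being Cauchy for the norm of the polydisc gives uniform convergence together with
    that of the coefficients and, on half the polydisc, of the derivatives. *)
Definition pcauchy n (r : R) (p : nat -> mp n) : Prop :=
  forall e : R, 0 < e -> exists N, forall i j, (N <= i)%N -> (N <= j)%N ->
    pnorm r (p i - p j) < e.

Definition plim n (r : R) (p : nat -> mp n) (f : 'cV[C]_n -> C) : Prop :=
  forall h, inbox r h -> nlim (fun k => ev (p k) h) (f h).

(** Holomorphic functions enter in this form: limits, on a polydisc, of polynomials for
    the weighted norm. Products, inverses and compositions are then limits of the
    corresponding polynomials. *)
Definition anal n (r : R) (f : 'cV[C]_n -> C) : Prop :=
  exists2 p, pcauchy r p & plim r p f.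

Section Fixed.
Variable n : nat.
Implicit Types (p q : nat -> mp n) (r : R) (f g : 'cV[C]_n -> C).

Lemma pcauchy_bounded r p : 0 <= r -> pcauchy r p ->
  exists2 B, 0 < B & exists N, forall k, (N <= k)%N -> pnorm r (p k) <= B.
Proof.
move=> r0 /(_ 1 ltr01)[N HN]; exists (pnorm r (p N) + 1).
  by rewrite ltr_wpDl ?pnorm_ge0.
exists N => k Nk; rewrite -{1}(subrK (p N) (p k)) addrC.
by apply: le_trans (pnormD _ _ r0) _; rewrite lerD2l ltW // HN.
Qed.

Lemma plim_ex r p : 0 <= r -> pcauchy r p -> exists f, plim r p f.
Proof.
move=> r0 cp.
have /choice[f hf] : forall h, exists l, inbox r h -> nlim (fun k => ev (p k) h) l.
  move=> h; have [hr|nh] := pselect (inbox r h); last by exists 0.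
  have [|l hl] := @cauchyC R (fun k => ev (p k) h); last by exists l.
  move=> e /cp[N HN]; exists N => i j Ni Nj; rewrite -evB.
  exact: le_lt_trans (ev_bound _ hr) (HN i j Ni Nj).
by exists f.
Qed.

(** The bound between polynomials passes to the limit pointwise, which makes the
    convergence uniform. *)
Lemma plim_close r p f e N h : plim r p f -> inbox r h ->
  (forall i j, (N <= i)%N -> (N <= j)%N -> pnorm r (p i - p j) <= e) ->
  forall k, (N <= k)%N -> nrm (ev (p k) h - f h) <= e.
Proof.
move=> hp hr he k Nk; have hB := nlimB (nlim_cst (ev (p k) h)) (hp h hr).
apply: (nlim_le (N := N) hB) => i Ni; rewrite -evB.
exact: le_trans (ev_bound _ hr) (he k i Nk Ni).
Qed.

Lemma inbox_le r r' (h : 'cV[C]_n) : r' <= r -> inbox r' h -> inbox r h.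
Proof. by move=> rr hh i; apply: le_trans rr. Qed.

Lemma pcauchy_le r r' p : 0 <= r' -> r' <= r -> pcauchy r p -> pcauchy r' p.
Proof.
move=> r0 rr cp e /cp[N HN]; exists N => i j Ni Nj.
exact: le_lt_trans (pnorm_le _ r0 rr) (HN i j Ni Nj).
Qed.

Lemma anal_le r r' f : 0 <= r' -> r' <= r -> anal r f -> anal r' f.
Proof.
move=> r0 rr [p cp hp]; exists p; first exact: pcauchy_le cp.
by move=> h hh; apply: hp; apply: inbox_le hh.
Qed.

Lemma anal_eq r f g : (forall h, inbox r h -> f h = g h) -> anal r f -> anal r g.
Proof. by move=> e [p cp hp]; exists p => // h hr; rewrite -e //; apply: hp. Qed.

Lemma anal_ev r (P : mp n) : anal r (ev P).
Proof.
exists (fun=> P); last by move=> h _; apply: nlim_cst.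
by move=> e e0; exists 0%N => *; rewrite subrr pnorm0.
Qed.

Lemma anal_cst r c : anal r (fun _ : 'cV[C]_n => c).
Proof.
by apply: anal_eq (anal_ev r (mpolyC n c)) => h _; rewrite /ev mevalC.
Qed.

Lemma anal_coord r i : anal r (fun h : 'cV[C]_n => h i 0).
Proof.
by apply: anal_eq (anal_ev r (mpolyX C (mnm1 i))) => h _; rewrite /ev mevalXU.
Qed.

Lemma nlimM (u v : nat -> C) l k : nlim u l -> nlim v k ->
  nlim (fun i => u i * v i) (l * k).
Proof.
move=> hu hv.
have [Nb Hb] := hu 1 ltr01; pose B := nrm l + 1.
have B0 : 0 < B by rewrite ltr_wpDl ?nrm_ge0.
have ub i : (Nb <= i)%N -> nrm (u i) <= B.
  move=> /Hb/ltW h; rewrite -(subrK l (u i)) addrC.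
  by apply: le_trans (nrmD _ _) _; rewrite lerD2l.
move=> e e0; have e2 : 0 < e / 2 by rewrite divr_gt0.
have k0 : 0 < nrm k + 1 by rewrite ltr_wpDl ?nrm_ge0.
have [N1 H1] := hv _ (divr_gt0 e2 B0); have [N2 H2] := hu _ (divr_gt0 e2 k0).
exists (maxn Nb (maxn N1 N2)) => i; rewrite !geq_max => /and3P[ib i1 i2].
have -> : u i * v i - l * k = u i * (v i - k) + (u i - l) * k by ring.
apply: le_lt_trans (nrmD _ _) _; rewrite !nrmM (splitr e).
have h1 := H1 _ i1; have h2 := H2 _ i2.
rewrite ltr_pdivlMr // in h1; rewrite ltr_pdivlMr // in h2.
apply: ltrD.
  apply: le_lt_trans h1; rewrite [X in _ <= X]mulrC.
  by rewrite ler_wpM2r ?nrm_ge0 ?ub.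
by apply: le_lt_trans h2; rewrite ler_wpM2l ?nrm_ge0 // lerDl.
Qed.

Lemma analD r f g : 0 <= r -> anal r f -> anal r g -> anal r (fun h => f h + g h).
Proof.
move=> r0 [p cp hp] [q cq hq]; exists (fun k => p k + q k); last first.
  move=> h hr; under [X in nlim X]eq_fun do rewrite evD.
  by apply: nlimD; [apply: hp|apply: hq].
move=> e e0; have e2 : 0 < e / 2 by rewrite divr_gt0.
have [N HN] := cp _ e2; have [N' HN'] := cq _ e2.
exists (maxn N N') => i j; rewrite !geq_max => /andP[i1 i2] /andP[j1 j2].
rewrite opprD addrACA (splitr e); apply: le_lt_trans (pnormD _ _ r0) _.
by apply: ltrD; [apply: HN|apply: HN'].
Qed.

Lemma analM r f g : 0 <= r -> anal r f -> anal r g -> anal r (fun h => f h * g h).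
Proof.
move=> r0 [p cp hp] [q cq hq]; exists (fun k => p k * q k); last first.
  move=> h hr; under [X in nlim X]eq_fun do rewrite evM.
  by apply: nlimM; [apply: hp|apply: hq].
move=> e e0; have e2 : 0 < e / 2 by rewrite divr_gt0.
have [A A0 [NA HA]] := pcauchy_bounded r0 cp; have [B B0 [NB HB]] := pcauchy_bounded r0 cq.
have [N HN] := cp _ (divr_gt0 e2 B0); have [N' HN'] := cq _ (divr_gt0 e2 A0).
exists (maxn (maxn NA NB) (maxn N N')) => i j; rewrite !geq_max.
move=> /andP[/andP[iA iB] /andP[i1 i2]] /andP[/andP[jA jB] /andP[j1 j2]].
have -> : p i * q i - p j * q j = p i * (q i - q j) + (p i - p j) * q j.
  by rewrite mulrBr mulrBl addrA subrK.
apply: le_lt_trans (pnormD _ _ r0) _; rewrite (splitr e).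
have h1 := HN _ _ i1 j1; have h2 := HN' _ _ i2 j2.
rewrite ltr_pdivlMr // in h1; rewrite ltr_pdivlMr // in h2.
apply: ltrD; apply: le_lt_trans (pnormM _ _ r0) _.
  by apply: le_lt_trans h2; rewrite mulrC ler_wpM2l ?pnorm_ge0 ?HA.
by apply: le_lt_trans h1; rewrite ler_wpM2l ?pnorm_ge0 ?HB.
Qed.

Lemma analZ r c f : 0 <= r -> anal r f -> anal r (fun h => c * f h).
Proof. by move=> r0 hf; apply: analM => //; apply: anal_cst. Qed.

(** Every non constant monomial gains the factor rho / r. *)
Lemma pnorm_shrink r rho (P : mp n) : 0 <= rho -> rho <= r -> 0 < r ->
  pnorm rho (P - mpolyC n P@_mnm0) <= rho / r * pnorm r P.
Proof.
move=> rho0 rr r0; have := pnorm_trunc 0 P rho0 rr r0; rewrite expr1.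
congr (pnorm rho (P - _) <= _); rewrite /mtrunc.
under eq_bigl do rewrite leqn0 mdeg_eq0.
rewrite -big_filter; have [h|/memN_msupp_eq0 h] := boolP (mnm0 \in msupp P).
  rewrite (@perm_big _ _ _ _ _ [:: mnm0]) ?big_seq1 -?mul_mpolyC ?mpolyX0 ?mulr1 //.
  apply: uniq_perm => //; first by rewrite filter_uniq // msupp_uniq.
  by move=> m; rewrite mem_filter inE; case: eqP => //= ->.
rewrite h mpolyC0 big_seq big1 // => m; rewrite mem_filter => /andP[/eqP -> _].
by rewrite h scale0r.
Qed.

Lemma pnormC r (c : C) : pnorm r (mpolyC n c) = nrm c.
Proof. by rewrite -alg_mpolyC pnormZ pnorm1 mulr1. Qed.

Lemma ev0 (P : mp n) : ev P 0 = P@_mnm0.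
Proof.
rewrite /ev -[in LHS](subrK (mpolyC n P@_mnm0) P) mevalD mevalC.
rewrite [X in X + _ = _](_ : _ = 0) ?add0r //.
apply/eqP; rewrite -nrm_eq0; apply/eqP/le_anti; rewrite nrm_ge0 andbT.
have h0 : forall i, nrm ((0 : 'cV[C]_n) i 0) <= 0 by move=> i; rewrite mxE nrm0.
apply: le_trans (ev_bound (P - mpolyC n P@_mnm0) h0) _.
by have := pnorm_shrink P (lexx 0) ler01 ltr01; rewrite !mul0r.
Qed.

Lemma pnorm_geom r (u : mp n) k : 0 <= r -> pnorm r u <= 2^-1 ->
  pnorm r (\sum_(i < k) u ^+ i) <= 2.
Proof.
move=> r0 hu; suff : pnorm r (\sum_(i < k) u ^+ i) <= 2 - 2 * 2^-1 ^+ k.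
  by move=> h; apply: le_trans h _; rewrite gerBl mulr_ge0 ?exprn_ge0 ?invr_ge0.
elim: k => [|k IH]; first by rewrite big_ord0 pnorm0 expr0 mulr1 subrr.
rewrite big_ord_recr /=; apply: le_trans (pnormD _ _ r0) _.
have h : pnorm r (u ^+ k) <= 2^-1 ^+ k.
  apply: le_trans (pnorm_exp _ _ r0) _.
  by rewrite lerXn2r // nnegrE ?pnorm_ge0 ?invr_ge0.
rewrite exprS; lra.
Qed.

Lemma half_pow (e : R) : 0 < e -> exists N, forall k, (N <= k)%N -> 2^-1 ^+ k < e.
Proof.
move=> e0; exists (Num.bound e^-1) => k Nk.
have h : e^-1 < (2 ^ k)%:R.
  apply: lt_trans (archi_boundP _) _; first by rewrite invr_ge0 ltW.
  by rewrite ltr_nat (leq_ltn_trans Nk) // ltn_expl.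
by rewrite exprVn -natrX invf_plt ?posrE // ltr0n expn_gt0.
Qed.

(** The Neumann series: with u = 1 - p, the partial sums of the powers of u approximate
    the inverse of p. *)
Lemma anal_inv_near1 r f p N : 0 <= r -> pcauchy r p -> plim r p f ->
  (forall k, (N <= k)%N -> pnorm r (1 - p k) <= 2^-1) ->
  anal r (fun h => (f h)^-1).
Proof.
move=> r0 cp hp hN.
pose u k : mp n := 1 - p k; pose g k : mp n := \sum_(i < k) u k ^+ i.
have gp k : g k * p k = 1 - u k ^+ k.
  have -> : p k = - (u k - 1) by rewrite /u addrAC subrr sub0r opprK.
  by rewrite mulrN mulrC -subrX1 opprB.
have un k : (N <= k)%N -> pnorm r (u k ^+ k) <= 2^-1 ^+ k.
  move=> Nk; apply: le_trans (pnorm_exp _ _ r0) _.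
  by rewrite lerXn2r ?nnegrE ?pnorm_ge0 ?invr_ge0 ?hN.
have cg : pcauchy r g.
  move=> e e0; have e8 : 0 < e / 16 by rewrite divr_gt0.
  have [M HM] := half_pow e8; have [M' HM'] := cp _ e8.
  exists (maxn N (maxn M M')) => i j; rewrite !geq_max.
  move=> /and3P[iN iM iM'] /and3P[jN jM jM'].
  (* Each truncated geometric series is an inverse up to a small power of u. *)
  have -> : g i - g j = g i * g j * (p j - p i) + (g i * u j ^+ j - g j * u i ^+ i).
    have ei : u i ^+ i = 1 - g i * p i by rewrite gp opprB addrC subrK.
    have ej : u j ^+ j = 1 - g j * p j by rewrite gp opprB addrC subrK.
    rewrite ei ej; move: (g i) (g j) (p i) (p j) => a b c d.
    ring.
  have gi := pnorm_geom i r0 (hN i iN); have gj := pnorm_geom j r0 (hN j jN).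
  have ui : pnorm r (u i ^+ i) < e / 16 := le_lt_trans (un i iN) (HM _ iM).
  have uj : pnorm r (u j ^+ j) < e / 16 := le_lt_trans (un j jN) (HM _ jM).
  have pij := HM' _ _ jM' iM'.
  have mulb (a b : mp n) A B : pnorm r a <= A -> pnorm r b <= B -> pnorm r (a * b) <= A * B.
    by move=> ha hb; apply: le_trans (pnormM _ _ r0) _; rewrite ler_pM ?pnorm_ge0.
  have h1 := mulb _ _ _ _ (mulb _ _ _ _ gi gj) (ltW pij).
  have h2 := mulb _ _ _ _ gi (ltW uj); have h3 := mulb _ _ _ _ gj (ltW ui).
  have h4 := pnormD (g i * g j * (p j - p i)) (g i * u j ^+ j - g j * u i ^+ i) r0.
  have h5 := pnormD (g i * u j ^+ j) (- (g j * u i ^+ i)) r0.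
  rewrite pnormN in h5; lra.
have [l hl] := plim_ex r0 cg.
exists g => // h hr; suff -> : (f h)^-1 = l h by apply: hl.
have : l h * f h = 1.
  apply: nlim_unique (nlimM (hl h hr) (hp h hr)) _.
  move=> e e0; have [M HM] := half_pow e0; exists (maxn N M) => k.
  rewrite geq_max => /andP[kN kM]; rewrite -evM gp evB /ev meval1 addrAC subrr sub0r nrmN.
  exact: le_lt_trans (ev_bound _ hr) (le_lt_trans (un k kN) (HM _ kM)).
move=> lf; have fn0 : f h != 0.
  by apply/eqP => f0; move: lf; rewrite f0 mulr0 => /eqP; rewrite eq_sym oner_eq0.
by apply: (mulIf fn0); rewrite lf mulVf.
Qed.

(** After division by the value at the centre and shrinking of the polydisc, the
    function is close to 1 and the Neumann series applies. *)
Lemma anal_inv r f : 0 < r -> anal r f -> f 0 != 0 ->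
  exists2 r', 0 < r' <= r & anal r' (fun h => (f h)^-1).
Proof.
move=> r0 [p cp hp] f0; set c := f 0 in f0.
pose q k := c^-1 *: p k.
have in0 : inbox r (0 : 'cV[C]_n) by move=> i; rewrite mxE nrm0 ltW.
have cq : pcauchy r q.
  have nc : 0 < nrm c^-1 by rewrite nrm_gt0 invr_eq0.
  move=> e e0; have [N HN] := cp _ (divr_gt0 e0 nc); exists N => i j iN jN.
  by rewrite -scalerBr pnormZ mulrC -ltr_pdivlMr // HN.
have [B B0 [NB HB]] := pcauchy_bounded (ltW r0) cq.
have lq0 : nlim (fun k => ev (q k) 0) 1.
  under [X in nlim X]eq_fun do rewrite /ev mevalZ.
  by rewrite -(mulVf f0); apply: nlimZ; apply: hp.
have [N0 HN0] := lq0 (4^-1) ltac:(by rewrite invr_gt0).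
have B5 : 0 < 4 * (1 + B) by rewrite mulr_gt0 // addr_gt0.
pose r' := r / (4 * (1 + B)).
have r'0 : 0 < r' by rewrite divr_gt0.
have r'r : r' <= r by rewrite ler_pdivrMr // ler_peMr ?(ltW r0) //; lra.
exists r'; first by rewrite r'0.
have c'q := pcauchy_le (ltW r'0) r'r cq.
have hq : plim r' q (fun h => c^-1 * f h).
  move=> h hh; under [X in nlim X]eq_fun do rewrite /ev mevalZ.
  by apply/nlimZ/hp/inbox_le/hh.
have hN k : (maxn NB N0 <= k)%N -> pnorm r' (1 - q k) <= 2^-1.
  rewrite geq_max => /andP[kB k0].
  rewrite -(subrK (mpolyC n (1 - q k)@_mnm0) (1 - q k)).
  apply: le_trans (pnormD _ _ (ltW r'0)) _; rewrite pnormC.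
  have h1 : nrm (1 - q k)@_mnm0 < 4^-1.
    by rewrite mcoeffB mcoeff1 eqxx nrmB -ev0 HN0.
  have h2 := pnorm_shrink (1 - q k) (ltW r'0) r'r r0.
  have h3 : pnorm r (1 - q k) <= 1 + B.
    by apply: le_trans (pnormD _ _ (ltW r0)) _; rewrite pnorm1 pnormN lerD2l HB.
  have h4 : r' / r * pnorm r (1 - q k) <= 4^-1.
    have -> : r' / r = (4 * (1 + B))^-1.
      by rewrite /r' mulrAC divff ?gt_eqF // mul1r.
    rewrite ler_pdivrMl // mulrAC divff ?mul1r //.
  lra.
apply: anal_eq (analZ c^-1 (ltW r'0) (anal_inv_near1 (ltW r'0) c'q hq hN)) => h _.
by rewrite invfM invrK mulrA mulVf // mul1r.
Qed.

End Fixed.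

Lemma fin_pos n (d : 'I_n -> R) : (forall i, 0 < d i) ->
  exists2 e, 0 < e & forall i, e <= d i.
Proof.
move=> d0; exists (\big[Num.min/1]_i d i).
  by elim/big_ind : _ => // x y x0 y0; rewrite lt_min x0.
by move=> i; rewrite (bigD1 i) //= ge_min lexx.
Qed.

(** The norm of a composite is bounded by the norm of the outer polynomial on the
    polydisc containing the image. *)
Lemma anal_comp n k r (f : 'cV[C]_n -> C) (lq : n.-tuple (mp k)) : 0 < r ->
  anal r f -> (forall i, nrm (ev (tnth lq i) 0) < r) ->
  exists2 r', 0 < r' & anal r' (fun h => f (\col_i ev (tnth lq i) h)) /\
     forall h, inbox r' h -> inbox r (\col_i ev (tnth lq i) h).
Proof.
move=> r0 [p cp hp] hq.
have hd i : 0 < r - nrm (ev (tnth lq i) 0) by rewrite subr_gt0.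
have [d d0 dle] := fin_pos hd.
pose B := 1 + \sum_i pnorm 1 (tnth lq i).
have S0 : 0 <= \sum_i pnorm 1 (tnth lq i) by apply: sumr_ge0 => i _; apply: pnorm_ge0.
have B1 : 0 < B by rewrite ltr_pwDl.
pose r' := Num.min 1 (d / B).
have r'0 : 0 < r' by rewrite lt_min ltr01 divr_gt0.
have hr i : pnorm r' (tnth lq i) <= r.
  rewrite -(subrK (mpolyC k (tnth lq i)@_mnm0) (tnth lq i)).
  apply: le_trans (pnormD _ _ (ltW r'0)) _; rewrite pnormC.
  have r'1 : r' <= 1 by rewrite ge_min lexx.
  have h2 := pnorm_shrink (tnth lq i) (ltW r'0) r'1 ltr01; rewrite divr1 in h2.
  have h3 : pnorm 1 (tnth lq i) <= B.
    rewrite /B (bigD1 i) //= addrCA lerDl addr_ge0 ?ler01 // sumr_ge0 // => j _.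
    exact: pnorm_ge0.
  have h4 : r' * pnorm 1 (tnth lq i) <= d.
    apply: le_trans (ler_wpM2l (ltW r'0) h3) _.
    by rewrite -ler_pdivlMr // ge_min lexx orbT.
  have := dle i; rewrite ev0; lra.
exists r' => //; split; last first.
  by move=> h hh i; rewrite mxE; apply: le_trans (hr i); apply: ev_bound.
exists (fun j => comp_mpoly lq (p j)).
  move=> e /cp[N HN]; exists N => i j iN jN; rewrite -raddfB.
  exact: le_lt_trans (pnorm_comp _ (ltW r'0) hr) (HN i j iN jN).
move=> h hh; under [X in nlim X]eq_fun do rewrite ev_comp; apply: hp => i.
by rewrite mxE; apply: le_trans (hr i); apply: ev_bound.
Qed.

(** The quadratic remainder of the polynomials is uniform, so that it passes to the
    limit and identifies the limit of the derivatives. *)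
Lemma anal_partial n rho (f : 'cV[C]_n -> C) (i : 'I_n) p : 0 < rho ->
  pcauchy (2 * rho) p -> plim (2 * rho) p f ->
  [/\ pcauchy rho (fun k => mderiv i (p k)), plim rho (fun k => mderiv i (p k)) (partial i f) &
  exists K, forall h t, inbox rho h -> nrm t <= rho ->
    nrm (f (h + t *: delta_mx i 0) - f h - t * partial i f h) <= K * nrm t ^+ 2].
Proof.
move=> r0 cp hp; have r20 : 0 < 2 * rho by rewrite mulr_gt0.
pose q k := mderiv i (p k).
have cq : pcauchy rho q.
  move=> e e0; have [N HN] := cp _ (mulr_gt0 e0 r0); exists N => a b aN bN.
  have := le_lt_trans (pnorm_deriv (p a - p b) i (ltW r0)) (HN a b aN bN).
  by rewrite ltr_pM2r // raddfB.
have [g hg] := plim_ex (ltW r0) cq.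
have [B B0 [NB HB]] := pcauchy_bounded (ltW r20) cp.
pose K := B / rho ^+ 2.
have rle : rho <= 2 * rho by lra.
have hK h t : inbox rho h -> nrm t <= rho ->
    nrm (f (h + t *: delta_mx i 0) - f h - t * g h) <= K * nrm t ^+ 2.
  move=> hh ht.
  have hin : inbox (2 * rho) (h + t *: delta_mx i 0).
    move=> j; rewrite !mxE; apply: le_trans (nrmD _ _) _; rewrite nrmM.
    have h1 := hh j.
    have h2 : nrm t * nrm ((j == i) && (0 == 0 :> 'I_1))%:R <= rho.
      by rewrite nrm_nat; case: (_ && _); rewrite ?mulr1 // mulr0 ltW.
    lra.
  apply: (nlim_le (N := NB) (nlimB (nlimB (hp _ hin) (hp _ (inbox_le rle hh))) (nlimZ t (hg h hh)))).
  move=> k kB; have := poly_taylor (p k) i (ltW r0) hh ht.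
  rewrite -ler_pdivlMr ?exprn_gt0 // => /le_trans; apply.
  rewrite /K [X in _ <= X]mulrAC ler_wpM2r ?invr_ge0 ?exprn_ge0 ?(ltW r0) //.
  by rewrite mulrC ler_wpM2r ?exprn_ge0 ?nrm_ge0 ?HB.
have pg h : inbox rho h -> partial i f h = g h.
  by move=> hh; apply: quad_derive r0 _ => t ht; apply: hK.
split=> // [h hh|]; first by rewrite pg //; apply: hg.
by exists K => h t hh ht; rewrite pg //; apply: hK.
Qed.

End Analytic.

(** * Power series and their derivatives *)
Section Taylor.
Variable R : realType.
Notation C := (Cx R).
Notation mp n := (mpoly n C).
Local Notation "p @_ m" := (mcoeff m p) (at level 3, m at level 2).

Definition mm n (m : {ffun 'I_n -> nat}) : multinom n := Multinom [tuple m i | i < n].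
Definition bm n N (m : {ffun 'I_n -> 'I_N}) : {ffun 'I_n -> nat} := [ffun i => m i : nat].
Definition mfact n (m : {ffun 'I_n -> nat}) : C := \prod_i (m i)`!%:R.

Lemma mmE n (m : {ffun 'I_n -> nat}) i : mm m i = m i.
Proof. by rewrite /mm mnmE. Qed.
Lemma mm_inj n : injective (@mm n).
Proof. by move=> a b /mnmP h; apply/ffunP => i; rewrite -!mmE h. Qed.
Lemma bm_inj n N : injective (@bm n N).
Proof. by move=> a b /ffunP h; apply/ffunP => i; apply/val_inj; have := h i; rewrite !ffunE. Qed.
Lemma mfact_neq0 n (m : {ffun 'I_n -> nat}) : mfact m != 0.
Proof. by apply/prodf_neq0 => i _; rewrite pnatr_eq0 -lt0n fact_gt0. Qed.

Definition tpoly n (c : {ffun 'I_n -> nat} -> C) N : mp n :=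
  \sum_(m : {ffun 'I_n -> 'I_N}) (c (bm m) / mfact (bm m)) *: mpolyX C (mm (bm m)).

Lemma ev_tpoly n (c : {ffun 'I_n -> nat} -> C) N h : ev (tpoly c N) h = taylor_sum c h N.
Proof.
rewrite /tpoly ev_sum; apply: eq_bigr => m _; rewrite /ev mevalZ mevalX -mulrA.
congr (_ * _); rewrite /mfact -prodfV -big_split /=; apply: eq_bigr => i _.
by rewrite mmE !ffunE mulrC.
Qed.

(** Truncation to a box of exponents, the shape in which the partial sums of a power
    series are indexed. *)
Definition boxp n N (p : mp n) : mp n :=
  \sum_(m : {ffun 'I_n -> 'I_N}) p@_(mm (bm m)) *: mpolyX C (mm (bm m)).

Lemma boxpB n N (p q : mp n) : boxp N (p - q) = boxp N p - boxp N q.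
Proof. by rewrite /boxp -sumrB; apply: eq_bigr => m _; rewrite mcoeffB scalerBl. Qed.

Lemma pnorm_boxp n N r (p : mp n) : 0 <= r -> pnorm r (boxp N p) <= pnorm r p.
Proof.
move=> r0; apply: le_trans (pnorm_sum _ _ _ r0) _.
apply: le_trans (pnorm_inj p r0 (inj_comp (@mm_inj n) (@bm_inj n N))).
by apply: ler_sum => m _; rewrite pnormZ pnormX.
Qed.

Lemma sum_supp (I : eqType) (V : nmodType) (s s' : seq I) (G : I -> V) : uniq s -> uniq s' ->
  (forall m, m \in s -> m \notin s' -> G m = 0) ->
  (forall m, m \in s' -> m \notin s -> G m = 0) ->
  \sum_(m <- s) G m = \sum_(m <- s') G m.
Proof.
move=> us us' h h'.
rewrite big_seq (bigID (mem s')) /= [X in _ + X]big1 ?addr0; last first.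
  by move=> m /andP[]; apply: h.
rewrite [RHS]big_seq [RHS](bigID (mem s)) /= [X in _ = _ + X]big1 ?addr0; last first.
  by move=> m /andP[]; apply: h'.
rewrite -big_filter -[RHS]big_filter; apply/perm_big/uniq_perm; rewrite ?filter_uniq //.
by move=> m; rewrite !mem_filter; case: (m \in s); case: (m \in s').
Qed.

Definition mbox n N : seq (multinom n) := [seq mm (bm m) | m <- enum {ffun 'I_n -> 'I_N}].

Lemma mbox_uniq n N : uniq (mbox n N).
Proof. by rewrite map_inj_uniq ?enum_uniq // => a b /mm_inj/bm_inj. Qed.

Lemma mem_mbox n N (m : multinom n) : (m \in mbox n N) = [forall i, (m i < N)%N].
Proof.
apply/mapP/forallP => [[x _ ->] i|h]; first by rewrite mmE ffunE.
exists [ffun i => Ordinal (h i)]; first by rewrite mem_enum.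
by apply/mnmP => i; rewrite mmE !ffunE.
Qed.

Lemma sum_mbox n N (V : nmodType) (G : multinom n -> V) :
  \sum_(m : {ffun 'I_n -> 'I_N}) G (mm (bm m)) = \sum_(m <- mbox n N) G m.
Proof. by rewrite /mbox big_map big_enum. Qed.

Lemma mdeg_ge n (m : multinom n) i : (m i <= mdeg m)%N.
Proof. by rewrite mdegE (bigD1 i) //= leq_addr. Qed.

Lemma notin_box n N (m : multinom n) : ~~ [forall i, (m i < N)%N] -> exists i, (N <= m i)%N.
Proof.
move=> h; case: (pickP (fun i : 'I_n => (N <= m i)%N)) => [i hi|h']; first by exists i.
by case/negP: h; apply/forallP => i; rewrite ltnNge; apply/negbT/h'.
Qed.

Lemma boxp_id n N (p : mp n) : (msize p <= N)%N -> boxp N p = p.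
Proof.
move=> hN; rewrite [RHS]mpolyE /boxp.
rewrite (sum_mbox N (fun m => p@_m *: mpolyX C m)); apply: sum_supp.
- exact: mbox_uniq.
- exact: msupp_uniq.
- by move=> m _ /memN_msupp_eq0 ->; rewrite scale0r.
move=> m hm; rewrite mem_mbox => /notin_box[i Ni].
have := msize_mdeg_lt hm; have := mdeg_ge m i => a b.
by have := leq_ltn_trans a (leq_trans b hN); rewrite ltnNge Ni.
Qed.

Lemma coef_boxp n N (p : mp n) (m : multinom n) :
  (boxp N p)@_m = if [forall i, (m i < N)%N] then p@_m else 0.
Proof.
rewrite /boxp (sum_mbox N (fun m => p@_m *: mpolyX C m)) raddf_sum /=.
case: ifP => hm.
  rewrite (bigD1_seq m) ?mbox_uniq ?mem_mbox //= mcoeffZ mcoeffX eqxx mulr1.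
  by rewrite big1 ?addr0 // => k /negbTE kn; rewrite mcoeffZ mcoeffX kn mulr0.
rewrite big_seq big1 // => k; rewrite mem_mbox => hk; rewrite mcoeffZ mcoeffX.
by case: eqP => [e|]; rewrite ?mulr0 //; rewrite e hm in hk.
Qed.

(** A monomial outside the box has total degree at least N. *)
Lemma pnorm_box_tail n N rho r (p : mp n) : 0 <= rho -> rho <= r -> 0 < r ->
  pnorm rho (p - boxp N p) <= (rho / r) ^+ N * pnorm r p.
Proof.
move=> rho0 rr r0.
have -> : p - boxp N p = \sum_(m <- msupp p | ~~ [forall i, (m i < N)%N]) p@_m *: mpolyX C m.
  rewrite {1}[p]mpolyE (bigID (fun m : multinom n => [forall i, (m i < N)%N])) /=.
  rewrite (_ : boxp N p = \sum_(m <- msupp p | [forall i, (m i < N)%N]) p@_m *: mpolyX C m).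
    by rewrite addrAC subrr add0r.
  rewrite /boxp (sum_mbox N (fun m => p@_m *: mpolyX C m)) -[RHS]big_filter.
  apply: sum_supp; rewrite ?mbox_uniq ?filter_uniq ?msupp_uniq //.
    move=> m; rewrite mem_mbox mem_filter => ->.
    by move=> /memN_msupp_eq0 ->; rewrite scale0r.
  by move=> m; rewrite mem_filter mem_mbox => /andP[->].
apply: le_trans (pnorm_sum _ _ _ rho0) _.
rewrite {2}/pnorm [X in _ * X](bigID (fun m : multinom n => ~~ [forall i, (m i < N)%N])) /= mulrDr.
rewrite -[X in X <= _]addr0 lerD //; last first.
  by rewrite mulr_ge0 ?exprn_ge0 ?divr_ge0 ?(ltW r0) // sumr_ge0 // => m _;
     rewrite mulr_ge0 ?nrm_ge0 ?exprn_ge0 ?(ltW r0).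
rewrite mulr_sumr; apply: ler_sum => m /notin_box[i Ni]; have hm := leq_trans Ni (mdeg_ge m i).
rewrite pnormZ pnormX mulrCA.
rewrite ler_wpM2l ?nrm_ge0 // -(subnK hm) !exprD mulrCA expr_div_n divfK; last first.
  by rewrite expf_neq0 ?gt_eqF.
by rewrite ler_wpM2r ?exprn_ge0 // lerXn2r // nnegrE // ltW.
Qed.

Lemma coef_tpoly n (c : {ffun 'I_n -> nat} -> C) N (m : {ffun 'I_n -> nat}) :
  (tpoly c N)@_(mm m) = if [forall i, (m i < N)%N] then c m / mfact m else 0.
Proof.
rewrite raddf_sum /=; under eq_bigr do rewrite mcoeffZ mcoeffX.
case: ifPn => [/forallP h|].
  pose m' : {ffun 'I_n -> 'I_N} := [ffun i => Ordinal (h i)].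
  have bE : bm m' = m by apply/ffunP => i; rewrite !ffunE.
  rewrite (bigD1 m') //= bE eqxx mulr1 big1 ?addr0 // => k kn.
  by case: eqP => [/mm_inj e|]; rewrite ?mulr0 //; case/eqP: kn; apply: bm_inj; rewrite bE.
rewrite negb_forall => /existsP[i hi]; rewrite big1 // => k _.
case: eqP => [/mm_inj e|]; rewrite ?mulr0 //.
by case/negP: hi; rewrite -e ffunE.
Qed.

Lemma boxp_tpoly n (c : {ffun 'I_n -> nat} -> C) N M : (N <= M)%N ->
  boxp N (tpoly c M) = tpoly c N.
Proof.
move=> NM; apply: eq_bigr => m _; rewrite coef_tpoly ifT //.
by apply/forallP => i; rewrite ffunE (leq_trans (ltn_ord _)).
Qed.

(** The sum over the box is the product of n geometric sums. *)
Lemma geom_box n N : \sum_(m : {ffun 'I_n -> 'I_N}) \prod_i (2^-1 : R) ^+ m i <= 2 ^+ n.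
Proof.
rewrite -(bigA_distr_bigA (fun (i : 'I_n) (j : 'I_N) => (2^-1 : R) ^+ j)) /=.
have h : \sum_(j < N) (2^-1 : R) ^+ j <= 2.
  suff : \sum_(j < N) (2^-1 : R) ^+ j <= 2 - 2 * 2^-1 ^+ N.
    by move=> h; apply: le_trans h _; rewrite gerBl mulr_ge0 ?exprn_ge0 ?invr_ge0.
  elim: N => [|N IH]; first by rewrite big_ord0 expr0 mulr1 subrr.
  by rewrite big_ord_recr /= exprS; lra.
rewrite -[X in _ <= 2 ^+ X](card_ord n) -prodr_const; apply: ler_prod => i _.
by rewrite h andbT sumr_ge0 // => j _; rewrite exprn_ge0 ?invr_ge0.
Qed.

(** Abel's lemma: on half the polydisc the terms are dominated by a geometric series. *)
Lemma tpoly_cauchy n (c : {ffun 'I_n -> nat} -> C) (r M : R) : 0 < r ->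
  (forall m, nrm (c m) * \prod_i (r ^+ m i / (m i)`!%:R) <= M) ->
  pcauchy (r / 2) (tpoly c) /\ forall N, pnorm (r / 2) (tpoly c N) <= M * 2 ^+ n.
Proof.
move=> r0 hM; have r20 : 0 <= r / 2 by rewrite divr_ge0 // ltW.
have M0 : 0 <= M.
  apply: le_trans (hM [ffun=> 0%N]); rewrite mulr_ge0 ?nrm_ge0 // prodr_ge0 // => i _.
  by rewrite divr_ge0 ?exprn_ge0 // ltW.
have bnd N : pnorm (r / 2) (tpoly c N) <= M * 2 ^+ n.
  apply: le_trans (pnorm_sum _ _ _ r20) _.
  apply: le_trans (ler_wpM2l M0 (geom_box n N)); rewrite mulr_sumr.
  apply: ler_sum => m _; rewrite pnormZ pnormX nrmM nrmV.
  have -> : (r / 2) ^+ mdeg (mm (bm m)) = \prod_i r ^+ m i * \prod_i 2^-1 ^+ m i.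
    rewrite mdegE -prodrXr -big_split /=; apply: eq_bigr => i _.
    by rewrite mmE ffunE exprMn.
  rewrite mulrA; apply: ler_wpM2r.
    by apply: prodr_ge0 => i _; rewrite exprn_ge0 ?invr_ge0.
  apply: le_trans (hM (bm m)); rewrite -mulrA ler_wpM2l ?nrm_ge0 //.
  rewrite big_split /= mulrC le_eqVlt; apply/orP; left; apply/eqP; congr (_ * _).
    by apply: eq_bigr => i _; rewrite ffunE.
  rewrite prodfV; congr (_^-1); rewrite /mfact nrm_prod.
  by apply: eq_bigr => i _; rewrite nrm_nat.
split=> // e e0.
have mono N N' : (N <= N')%N -> pnorm (r / 2) (tpoly c N' - tpoly c N)
    = pnorm (r / 2) (tpoly c N') - pnorm (r / 2) (tpoly c N).
  move=> NN; rewrite -(boxp_tpoly c NN).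
  set p := tpoly c N'; pose s := msupp p.
  have us : uniq s by apply: msupp_uniq.
  have box0 m : m \notin s -> (boxp N p)@_m = 0.
    by move=> /memN_msupp_eq0 h; rewrite coef_boxp h if_same.
  rewrite !(@pnormw _ _ _ _ s) //.
  - rewrite -sumrB; apply: eq_bigr => m _; rewrite mcoeffB coef_boxp.
    by case: ifP; rewrite ?subrr ?nrm0 ?mul0r ?subr0.
  - by move=> m; apply: contraTT => /box0 h; rewrite mcoeff_msupp h eqxx.
  - move=> m; apply: contraTT => hm; rewrite mcoeff_msupp mcoeffB box0 //.
    by rewrite memN_msupp_eq0 // subr0 eqxx.
pose u N := pnorm (r / 2) (tpoly c N).
have [l hl] : exists l, forall e : R, 0 < e -> exists N, forall k, (N <= k)%N -> `|u k - l| < e.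
  have cu : cvgn u.
    apply: nondecreasing_is_cvgn.
      move=> a b ab; rewrite -subr_ge0 -mono // pnorm_ge0 //.
    by exists (M * 2 ^+ n) => _ [k _ <-]; apply: bnd.
  exists (limn u) => e' e'0.
  have := (@cvgrPdist_lt _ _ _ _ _ _ _).1 cu e' e'0 => -[N _ HN].
  by exists N => k Nk; rewrite distrC; apply: HN.
have [N HN] := hl _ (divr_gt0 e0 (@ltr0Sn R 1)); exists N => i j iN jN.
wlog ij : i j iN jN / (i <= j)%N => [H|].
  by case/orP: (leq_total i j) => ?; [|rewrite pnormB]; apply: H.
rewrite pnormB mono // -/(u j) -/(u i).
have := HN _ iN; have := HN _ jN; rewrite !ltr_norml.
by move=> /andP[a b] /andP[a' b']; lra.
Qed.

Lemma taylor_poly n (f : 'cV[C]_n -> C) a c : taylor_at f a c ->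
  exists2 r, 0 < r & exists B, [/\ pcauchy r (tpoly c), plim r (tpoly c) (fun h => f (a + h)) &
    forall N, pnorm r (tpoly c N) <= B].
Proof.
move=> [r [M [r0 [hM hf]]]]; have [r' r'0 rE] := pos_real r0.
have prodE m : (\prod_i (r' ^+ m i / (m i)`!%:R))%:C%C = \prod_i (r ^+ m i / (m i)`!%:R) :> C.
  rewrite rmorph_prod; apply: eq_bigr => i _.
  by rewrite rE rmorphM rmorphXn fmorphV rmorph_nat.
have hM' : forall m, nrm (c m) * \prod_i (r' ^+ m i / (m i)`!%:R) <= nrm M.
  move=> m; rewrite -rc_le rmorphM /= prodE -!nrmE.
  apply: le_trans (hM m) _; rewrite ger0_norm //; apply: le_trans (hM m).
  by rewrite -prodE nrmE -rmorphM /= (rc_le 0) mulr_ge0 ?nrm_ge0 ?prodr_ge0 // => i _;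
     rewrite divr_ge0 ?exprn_ge0 // ltW.
have [cp bnd] := tpoly_cauchy r'0 hM'; have r20 : 0 < r' / 2 by rewrite divr_gt0.
have lp : plim (r' / 2) (tpoly c) (fun h => f (a + h)).
  move=> h hh; under [X in nlim X]eq_fun do rewrite ev_tpoly.
  apply/cvgC/hf => i; rewrite rE nrm_ltP; apply: le_lt_trans (hh i) _.
  by rewrite ltr_pdivrMr // ltr_pMr //; lra.
by exists (r' / 2) => //; exists (nrm M * 2 ^+ n).
Qed.

(** The remainder after the terms of the box is bounded by the weighted norm of the
    tail, whence the Taylor formula. *)
Lemma taylor_anal n (f : 'cV[C]_n -> C) a c : taylor_at f a c ->
  exists2 r, 0 < r & anal r (fun h => f (a + h)) /\ forall N, exists K, forall rho h,
    0 <= rho -> rho <= r -> inbox rho h -> nrm (f (a + h) - taylor_sum c h N) <= K * rho ^+ N.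
Proof.
move=> /taylor_poly[r r0 [B [cp lp bnd]]].
exists r => //; split; first by exists (tpoly c).
move=> N; exists (B / r ^+ N) => rho h rho0 hrho hh.
have hl := nlimB (lp h (inbox_le hrho hh)) (nlim_cst (taylor_sum c h N)).
apply: (nlim_le (N := N) hl) => k Nk.
  rewrite -ev_tpoly -evB -(boxp_tpoly c (Nk : N <= k)%N).
  apply: le_trans (ev_bound _ hh) _; apply: le_trans (pnorm_box_tail _ _ rho0 hrho r0) _.
  rewrite expr_div_n mulrC mulrA -[X in _ <= X]mulrAC.
  by rewrite ler_wpM2r ?invr_ge0 ?exprn_ge0 ?(ltW r0) // ler_wpM2r ?exprn_ge0 ?bnd.
Qed.

(** The limits of the coefficients are the Taylor coefficients: truncation to a box is
    continuous for the weighted norm. *)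
Lemma plim_taylor n (f : 'cV[C]_n -> C) a r p c : 0 < r -> pcauchy r p ->
  plim r p (fun h => f (a + h)) -> (forall m, nlim (fun k => (p k)@_(mm m)) (c m)) ->
  taylor_at f a (fun m => mfact m * c m).
Proof.
move=> r0 cp hp hc.
have [B B0 [NB HB]] := pcauchy_bounded (ltW r0) cp.
pose d (m : {ffun 'I_n -> nat}) := mfact m * c m.
rewrite -/d; exists (r%:C%C : C), (B%:C%C : C); split; first by rewrite (rc_lt 0).
split=> [m|h hh].
  have -> : \prod_i ((r%:C%C : C) ^+ m i / (m i)`!%:R) = (r ^+ mdeg (mm m))%:C%C / mfact m.
    rewrite big_split /= /mfact prodfV; congr (_ * _).
    rewrite mdegE -prodrXr rmorph_prod; apply: eq_bigr => i _.
    by rewrite mmE rmorphXn.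
  have mf := mfact_neq0 m.
  rewrite nrmE /d nrmM -[_%:C%C / _]ger0_norm; last first.
    rewrite divr_ge0 ?(rc_le 0) ?exprn_ge0 ?(ltW r0) // prodr_ge0 // => i _.
  rewrite nrmE nrmM nrmV nrmR ?exprn_ge0 ?(ltW r0) // -rmorphM rc_le.
  have mf' : nrm (mfact m) != 0 by rewrite nrm_eq0.
  have -> : nrm (mfact m) * nrm (c m) * (r ^+ mdeg (mm m) / nrm (mfact m))
      = nrm (r ^+ mdeg (mm m))%:C%C * nrm (c m).
    by rewrite nrmR ?exprn_ge0 ?(ltW r0) //; field.
  have hlim := nlimZ (r ^+ mdeg (mm m))%:C%C (hc m).
  rewrite -nrmM; apply: (nlim_le (N := NB) hlim) => k kB.
  rewrite nrmM nrmR ?exprn_ge0 ?(ltW r0) // mulrC.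
  exact: le_trans (pnorm_coef _ _ (ltW r0)) (HB k kB).
have hin : inbox r h by move=> i; rewrite ltW // -nrm_ltP.
apply/cvgC => e e0; have e3 : 0 < e / 3 by rewrite divr_gt0.
have [N HN] := cp _ e3; exists (msize (p N)) => M hM.
have h1 : nrm (ev (p N) h - f (a + h)) <= e / 3.
  by apply: (plim_close hp hin) (leqnn N) => i j iN jN; apply/ltW/HN.
have h2 : nrm (ev (p N) h - taylor_sum d h M) <= e / 3.
  rewrite -{1}(boxp_id hM).
  have evb k : ev (boxp M (p k)) h = \sum_(m : {ffun 'I_n -> 'I_M})
      \prod_i h i 0 ^+ m i * (p k)@_(mm (bm m)).
    rewrite /boxp ev_sum; apply: eq_bigr => m _; rewrite /ev mevalZ mevalX mulrC.
    by congr (_ * _); apply: eq_bigr => i _; rewrite mmE ffunE.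
  have lb : nlim (fun k => ev (boxp M (p k)) h) (taylor_sum d h M).
    under [X in nlim X]eq_fun do rewrite evb.
    rewrite (_ : taylor_sum d h M = \sum_(m : {ffun 'I_n -> 'I_M})
      \prod_i h i 0 ^+ m i * c (bm m)); first by apply: nlim_sum => m; apply: nlimZ.
    apply: eq_bigr => m _; rewrite /d -mulrA mulrCA [RHS]mulrC; congr (_ * _).
    rewrite /mfact -big_split /=; apply: eq_bigr => i _; rewrite ffunE mulrCA mulfV ?mulr1 //.
  apply: (nlim_le (N := N) (nlimB (nlim_cst _) lb)) => k kN.
  rewrite -evB -boxpB; apply: le_trans (ev_bound _ hin) _.
  by apply: le_trans (pnorm_boxp _ _ (ltW r0)) _; apply/ltW/HN.
apply: le_lt_trans (nrm_triB _ (ev (p N) h) _) _; rewrite nrmB.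
by have e3' : e = e / 3 + e / 3 + e / 3; lra.
Qed.


Lemma anal_taylor n (f : 'cV[C]_n -> C) a r : 0 < r -> anal r (fun h => f (a + h)) ->
  exists c, taylor_at f a c.
Proof.
move=> r0 [p cp hp].
have /choice[c hc] : forall m : {ffun 'I_n -> nat}, exists l : C, nlim (fun k => (p k)@_(mm m)) l.
  move=> m; apply: cauchyC => e e0.
  have rm : 0 < r ^+ mdeg (mm m) by rewrite exprn_gt0.
  have [N HN] := cp _ (mulr_gt0 e0 rm); exists N => i j iN jN.
  rewrite -mcoeffB -(ltr_pM2r rm); apply: le_lt_trans (HN i j iN jN).
  exact: pnorm_coef (ltW r0).
by exists (fun m => mfact m * c m); apply: plim_taylor r0 cp hp hc.
Qed.

Lemma holoP n (f : 'cV[C]_n -> C) a :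
  holomorphic_at f a <-> exists2 r, 0 < r & anal r (fun h => f (a + h)).
Proof.
split=> [[c /taylor_anal[r r0 [hr _]]]|[r r0 /(anal_taylor r0)//]].
by exists r.
Qed.

Definition shiftm n (i : 'I_n) (m : {ffun 'I_n -> nat}) : {ffun 'I_n -> nat} :=
  [ffun j => (m j + (j == i))%N].

Lemma partial_shift n i (f : 'cV[C]_n -> C) a h :
  partial i (fun h => f (a + h)) h = partial i f (a + h).
Proof.
rewrite /partial /derive.
rewrite (_ : (fun t : C => t^-1 *: (((fun h0 => f (a + h0)) \o shift h) (t *: delta_mx i 0)
    - f (a + h))) = (fun t : C => t^-1 *: ((f \o shift (a + h)) (t *: delta_mx i 0)
    - f (a + h)))) //.
by apply/funext => t /=; rewrite addrCA.
Qed.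

Lemma plim_partial n (f : 'cV[C]_n -> C) a rho p i : 0 < rho -> pcauchy (2 * rho) p ->
  plim (2 * rho) p (fun h => f (a + h)) ->
  pcauchy rho (fun k => mderiv i (p k)) /\
  plim rho (fun k => mderiv i (p k)) (fun h => partial i f (a + h)).
Proof.
move=> r0 cp hp; have [h1 h2 _] := anal_partial i r0 cp hp; split; first exact: h1.
move=> h hh.
by rewrite -partial_shift; apply: h2.
Qed.

(** The derivatives of the Taylor polynomials converge to the derivative, and their
    coefficients are shifted. *)
Lemma taylor_partial n (f : 'cV[C]_n -> C) a c i : taylor_at f a c ->
  taylor_at (partial i f) a (fun m => c (shiftm i m)).
Proof.
move=> /taylor_poly[r r0 [_ [cp hp _]]].
have r20 : 0 < r / 2 by rewrite divr_gt0.
have e : 2 * (r / 2) = r by rewrite mulrC divfK.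
rewrite -e in cp hp; have [cq hq] := plim_partial i r20 cp hp.
have := plim_taylor (c := fun m => c (shiftm i m) / mfact m) r20 cq hq.
have -> : (fun m => mfact m * (c (shiftm i m) / mfact m)) = (fun m => c (shiftm i m)).
  by apply/funext => m; rewrite mulrC divfK ?mfact_neq0.
apply=> m; have shE : mnm_add (mm m) (mnm1 i) = mm (shiftm i m).
  by apply/mnmP => j; rewrite mnmDE mnm1E !mmE ffunE eq_sym.
have [N HN] : exists N, forall j, (shiftm i m j < N)%N.
  exists (\sum_j shiftm i m j).+1 => j; rewrite ltnS (bigD1 j) //= leq_addr.
  by [].
move=> e' e'0; exists N => k Nk.
rewrite mcoeff_deriv shE coef_tpoly ifT; last first.
  by apply/forallP => j; apply: leq_trans (HN j) Nk.
rewrite [X in nrm X](_ : _ = 0) ?nrm0 //; apply/eqP; rewrite subr_eq0; apply/eqP.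
rewrite mmE -mulr_natr; have -> : mfact (shiftm i m) = mfact m * (m i).+1%:R.
  rewrite /mfact (bigD1 i) //= [in RHS](bigD1 i) //= ffunE eqxx addn1 factS natrM.
  rewrite -mulrA mulrC; congr (_ * _ * _); apply: eq_bigr => j ji.
  by rewrite ffunE (negbTE ji) addn0.
have h1 := mfact_neq0 m; have h2 : (m i).+1%:R != 0 :> C by rewrite pnatr_eq0.
by rewrite invfM mulrA divfK.
Qed.

Lemma taylor_sum1 n (c : {ffun 'I_n -> nat} -> C) h : taylor_sum c h 1 = c [ffun=> 0%N].
Proof.
rewrite /taylor_sum (big_pred1 [ffun=> ord0]) => [|m]; last first.
  by apply/esym/eqP/ffunP => i; rewrite !ffunE (ord1 (m i)).
rewrite big1 ?mulr1 => [|i _]; last by rewrite ffunE expr0 fact0 invr1 mulr1.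
by congr c; apply/ffunP => i; rewrite !ffunE.
Qed.

Lemma taylor_value n (f : 'cV[C]_n -> C) a c : taylor_at f a c -> f a = c [ffun=> 0%N].
Proof.
move=> /taylor_anal[r r0 [_ /(_ 1%N)[K hK]]].
have h0 : inbox 0 (0 : 'cV[C]_n) by move=> i; rewrite mxE nrm0.
have := hK 0 0 (lexx 0) (ltW r0) h0; rewrite expr1 mulr0 addr0 taylor_sum1 => h.
apply/eqP; rewrite -subr_eq0 -nrm_eq0; apply/eqP/le_anti; rewrite nrm_ge0 andbT.
exact: h.
Qed.

Lemma taylor_partials (F : 'cV[C]_2 -> C) a c j k : taylor_at F a c ->
  taylor_at (partials F j k) a (fun m => c [ffun i : 'I_2 => (m i + (if i == 0%R then j else k))%N]).
Proof.
have aux G d (i : 'I_2) l : taylor_at G a d ->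
    taylor_at (iter l (partial i) G) a (fun m => d [ffun i' => (m i' + (if i' == i then l else 0))%N]).
  move=> hG; elim: l => [|l IH] /=.
    rewrite (_ : (fun m => _) = d) //; apply/funext => m; congr d.
    by apply/ffunP => i'; rewrite ffunE if_same addn0.
  rewrite (_ : (fun m => _) = (fun m => d [ffun i' => (shiftm i m i' + (if i' == i then l else 0))%N])).
    exact: taylor_partial IH.
  apply/funext => m; congr d; apply/ffunP => i'; rewrite !ffunE.
  by case: (i' == i); rewrite ?addn1 ?addn0 ?addnS.
move=> hF; have := aux _ _ 0 j (aux _ _ 1 k hF).
rewrite (_ : (fun m : {ffun 'I_2 -> nat} => _) = (fun m : {ffun 'I_2 -> nat} => c [ffun i : 'I_2 => (m i + (if i == 0%R then j else k))%N])) //.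
apply/funext => m; congr c; apply/ffunP => i; rewrite !ffunE.
have [i0|i1] : i = 0%R \/ i = 1%R.
  by case: i => [[|[|]]] // hi; [left|right]; apply/val_inj.
  by rewrite i0 eqxx /= addn0.
by rewrite i1 eqxx /= addn0.
Qed.

Lemma partials_taylor (F : 'cV[C]_2 -> C) a G j k : taylor_at F a (Defs.double G) ->
  partials F j k a = G j k.
Proof.
move=> /(taylor_partials j k)/taylor_value ->.
by rewrite /Defs.double !ffunE.
Qed.

Lemma taylor_scale n (f : 'cV[C]_n -> C) c (d : C) (m : 'I_n -> C) : (forall i, m i != 0) ->
  taylor_at f 0 c ->
  taylor_at (fun h => d * f (\col_i (h i 0 / m i))) 0 (fun x => d * c x / \prod_i m i ^+ x i).
Proof.
move=> m0 [r [M [r0 [hM hf]]]].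
have hm i : 0 < nrm (m i) by rewrite nrm_gt0.
have [e e0 he] := fin_pos hm; have ec : (0 : C) < e%:C%C by rewrite (rc_lt 0).
exists (r * e%:C%C), (`|d| * M); split; first by rewrite mulr_gt0.
have em i : (e%:C%C : C) <= `|m i| by rewrite nrmE rc_le.
split=> [x|h hh].
  rewrite !normrM -[X in X <= _]mulrA -[X in X <= _]mulrA ler_wpM2l //.
  apply: le_trans (hM x); rewrite ler_wpM2l // normfV normr_prod -prodfV -big_split /=.
  apply: ler_prod => i _; rewrite normrX exprMn.
  set A := (X in _ <= X <= _).
  have -> : A = (e%:C%C ^+ x i / `|m i| ^+ x i) * (r ^+ x i / (x i)`!%:R).
    by rewrite /A; ring.
  have p1 : 0 <= r ^+ x i / (x i)`!%:R by rewrite divr_ge0 ?exprn_ge0 // ltW.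
  have p2 : (0 : C) <= e%:C%C ^+ x i / `|m i| ^+ x i by rewrite divr_ge0 ?exprn_ge0 // ltW.
  rewrite mulr_ge0 //= ler_piMl // ler_pdivrMr ?exprn_gt0 ?normr_gt0 // mul1r.
  by rewrite lerXn2r // nnegrE ltW.
rewrite add0r; set k := \col_i _.
have hk i : `|k i 0| < r.
  rewrite mxE normrM normfV ltr_pdivrMr ?normr_gt0 //; apply: lt_le_trans (hh i) _.
  by rewrite ler_wpM2l // ltW.
have := hf k hk; rewrite add0r => /cvgC h1; apply/cvgC.
have := nlimZ d h1; congr nlim; apply/funext => N.
rewrite /taylor_sum mulr_sumr; apply: eq_bigr => x _.
rewrite -!mulrA; congr (_ * (_ * _)); rewrite -prodfV -big_split /=; apply: eq_bigr => i _.
by rewrite mxE ffunE expr_div_n mulrAC mulrC.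
Qed.

End Taylor.

(** * Closure properties of holomorphic functions *)
Section Holo.
Variable R : realType.
Notation C := (Cx R).
Notation mp n := (mpoly n C).
Implicit Types (n : nat).
Local Opaque partial holomorphic_at taylor_at.
Local Notation "p @_ m" := (mcoeff m p) (at level 3, m at level 2).

Lemma inbox_nbhs n (a : 'cV[C]_n) (r : R) (P : 'cV[C]_n -> Prop) : 0 < r ->
  (forall h, inbox r h -> P (a + h)) -> nbhs a P.
Proof.
move=> r0 h; apply/nbhsV; exists r => // w hw; rewrite -(subrKC a w); apply: h => i.
by rewrite !mxE ltW.
Qed.

Lemma nbhs_inbox n (a : 'cV[C]_n) (P : 'cV[C]_n -> Prop) : nbhs a P ->
  exists2 r : R, 0 < r & forall h, inbox r h -> P (a + h).
Proof.
move=> /nbhsV[e e0 H]; exists (e / 2); first by rewrite divr_gt0.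
move=> h hh; apply: H => i; rewrite !mxE addrAC subrr add0r.
by apply: le_lt_trans (hh i) _; rewrite ltr_pdivrMr // ltr_pMr //; lra.
Qed.

Lemma holo2 n (f g : 'cV[C]_n -> C) (op : ('cV[C]_n -> C) -> ('cV[C]_n -> C) -> 'cV[C]_n -> C) a :
  (forall r f g, 0 <= r -> anal r f -> anal r g -> anal r (op f g)) ->
  (forall f g, (fun h => op f g (a + h)) = op (fun h => f (a + h)) (fun h => g (a + h))) ->
  holomorphic_at f a -> holomorphic_at g a -> holomorphic_at (op f g) a.
Proof.
move=> hop hs /holoP[r r0 hf] /holoP[r' r'0 hg]; apply/holoP.
exists (Num.min r r'); first by rewrite lt_min r0.
have m0 : 0 <= Num.min r r' by rewrite le_min !ltW.
by rewrite hs; apply: hop => //; [apply: anal_le hf|apply: anal_le hg];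
   rewrite ?m0 ?ge_min ?lexx ?orbT.
Qed.

Lemma holoD n (f g : 'cV[C]_n -> C) a : holomorphic_at f a -> holomorphic_at g a ->
  holomorphic_at (fun h => f h + g h) a.
Proof. exact: (holo2 (op := fun f g h => f h + g h) (@analD R n)). Qed.

Lemma holoM n (f g : 'cV[C]_n -> C) a : holomorphic_at f a -> holomorphic_at g a ->
  holomorphic_at (fun h => f h * g h) a.
Proof. exact: (holo2 (op := fun f g h => f h * g h) (@analM R n)). Qed.

Lemma holo_cst n (c : C) (a : 'cV[C]_n) : holomorphic_at (fun=> c) a.
Proof. by apply/holoP; exists 1 => //; apply: anal_cst. Qed.

Lemma holo_coord n i (a : 'cV[C]_n) : holomorphic_at (fun h => h i 0) a.
Proof.
apply/holoP; exists 1 => //.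
have h1 := analD ler01 (@anal_cst R n 1 (a i 0)) (@anal_coord R n 1 i).
by apply: (anal_eq _ h1) => h _; rewrite !mxE.
Qed.

Lemma holoN n (f : 'cV[C]_n -> C) a : holomorphic_at f a -> holomorphic_at (fun h => - f h) a.
Proof.
move=> hf; have := holoM (holo_cst (-1) a) hf.
by under [X in holomorphic_at X]eq_fun do rewrite mulN1r.
Qed.

Lemma holoB n (f g : 'cV[C]_n -> C) a : holomorphic_at f a -> holomorphic_at g a ->
  holomorphic_at (fun h => f h - g h) a.
Proof. by move=> hf /holoN; apply: holoD. Qed.

Lemma holoV n (f : 'cV[C]_n -> C) a : holomorphic_at f a -> f a != 0 ->
  holomorphic_at (fun h => (f h)^-1) a.
Proof.
move=> /holoP[r r0 hf] fa; apply/holoP.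
have [|r' /andP[r'0 _] h'] := anal_inv r0 hf; first by rewrite addr0.
by exists r'.
Qed.

Definition polymap k n (lq : n.-tuple (mp k)) (h : 'cV[C]_k) : 'cV[C]_n :=
  \col_i ev (tnth lq i) h.

Definition shiftp k (a : 'cV[C]_k) : k.-tuple (mp k) :=
  [tuple mpolyX C (mnm1 i) + mpolyC k (a i 0) | i < k].

Lemma polymap_shift k (a h : 'cV[C]_k) : polymap (shiftp a) h = a + h.
Proof.
apply/matrixP => i j; rewrite (ord1 j) /polymap !mxE tnth_mktuple /ev mevalD mevalXU mevalC.
by rewrite addrC.
Qed.

Lemma anal_polymap n k r (f : 'cV[C]_n -> C) (lq : n.-tuple (mp k)) b : 0 < r ->
  anal r f -> (forall i, nrm (polymap lq b i 0) < r) ->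
  exists2 r', 0 < r' & anal r' (fun h => f (polymap lq (b + h))) /\
     forall h, inbox r' h -> inbox r (polymap lq (b + h)).
Proof.
move=> r0 hf hb.
pose lq' := [tuple comp_mpoly (shiftp b) (tnth lq i) | i < n].
have E h : (\col_i ev (tnth lq' i) h : 'cV[C]_n) = polymap lq (b + h).
  apply/matrixP => i j; rewrite (ord1 j) !mxE tnth_mktuple ev_comp.
  by congr ev; rewrite -polymap_shift.
have [i|r' r'0 [h1 h2]] := anal_comp (lq := lq') r0 hf.
  by have := hb i; rewrite -[b in polymap _ b]addr0 -E mxE.
exists r' => //; split=> [|h hh]; last by rewrite -E; apply: h2.
by move: h1; congr anal; apply/funext => h; rewrite -E.
Qed.

(** A polynomial change of variables sends a small polydisc into the polydisc of
    convergence. *)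
Lemma holo_polymap n k (f : 'cV[C]_n -> C) (lq : n.-tuple (mp k)) b :
  holomorphic_at f (polymap lq b) -> holomorphic_at (fun h => f (polymap lq h)) b.
Proof.
move=> /holoP[r r0 hf]; apply/holoP.
set a := polymap lq b in hf.
have E (c : 'cV[C]_n) h :
    polymap [tuple tnth lq i - mpolyC k (c i 0) | i < n] h = polymap lq h - c.
  by apply/matrixP => i j; rewrite (ord1 j) !mxE tnth_mktuple /ev mevalB mevalC.
pose lq' := [tuple tnth lq i - mpolyC k (a i 0) | i < n].
have [i|r' r'0 [h1 _]] := anal_polymap (lq := lq') (b := b) r0 hf.
  by rewrite E -/a subrr mxE nrm0.
exists r' => //; move: h1; congr anal; apply/funext => h.
by rewrite E addrC subrK.
Qed.

(** A function analytic on a polydisc is analytic on a smaller one about each of its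
    points, by translation. *)
Lemma holo_open n (f : 'cV[C]_n -> C) a : holomorphic_at f a ->
  \forall w \near a, holomorphic_at f w.
Proof.
move=> /holoP[r r0 hf]; apply/nbhsV; exists r => // w hw; apply/holoP.
have [i|r' r'0 [h1 _]] := anal_polymap (lq := shiftp (w - a)) (b := 0) r0 hf.
  by rewrite polymap_shift addr0 !mxE.
exists r' => //; move: h1; congr anal; apply/funext => h.
by rewrite polymap_shift add0r addrA (addrC a) subrK.
Qed.

Lemma holo_partial n i (f : 'cV[C]_n -> C) a : holomorphic_at f a ->
  holomorphic_at (partial i f) a.
Proof. by move=> [c /(taylor_partial i) h]; exists (fun m => c (shiftm i m)). Qed.

Lemma holo_partials (f : 'cV[C]_2 -> C) a j k : holomorphic_at f a ->
  holomorphic_at (partials f j k) a.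
Proof.
move=> hf; rewrite /partials; elim: j => [|j IH] /=; last exact: holo_partial.
by elim: k => [|k IH] /=; [|apply: holo_partial].
Qed.

Lemma ev_trunc1 n (p : mp n) h :
  ev (mtrunc 1 p) h = p@_mnm0 + \sum_i p@_(mnm1 i) * h i 0.
Proof.
have -> : mtrunc 1 p = \sum_(m <- mnm0 :: [seq mnm1 i | i <- enum 'I_n]) p@_m *: mpolyX C m.
  rewrite /mtrunc -big_filter; apply: sum_supp.
  - by rewrite filter_uniq ?msupp_uniq.
  - rewrite /= map_inj_uniq ?enum_uniq ?andbT.
      by apply/mapP => -[i _ /(congr1 mdeg)]; rewrite mdeg0 mdeg1.
    by move=> i j /mnmP/(_ i); rewrite !mnm1E eqxx; case: eqP.
  - move=> m; rewrite mem_filter => /andP[hm _]; rewrite inE negb_or => /andP[m0 hn].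
    case/negP: hn; have /mdeg1P[i /eqP ->] : (mdeg m == 1)%N.
      by rewrite eqn_leq hm lt0n mdeg_eq0.
    by rewrite map_f // mem_enum.
  - move=> m hm; rewrite mem_filter => hn.
    have dm : (mdeg m <= 1)%N.
      by move: hm; rewrite inE => /orP[/eqP ->|/mapP[i _ ->]]; rewrite ?mdeg0 ?mdeg1.
    by rewrite dm /= in hn; rewrite (memN_msupp_eq0 hn) scale0r.
rewrite big_cons evD /ev mevalZ mpolyX0 meval1 mulr1; congr (_ + _).
rewrite big_map big_enum raddf_sum /=; apply: eq_bigr => i _.
by rewrite mevalZ mevalXU.
Qed.

Lemma holo_frechet n (f : 'cV[C]_n -> C) a : holomorphic_at f a ->
  exists (l : 'I_n -> C) (K r : R), [/\ 0 < r, 0 <= K &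
    forall rho h, 0 <= rho -> rho <= r -> inbox rho h ->
    nrm (f (a + h) - f a - \sum_i l i * h i 0) <= K * rho ^+ 2].
Proof.
move=> /holoP[r r0 [p cp hp]].
have [B B0 [NB HB]] := pcauchy_bounded (ltW r0) cp.
have /choice[l hl] : forall i, exists l : C, nlim (fun k => (p k)@_(mnm1 i)) l.
  move=> i; apply: cauchyC => e e0.
  have [N HN] := cp _ (mulr_gt0 e0 r0); exists N => j k jN kN.
  rewrite -mcoeffB -(ltr_pM2r r0); apply: le_lt_trans (HN j k jN kN).
  by have := pnorm_coef (p j - p k) (mnm1 i) (ltW r0); rewrite mdeg1 expr1.
exists l, (B / r ^+ 2), r; split=> // [|rho h rho0 hr hh].
  by rewrite divr_ge0 ?exprn_ge0 ?ltW.
have in0 : inbox r (0 : 'cV[C]_n) by move=> i; rewrite mxE nrm0 ltW.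
have := hp _ in0; rewrite addr0 => hp0.
have hs : nlim (fun k => \sum_i (p k)@_(mnm1 i) * h i 0) (\sum_i l i * h i 0).
  apply: nlim_sum => i; have := nlimZ (h i 0) (hl i).
  by rewrite mulrC; under [X in nlim X]eq_fun do rewrite mulrC.
have hl' := nlimB (nlimB (hp _ (inbox_le hr hh)) hp0) hs.
apply: (nlim_le (N := NB) hl') => k kB.
have -> : ev (p k) h - ev (p k) 0 - \sum_i (p k)@_(mnm1 i) * h i 0
    = ev (p k - mtrunc 1 (p k)) h by rewrite evB ev_trunc1 ev0 opprD addrA.
apply: le_trans (ev_bound _ hh) _; apply: le_trans (pnorm_trunc 1 _ rho0 hr r0) _.
rewrite expr_div_n mulrC mulrA [X in _ <= X]mulrAC.
by rewrite ler_wpM2r ?invr_ge0 ?exprn_ge0 ?(ltW r0) // ler_wpM2r ?exprn_ge0 ?HB.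
Qed.

Lemma holo_cont n (f : 'cV[C]_n -> C) a (e : R) : holomorphic_at f a -> 0 < e ->
  exists2 r : R, 0 < r & forall h, inbox r h -> nrm (f (a + h) - f a) < e.
Proof.
move=> /holoP[r0 r00 hf] e0; have [c hc] := anal_taylor r00 hf.
have [r r0' [_ /(_ 1%N)[K hK]]] := taylor_anal hc.
have fa := taylor_value hc.
have K0 : 0 < `|K| + 1 by rewrite ltr_wpDl.
pose rho := Num.min r (e / (`|K| + 1) / 2).
have rho0 : 0 < rho by rewrite lt_min r0' !divr_gt0.
have rr : rho <= r by rewrite ge_min lexx.
exists rho => // h hh.
have := hK rho h (ltW rho0) rr hh; rewrite taylor_sum1 -fa expr1 => /le_lt_trans; apply.
have h1 : rho <= e / (`|K| + 1) / 2 by rewrite ge_min lexx orbT.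
apply: (@le_lt_trans _ _ ((`|K| + 1) * rho)).
  by rewrite ler_wpM2r ?(ltW rho0) // (le_trans (ler_norm K)) // lerDl.
apply: (@le_lt_trans _ _ ((`|K| + 1) * (e / (`|K| + 1) / 2))).
  by rewrite ler_wpM2l // ltW.
by rewrite mulrA mulrCA mulfV ?gt_eqF // mulr1 ltr_pdivrMr // ltr_pMr //; lra.
Qed.
End Holo.

(** * Jets of functions of two variables *)
Section Jets.
Variable R : realType.
Notation C := (Cx R).
Notation BP := {poly {poly C}}.
Local Opaque partial holomorphic_at taylor_at.

(** Jets are represented by polynomials in y whose coefficients are polynomials, x being
    the outer variable; this reuses the ring structure of univariate polynomials. *)
Definition bev (P : BP) (x y : C) : C := (P.[x%:P]).[y].
Definition bX : BP := 'X.
Definition bY : BP := ('X : {poly C})%:P.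
Definition bC (c : C) : BP := (c%:P)%:P.
Definition bc (P : BP) (j k : nat) : C := P`_j`_k.

Lemma bevD P Q x y : bev (P + Q) x y = bev P x y + bev Q x y.
Proof. by rewrite /bev !hornerD. Qed.
Lemma bevN P x y : bev (- P) x y = - bev P x y.
Proof. by rewrite /bev !hornerN. Qed.
Lemma bevM P Q x y : bev (P * Q) x y = bev P x y * bev Q x y.
Proof. by rewrite /bev !hornerM. Qed.
Lemma bevX P k x y : bev (P ^+ k) x y = bev P x y ^+ k.
Proof. by elim: k => [|k IH]; rewrite ?expr0 /bev ?hornerC // !exprS -IH -/(bev _ _ _) bevM. Qed.
Lemma bev_bX x y : bev bX x y = x.
Proof. by rewrite /bev /bX hornerX hornerC. Qed.
Lemma bev_bY x y : bev bY x y = y.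
Proof. by rewrite /bev /bY hornerC hornerX. Qed.
Lemma bev_bC c x y : bev (bC c) x y = c.
Proof. by rewrite /bev /bC !hornerC. Qed.
Lemma bev_sum I (s : seq I) (Pr : pred I) (F : I -> BP) x y :
  bev (\sum_(i <- s | Pr i) F i) x y = \sum_(i <- s | Pr i) bev (F i) x y.
Proof.
elim/big_rec2 : _ => [|i a b _ <-]; first by rewrite /bev !horner0.
by rewrite bevD.
Qed.

Lemma bcD P Q j k : bc (P + Q) j k = bc P j k + bc Q j k.
Proof. by rewrite /bc !coefD. Qed.
Lemma bcN P j k : bc (- P) j k = - bc P j k.
Proof. by rewrite /bc !coefN. Qed.
Lemma bcB P Q j k : bc (P - Q) j k = bc P j k - bc Q j k.
Proof. by rewrite bcD bcN. Qed.
Lemma bc_sum I (s : seq I) (Pr : pred I) (F : I -> BP) j k :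
  bc (\sum_(i <- s | Pr i) F i) j k = \sum_(i <- s | Pr i) bc (F i) j k.
Proof. by rewrite /bc !coef_sum. Qed.
Lemma bcM P Q j k : bc (P * Q) j k =
  \sum_(i < j.+1) \sum_(l < k.+1) bc P i l * bc Q (j - i) (k - l).
Proof. by rewrite /bc coefM coef_sum; apply: eq_bigr => i _; rewrite coefM. Qed.
Lemma bc_C c P j k : bc (bC c * P) j k = c * bc P j k.
Proof. by rewrite /bc /bC !coefCM. Qed.
Lemma bc_CE c j k : bc (bC c) j k = if (j == 0)%N && (k == 0)%N then c else 0.
Proof.
rewrite /bc /bC coefC; case: eqP => //= _; last by rewrite coef0.
by rewrite coefC; case: eqP.
Qed.
Lemma bc_X P j k : bc (bX * P) j k = if j is j'.+1 then bc P j' k else 0.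
Proof. by rewrite /bc /bX coefXM; case: j => //=; rewrite coef0. Qed.
Lemma bc_Y P j k : bc (bY * P) j k = if k is k'.+1 then bc P j k' else 0.
Proof. by rewrite /bc /bY coefCM coefXM; case: k. Qed.
Lemma bc_XY a b j k : bc (bX ^+ a * bY ^+ b) j k = ((j == a) && (k == b))%:R.
Proof.
elim: a j => [|a IH] j; last by rewrite exprS -mulrA bc_X; case: j => // j; rewrite IH.
rewrite expr0 mul1r; elim: b k => [|b IH] k.
  by rewrite expr0 /bc coef1; case: eqP => //= _; rewrite ?coef1 ?coef0.
rewrite exprS bc_Y; case: k => [|k]; first by rewrite andbF.
by rewrite IH.
Qed.

Lemma bev_bc (P : BP) N x y : (forall j k, (N <= j)%N || (N <= k)%N -> bc P j k = 0) ->
  bev P x y = \sum_(j < N) \sum_(k < N) bc P j k * x ^+ j * y ^+ k.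
Proof.
move=> h; rewrite /bev.
have sP : (size P <= N)%N.
  apply/leq_sizeP => j hj; apply/polyP => k; rewrite coef0; apply: h.
  by rewrite hj.
rewrite (horner_coef_wide _ sP) horner_sum; apply: eq_bigr => j _.
rewrite -rmorphXn /= mulrC mul_polyC hornerZ (@horner_coef_wide _ N).
  by rewrite mulr_sumr; apply: eq_bigr => k _; rewrite /bc mulrCA !mulrA.
by apply/leq_sizeP => k hk; apply: h; rewrite hk orbT.
Qed.

Lemma bc_bound (P : BP) : exists N, forall j k, (N <= j)%N || (N <= k)%N -> bc P j k = 0.
Proof.
exists (maxn (size P) (\max_(j < size P) size (P`_j)%R)) => j k.
have [hj|hj] := leqP (size P) j; first by rewrite /bc (nth_default _ hj) coef0.
rewrite !geq_max [(size P <= j)%N]leqNgt hj /= => /andP[_ /bigmax_leqP h].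
by rewrite /bc nth_default //; apply: (h (Ordinal hj)).
Qed.

Definition bpoly N (g : nat -> nat -> C) : BP :=
  \poly_(j < N) \poly_(k < N) g j k.

Lemma bc_bpoly N g j k : bc (bpoly N g) j k = if (j < N)%N && (k < N)%N then g j k else 0.
Proof. by rewrite /bc /bpoly coef_poly; case: ifP => //= _; rewrite ?coef0 // coef_poly. Qed.

Lemma bpolyE N g : bpoly N g = \sum_(j < N) \sum_(k < N) bC (g j k) * bX ^+ j * bY ^+ k.
Proof.
apply/polyP => j; apply/polyP => k; rewrite -/(bc _ _ _) -/(bc (\sum_(_ < _) _) _ _) bc_bpoly bc_sum.
under eq_bigr => j' _.
  rewrite bc_sum; under eq_bigr => k' _ do rewrite -mulrA bc_C bc_XY.
  over.
case: ifPn => [/andP[hj hk]|hn].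
  rewrite (bigD1 (Ordinal hj)) //= (bigD1 (Ordinal hk)) //= !eqxx mulr1.
  rewrite big1 => [|k' /eqP hk']; last first.
    by case: eqP => [e|]; rewrite ?mulr0 //; case: hk'; apply: val_inj.
  rewrite big1 ?addr0 // => j' /eqP hj'; rewrite big1 // => k' _.
  by case: eqP => [e|]; rewrite ?mulr0 //; case: hj'; apply: val_inj.
rewrite big1 // => j' _; rewrite big1 // => k' _.
by case: andP => [[/eqP e /eqP e']|]; rewrite ?mulr0 //; rewrite e e' !ltn_ord in hn.
Qed.

Lemma bev_bpoly N g x y : bev (bpoly N g) x y = \sum_(j < N) \sum_(k < N) g j k * x ^+ j * y ^+ k.
Proof.
rewrite bpolyE bev_sum; apply: eq_bigr => j _; rewrite bev_sum; apply: eq_bigr => k _.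
by rewrite !bevM !bevX bev_bC bev_bX bev_bY.
Qed.

(** The N-jet at the origin, up to terms of order N. No derivative is involved: sums,
    products and composites of jets follow from estimates alone. *)
Definition jeq (N : nat) (f : 'cV[C]_2 -> C) (P : BP) : Prop :=
  exists (K r : R), [/\ 0 < r, 0 <= K & forall rho h, 0 <= rho -> rho <= r -> inbox rho h ->
    nrm (f h - bev P (h 0 0) (h 1 0)) <= K * rho ^+ N].

Lemma bev_bounded P (r : R) : exists2 B : R, 0 <= B & forall h : 'cV[C]_2, inbox r h ->
  nrm (bev P (h 0 0) (h 1 0)) <= B.
Proof.
have [N /bev_bc hN] := bc_bound P.
exists (\sum_(j < N) \sum_(k < N) nrm (bc P j k) * `|r| ^+ j * `|r| ^+ k).
  by do 2!(apply: sumr_ge0 => ? _); rewrite !mulr_ge0 ?nrm_ge0 ?exprn_ge0.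
move=> h hh; rewrite hN; apply: le_trans (nrm_sum _ _ _) _; apply: ler_sum => j _.
apply: le_trans (nrm_sum _ _ _) _; apply: ler_sum => k _.
have hr i : nrm (h i 0) <= `|r| := le_trans (hh i) (ler_norm r).
by rewrite !nrmM !nrmX !ler_pM ?mulr_ge0 ?nrm_ge0 ?exprn_ge0 ?nrm_ge0 //; apply: lerXn2r;
   rewrite ?nnegrE ?nrm_ge0 ?hr.
Qed.

Lemma jeq_ev N P : jeq N (fun h => bev P (h 0 0) (h 1 0)) P.
Proof. by exists 0, 1; split=> // rho h _ _ _; rewrite subrr nrm0 mul0r. Qed.

Lemma jeq_eq N f g P : (\forall h \near (0 : 'cV[C]_2), f h = g h) -> jeq N f P -> jeq N g P.
Proof.
move=> /nbhs_inbox[r' r'0 e] [K [r [r0 K0 h]]]; exists K, (Num.min r r').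
split=> // [|rho k rho0]; first by rewrite lt_min r0.
rewrite le_min => /andP[h1 h2] hk.
by rewrite -[k]add0r -e ?add0r; [apply: h|apply: inbox_le hk].
Qed.

Lemma jeqD N f g P Q : jeq N f P -> jeq N g Q -> jeq N (fun h => f h + g h) (P + Q).
Proof.
move=> [K [r [r0 K0 h]]] [K' [r' [r'0 K'0 h']]].
exists (K + K'), (Num.min r r'); split=> [||rho k rho0]; rewrite ?lt_min ?r0 ?addr_ge0 //.
rewrite le_min => /andP[h1 h2] hk; rewrite bevD opprD addrACA mulrDl.
by apply: le_trans (nrmD _ _) _; rewrite lerD ?h ?h'.
Qed.

Lemma jeqM N f g P Q : jeq N f P -> jeq N g Q -> jeq N (fun h => f h * g h) (P * Q).
Proof.
move=> [K [r [r0 K0 h]]] [K' [r' [r'0 K'0 h']]].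
pose m := Num.min (Num.min r r') 1.
have [A A0 HA] := bev_bounded P m; have [B B0 HB] := bev_bounded Q m.
exists (K * (B + K') + A * K'), m; split=> [||rho k rho0].
- by rewrite !lt_min r0 r'0 ltr01.
- by rewrite addr_ge0 ?mulr_ge0 ?addr_ge0.
move=> hm hk; have := hm; rewrite !le_min => /andP[/andP[h1 h2] h3].
set p := bev P (k 0 0) (k 1 0); set q := bev Q (k 0 0) (k 1 0).
have kp := h rho k rho0 h1 hk; have kq := h' rho k rho0 h2 hk.
have qb : nrm q <= B by apply/HB/inbox_le/hk.
have pb : nrm p <= A by apply/HA/inbox_le/hk.
have gb : nrm (g k) <= B + K'.
  rewrite -(subrK q (g k)) addrC; apply: le_trans (nrmD _ _) _; rewrite lerD //.
  by apply: le_trans kq _; rewrite ler_piMr // exprn_ile1.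
rewrite bevM -/p -/q.
have -> : f k * g k - p * q = (f k - p) * g k + p * (g k - q) by ring.
apply: le_trans (nrmD _ _) _; rewrite !nrmM mulrDl lerD //.
  by rewrite mulrAC ler_pM ?nrm_ge0.
by rewrite -mulrA ler_pM ?nrm_ge0.
Qed.

Lemma jeqC N c : jeq N (fun=> c) (bC c).
Proof. by have := jeq_ev N (bC c); congr jeq; apply/funext => h; rewrite bev_bC. Qed.

Lemma jeqN N f P : jeq N f P -> jeq N (fun h => - f h) (- P).
Proof.
move=> [K [r [r0 K0 h]]]; exists K, r; split=> // rho k r1 r2 hk.
by rewrite bevN -opprD nrmN; apply: h.
Qed.

Lemma jeqB N f g P Q : jeq N f P -> jeq N g Q -> jeq N (fun h => f h - g h) (P - Q).
Proof. by move=> hf /jeqN; apply: jeqD. Qed.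

Lemma jeqX N f P k : jeq N f P -> jeq N (fun h => f h ^+ k) (P ^+ k).
Proof.
move=> h; elim: k => [|k IH].
  by have := jeqC N 1; congr jeq; apply/funext.
rewrite exprS; have := jeqM h IH; congr jeq; apply/funext => x; by rewrite exprS.
Qed.

Lemma jeq_sum N I (s : seq I) (Pr : pred I) (f : I -> 'cV[C]_2 -> C) P :
  (forall i, jeq N (f i) (P i)) ->
  jeq N (fun h => \sum_(i <- s | Pr i) f i h) (\sum_(i <- s | Pr i) P i).
Proof.
move=> h; elim: s => [|i s IH].
  rewrite big_nil; have := jeqC N 0; rewrite /bC !polyC0; congr jeq.
  by apply/funext => x; rewrite big_nil.
rewrite big_cons; under [X in jeq _ X]eq_fun do rewrite big_cons.
by case: (Pr i); [exact: (jeqD (h i) IH)|exact: IH].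
Qed.

(** If the constant coefficient were nonzero the bound would fail for small s; dividing
    by the variable lowers N. *)
Lemma poly_small (q : {poly C}) (K r : R) N : 0 < r ->
  (forall s : C, s != 0 -> nrm s <= r -> nrm q.[s] <= K * nrm s ^+ N) ->
  forall d, (d < N)%N -> q`_d = 0.
Proof.
elim: N q => // N IH q r0 h.
have q0 : q`_0 = 0.
  pose B := \sum_(i < size q) nrm q`_i.
  have B0 : 0 <= B by apply: sumr_ge0 => i _; apply: nrm_ge0.
  have hB s : nrm s <= 1 -> nrm (q.[s] - q`_0) <= B * nrm s.
    move=> hs; rewrite horner_coef.
    case sq : (size q) => [|m].
      by rewrite big_ord0 nth_default ?sq // subrr nrm0 mulr_ge0 ?nrm_ge0.
    rewrite big_ord_recl /= expr0 mulr1 addrAC subrr add0r.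
    apply: le_trans (nrm_sum _ _ _) _; rewrite /B sq big_ord_recl mulrDl.
    rewrite -[X in X <= _]add0r lerD ?mulr_ge0 ?nrm_ge0 // mulr_suml.
    apply: ler_sum => i _; rewrite nrmM nrmX ler_wpM2l ?nrm_ge0 // exprS.
    by rewrite ler_piMr ?nrm_ge0 // exprn_ile1 ?nrm_ge0.
  apply/eqP; rewrite -nrm_eq0; apply: contraT => c0; have cp : 0 < nrm q`_0 by rewrite lt_def c0 nrm_ge0.
  pose D := `|K| + B + 1; have D0 : 0 < D by rewrite ltr_wpDl ?addr_ge0.
  (* At a point this close to 0 the constant term would outweigh all the others. *)
  pose s := Num.min (Num.min 1 r) (nrm q`_0 / D / 2).
  have s0 : 0 < s by rewrite !lt_min ltr01 r0 !divr_gt0.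
  have ns : nrm (s%:C%C : C) = s by rewrite nrmR // ltW.
  have s1 : s <= 1 by rewrite !ge_min lexx.
  have sr : s <= r by rewrite !ge_min lexx orbT.
  have sD : s <= nrm q`_0 / D / 2 by rewrite !ge_min lexx !orbT.
  have hs : (s%:C%C : C) != 0 by rewrite -nrm_gt0 ns.
  have h1 := h _ hs; rewrite ns in h1; have {h1} := h1 sr.
  have h2 := hB (s%:C%C : C); rewrite ns in h2; have {h2} := h2 s1.
  have h3 := nrmD q.[s%:C%C] (q`_0 - q.[s%:C%C]); rewrite [X in nrm X <= _]addrC subrK in h3.
  rewrite nrmB in h3 => h4 h5.
  have h6 : K * s ^+ N.+1 <= `|K| * s.
    apply: le_trans (ler_wpM2r (exprn_ge0 _ (ltW s0)) (ler_norm K)) _.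
    by rewrite ler_wpM2l ?normr_ge0 // exprS ler_piMr ?(ltW s0) // exprn_ile1 ?(ltW s0).
  have h7 : D * s <= nrm q`_0 / 2.
    by rewrite mulrC -ler_pdivlMr // mulrAC.
  have h8 : D * s = `|K| * s + B * s + s by rewrite /D; ring.
  have h9 : nrm q`_0 <= D * s.
    rewrite h8; apply: le_trans h3 _; apply: le_trans (lerD (le_trans h5 h6) h4) _.
    by rewrite lerDl ltW.
  have := le_trans h9 h7; rewrite ler_pdivlMr // mulr_natr mulr2n.
  by rewrite gerDl leNgt cp.
have [q' qE] : exists q', q = q' * 'X.
  exists (\poly_(i < (size q).-1) q`_i.+1); apply/polyP => i.
  rewrite coefMX coef_poly; case: i => //= i; case: ltnP => // hi.
  by rewrite nth_default //; case: (size q) hi.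
move=> [|d] hd //; rewrite qE coefMX /=; apply: IH hd => // s s0 sr.
have ns : 0 < nrm s by rewrite nrm_gt0.
have := h s s0 sr; rewrite qE hornerM hornerX nrmM exprSr mulrA ler_pM2r //.
Qed.

(** Restricting to the lines (t s, s) gives polynomials in s that are small of order N,
    whose coefficients are polynomials in t vanishing on a disc. *)
Lemma bc0_jet N P : jeq N (fun=> 0) P -> forall j k, (j + k < N)%N -> bc P j k = 0.
Proof.
move=> [K [r [r0 K0 h]]] j k.
move=> hjk; pose d := (j + k)%N.
have [M [hM dM]] : exists M, (forall j k, (M <= j)%N || (M <= k)%N -> bc P j k = 0) /\ (d < M)%N.
  have [M0 h0] := bc_bound P; exists (maxn M0 d.+1); rewrite leq_max leqnn orbT.
  by split=> // j' k'; rewrite !geq_max => h1; apply: h0; case/orP: h1 => /andP[-> _]; rewrite ?orbT.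
pose q (t : C) : {poly C} := \sum_(j < M) \sum_(k < M) (bc P j k * t ^+ j) *: 'X^(j + k).
have hq t s : nrm t <= 1 -> nrm s <= r -> nrm (q t).[s] <= K * nrm s ^+ N.
  move=> ht hs.
  have -> : (q t).[s] = bev P (t * s) s.
    rewrite (bev_bc _ _ hM) horner_sum; apply: eq_bigr => a _; rewrite horner_sum.
    apply: eq_bigr => b _; rewrite hornerZ hornerXn exprMn exprD; ring.
  pose v : 'cV[C]_2 := \col_i (if i == 0 then t * s else s).
  have := h (nrm s) v (nrm_ge0 _) hs; rewrite !mxE /= sub0r nrmN; apply.
  move=> i; rewrite mxE; case: ifP => _ //; rewrite nrmM.
  by rewrite ler_piMl ?nrm_ge0.
have hq0 t d' : nrm t <= 1 -> (d' < N)%N -> (q t)`_d' = 0.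
  by move=> ht; apply: (poly_small (K := K) r0) => s _; apply: hq.
pose p : {poly C} := \poly_(i < d.+1) bc P i (d - i).
have hp t : nrm t <= 1 -> p.[t] = 0.
  move=> ht; rewrite horner_poly; apply: etrans _ (hq0 t d ht hjk); rewrite coef_sum.
  rewrite (big_ord_widen M (fun i => bc P i (d - i) * t ^+ i)) // big_mkcond.
  apply: eq_bigr => a _; rewrite coef_sum ltnS; case: leqP => hd.
    have hk : (d - a < M)%N by apply: leq_ltn_trans (leq_subr _ _) dM.
    rewrite (bigD1 (Ordinal hk)) //= coefZ coefXn subnKC // eqxx mulr1 big1 ?addr0 // => b.
    move=> /eqP hb; rewrite coefZ coefXn; case: eqP => [e|]; rewrite ?mulr0 //.
    by case: hb; apply: val_inj; rewrite /= e addKn.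
  rewrite big1 // => b _; rewrite coefZ coefXn; case: eqP => [e|]; rewrite ?mulr0 //.
  by move: hd; rewrite e ltnNge leq_addr.
have : p`_j = 0.
  have p0 : forall s : C, s != 0 -> nrm s <= 1 -> nrm p.[s] <= 0 * nrm s ^+ j.+1.
    by move=> s _ hs; rewrite hp // nrm0 mul0r.
  exact: (poly_small ltr01 p0).
by rewrite coef_poly ltnS leq_addr /d addKn.
Qed.

Lemma jet_unique N f P Q : jeq N f P -> jeq N f Q ->
  forall j k, (j + k < N)%N -> bc P j k = bc Q j k.
Proof.
move=> hP hQ j k hjk; apply/eqP; rewrite -subr_eq0 -bcB; apply/eqP.
apply: bc0_jet hjk; have := jeqB hP hQ; congr jeq.
by apply/funext => h; rewrite subrr.
Qed.

Lemma jeq_mod N f P Q : (forall j k, (j + k < N)%N -> bc P j k = bc Q j k) ->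
  jeq N f P -> jeq N f Q.
Proof.
move=> e hP; suff h : jeq N (fun=> 0) (Q - P).
  have := jeqD hP h; rewrite addrCA subrr addr0; congr jeq.
  by apply/funext => x; rewrite addr0.
have [M hM] := bc_bound (Q - P); set D := Q - P in hM *.
have D0 j k : (j + k < N)%N -> bc D j k = 0 by move=> h; rewrite bcB e ?subrr.
pose K := \sum_(j < M) \sum_(k < M) nrm (bc D j k).
exists K, 1; split=> // [|rho h r0 r1 hh].
  by do 2!(apply: sumr_ge0 => ? _); apply: nrm_ge0.
rewrite sub0r nrmN (bev_bc _ _ hM) mulr_suml; apply: le_trans (nrm_sum _ _ _) _.
apply: ler_sum => j _; rewrite mulr_suml; apply: le_trans (nrm_sum _ _ _) _.
apply: ler_sum => k _; rewrite !nrmM !nrmX -mulrA.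
have [/D0 ->|hN] := ltnP (j + k) N; first by rewrite nrm0 !mul0r.
rewrite ler_wpM2l ?nrm_ge0 // (@le_trans _ _ (rho ^+ (j + k))) //.
  by rewrite exprD ler_pM ?exprn_ge0 ?nrm_ge0 //; apply: lerXn2r; rewrite ?nnegrE ?nrm_ge0 ?hh.
by rewrite -(subnKC hN) exprD ler_piMr ?exprn_ge0 // exprn_ile1.
Qed.

Lemma jeq_taylor N (f : 'cV[C]_2 -> C) a G : taylor_at f a (Defs.double G) ->
  jeq N (fun h => f (a + h)) (bpoly N (fun j k => G j k / (j`!%:R * k`!%:R))).
Proof.
move=> /taylor_anal[r r0 [_ /(_ N)[K hK]]]; exists `|K|, r; split=> // rho h h0 h1 hh.
apply: (@le_trans _ _ (K * rho ^+ N)); last by rewrite ler_wpM2r ?exprn_ge0 ?ler_norm.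
rewrite (_ : bev _ _ _ = taylor_sum (Defs.double G) h N); first exact: hK.
rewrite bev_bpoly /taylor_sum pair_big /=.
pose fw (u : 'I_N * 'I_N) : {ffun 'I_2 -> 'I_N} := [ffun i => if i == 0 then u.1 else u.2].
rewrite (reindex fw) /=; last first.
  exists (fun m => (m 0, m 1)) => [u _|m _]; first by rewrite !ffunE /=; case: u.
  apply/ffunP => i; rewrite ffunE; case: eqP => [-> //|i0].
  by congr (m _); case: i i0 => [[|[|]]] // hi; [case; apply: val_inj|move=> _; apply: val_inj].
apply: eq_bigr => -[j k] _; rewrite /= big_ord_recl big_ord1 /Defs.double !ffunE /=.
rewrite (_ : lift ord0 ord0 = 1 :> 'I_2) ?eqxx; last exact: val_inj.
by rewrite invfM; ring.
Qed.

(** Since X and Y are small of first order, the error of the outer jet is of the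
    required order after substitution. *)
Lemma jeq_comp N (f X Y : 'cV[C]_2 -> C) P PX PY :
  jeq N f P -> jeq N X PX -> jeq N Y PY ->
  (exists L r : R, [/\ 0 < r, 0 < L & forall rho h, 0 <= rho -> rho <= r -> inbox rho h ->
     nrm (X h) <= L * rho /\ nrm (Y h) <= L * rho]) ->
  forall M, (forall j k, (M <= j)%N || (M <= k)%N -> bc P j k = 0) ->
  jeq N (fun h => f (\col_i (if i == 0 then X h else Y h)))
    (\sum_(j < M) \sum_(k < M) bC (bc P j k) * PX ^+ j * PY ^+ k).
Proof.
move=> [K [r [r0 K0 hf]]] hX hY [L [r' [r'0 L0 hL]]] M hM.
have h1 : jeq N (fun h => bev P (X h) (Y h))
    (\sum_(j < M) \sum_(k < M) bC (bc P j k) * PX ^+ j * PY ^+ k).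
  have h2 : jeq N (fun h => \sum_(j < M) \sum_(k < M) bc P j k * X h ^+ j * Y h ^+ k)
      (\sum_(j < M) \sum_(k < M) bC (bc P j k) * PX ^+ j * PY ^+ k).
    apply: jeq_sum => j; apply: jeq_sum => k.
    exact: (jeqM (jeqM (jeqC N _) (jeqX _ hX)) (jeqX _ hY)).
  by move: h2; congr jeq; apply/funext => h; rewrite (bev_bc _ _ hM).
suff h2 : jeq N (fun h => f (\col_i (if i == 0 then X h else Y h)) - bev P (X h) (Y h)) 0.
  have := jeqD h2 h1; rewrite add0r; congr jeq; apply/funext => h; by rewrite subrK.
exists (K * L ^+ N), (Num.min r' (r / L)); split=> [||rho h rho0].
- by rewrite lt_min r'0 divr_gt0.
- by rewrite mulr_ge0 ?exprn_ge0 // ltW.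
rewrite le_min => /andP[h3 h4] hh; have [hx hy] := hL rho h rho0 h3 hh.
rewrite /bev !horner0 subr0 -mulrA -exprMn.
have := hf (L * rho) (\col_i (if i == 0 then X h else Y h)).
rewrite !mxE /=; apply.
- by rewrite mulr_ge0 // ltW.
- by rewrite mulrC -ler_pdivlMr.
by move=> i; rewrite mxE; case: ifP.
Qed.


End Jets.

(** * Affine maps and germs of surfaces *)
Section Germs.
Variable R : realType.
Notation C := (Cx R).
Local Notation pnt := Defs.point.
Local Opaque partial holomorphic_at taylor_at.
Implicit Types (g : affine R) (w : 'cV[C]_3) (h : 'cV[C]_2).

Definition vec2 (x y : C) : 'cV[C]_2 := \col_i (if i == 0 then x else y).

Lemma vec2_eta h : vec2 (h 0 0) (h 1 0) = h.
Proof.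
apply/matrixP => i j; rewrite (ord1 j) mxE; case: eqP => [-> //|i0].
by congr (h _ _); case: i i0 => [[|[|]]] // hi; [case; apply: val_inj|move=> _; apply: val_inj].
Qed.

Lemma ord2P (i : 'I_2) : i = 0 \/ i = 1.
Proof. by case: i => [[|[|]]] // hi; [left|right]; apply: val_inj. Qed.
Lemma ord3P (i : 'I_3) : [\/ i = 0, i = 1 | i = ord_max].
Proof.
by case: i => [[|[|[|]]]] // hi; [apply: Or31|apply: Or32|apply: Or33]; apply: val_inj.
Qed.

Lemma point0 h (u : C) : pnt h u 0 0 = h 0 0. Proof. by rewrite mxE. Qed.
Lemma point1 h (u : C) : pnt h u 1 0 = h 1 0. Proof. by rewrite mxE. Qed.
Lemma point2 h (u : C) : pnt h u ord_max 0 = u. Proof. by rewrite mxE. Qed.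
Lemma xy0 w : coord_xy w 0 0 = w 0 0. Proof. by rewrite mxE. Qed.
Lemma xy1 w : coord_xy w 1 0 = w 1 0. Proof. by rewrite mxE. Qed.

Lemma coord_xy_point h (u : C) : coord_xy (pnt h u) = h.
Proof.
by rewrite -[RHS]vec2_eta -[LHS]vec2_eta xy0 xy1 point0 point1.
Qed.
Lemma coord_u_point h (u : C) : coord_u (pnt h u) = u.
Proof. exact: point2. Qed.
Lemma cv3P w w' : w 0 0 = w' 0 0 -> w 1 0 = w' 1 0 -> w ord_max 0 = w' ord_max 0 -> w = w'.
Proof.
move=> h0 h1 h2; apply/matrixP => i j; rewrite (ord1 j).
by case: (ord3P i) => ->.
Qed.
Lemma point_coord w : pnt (coord_xy w) (coord_u w) = w.
Proof. by apply: cv3P; rewrite ?point0 ?point1 ?point2 ?xy0 ?xy1. Qed.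
Lemma graph_point (S : graphed R) w : graph S w -> w = pnt (coord_xy w) (fn S (coord_xy w)).
Proof. by move=> [_ e]; rewrite -e point_coord. Qed.
Lemma graph_pt (S : graphed R) h : dom S h -> graph S (pnt h (fn S h)).
Proof. by move=> hd; rewrite /graph /= coord_xy_point coord_u_point. Qed.

Lemma sum3 (F : 'I_3 -> C) : \sum_i F i = F 0 + F 1 + F ord_max.
Proof.
rewrite !big_ord_recl big_ord0 addr0 addrA; congr (_ + F _ + F _); exact: val_inj.
Qed.
Lemma sum2 (F : 'I_2 -> C) : \sum_i F i = F 0 + F 1.
Proof. by rewrite !big_ord_recl big_ord0 addr0; congr (_ + F _); exact: val_inj. Qed.

Lemma affE g w i : aff g w i 0 =
  g.1 i 0 * w 0 0 + g.1 i 1 * w 1 0 + g.1 i ord_max * w ord_max 0 + g.2 i 0.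
Proof. by rewrite /aff !mxE sum3. Qed.

(** The composite is written with the first map on the left. *)
Definition affc g g' : affine R := (g'.1 *m g.1, g'.1 *m g.2 + g'.2).
Definition affi g : affine R := (invmx g.1, - (invmx g.1 *m g.2)).
Definition aff1 : affine R := (1%:M, 0).

Lemma aff_comp g g' w : aff (affc g g') w = aff g' (aff g w).
Proof. by rewrite /aff /= mulmxDr mulmxA addrA. Qed.
Lemma aff_id w : aff aff1 w = w.
Proof. by rewrite /aff mul1mx addr0. Qed.
Lemma affiE g w : aff_inv g w = aff (affi g) w.
Proof. by rewrite /aff_inv /aff /= mulmxBr. Qed.
Lemma A3c g g' : A3 g -> A3 g' -> A3 (affc g g').
Proof. by rewrite /A3 /= => h h'; rewrite unitmx_mul h h'. Qed.
Lemma A3i g : A3 g -> A3 (affi g).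
Proof. by rewrite /A3 /= unitmx_inv. Qed.
Lemma A31 : A3 aff1. Proof. exact: unitmx1. Qed.
Lemma affK g w : A3 g -> aff (affi g) (aff g w) = w.
Proof. by move=> hg; rewrite /aff /= mulmxDr mulmxA mulVmx // mul1mx addrK. Qed.
Lemma affVK g w : A3 g -> aff g (aff (affi g) w) = w.
Proof.
move=> hg; rewrite /aff /= mulmxDr mulmxN !mulmxA mulmxV // !mul1mx.
by rewrite subrK.
Qed.

Lemma aff_near g p (P : 'cV[C]_3 -> Prop) : nbhs (aff g p) P -> nbhs p (fun w => P (aff g w)).
Proof.
move=> /nbhsV[e e0 H]; pose B := 1 + \sum_i \sum_j nrm (g.1 i j).
have S0 : 0 <= \sum_i \sum_j nrm (g.1 i j) by do 2!(apply: sumr_ge0 => ? _); apply: nrm_ge0.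
have B0 : 0 < B by rewrite ltr_pwDl.
apply/nbhsV; exists (e / B); first by rewrite divr_gt0.
move=> w hw; apply: H => i.
have -> : aff g w i 0 - aff g p i 0 = \sum_j g.1 i j * (w j 0 - p j 0).
  by rewrite !affE sum3; ring.
apply: le_lt_trans (nrm_sum _ _ _) _.
apply: (@le_lt_trans _ _ (\sum_j nrm (g.1 i j) * (e / B))).
  by apply: ler_sum => j _; rewrite nrmM ler_wpM2l ?nrm_ge0 // ltW.
rewrite -mulr_suml mulrA ltr_pdivrMr // mulrC ltr_pM2l // /B.
rewrite ltr_pwDl // [X in _ <= X](bigD1 i) //= lerDl.
by do 2!(apply: sumr_ge0 => ? _); apply: nrm_ge0.
Qed.

Lemma point_near h (P : 'cV[C]_3 -> Prop) (F : 'cV[C]_2 -> C) :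
  holomorphic_at F h -> nbhs (pnt h (F h)) P -> \forall k \near h, P (pnt k (F k)).
Proof.
move=> hF /nbhsV[e e0 H]; have [r r0 hr] := holo_cont hF e0.
apply: (@inbox_nbhs R 2 h (Num.min r (e / 2))); first by rewrite lt_min r0 divr_gt0.
move=> k hk; have k1 : inbox r k by apply: inbox_le hk; rewrite ge_min lexx.
have k2 : inbox (e / 2) k by apply: inbox_le hk; rewrite ge_min lexx orbT.
have e2 : e / 2 < e by rewrite ltr_pdivrMr // ltr_pMr //; lra.
apply: H => i; case: (ord3P i) => ->.
- by rewrite !point0 mxE addrAC subrr add0r (le_lt_trans (k2 0)).
- by rewrite !point1 mxE addrAC subrr add0r (le_lt_trans (k2 1)).
by rewrite !point2 hr.
Qed.

Lemma xy_near p (P : 'cV[C]_2 -> Prop) : nbhs (coord_xy p) P -> \forall w \near p, P (coord_xy w).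
Proof.
move=> /nbhsV[e e0 H]; apply/nbhsV; exists e => // w hw; apply: H => i.
by case: (ord2P i) => ->; rewrite ?xy0 ?xy1 hw.
Qed.

Lemma near_near n (p : 'cV[C]_n) (P : 'cV[C]_n -> Prop) : nbhs p P -> \forall w \near p, nbhs w P.
Proof.
move=> /nbhsV[e e0 H]; apply/nbhsV; exists (e / 2); first by rewrite divr_gt0.
move=> w hw; apply/nbhsV; exists (e / 2); first by rewrite divr_gt0.
move=> v hv; apply: H => i; apply: le_lt_trans (nrm_triB _ (w i 0) _) _.
by rewrite (splitr e) ltrD.
Qed.

Lemma surface_holo (S : graphed R) a : surface S -> dom S a -> holomorphic_at (fn S) a.
Proof. by case=> _ _ _ h _; apply: h. Qed.

(** The equation of the image is evaluated at the points of the graph, which near p are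
    parametrized by x and y. *)
Lemma graphs_as_fun (S : graphed R) p g G : surface S -> graph S p -> graphs_as S p g G ->
  exists2 F, taylor_at F 0 (Defs.double G) & \forall h \near coord_xy p,
    coord_u (aff g (pnt h (fn S h))) = F (coord_xy (aff g (pnt h (fn S h)))).
Proof.
move=> hS hp [_ _ [F hF hn]]; exists F => //.
have hd : dom S (coord_xy p) by case: hp.
have [op _ _ _ _] := hS.
rewrite (graph_point hp) in hn.
have h1 := point_near (surface_holo hS hd) hn.
have h2 : \forall h \near coord_xy p, dom S h by apply: open_nbhs_nbhs.
by near=> h; have /(_ _)[] := near h1 h => //; last move=> h3 _; apply: h3; apply: graph_pt; near: h.
Unshelve. all: by end_near. Qed.

Lemma germ_inv g (S S' : graphed R) p p' : A3 g -> germ_map g S p S' p' ->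
  germ_map (affi g) S' p' S p.
Proof.
move=> hg [e hn]; split; first by rewrite -e affK.
have : nbhs (aff (affi g) p') (fun w => graph S w <-> graph S' (aff g w)) by rewrite -e affK.
move=> /aff_near; apply: filterS => w; rewrite affVK // => -[h1 h2]; by split.
Qed.

Lemma germ_graphs g (S S' : graphed R) p p' g1 G : A3 g -> germ_map g S p S' p' ->
  graphs_as S' p' g1 G -> graphs_as S p (affc g g1) G.
Proof.
move=> hg [e hn] [h1 h2 [F hF hF']]; split; first exact: A3c.
  by rewrite aff_comp e.
exists F => //; rewrite -e in hF'; have h3 := aff_near hF'.
apply: filterS2 hn h3 => w e1 e2; rewrite aff_comp; exact: (iff_trans e1 e2).
Qed.

Lemma germ_normal4 g (S S' : graphed R) p p' g1 G : A3 g -> germ_map g S p S' p' ->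
  normal4 S' p' g1 G -> normal4 S p (affc g g1) G.
Proof.
move=> hg hm [[[h1 h2] h3 h4] h5]; split=> //; split=> //; split=> //.
exact: germ_graphs hm h1.
Qed.

Lemma in_B21_normal4 (S : graphed R) : surface S ->
  (forall p, graph S p -> exists g G, normal4 S p g G) -> in_B21 S.
Proof.
move=> hS h; have h' p : graph S p -> exists g G, normal3 S p g G /\ G 4%N 0%N != 0.
  by move=> /h[g [G [h1 h2]]]; exists g, G; split=> //; rewrite h2 oner_neq0.
split=> //; split=> // p /h'[g [G [[h1 h2 h3] h4]]]; exists g, G.
by split=> //; rewrite h2 oner_neq0.
Qed.

(** An open polydisc with explicit radius: connected, and as small as needed, it serves
    as the domain of every surface constructed. *)
Definition obox (r : R) : set 'cV[C]_2 := [set h | forall i, nrm (h i 0) < r].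

Lemma obox_open r : open (obox r).
Proof.
rewrite openE => h hh; have hd i : 0 < r - nrm (h i 0) by rewrite subr_gt0.
have [e e0 he] := fin_pos hd; apply/nbhsV; exists e => // w hw i.
rewrite -(subrK (h i 0) (w i 0)); apply: le_lt_trans (nrmD _ _) _.
by have := hw i; have := he i; lra.
Qed.

Lemma obox_connected r : 0 < r -> connected (obox r).
Proof.
move=> r0; pose seg (h : 'cV[C]_2) : set 'cV[C]_2 :=
  (fun t : R => (t%:C%C : C) *: h) @` `[0, 1]%classic.
have -> : obox r = \bigcup_(h in obox r) seg h.
  apply/seteqP; split=> [h hh|h [k hk [t]]].
    exists h => //; exists 1; last by rewrite scale1r.
    by rewrite /= in_itv /= ler01 lexx.
  rewrite /= in_itv /= => /andP[t0 t1] <- i; rewrite mxE nrmM nrmR //.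
  by apply: le_lt_trans (hk i); rewrite ler_piMl ?nrm_ge0.
apply: bigcup_connected.
  exists 0 => h _; exists 0; last by rewrite scale0r.
  by rewrite /= in_itv /= lexx ler01.
move=> h _; apply: connected_continuous_connected; first exact: segment_connected.
apply: continuous_subspaceT => t A /= /nbhsV[e e0 H].
pose B := 1 + nrm (h 0 0) + nrm (h 1 0).
have B0 : 0 < B by rewrite !ltr_wpDr ?nrm_ge0.
apply/nbhs_ballP; exists (e / B) => /=; first by rewrite divr_gt0.
move=> s; rewrite /ball /= => hs; apply: H => i.
rewrite !mxE -mulrBl nrmM -rmorphB /=.
have -> : nrm (s - t)%:C%C = `|t - s|.
  by rewrite distrC; apply: rc_inj; rewrite -nrmE normc_def /= expr0n /= addr0 sqrtr_sqr.
apply: (@le_lt_trans _ _ (`|t - s| * B)).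
  rewrite ler_wpM2l //; case: (ord2P i) => ->; rewrite /B; have := nrm_ge0 (h 0 0);
  have := nrm_ge0 (h 1 0); lra.
by rewrite -ltr_pdivlMr.
Qed.

End Germs.

(** * Normalization and localization of surfaces of the branch *)
Section Normal.
Variable R : realType.
Notation C := (Cx R).
Local Notation pnt := Defs.point.
Lemma hessianE (F : 'cV[C]_2 -> C) a :
  hessian F a = partials F 2 0 a * partials F 0 2 a - partials F 1 1 a ^+ 2.
Proof. by []. Qed.
Local Opaque partial holomorphic_at taylor_at hessian partials.
Implicit Types (g : affine R) (w : 'cV[C]_3) (h : 'cV[C]_2).

Lemma holo_nz n (f : 'cV[C]_n -> C) a : holomorphic_at f a -> f a != 0 ->
  \forall w \near a, f w != 0.
Proof.
move=> hf fa; have e0 : 0 < nrm (f a) by rewrite nrm_gt0.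
have [r r0 hr] := holo_cont hf e0; apply: (inbox_nbhs r0) => h hh.
apply/eqP => f0; have := hr h hh; rewrite f0 sub0r nrmN ltxx //.
Qed.

Lemma holo_hessian (F : 'cV[C]_2 -> C) a : holomorphic_at F a -> holomorphic_at (hessian F) a.
Proof.
move=> hF; have h1 := holoM (holo_partials 2 0 hF) (holo_partials 0 2 hF).
have h2 := holoM (holo_partials 1 1 hF) (holo_partials 1 1 hF).
by have := holoB h1 h2; congr holomorphic_at; apply/funext => h; rewrite /hessian expr2.
Qed.

(** The dilations that preserve the normalization of the coefficient of x cubed. *)
Definition dil (m : C) : affine R :=
  (\matrix_(i, j) (if i == j then m ^+ i.+1 else 0), 0).

Lemma dilE m w (i : 'I_3) : aff (dil m) w i 0 = m ^+ i.+1 * w i 0.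
Proof. by rewrite affE !mxE; case: (ord3P i) => -> /=; rewrite !mul0r ?addr0 ?add0r. Qed.

Lemma dil_A3 m : m != 0 -> A3 (dil m).
Proof.
move=> m0; rewrite /A3 /= -row_full_unit; apply/row_fullP.
exists (\matrix_(i, j) (if i == j then m ^- i.+1 else 0)).
apply/matrixP => i j; rewrite !mxE sum3 !mxE.
by case: (ord3P i) => ->; case: (ord3P j) => -> /=; rewrite ?mul0r ?mulr0 ?addr0 ?add0r //;
   rewrite mulVf ?expf_neq0.
Qed.

Lemma taylor_dil (F : 'cV[C]_2 -> C) G m : m != 0 -> taylor_at F 0 (Defs.double G) ->
  taylor_at (fun h => m ^+ 3 * F (vec2 (h 0 0 / m) (h 1 0 / m ^+ 2))) 0
    (Defs.double (fun j k => m ^+ 3 * G j k / (m ^+ j * (m ^+ 2) ^+ k))).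
Proof.
move=> m0 hF; pose ms (i : 'I_2) := if i == 0 then m else m ^+ 2.
have hms i : ms i != 0 by rewrite /ms; case: ifP; rewrite ?expf_neq0.
have h := taylor_scale (m ^+ 3) hms hF.
have e1 : (fun h => m ^+ 3 * F (\col_i (h i 0 / ms i)))
    = (fun h => m ^+ 3 * F (vec2 (h 0 0 / m) (h 1 0 / m ^+ 2))).
  apply/funext => k; congr (_ * F _); apply/matrixP => i j.
  by rewrite !mxE /ms; case: (ord2P i) => ->.
have e2 : (fun x : {ffun 'I_2 -> nat} => m ^+ 3 * Defs.double G x / \prod_i ms i ^+ x i)
    = Defs.double (fun j k => m ^+ 3 * G j k / (m ^+ j * (m ^+ 2) ^+ k)).
  apply/funext => x; rewrite /Defs.double big_ord_recl big_ord1.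
  by rewrite (_ : lift ord0 ord0 = 1 :> 'I_2) //; apply: val_inj.
by rewrite -e1 -e2.
Qed.

(** A weighted dilation multiplies the coefficient of x to the fourth by the inverse of
    its parameter. *)
Lemma in_B21_ex (S : graphed R) p : in_B21 S -> graph S p -> exists g G, normal4 S p g G.
Proof.
move=> [_ hS] /hS[g [G [[[h1 [h2 h3 h4]] h5 h6] m0]]]; set m := G 4%N 0%N in m0.
pose G' j k := m ^+ 3 * G j k / (m ^+ j * (m ^+ 2) ^+ k).
exists (affc g (dil m)), G'.
have [a1 a2 [F hF hn]] := h1; have [b1 b2 b3] := h2; have [c1 c2 c3] := h3; have [d1 d2] := h4.
have ga : graphs_as S p (affc g (dil m)) G'.
  split; first by apply: A3c => //; apply: dil_A3.
    by rewrite aff_comp a2; apply: cv3P; rewrite dilE !mxE mulr0.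
  exists (fun h => m ^+ 3 * F (vec2 (h 0 0 / m) (h 1 0 / m ^+ 2))); first exact: taylor_dil.
  move: hn; apply: filterS => w; rewrite aff_comp /coord_u dilE => hw.
  set v := aff g w in hw *.
  have -> : vec2 (coord_xy (aff (dil m) v) 0 0 / m) (coord_xy (aff (dil m) v) 1 0 / m ^+ 2) = coord_xy v.
    rewrite xy0 xy1 !dilE -[RHS]vec2_eta xy0 xy1; congr vec2.
      by rewrite expr1 mulrC mulKf.
    by rewrite mulrC mulKf ?expf_neq0.
  split=> [/hw <- //|]; have m3 : m ^+ 3 != 0 by rewrite expf_neq0.
  by move/(mulfI m3) => h; apply/hw.
split; last by rewrite /G' -/m /= expr0 mulr1 -exprSr divff ?expf_neq0.
split; last 2 first.
- by rewrite /G' h5 expr0 !mulr1 divff ?expf_neq0.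
- by rewrite /G' h6 mulr0 mul0r.
split=> //; split; split; rewrite /G' ?b1 ?b2 ?b3 ?c1 ?c3 ?d1 ?d2 ?mulr0 ?mul0r //.
by rewrite c2 mulr1 !expr1 -exprS divff ?expf_neq0.
Qed.

(** The function of the normal form, restricted to a small polydisc, defines a surface
    whose germs are images of germs of S; membership in the branch is thus inherited. *)
Lemma normal_surface (S : graphed R) p g G : in_B21 S -> graph S p -> graphs_as S p g G ->
  G 0%N 0%N = 0 -> G 2%N 0%N * G 0%N 2%N - G 1%N 1%N ^+ 2 != 0 ->
  exists S', [/\ in_B21 S', graph S' 0, germ_map g S p S' 0 & taylor_at (fn S') 0 (Defs.double G)].
Proof.
move=> hS hp [hg gp [F hF hn]] G00 hG.
have F0 : F 0 = 0.
  by rewrite (taylor_value hF) /Defs.double !ffunE.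
have holF : holomorphic_at F 0 by exists (Defs.double G).
pose P w := graph S w <-> coord_u (aff g w) = F (coord_xy (aff g w)).
have pg : aff (affi g) 0 = p by rewrite -gp affK.
have p00 : pnt (0 : 'cV[C]_2) 0 = 0.
  by apply: cv3P; rewrite ?point0 ?point1 ?point2 !mxE.
have n1 : nbhs (aff (affi g) (pnt 0 (F 0))) (fun w => nbhs w P).
  by rewrite F0 p00 pg; apply: near_near.
have n2 := point_near holF (aff_near n1).
have n3 := holo_open holF.
have n4 : \forall h \near (0 : 'cV[C]_2), hessian F h != 0.
  apply: holo_nz; first exact: holo_hessian.
  by rewrite hessianE !(partials_taylor _ _ hF).
have [r r0 hr] : exists2 r : R, 0 < r & forall h, obox r h ->
    [/\ nbhs (aff (affi g) (pnt h (F h))) P, holomorphic_at F h & hessian F h != 0].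
  have n5 : nbhs (0 : 'cV[C]_2) (fun h =>
      [/\ nbhs (aff (affi g) (pnt h (F h))) P, holomorphic_at F h & hessian F h != 0]).
    apply: filterS2 n2 (filterI n3 n4) => h h1 [h2 h3].
    split; [exact: h1|exact: h2|exact: h3].
  have /nbhsV[r r0 hr] := n5; exists r; first exact: r0.
  move=> h hh; apply: hr => i; rewrite mxE subr0; exact: hh.
pose S' := Graphed (obox r) F.
have dS' h : nbhs h (dom S') = nbhs h (obox r) by [].
have germ w : nbhs w P -> obox r (coord_xy (aff g w)) -> germ_map g S w S' (aff g w).
  move=> hw hb; split=> //.
  have hb' : nbhs (coord_xy (aff g w)) (obox r) by apply: open_nbhs_nbhs; split=> //; exact: obox_open.
  have h1 := aff_near (xy_near hb').
  by apply: filterS2 hw h1 => v [v1 v2] v3; split=> [/v1 v4|[_ /v2]].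
have xy00 : coord_xy (0 : 'cV[C]_3) = 0.
  by apply/matrixP => i j; rewrite (ord1 j); case: (ord2P i) => ->; rewrite ?xy0 ?xy1 !mxE.
have b0 : obox r (0 : 'cV[C]_2) by move=> i; rewrite mxE nrm0.
exists S'; split; last exact: hF.
- apply: in_B21_normal4.
    split; [exact: obox_open|exact: obox_connected|by exists 0| |].
      move=> a /hr[_ h _]; exact: h.
    move=> a /hr[_ _ h]; exact: h.
  move=> p' hp'; pose w := aff (affi g) p'.
  have hd : obox r (coord_xy p') by case: hp'.
  have ep' := graph_point hp'; have [hw _ _] := hr _ hd.
  rewrite -ep' -/w in hw.
  have gw : aff g w = p' by rewrite affVK.
  have hb : obox r (coord_xy (aff g w)) by rewrite gw.
  have gm := germ w hw hb; rewrite gw in gm.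
  have Sw : graph S w.
    by have [_] := nbhs_singleton hw; apply; rewrite gw; case: hp'.
  have [g1 [G1 hn1]] := in_B21_ex hS Sw.
  exists (affc (affi g) g1), G1; apply: germ_normal4 (germ_inv hg gm) hn1.
  exact: A3i.
- by rewrite /graph /= xy00; split=> //; rewrite /coord_u mxE.
by rewrite -gp; apply: germ => //; rewrite gp xy00.
Qed.

End Normal.

(** * The equation relating a graph and its affine image *)
Section Star.
Variable R : realType.
Notation C := (Cx R).
Notation BP := {poly {poly C}}.
Local Notation pnt := Defs.point.
Local Notation xx := (bX R).
Local Notation yy := (bY R).
Local Opaque partial holomorphic_at taylor_at hessian partials jeq.
Implicit Types (g : affine R) (w : 'cV[C]_3) (h : 'cV[C]_2).

Lemma bCD (x y : C) : bC (x + y) = bC x + bC y. Proof. by rewrite /bC !polyCD. Qed.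
Lemma bCM (x y : C) : bC (x * y) = bC x * bC y. Proof. by rewrite /bC !polyCM. Qed.
Lemma bC0 : bC (0 : C) = 0. Proof. by rewrite /bC !polyC0. Qed.
Lemma bC1 : bC (1 : C) = 1. Proof. by []. Qed.
Lemma bc0 j k : bc (0 : BP) j k = 0. Proof. by rewrite /bc !coef0. Qed.

(** Taylor coefficients with the factorials divided out; products of jets are products
    of polynomials in these. *)
Definition fc (G : nat -> nat -> C) (j k : nat) : C := G j k / (j`!%:R * k`!%:R).

(** The part of order at least two: constant and linear terms are absorbed by the affine
    change of coordinates. *)
Definition cut (G : nat -> nat -> C) (j k : nat) : C := if (2 <= j + k)%N then G j k else 0.

Definition Np N (G : nat -> nat -> C) (P Q : BP) : BP :=
  \sum_(j < N) \sum_(k < N) bC (fc G j k) * P ^+ j * Q ^+ k.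

Lemma bpoly_Np N G : bpoly N (fc G) = Np N G xx yy.
Proof. exact: bpolyE. Qed.

Lemma fact_neq0 n : n`!%:R != 0 :> C.
Proof. by rewrite pnatr_eq0 -lt0n fact_gt0. Qed.

Lemma taylor_of_partials F (a : 'cV[C]_2) : holomorphic_at F a ->
  taylor_at F a (Defs.double (fun j k => partials F j k a)).
Proof.
Local Transparent holomorphic_at.
move=> [c hc]; pose G j k := c [ffun i : 'I_2 => if i == 0 then j else k].
have cE : c = Defs.double G.
  apply/funext => x; rewrite /Defs.double /G; congr c; apply/ffunP => i.
  by rewrite ffunE; case: (ord2P i) => ->.
rewrite cE in hc; rewrite (_ : (fun j k => _) = G) //.
by apply/funext => j; apply/funext => k; rewrite (partials_taylor _ _ hc).
Qed.
Local Opaque holomorphic_at.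

Definition ordge (d : nat) (P : BP) : Prop := forall j k, (j + k < d)%N -> bc P j k = 0.

Lemma ordgeD d P Q : ordge d P -> ordge d Q -> ordge d (P + Q).
Proof. by move=> h1 h2 j k hjk; rewrite bcD h1 // h2 // addr0. Qed.
Lemma ordgeM d e P Q : ordge d P -> ordge e Q -> ordge (d + e) (P * Q).
Proof.
move=> h1 h2 j k hjk; rewrite bcM big1 // => i _; rewrite big1 // => l _.
have [hl|hl] := ltnP (i + l) d; first by rewrite h1 // mul0r.
rewrite [X in _ * X]h2 ?mulr0 //.
have := ltn_ord i; have := ltn_ord l; lia.
Qed.
Lemma ordge_le d e P : (d <= e)%N -> ordge e P -> ordge d P.
Proof. by move=> de h j k hjk; apply: h; apply: leq_trans hjk de. Qed.
Lemma ordgeX d P n : ordge d P -> ordge (d * n) (P ^+ n).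
Proof.
move=> h; elim: n => [|n IH]; first by rewrite muln0 => j k.
by rewrite exprS mulnS; apply: ordgeM.
Qed.
Lemma ordgeC d c P : ordge d P -> ordge d (bC c * P).
Proof. by move=> h j k hjk; rewrite bc_C h // mulr0. Qed.
Lemma ordge_sum d I (s : seq I) (Pr : pred I) (F : I -> BP) :
  (forall i, Pr i -> ordge d (F i)) -> ordge d (\sum_(i <- s | Pr i) F i).
Proof. by move=> h j k hjk; rewrite bc_sum big1 // => i /h ->. Qed.
Lemma ordge_bX : ordge 1 xx.
Proof. by move=> [|j] [|k] //= _; rewrite -[xx]mulr1 bc_X. Qed.
Lemma ordge_bY : ordge 1 yy.
Proof. by move=> [|j] [|k] //= _; rewrite -[yy]mulr1 bc_Y. Qed.

Lemma ordge_Np N G P Q d : (forall j k, (j + k < d)%N -> G j k = 0) -> ordge 1 P -> ordge 1 Q ->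
  ordge d (Np N G P Q).
Proof.
move=> hG hP hQ; apply: ordge_sum => j _; apply: ordge_sum => k _.
have [h|h] := ltnP (j + k) d; first by rewrite /fc hG // mul0r bC0 !mul0r; move=> ? ? _; exact: bc0.
apply: (ordge_le h); rewrite -mulrA; apply: ordgeC; apply: ordgeM.
  by rewrite -[X in ordge X _]mul1n; apply: ordgeX.
by rewrite -[X in ordge X _]mul1n; apply: ordgeX.
Qed.

Lemma bc_bX1 j k : bc xx j k = ((j == 1%N) && (k == 0%N))%:R.
Proof. by have := bc_XY R 1 0 j k; rewrite expr1 expr0 mulr1. Qed.
Lemma bc_bY1 j k : bc yy j k = ((j == 0%N) && (k == 1%N))%:R.
Proof. by have := bc_XY R 0 1 j k; rewrite expr1 expr0 mul1r. Qed.
Lemma cut0 G j k : (j + k < 2)%N -> cut G j k = 0.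
Proof. by move=> h; rewrite /cut leqNgt h. Qed.
Lemma fcut0 G j k : (j + k < 2)%N -> fc (cut G) j k = 0.
Proof. by move=> h; rewrite /fc /cut leqNgt h mul0r. Qed.
Lemma fcutE G j k : (2 <= j + k)%N -> fc (cut G) j k = fc G j k.
Proof. by rewrite /fc /cut => ->. Qed.
Lemma fc00 G : fc G 0 0 = G 0%N 0%N. Proof. by rewrite /fc mulr1 divr1. Qed.
Lemma fc10 G : fc G 1 0 = G 1%N 0%N. Proof. by rewrite /fc mulr1 divr1. Qed.
Lemma fc01 G : fc G 0 1 = G 0%N 1%N. Proof. by rewrite /fc mulr1 divr1. Qed.

Lemma bpoly_hi N (G : nat -> nat -> C) j k : (N <= j)%N || (N <= k)%N -> bc (bpoly N G) j k = 0.
Proof. by move=> hjk; rewrite bc_bpoly ifF //; apply/negbTE; rewrite negb_and -!leqNgt. Qed.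

Lemma bc_bpoly_lt N (G : nat -> nat -> C) j k : (j + k < N)%N -> bc (bpoly N G) j k = G j k.
Proof.
move=> h; rewrite bc_bpoly ifT //; apply/andP; split; apply: leq_ltn_trans h.
  exact: leq_addr.
exact: leq_addl.
Qed.

Local Transparent jeq.
Lemma jeq_lin N (f : 'cV[C]_2 -> C) P : (0 < N)%N -> jeq N f P -> bc P 0 0 = 0 ->
  exists L r : R, [/\ 0 < r, 0 < L & forall rho h, 0 <= rho -> rho <= r -> inbox rho h ->
     nrm (f h) <= L * rho].
Proof.
move=> N0 [K [r [r0 K0 h]]] P0.
have h1 : jeq 1 f P.
  exists K, (Num.min r 1); split=> // [|rho k rho0]; first by rewrite lt_min r0 ltr01.
  rewrite le_min => /andP[h1 h2] hk; apply: le_trans (h _ _ rho0 h1 hk) _.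
  by rewrite ler_wpM2l // -(prednK N0) exprS ler_piMr // exprn_ile1.
have h2 : jeq 1 f 0 by apply: jeq_mod h1 => -[|j] [|k] // _; rewrite P0 bc0.
have [L [r' [r'0 L0 h3]]] := h2; exists (L + 1), r'; split=> //; first by rewrite ltr_wpDl.
move=> rho k rho0 h4 hk; have := h3 rho k rho0 h4 hk.
rewrite expr1 /bev !horner0 subr0 => /le_trans; apply.
by rewrite ler_wpM2r // lerDl.
Qed.
Local Opaque jeq.

Local Opaque bC bX bY bc bev cut fc.

Section Image.
Variables (f F : 'cV[C]_2 -> C) (c G : nat -> nat -> C) (M : 'I_3 -> 'I_3 -> C).
Hypothesis hf : forall N, jeq N f (bpoly N (fc c)).
Hypothesis hF : forall N, jeq N F (bpoly N (fc G)).
(** The coordinates of the image of the point of the graph above h, relative to the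
    image of the point above the origin. *)
Definition img (i : 'I_3) (h : 'cV[C]_2) : C :=
  M i 0 * h 0 0 + M i 1 * h 1 0 + M i ord_max * (f h - c 0%N 0%N).
Hypothesis hrel : \forall h \near (0 : 'cV[C]_2), img ord_max h = F (vec2 (img 0 h) (img 1 h)).

Definition lin0 (i : 'I_3) : C := M i 0 + M i ord_max * c 1%N 0%N.
Definition lin1 (i : 'I_3) : C := M i 1 + M i ord_max * c 0%N 1%N.
Definition imgp N (i : 'I_3) : BP :=
  bC (lin0 i) * xx + bC (lin1 i) * yy + bC (M i ord_max) * Np N (cut c) xx yy.

Lemma jeq_img N i : jeq N (img i) (imgp N i).
Proof.
have h1 := jeqB (hf N) (jeqC N (c 0%N 0%N)).
have h2 := jeqD (jeqD (jeq_ev N (bC (M i 0) * xx)) (jeq_ev N (bC (M i 1) * yy)))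
  (jeqM (jeqC N (M i ord_max)) h1).
have e : (fun h : 'cV[C]_2 => bev (bC (M i 0) * xx) (h 0 0) (h 1 0) +
    bev (bC (M i 1) * yy) (h 0 0) (h 1 0) + M i ord_max * (f h - c 0%N 0%N)) = img i.
  by apply/funext => h; rewrite (bevM (bC _)) (bevM (bC (M i 1))) !bev_bC bev_bX bev_bY.
rewrite e in h2; apply: jeq_mod h2 => j k hjk.
rewrite /imgp -bpoly_Np !bcD !bc_C bcB bc_CE bc_bX1 bc_bY1 !(bc_bpoly_lt _ hjk).
have [h|h] := leqP 2 (j + k).
  rewrite (fcutE _ h); case: j k h {hjk} => [|[|j]] [|[|k]] //= _;
  by rewrite ?mulr0 ?subr0 ?add0r.
rewrite (fcut0 _ h); case: j k h {hjk} => [|[|j]] [|[|k]] //= _;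
  rewrite ?fc00 ?fc10 ?fc01 /lin0 /lin1; ring.
Qed.

(** The third coordinate of the image is F of the first two; the jets of both sides
    agree by uniqueness. *)
Lemma star1 N j k : (j + k < N)%N ->
  bc (imgp N ord_max) j k = bc (Np N G (imgp N 0) (imgp N 1)) j k.
Proof.
move=> hjk; have N0 : (0 < N)%N by apply: leq_ltn_trans hjk.
have z i : bc (imgp N i) 0 0 = 0.
  rewrite /imgp -bpoly_Np !bcD !bc_C bc_bX1 bc_bY1 (bc_bpoly_lt _ (N0 : 0 + 0 < N)%N).
  by rewrite fcut0 //= !mulr0 !addr0.
have [L [r [r0 L0 h1]]] := jeq_lin N0 (jeq_img N 0) (z 0).
have [L' [r' [r'0 L'0 h2]]] := jeq_lin N0 (jeq_img N 1) (z 1).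
have hL : exists L r : R, [/\ 0 < r, 0 < L & forall rho h, 0 <= rho -> rho <= r -> inbox rho h ->
     nrm (img 0 h) <= L * rho /\ nrm (img 1 h) <= L * rho].
  exists (L + L'), (Num.min r r'); split; rewrite ?lt_min ?r0 ?addr_gt0 //.
  move=> rho h rho0; rewrite le_min => /andP[a1 a2] hh; split.
    by apply: le_trans (h1 _ _ rho0 a1 hh) _; rewrite ler_wpM2r // lerDl ltW.
  by apply: le_trans (h2 _ _ rho0 a2 hh) _; rewrite ler_wpM2r // lerDr ltW.
have h4 := jeq_comp (hF N) (jeq_img N 0) (jeq_img N 1) hL (@bpoly_hi N (fc G)).
have hrel' : \forall h \near (0 : 'cV[C]_2), F (vec2 (img 0 h) (img 1 h)) = img ord_max h.
  by move: hrel; apply: filterS => h ->.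
have h5 := jeq_eq hrel' h4.
rewrite (jet_unique (jeq_img N ord_max) h5 hjk); congr bc.
by apply: eq_bigr => j' _; apply: eq_bigr => k' _; rewrite bc_bpoly !ltn_ord.
Qed.

Hypothesis hG : forall j k, (j + k < 2)%N -> G j k = 0.

Lemma ordge_W N : ordge 2 (Np N (cut c) xx yy).
Proof.
apply: ordge_Np; [|exact: ordge_bX|exact: ordge_bY].
by move=> j k; apply: cut0.
Qed.

(** F vanishes to second order, so the linear part of the third coordinate must vanish. *)
Lemma lin_max : lin0 ord_max = 0 /\ lin1 ord_max = 0.
Proof.
have o1 i : ordge 1 (imgp 2 i).
  apply: ordgeD; last by apply: ordgeC; apply: ordge_le (ordge_W 2).
  by apply: ordgeD; apply: ordgeC; [exact: ordge_bX|exact: ordge_bY].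
have o2 : ordge 2 (Np 2 G (imgp 2 0) (imgp 2 1)) by apply: ordge_Np.
have e j k : (j + k < 2)%N -> bc (imgp 2 ord_max) j k = 0.
  by move=> hjk; rewrite (star1 hjk) o2.
have := e 1%N 0%N isT; have := e 0%N 1%N isT.
rewrite /imgp !bcD !bc_C !bc_bX1 !bc_bY1 !ordge_W //= !mulr0 !mulr1 !addr0 add0r.
by move=> -> ->.
Qed.
End Image.
End Star.

(** * Linear substitutions in Taylor polynomials *)
Section Linear.
Variable R : realType.
Notation C := (Cx R).
Notation BP := {poly {poly C}}.
Local Opaque partial holomorphic_at taylor_at hessian partials jeq.
Local Opaque bC bX bY bc bev cut fc.
Local Notation pnt := Defs.point.
Local Notation xx := (bX R).
Local Notation yy := (bY R).

Section LinearPowers.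
Variables (A00 A01 A10 A11 : C).
Let LX : BP := bC A00 * xx + bC A01 * yy.
Let LY : BP := bC A10 * xx + bC A11 * yy.

Lemma bc_LXm P m : bc (LX * P) m 0 = if m is m'.+1 then A00 * bc P m' 0 else 0.
Proof. by rewrite /LX mulrDl -!mulrA bcD !bc_C bc_X bc_Y; case: m => [|m]; rewrite !mulr0 ?addr0. Qed.
Lemma bc_LYm P m : bc (LY * P) m 0 = if m is m'.+1 then A10 * bc P m' 0 else 0.
Proof. by rewrite /LY mulrDl -!mulrA bcD !bc_C bc_X bc_Y; case: m => [|m]; rewrite !mulr0 ?addr0. Qed.
Lemma bc_LXn P m n : bc (LX * P) m n.+1 = (if m is m'.+1 then A00 * bc P m' n.+1 else 0) + A01 * bc P m n.
Proof. by rewrite /LX mulrDl -!mulrA bcD !bc_C bc_X bc_Y; case: m => [|m]; rewrite ?mulr0. Qed.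
Lemma bc_LYn P m n : bc (LY * P) m n.+1 = (if m is m'.+1 then A10 * bc P m' n.+1 else 0) + A11 * bc P m n.
Proof. by rewrite /LY mulrDl -!mulrA bcD !bc_C bc_X bc_Y; case: m => [|m]; rewrite ?mulr0. Qed.

Lemma bc_1 j k : bc (1 : BP) j k = ((j == 0%N) && (k == 0%N))%:R.
Proof. by have := bc_XY R 0 0 j k; rewrite !expr0 mulr1. Qed.

Lemma lin_m0 j k m : bc (LX ^+ j * LY ^+ k) m 0 =
  if m == (j + k)%N then A00 ^+ j * A10 ^+ k else 0.
Proof.
elim: j m => [|j IH] m; last first.
  by rewrite exprS -mulrA bc_LXm; case: m => // m; rewrite IH eqSS exprS; case: eqP;
     rewrite ?mulr0 // mulrA.
rewrite expr0 mul1r; elim: k m => [|k IH] m; first by rewrite expr0 bc_1 andbT mulr1; case: eqP.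
rewrite exprS bc_LYm; case: m => // m; rewrite IH eqSS exprS !expr0 !mul1r.
by case: eqP; rewrite ?mulr0.
Qed.

Lemma lin_0n j k n : bc (LX ^+ j * LY ^+ k) 0 n =
  if n == (j + k)%N then A01 ^+ j * A11 ^+ k else 0.
Proof.
elim: j n => [|j IH] n.
  rewrite expr0 mul1r; elim: k n => [|k IH] n; first by rewrite !expr0 bc_1 mulr1; case: n.
  rewrite exprS; case: n => [|n]; first by rewrite bc_LYm.
  by rewrite bc_LYn IH eqSS exprS !expr0 !mul1r add0r; case: eqP; rewrite ?mulr0.
rewrite exprS -mulrA; case: n => [|n]; first by rewrite bc_LXm.
by rewrite bc_LXn IH eqSS exprS add0r; case: eqP; rewrite ?mulr0 // mulrA.
Qed.

(** Only coefficients with at most one factor x, or at most one factor y, are computed: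
    those of order at most three and those of the fourth powers are of this kind. *)
Lemma lin_m1 j k m : bc (LX ^+ j * LY ^+ k) m 1 = if m.+1 == (j + k)%N then
  j%:R * A01 * A00 ^+ j.-1 * A10 ^+ k + k%:R * A11 * A00 ^+ j * A10 ^+ k.-1 else 0.
Proof.
elim: j m => [|j IH] m; last first.
  rewrite exprS -mulrA bc_LXn lin_m0; case: m => [|m].
    rewrite add0r eqSS; case: j {IH} => [|j]; case: k => [|k] //=; rewrite ?mulr0 //.
    by rewrite !expr0; ring.
  rewrite IH addSn eqSS; case: eqP => [e|_]; rewrite ?mulr0 ?addr0 //.
  by case: j e {IH} => [|j] e /=; rewrite ?expr0 -?natr1 ?exprS; ring.
rewrite expr0 mul1r mul0r; elim: k m => [|k IH] m; first by rewrite expr0 bc_1 andbF.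
rewrite exprS bc_LYn; have := lin_m0 0 k m; rewrite expr0 mul1r => ->.
case: m => [|m].
  rewrite add0r !add0n eqSS; case: k {IH} => [|k] //=; rewrite ?mulr0 //.
  by rewrite !expr0; ring.
rewrite IH !add0n !eqSS expr0; case: eqP => [e|_]; rewrite ?mulr0 ?addr0 //.
by case: k e {IH} => [|k] e /=; rewrite ?expr0 -?natr1 ?exprS; ring.
Qed.

Lemma lin_1n j k n : bc (LX ^+ j * LY ^+ k) 1 n = if n.+1 == (j + k)%N then
  j%:R * A00 * A01 ^+ j.-1 * A11 ^+ k + k%:R * A10 * A01 ^+ j * A11 ^+ k.-1 else 0.
Proof.
elim: j n => [|j IH] n; last first.
  rewrite exprS -mulrA; case: n => [|n].
    rewrite bc_LXm lin_0n addSn eqSS; case: j {IH} => [|j]; case: k => [|k] //=; rewrite ?mulr0 //.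
    by rewrite !expr0; ring.
  rewrite bc_LXn lin_0n IH addSn !eqSS; case: eqP => [e|_]; rewrite ?mulr0 ?addr0 //.
  by case: j e {IH} => [|j] e /=; rewrite ?expr0 -?natr1 ?exprS; ring.
rewrite expr0 mul1r mul0r; elim: k n => [|k IH] n; first by rewrite expr0 bc_1.
rewrite exprS; have h0 n' := lin_0n 0 k n'; case: n => [|n].
  have := h0 0%N; rewrite bc_LYm expr0 mul1r => ->; rewrite !add0n eqSS.
  case: k {IH h0} => [|k] //=; rewrite ?mulr0 //.
  by rewrite !expr0; ring.
have := h0 n.+1; rewrite bc_LYn expr0 mul1r => ->.
rewrite IH !add0n !eqSS expr0; case: eqP => [e|_]; rewrite ?mulr0 ?addr0 //.
by case: k e {IH h0} => [|k] e /=; rewrite ?expr0 -?natr1 ?exprS; ring.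
Qed.

End LinearPowers.

Definition Lx (A : 'M[C]_2) : BP := bC (A 0 0) * xx + bC (A 0 1) * yy.
Definition Ly (A : 'M[C]_2) : BP := bC (A 1 0) * xx + bC (A 1 1) * yy.

Lemma mulA0 (A : 'M[C]_2) (h : 'cV[C]_2) i : (A *m h) i 0 = A i 0 * h 0 0 + A i 1 * h 1 0.
Proof. by rewrite mxE sum2. Qed.

Lemma bc_Np N (G : nat -> nat -> C) P Q j k : bc (Np N G P Q) j k =
  \sum_(m < N) \sum_(n < N) fc G m n * bc (P ^+ m * Q ^+ n) j k.
Proof.
rewrite bc_sum; apply: eq_bigr => m _; rewrite bc_sum; apply: eq_bigr => n _.
by rewrite -mulrA bc_C.
Qed.

Section Substitution.
Variables (f : 'cV[C]_2 -> C) (a : 'cV[C]_2) (A : 'M[C]_2).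
Hypothesis hf : holomorphic_at f a.
Let c j k := partials f j k a.
Definition fsub (h : 'cV[C]_2) : C := f (a + A *m h).
Definition csub (j k : nat) : C := partials fsub j k 0.

Lemma holo_fsub : holomorphic_at fsub 0.
Proof.
pose lq : 2.-tuple (mpoly 2 C) := [tuple mpolyC 2 (a i 0) + (A i 0 *: mpolyX C (mnm1 0)
  + A i 1 *: mpolyX C (mnm1 1)) | i < 2].
have E h : polymap lq h = a + A *m h.
  apply/matrixP => i j; rewrite (ord1 j) [LHS]mxE [RHS]mxE mulA0 tnth_mktuple /ev !mevalD.
  by rewrite mevalC !mevalZ !mevalXU.
have h1 : holomorphic_at (fun h => f (polymap lq h)) 0.
  by apply: holo_polymap; rewrite E mulmx0 addr0.
rewrite (_ : fsub = (fun h => f (polymap lq h))) //.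
by apply/funext => h; rewrite E.
Qed.

Lemma jeq_fsub N : jeq N fsub (bpoly N (fc csub)).
Proof.
have := jeq_taylor N (taylor_of_partials holo_fsub).
rewrite (_ : (fun h => fsub (0 + h)) = fsub) //.
by apply/funext => h; rewrite add0r.
Qed.

Lemma csubE N j k : (j + k < N)%N -> fc csub j k = bc (Np N c (Lx A) (Ly A)) j k.
Proof.
move=> hjk; rewrite -(bc_bpoly_lt (fc csub) hjk).
have hX i : jeq N (fun h : 'cV[C]_2 => (A *m h) i 0) (bC (A i 0) * xx + bC (A i 1) * yy).
  have := jeq_ev N (bC (A i 0) * xx + bC (A i 1) * yy).
  rewrite (_ : (fun h : 'cV[C]_2 => bev _ _ _) = (fun h => (A *m h) i 0)) //.
  by apply/funext => h; rewrite bevD !bevM !bev_bC bev_bX bev_bY mulA0.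
have N0 : (0 < N)%N by apply: leq_ltn_trans hjk.
have z i : bc (bC (A i 0) * xx + bC (A i 1) * yy) 0 0 = 0.
  by rewrite bcD !bc_C bc_bX1 bc_bY1 /= !mulr0 addr0.
have [L [r [r0 L0 h1]]] := jeq_lin N0 (hX 0) (z 0).
have [L' [r' [r'0 L'0 h2]]] := jeq_lin N0 (hX 1) (z 1).
have hL : exists L r : R, [/\ 0 < r, 0 < L & forall rho (h : 'cV[C]_2), 0 <= rho -> rho <= r ->
     inbox rho h -> nrm ((A *m h) 0 0) <= L * rho /\ nrm ((A *m h) 1 0) <= L * rho].
  exists (L + L'), (Num.min r r'); split; rewrite ?lt_min ?r0 ?addr_gt0 //.
  move=> rho h rho0; rewrite le_min => /andP[a1 a2] hh; split.
    by apply: le_trans (h1 _ _ rho0 a1 hh) _; rewrite ler_wpM2r // lerDl ltW.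
  by apply: le_trans (h2 _ _ rho0 a2 hh) _; rewrite ler_wpM2r // lerDr ltW.
have hT := jeq_taylor N (taylor_of_partials hf).
have h4 := jeq_comp hT (hX 0) (hX 1) hL (@bpoly_hi _ N (fc c)).
have e : (fun h : 'cV[C]_2 => f (a + \col_i (if i == 0 then (A *m h) 0 0 else (A *m h) 1 0))) = fsub.
  apply/funext => h; rewrite /fsub; congr (f (_ + _)); apply/matrixP => i i'.
  by rewrite (ord1 i') mxE; case: (ord2P i) => ->.
rewrite e in h4; rewrite (jet_unique (jeq_fsub N) h4 hjk); congr bc.
by apply: eq_bigr => j' _; apply: eq_bigr => k' _; rewrite bc_bpoly !ltn_ord.
Qed.

End Substitution.

End Linear.

(** * Coordinates adapted to a normal form *)
Section Adapted.
Variable R : realType.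
Notation C := (Cx R).
Notation BP := {poly {poly C}}.
Local Opaque partial holomorphic_at taylor_at hessian partials jeq.
Local Opaque bC bX bY bc bev cut fc.
Local Notation pnt := Defs.point.
Local Notation xx := (bX R).
Local Notation yy := (bY R).

Lemma lin_near (a : 'cV[C]_2) (A : 'M[C]_2) (P : 'cV[C]_2 -> Prop) : nbhs a P ->
  \forall h \near (0 : 'cV[C]_2), P (a + A *m h).
Proof.
move=> /nbhs_inbox[r r0 H].
pose B := 1 + (nrm (A 0 0) + nrm (A 0 1) + nrm (A 1 0) + nrm (A 1 1)).
have a0 := nrm_ge0 (A 0 0); have a1 := nrm_ge0 (A 0 1).
have a2 := nrm_ge0 (A 1 0); have a3 := nrm_ge0 (A 1 1).
have B0 : 0 < B by rewrite /B; lra.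
apply: (@inbox_nbhs R 2 0 (r / B)); first by rewrite divr_gt0.
move=> h hh; rewrite add0r; apply: H => i; rewrite mulA0.
have b : nrm (A i 0) + nrm (A i 1) <= B by rewrite /B; case: (ord2P i) => ->; lra.
apply: le_trans (nrmD _ _) _; rewrite !nrmM.
apply: (@le_trans _ _ ((nrm (A i 0) + nrm (A i 1)) * (r / B))).
  by rewrite mulrDl lerD // ler_wpM2l ?nrm_ge0.
have rB : 0 <= r / B by rewrite divr_ge0 ?ltW.
by apply: le_trans (ler_wpM2r rB b) _; rewrite mulrCA divff ?gt_eqF // mulr1.
Qed.

Lemma lead_powers (P Q U V : BP) m n : ordge 2 U -> ordge 2 V -> P = xx + U -> Q = yy + V ->
  ordge (m + n).+1 (P ^+ m * Q ^+ n - xx ^+ m * yy ^+ n).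
Proof.
move=> hU hV hP hQ.
have oX : ordge 1 xx by apply: ordge_bX.
have oY : ordge 1 yy by apply: ordge_bY.
have oP : ordge 1 P by rewrite hP; apply: ordgeD => //; apply: ordge_le hU.
have oQ : ordge 1 Q by rewrite hQ; apply: ordgeD => //; apply: ordge_le hV.
have ox k (Z : BP) : ordge 1 Z -> ordge k (Z ^+ k).
  by move=> h; have := @ordgeX _ 1 Z k h; rewrite mul1n.
elim: m => [|m IH].
  rewrite !expr0 !mul1r add0n; elim: n => [|n IH]; first by rewrite !expr0 subrr => j k _; apply: bc0.
  have -> : Q ^+ n.+1 - yy ^+ n.+1 = V * Q ^+ n + yy * (Q ^+ n - yy ^+ n).
    by rewrite !exprS hQ; ring.
  apply: ordgeD; last by rewrite -add1n; apply: ordgeM.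
  by rewrite -addn2 addnC; apply: ordgeM => //; apply: ox.
have -> : P ^+ m.+1 * Q ^+ n - xx ^+ m.+1 * yy ^+ n
    = U * (P ^+ m * Q ^+ n) + xx * (P ^+ m * Q ^+ n - xx ^+ m * yy ^+ n).
  by rewrite !exprS {1}hP; ring.
rewrite addSn; apply: ordgeD; last by rewrite -add1n; apply: ordgeM.
by rewrite -addn2 addnC; apply: ordgeM => //; apply: ordgeM; apply: ox.
Qed.

Lemma bc_lead (P Q U V : BP) m n j k : ordge 2 U -> ordge 2 V -> P = xx + U -> Q = yy + V ->
  (j + k <= m + n)%N -> bc (P ^+ m * Q ^+ n) j k = ((j == m) && (k == n))%:R.
Proof.
move=> hU hV hP hQ h; rewrite -bc_XY; apply/eqP; rewrite -subr_eq0 -bcB; apply/eqP.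
exact: (lead_powers hU hV hP hQ).
Qed.

Lemma lin_ring (m0 m1 m2 d0 d1 a0 a1 : C) :
  m0 * a0 + m1 * a1 + m2 * (d0 * a0 + d1 * a1) = (m0 + m2 * d0) * a0 + (m1 + m2 * d1) * a1.
Proof. ring. Qed.

Lemma inv_ring (k d0 d1 x0 x1 y m0 m1 : C) : k != 0 -> m0 + k * d0 = 0 -> m1 + k * d1 = 0 ->
  m0 * x0 + m1 * x1 + k * y = 0 -> y = d0 * x0 + d1 * x1.
Proof.
move=> k0 h0 h1 h; apply: (mulfI k0); apply/eqP; rewrite -subr_eq0; apply/eqP.
have -> : k * y - k * (d0 * x0 + d1 * x1)
   = m0 * x0 + m1 * x1 + k * y - (m0 + k * d0) * x0 - (m1 + k * d1) * x1 by ring.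
by rewrite h h0 h1 !mul0r !subr0.
Qed.

Lemma dot10 (x y : C) : x * 1 + y * 0 = x. Proof. ring. Qed.
Lemma dot01 (x y : C) : x * 0 + y * 1 = y. Proof. ring. Qed.

Lemma comb10 (A : nzRingType) (e z x y W : A) : e = 1 -> z = 0 -> e * x + z * y + W = x + W.
Proof. by move=> -> ->; rewrite mul1r mul0r addr0. Qed.
Lemma comb01 (A : nzRingType) (e z x y W : A) : e = 1 -> z = 0 -> z * x + e * y + W = y + W.
Proof. by move=> -> ->; rewrite mul1r mul0r add0r. Qed.
Lemma comb00 (A : nzRingType) (z z' x y W : A) : z = 0 -> z' = 0 -> z * x + z' * y + W = W.
Proof. by move=> -> ->; rewrite !mul0r !add0r. Qed.

Lemma imgp0 (c : nat -> nat -> C) M N i : lin0 c M i = 0 -> lin1 c M i = 0 ->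
  imgp c M N i = bC (M i ord_max) * Np N (cut c) xx yy.
Proof. by rewrite /imgp => -> ->; exact: (comb00 xx yy _ (bC0 R) (bC0 R)). Qed.

Definition emb (i : 'I_2) : 'I_3 := if i == 0 then 0 else 1.

Section Surface.
Variables (S : graphed R) (p : 'cV[C]_3) (g : affine R) (G : nat -> nat -> C).
Hypothesis (hS : surface S) (hp : graph S p) (hg : graphs_as S p g G).
Hypothesis (hG : forall j k, (j + k < 2)%N -> G j k = 0).

Let f := fn S.
Let a := coord_xy p.

Lemma holo_a : holomorphic_at f a.
Proof. by apply: surface_holo hS _; case: hp. Qed.

Section Subst.
Variable A : 'M[C]_2.
Let w := csub f a A.

(** The linear part of g read in coordinates in which the (x, y)-plane has been
    transformed by A. *)
Definition MA (i j : 'I_3) : C :=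
  if j == 0 then g.1 i 0 * A 0 0 + g.1 i 1 * A 1 0
  else if j == 1 then g.1 i 0 * A 0 1 + g.1 i 1 * A 1 1 else g.1 i ord_max.

Lemma csub00 : w 0 0 = f a.
Proof.
Local Transparent partials.
by rewrite /w /csub /partials /= /fsub mulmx0 addr0.
Qed.
Local Opaque partials.

Lemma aff_img h i : aff g (pnt (a + A *m h) (f (a + A *m h))) i 0 = img (fsub f a A) w MA i h.
Proof.
have [_ gp _] := hg; have e : aff g p i 0 = 0 by rewrite gp mxE.
rewrite affE in e; rewrite affE point0 point1 point2 /img csub00 /fsub.
have pE := graph_point hp.
have p0 : p 0 0 = a 0 0 by rewrite /a xy0.
have p1 : p 1 0 = a 1 0 by rewrite /a xy1.
have p2 : p ord_max 0 = f a by rewrite [in LHS]pE point2.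
rewrite p0 p1 p2 in e.
rewrite [(a + _) 0 0]mxE [(a + _) 1 0]mxE !mulA0 /MA /=.
move: (f (a + A *m h)) (f a) (a 0 0) (a 1 0) (h 0 0) (h 1 0) (g.2 i 0) e => F1 F2 a0 a1 h0 h1 b.
move: (g.1 i 0) (g.1 i 1) (g.1 i ord_max) (A 0 0) (A 0 1) (A 1 0) (A 1 1) => m0 m1 m2 A00 A01 A10 A11 e.
have -> : b = - (m0 * a0 + m1 * a1 + m2 * F2) by apply/eqP; rewrite -addr_eq0 addrC e.
ring.
Qed.

Lemma img_rel : exists2 F, (forall N, jeq N F (bpoly N (fc G))) &
  \forall h \near (0 : 'cV[C]_2), img (fsub f a A) w MA ord_max h =
    F (vec2 (img (fsub f a A) w MA 0 h) (img (fsub f a A) w MA 1 h)).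
Proof.
have [F hF hn] := graphs_as_fun hS hp hg; exists F.
  move=> N; have := jeq_taylor N hF; rewrite (_ : (fun h => F (0 + h)) = F) //.
  by apply/funext => h; rewrite add0r.
have := lin_near A hn; apply: filterS => h.
rewrite /coord_u aff_img => ->; congr F; rewrite -[LHS]vec2_eta xy0 xy1.
by rewrite !aff_img.
Qed.

Lemma jeq_w N : jeq N (fsub f a A) (bpoly N (fc w)).
Proof. exact: jeq_fsub holo_a N. Qed.

Lemma surf_star1 N j k : (j + k < N)%N ->
  bc (imgp w MA N ord_max) j k = bc (Np N G (imgp w MA N 0) (imgp w MA N 1)) j k.
Proof. by have [F hF hrel] := img_rel; apply: (star1 jeq_w hF hrel). Qed.

Lemma surf_lin_max : lin0 w MA ord_max = 0 /\ lin1 w MA ord_max = 0.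
Proof. by have [F hF hrel] := img_rel; apply: (lin_max jeq_w hF hrel hG). Qed.

Definition d1 (j : 'I_2) : C := if j == 0 then partials f 1 0 a else partials f 0 1 a.
(** The differential of the coordinates of g along the tangent plane of S. *)
Definition lk (i : 'I_3) (j : 'I_2) : C := g.1 i (emb j) + g.1 i ord_max * d1 j.

Lemma csub10 : w 1 0 = d1 0 * A 0 0 + d1 1 * A 1 0.
Proof.
have := @csubE _ _ _ A holo_a 2 1 0 isT; rewrite fc10 -/w => ->.
rewrite bc_Np !big_ord_recl !big_ord0 /= !addr0 !lin_m0 /= /d1 /=.
by rewrite fc10 fc01 expr0 expr1 mulr1 !mulr0 !addr0 add0r mul1r addrC.
Qed.
Lemma csub01 : w 0 1 = d1 0 * A 0 1 + d1 1 * A 1 1.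
Proof.
have := @csubE _ _ _ A holo_a 2 0 1 isT; rewrite fc01 -/w => ->.
rewrite bc_Np !big_ord_recl !big_ord0 /= !addr0 !lin_0n /= /d1 /=.
by rewrite fc10 fc01 expr0 expr1 mulr1 !mulr0 !addr0 add0r mul1r addrC.
Qed.

Lemma lin0E i : lin0 w MA i = lk i 0 * A 0 0 + lk i 1 * A 1 0.
Proof. by rewrite /lin0 csub10; exact: lin_ring. Qed.
Lemma lin1E i : lin1 w MA i = lk i 0 * A 0 1 + lk i 1 * A 1 1.
Proof. by rewrite /lin1 csub01; exact: lin_ring. Qed.

End Subst.

Definition kap : C := g.1 ord_max ord_max.

Lemma lk_max j : lk ord_max j = 0.
Proof.
have [e0 e1] := surf_lin_max 1%:M.
rewrite lin0E !mxE /= dot10 in e0; rewrite lin1E !mxE /= dot01 in e1.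
by case: (ord2P j) => ->; [exact: e0|exact: e1].
Qed.

Lemma kap_neq0 : kap != 0.
Proof.
apply/eqP => k0; have := lk_max 0; have := lk_max 1.
have z (x y : C) : x + kap * y = 0 -> x = 0 by rewrite k0 mul0r addr0.
move=> /z e0 /z e1.
have [Mu _ _] := hg; have := congr1 (fun X : 'M[C]_3 => X ord_max ord_max) (mulmxV Mu).
rewrite [LHS]mxE sum3 -/kap [X in _ = X]mxE eqxx.
rewrite (e1 : g.1 ord_max 0 = 0) (e0 : g.1 ord_max 1 = 0) k0.
by rewrite !mul0r !addr0 => /eqP; rewrite eq_sym oner_eq0.
Qed.

(** Coordinates of the base plane in which the tangent map of g becomes the identity. *)
Definition adA : 'M[C]_2 := \matrix_(i, j) invmx g.1 (emb i) (emb j).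
Definition lkm : 'M[C]_2 := \matrix_(i, j) lk (emb i) j.

Lemma emb_inj i j : (emb i == emb j) = (i == j).
Proof. by case: (ord2P i) => ->; case: (ord2P j) => ->. Qed.
Lemma emb_max i : (ord_max == emb i) = false.
Proof. by case: (ord2P i) => ->. Qed.

(** The block of the inverse of g maps the normalized (x, y)-plane onto the tangent
    plane, in its projection to the (x, y)-plane. *)
Lemma lk_adA : lkm *m adA = 1%:M.
Proof.
have [Mu _ _] := hg; have MK := mulmxV Mu; set K := invmx g.1 in MK.
apply/matrixP => i j; rewrite mxE sum2 /lkm /adA !(mxE matrix_key) -/K.
have e2 : K ord_max (emb j) = d1 0 * K 0 (emb j) + d1 1 * K 1 (emb j).
  have := congr1 (fun X : 'M[C]_3 => X ord_max (emb j)) MK.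
  rewrite [LHS]mxE sum3 [X in _ = X]mxE emb_max.
  have h0 : g.1 ord_max 0 + kap * d1 0 = 0 := lk_max 0.
  have h1 : g.1 ord_max 1 + kap * d1 1 = 0 := lk_max 1.
  move: (K 0 (emb j)) (K 1 (emb j)) (K ord_max (emb j)) => x0 x1 y h.
  have {}h : g.1 ord_max 0 * x0 + g.1 ord_max 1 * x1 + kap * y = 0 by exact: h.
  have := inv_ring kap_neq0 h0 h1 h; exact.
have := congr1 (fun X : 'M[C]_3 => X (emb i) (emb j)) MK.
rewrite [LHS]mxE sum3 [X in _ = X]mxE emb_inj e2 => h; rewrite [RHS]mxE -h.
by rewrite lin_ring.
Qed.

Lemma adA_unit : adA *m lkm = 1%:M. Proof. exact: mulmx1C lk_adA. Qed.

Definition adw := csub f a adA.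
Definition adW N : BP := Np N (cut adw) xx yy.
Definition p3 : C := g.1 0 ord_max.
Definition q3 : C := g.1 1 ord_max.

(** In adapted coordinates, with W the nonlinear part of the function of S, the point
    (x, y, W) goes to (x + p3 W, y + q3 W, kap W), which lies on the normalized graph.
    This is the equation between the jets of S and of its normal form. *)
Lemma star N j k : (j + k < N)%N ->
  bc (bC kap * adW N) j k = bc (Np N G (xx + bC p3 * adW N) (yy + bC q3 * adW N)) j k.
Proof.
move=> hjk; have := surf_star1 adA hjk.
have [e0 e1] := surf_lin_max adA; rewrite (imgp0 N e0 e1).
have L (i j' : 'I_2) : lk (emb i) 0 * adA 0 j' + lk (emb i) 1 * adA 1 j' = (i == j')%:R.
  have := congr1 (fun X : 'M[C]_2 => X i j') lk_adA.
  by rewrite [LHS]mxE sum2 /lkm !(mxE matrix_key) [X in _ = X]mxE.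
have H (i : 'I_3) (u v : C) : lk i 0 * adA 0 0 + lk i 1 * adA 1 0 = u ->
    lk i 0 * adA 0 1 + lk i 1 * adA 1 1 = v ->
    imgp adw (MA adA) N i = bC u * xx + bC v * yy + bC (MA adA i ord_max) * adW N.
  by move=> hu hv; rewrite /imgp lin0E lin1E hu hv.
have i0 : imgp adw (MA adA) N 0 = xx + bC p3 * adW N := etrans (H 0 1 0 (L 0 0) (L 0 1)) (comb10 xx yy _ (bC1 R) (bC0 R)).
have i1 : imgp adw (MA adA) N 1 = yy + bC q3 * adW N := etrans (H 1 0 1 (L 1 0) (L 1 1)) (comb01 xx yy _ (bC1 R) (bC0 R)).
by rewrite i0 i1.
Qed.

Lemma ordge_adW N : ordge 2 (adW N).
Proof. exact: ordge_W. Qed.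

Lemma bc_adW N j k : (j + k < N)%N -> bc (adW N) j k = fc (cut adw) j k.
Proof. by move=> h; rewrite /adW -bpoly_Np bc_bpoly_lt. Qed.

(** The powers with m + n = j + k contribute only their leading monomials, and those of
    higher degree nothing. So the coefficients of the normal form are polynomials in the
    adapted coefficients of S and in kap, p3, q3. *)
Lemma star_tri N j k : (2 <= j + k)%N -> (j + k < N)%N ->
  kap * fc adw j k = fc G j k + \sum_(m < N) \sum_(n < N | (m + n < j + k)%N)
     fc G m n * bc ((xx + bC p3 * adW N) ^+ m * (yy + bC q3 * adW N) ^+ n) j k.
Proof.
move=> h2 hN; have := star hN; rewrite bc_C bc_adW // fcutE // => ->.
rewrite bc_Np.
have jN : (j < N)%N by apply: leq_ltn_trans (leq_addr k j) hN.
have kN : (k < N)%N by apply: leq_ltn_trans (leq_addl j k) hN.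
under eq_bigr => m _ do rewrite (bigID (fun n : 'I_N => (m + n < j + k)%N)) /=.
rewrite big_split /= addrC; congr (_ + _).
have lead (m n : 'I_N) : ~~ (m + n < j + k)%N ->
    fc G m n * bc ((xx + bC p3 * adW N) ^+ m * (yy + bC q3 * adW N) ^+ n) j k
    = fc G m n * ((j == m) && (k == n))%:R.
  rewrite -leqNgt => h; congr (_ * _).
  apply: (bc_lead (U := bC p3 * adW N) (V := bC q3 * adW N)) => //.
    by apply: ordgeC; apply: ordge_adW.
  by apply: ordgeC; apply: ordge_adW.
rewrite (bigD1 (Ordinal jN)) //= [X in _ + X]big1 ?addr0; last first.
  move=> m mj; rewrite big1 // => n hn; rewrite lead //.
  case: eqP => [e|]; last by rewrite mulr0.
  by case/eqP: mj; apply: val_inj.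
rewrite (bigD1 (Ordinal kN)) /= ?ltnn // [X in _ + X]big1 ?addr0; last first.
  move=> n /andP[hn nk]; rewrite (lead (Ordinal jN) n) //= eqxx andTb.
  case: eqP => [e|]; last by rewrite mulr0.
  by case/eqP: nk; apply: val_inj.
by rewrite (lead (Ordinal jN) (Ordinal kN)) /= ?ltnn // !eqxx mulr1.
Qed.

End Surface.
End Adapted.

(** * The equations of low order *)
Section LowOrder.
Variable R : realType.
Notation C := (Cx R).
Notation BP := {poly {poly C}}.
Local Opaque partial holomorphic_at taylor_at hessian partials jeq.
Local Opaque bC bX bY bc bev cut fc.
Local Notation xx := (bX R).
Local Notation yy := (bY R).

Lemma sparse2 (F : nat -> nat -> C) : F 0%N 0%N = 0 -> F 1%N 0%N = 0 -> F 0%N 1%N = 0 ->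
  \sum_(m < 3) \sum_(n < 3 | (m + n < 2)%N) F m n = 0.
Proof.
move=> h0 h1 h2; under eq_bigr => m _ do rewrite big_mkcond /=.
by rewrite !big_ord_recl !big_ord0 /= h0 h1 h2 !addr0.
Qed.

Lemma sparse3 (F : nat -> nat -> C) : F 0%N 0%N = 0 -> F 1%N 0%N = 0 -> F 0%N 1%N = 0 ->
  F 2%N 0%N = 0 -> F 0%N 2%N = 0 ->
  \sum_(m < 4) \sum_(n < 4 | (m + n < 3)%N) F m n = F 1%N 1%N.
Proof.
move=> h0 h1 h2 h3 h4; under eq_bigr => m _ do rewrite big_mkcond /=.
by rewrite !big_ord_recl !big_ord0 /= /bump /= h0 h1 h2 h3 h4 !addr0 !add0r.
Qed.

Lemma sparse4 (F : nat -> nat -> C) : F 0%N 0%N = 0 -> F 1%N 0%N = 0 -> F 0%N 1%N = 0 ->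
  F 2%N 0%N = 0 -> F 0%N 2%N = 0 -> F 2%N 1%N = 0 -> F 1%N 2%N = 0 -> F 0%N 3%N = 0 ->
  \sum_(m < 5) \sum_(n < 5 | (m + n < 4)%N) F m n = F 1%N 1%N + F 3%N 0%N.
Proof.
move=> h0 h1 h2 h3 h4 h5 h6 h7; under eq_bigr => m _ do rewrite big_mkcond /=.
by rewrite !big_ord_recl !big_ord0 /= /bump /= h0 h1 h2 h3 h4 h5 h6 h7 !addr0 !add0r.
Qed.

Lemma mul_shift (A : comNzRingType) (x y p q W : A) :
  (x + p * W) ^+ 1 * (y + q * W) ^+ 1 = x * y + q * (x * W) + p * (y * W) + p * (q * (W * W)).
Proof. ring. Qed.

Lemma cube_shift (A : comNzRingType) (x y p q W : A) :
  (x + p * W) ^+ 3 * (y + q * W) ^+ 0 =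
    x ^+ 3 + (3%:R * p) * (x * (x * W)) + W * (W * ((3%:R * p ^+ 2) * x + p ^+ 3 * W)).
Proof. ring. Qed.

Lemma bc_shift11 (W : BP) (p q : C) j k : bc ((xx + bC p * W) ^+ 1 * (yy + bC q * W) ^+ 1) j k =
  bc (xx * yy) j k + q * bc (xx * W) j k + p * bc (yy * W) j k + p * (q * bc (W * W) j k).
Proof. by rewrite mul_shift !bcD !bc_C. Qed.

Lemma bC_nat n : bC (n%:R : C) = n%:R.
Proof. Local Transparent bC. by rewrite /bC !polyC_natr. Qed.
Local Opaque bC.

Lemma bc_shift30 (W : BP) (p q : C) : ordge 2 W ->
  bc ((xx + bC p * W) ^+ 3 * (yy + bC q * W) ^+ 0) 4 0 = 3%:R * p * bc W 2 0.
Proof.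
move=> hW; rewrite cube_shift -bC_nat -bCM !bcD bc_C !bc_X.
rewrite bc_bX1 /= add0r.
rewrite [X in _ + X](_ : _ = 0) ?addr0 ?add0r //.
have o : ordge (2 + (2 + 1)) (W * (W * (bC 3%:R * bC p ^+ 2 * xx + bC p ^+ 3 * W))); last exact: o.
apply: ordgeM => //; apply: ordgeM => //; apply: ordgeD.
  rewrite (_ : bC 3%:R * bC p ^+ 2 = bC (3%:R * p ^+ 2)); last by rewrite bCM !expr2 bCM.
  by apply: ordgeC; apply: ordge_bX.
rewrite (_ : bC p ^+ 3 = bC (p ^+ 3)); last by rewrite !exprS expr0 !bCM bC1.
by apply: ordgeC; apply: ordge_le hW.
Qed.

Lemma bc_xy1 j k : bc (xx * yy) j k = ((j == 1%N) && (k == 1%N))%:R.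
Proof. by have := bc_XY R 1 1 j k; rewrite !expr1. Qed.

Lemma bcWW (W : BP) : ordge 2 W -> bc (W * W) 4 0 = bc W 2 0 * bc W 2 0.
Proof.
move=> h; rewrite bcM !big_ord_recl !big_ord0 /= /bump /= !subnE /=.
by rewrite (h 0 0)%N // (h 1 0)%N // !mul0r !mulr0 !addr0 !add0r.
Qed.

Lemma bcWW3 (W : BP) j k : ordge 2 W -> (j + k < 4)%N -> bc (W * W) j k = 0.
Proof. by move=> h hjk; have := @ordgeM _ 2 2 W W h h j k hjk. Qed.

Section Adapted.
Variables (S : graphed R) (p : 'cV[C]_3) (g : affine R) (G : nat -> nat -> C).
Hypothesis (hS : surface S) (hp : graph S p) (hn : normal4 S p g G).

Let f := fn S.
Let a := coord_xy p.
Local Notation A := (adA g).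
Local Notation w := (fc (adw S p g)).
Local Notation kp := (kap g).
Local Notation p_ := (p3 g).
Local Notation q_ := (q3 g).

Lemma normal4_low : graphs_as S p g G /\ (forall j k, (j + k < 2)%N -> G j k = 0).
Proof.
have [[[hg [[e1 e2 e3] _ _]] _ _] _] := hn; split=> //.
by move=> [|[|j]] [|[|k]].
Qed.

Lemma normal4_tri N j k : (2 <= j + k)%N -> (j + k < N)%N ->
  kp * w j k = fc G j k + \sum_(m < N) \sum_(n < N | (m + n < j + k)%N)
     fc G m n * bc ((xx + bC p_ * adW S p g N) ^+ m * (yy + bC q_ * adW S p g N) ^+ n) j k.
Proof. by have [hg lo] := normal4_low; apply: star_tri. Qed.

Lemma normal4_bcW N j k : (2 <= j + k)%N -> (j + k < N)%N -> bc (adW S p g N) j k = w j k.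
Proof. by move=> h1 h2; rewrite bc_adW // fcutE. Qed.

Lemma normal4_kap : kp != 0.
Proof. by have [hg lo] := normal4_low; apply: (kap_neq0 hS hp hg lo). Qed.

Lemma fcz j k : G j k = 0 -> fc G j k = 0.
Proof. Local Transparent fc. by rewrite /fc => ->; rewrite mul0r. Qed.

Lemma fc_vals : [/\ fc G 1 1 = 1, fc G 3 0 = 6%:R^-1 & fc G 4 0 = 24%:R^-1].
Proof.
have [[[_ [_ [_ e11 _] _]] e30 _] e40] := hn.
by rewrite /fc e11 e30 e40 !mulr1 !div1r invr1.
Qed.
Local Opaque fc.

(** The equations of orders two to four where the normal form has known coefficients:
    they determine the normalizing map. *)
Lemma adapted_eqs : [/\ w 2 0 = 0, w 0 2 = 0 & kp * w 1 1 = 1] /\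
  [/\ kp * w 3 0 = 6%:R^-1, kp * w 2 1 = q_ * w 1 1, kp * w 1 2 = p_ * w 1 1, w 0 3 = 0 &
      kp * w 4 0 = 24%:R^-1 + q_ * w 3 0].
Proof.
have [[[_ [[e00 e10 e01] [e20 e11 e02] [e21 e12]]] e30 e03] e40] := hn.
have [f11 f30 f40] := fc_vals.
have k0 := normal4_kap.
have kz (x : C) : kp * x = 0 -> x = 0.
  by move/eqP; rewrite mulf_eq0 (negPf k0) => /eqP.
have o N : ordge 2 (adW S p g N) by exact: ordge_adW.
pose F N j k m n := fc G m n * bc ((xx + bC p_ * adW S p g N) ^+ m * (yy + bC q_ * adW S p g N) ^+ n) j k.
have zz j k (x : C) : G j k = 0 -> fc G j k * x = 0 by move=> /fcz ->; rewrite mul0r.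
have t2 j k : (j + k = 2)%N -> kp * w j k = fc G j k.
  move=> hjk; have := @normal4_tri 3 j k; rewrite hjk => ->//.
  by have -> := @sparse2 (F 3%N j k) (zz _ _ _ e00) (zz _ _ _ e10) (zz _ _ _ e01); rewrite addr0.
have w20 : w 2 0 = 0 by apply: kz; rewrite t2 // fcz.
have w02 : w 0 2 = 0 by apply: kz; rewrite t2 // fcz.
have w11 : kp * w 1 1 = 1 by rewrite t2.
split=> //.
have t3 j k : (j + k = 3)%N -> kp * w j k = fc G j k +
    bc ((xx + bC p_ * adW S p g 4) ^+ 1 * (yy + bC q_ * adW S p g 4) ^+ 1) j k.
  move=> hjk; have := @normal4_tri 4 j k; rewrite hjk => ->//.
  have -> := @sparse3 (F 4%N j k) (zz _ _ _ e00) (zz _ _ _ e10) (zz _ _ _ e01) (zz _ _ _ e20) (zz _ _ _ e02).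
  by rewrite /F f11; congr (_ + _); exact: mul1r.
have W3 j k : (j + k = 3)%N -> bc (adW S p g 4 * adW S p g 4) j k = 0.
  by move=> h; apply: bcWW3 => //; rewrite h.
have w30 : kp * w 3 0 = 6%:R^-1.
  rewrite t3 // bc_shift11 W3 // bc_xy1 bc_X bc_Y f30 normal4_bcW // w20 /=.
  by rewrite !mulr0 !addr0.
have w21 : kp * w 2 1 = q_ * w 1 1.
  rewrite t3 // bc_shift11 W3 // bc_xy1 bc_X bc_Y (fcz e21) !normal4_bcW // w20 /=.
  by rewrite !mulr0 !addr0 !add0r.
have w12 : kp * w 1 2 = p_ * w 1 1.
  rewrite t3 // bc_shift11 W3 // bc_xy1 bc_X bc_Y (fcz e12) !normal4_bcW // w02 /=.
  by rewrite !mulr0 !addr0 !add0r.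
have w03 : w 0 3 = 0.
  apply: kz; rewrite t3 // bc_shift11 W3 // bc_xy1 bc_X bc_Y (fcz e03) !normal4_bcW // w02 /=.
  by rewrite !mulr0 !addr0.
split=> //.
rewrite (@normal4_tri 5 4 0) //.
have -> := @sparse4 (F 5%N 4%N 0%N) (zz _ _ _ e00) (zz _ _ _ e10) (zz _ _ _ e01) (zz _ _ _ e20)
  (zz _ _ _ e02) (zz _ _ _ e21) (zz _ _ _ e12) (zz _ _ _ e03).
rewrite /F f11 f30 bc_shift30 // mul1r bc_shift11 bcWW // bc_xy1 bc_X bc_Y !normal4_bcW // w20 /= f40.
by rewrite !mulr0 !addr0 !add0r.
Qed.

End Adapted.

Section Substituted.
Variables (c : nat -> nat -> C) (A : 'M[C]_2).
Let T N := Np N c (Lx A) (Ly A).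
Local Notation a := (A 0 0).
Local Notation b := (A 1 0).
Local Notation a' := (A 0 1).
Local Notation b' := (A 1 1).
Local Notation d := (fc c).

Ltac sub_tac := rewrite /T bc_Np !big_ord_recl !big_ord0 /= /bump /= ?lin_m0 ?lin_m1 ?lin_1n ?lin_0n /=;
  rewrite ?mulr0 ?addr0 ?add0r; ring.

Lemma sub20 : bc (T 3) 2 0 = d 2 0 * a ^+ 2 + d 1 1 * (a * b) + d 0 2 * b ^+ 2.
Proof. sub_tac. Qed.
Lemma sub11 : bc (T 3) 1 1 = 2%:R * d 2 0 * (a * a') + d 1 1 * (a * b' + a' * b)
   + 2%:R * d 0 2 * (b * b').
Proof. sub_tac. Qed.
Lemma sub02 : bc (T 3) 0 2 = d 2 0 * a' ^+ 2 + d 1 1 * (a' * b') + d 0 2 * b' ^+ 2.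
Proof. sub_tac. Qed.
Lemma sub30 : bc (T 4) 3 0 = d 3 0 * a ^+ 3 + d 2 1 * (a ^+ 2 * b) + d 1 2 * (a * b ^+ 2)
   + d 0 3 * b ^+ 3.
Proof. sub_tac. Qed.
Lemma sub03 : bc (T 4) 0 3 = d 3 0 * a' ^+ 3 + d 2 1 * (a' ^+ 2 * b') + d 1 2 * (a' * b' ^+ 2)
   + d 0 3 * b' ^+ 3.
Proof. sub_tac. Qed.
Lemma sub21 : bc (T 4) 2 1 = d 3 0 * (3%:R * (a ^+ 2 * a')) + d 2 1 * (a ^+ 2 * b' + 2%:R * (a * a' * b))
   + d 1 2 * (a' * b ^+ 2 + 2%:R * (a * b * b')) + d 0 3 * (3%:R * (b ^+ 2 * b')).
Proof. sub_tac. Qed.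
Lemma sub12 : bc (T 4) 1 2 = d 3 0 * (3%:R * (a' ^+ 2 * a)) + d 2 1 * (a' ^+ 2 * b + 2%:R * (a * a' * b'))
   + d 1 2 * (a * b' ^+ 2 + 2%:R * (a' * b * b')) + d 0 3 * (3%:R * (b' ^+ 2 * b)).
Proof. sub_tac. Qed.
Lemma sub40 : bc (T 5) 4 0 = d 4 0 * a ^+ 4 + d 3 1 * (a ^+ 3 * b) + d 2 2 * (a ^+ 2 * b ^+ 2)
   + d 1 3 * (a * b ^+ 3) + d 0 4 * b ^+ 4.
Proof. sub_tac. Qed.
End Substituted.

End LowOrder.

(** * The normalizing map in terms of the four-jet, and its uniqueness *)
Section Frame.
Variable R : realType.
Notation C := (Cx R).
Notation BP := {poly {poly C}}.
Local Opaque partial holomorphic_at taylor_at hessian partials jeq.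
Local Opaque bC bX bY bc bev cut fc.

Section Formulas.
Variable d : nat -> nat -> C.
(** The formulas below recover the normalizing map from the adapted four-jet d. The
    quadratic part Q has discriminant -frD; the linear form frL is the one for which the
    cubic part minus frL Q is apolar to Q. For a surface of the branch that difference
    is a cube: frT is its first coefficient and frS the slope of the linear form whose
    cube it is. *)
Definition frD : C := 4%:R * d 2 0 * d 0 2 - d 1 1 ^+ 2.
Definition frL0 : C := (6%:R * d 0 2 * d 3 0 - 2%:R * d 1 1 * d 2 1 + 2%:R * d 2 0 * d 1 2) * (2%:R * frD)^-1.
Definition frL1 : C := (2%:R * d 0 2 * d 2 1 - 2%:R * d 1 1 * d 1 2 + 6%:R * d 2 0 * d 0 3) * (2%:R * frD)^-1.
Definition frT : C := d 3 0 - d 2 0 * frL0.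
Definition frS : C := (d 2 1 - d 2 0 * frL1 - d 1 1 * frL0) * 3%:R^-1 * frT^-1.
(** Twice the pairing under Q of the first coordinate vector with the kernel (- frS, 1)
    of the linear form, which is isotropic; frV is the other isotropic direction. *)
Definition frH : C := d 1 1 - 2%:R * frS * d 2 0.
Definition frV0 : C := (d 1 1 - frS * d 2 0) * frH^-1.
Definition frV1 : C := - d 2 0 * frH^-1.
Definition frE : C := d 4 0 * frV0 ^+ 4 + d 3 1 * (frV0 ^+ 3 * frV1) + d 2 2 * (frV0 ^+ 2 * frV1 ^+ 2)
   + d 1 3 * (frV0 * frV1 ^+ 3) + d 0 4 * frV1 ^+ 4.
(** The quartic part along frV compared with the cubic part fixes the scale. *)
Definition frl : C := 4%:R * (frE * frT^-1 - (frL0 * frV0 + frL1 * frV1)).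
Definition frK : C := frl ^+ 3 * (6%:R * frT)^-1.
Definition frB (i j : 'I_2) : C :=
  if i == 0 then (if j == 0 then frV0 * frl^-1 else - frS * (6%:R * frT) * (frl ^+ 2 * frH)^-1)
  else if j == 0 then frV1 * frl^-1 else 6%:R * frT * (frl ^+ 2 * frH)^-1.
Definition frQ : C := frK * (frL0 * frB 0 0 + frL1 * frB 1 0).
Definition frP : C := frK * (frL0 * frB 0 1 + frL1 * frB 1 1).

Variables (l0 l1 m0 m1 k p q : C).
Let del := l0 * m1 - l1 * m0.
Hypotheses (k0 : k != 0) (del0 : del != 0).
Hypotheses (d20 : d 2 0 = l0 * m0 / k) (d11 : d 1 1 = (l0 * m1 + l1 * m0) / k)
  (d02 : d 0 2 = l1 * m1 / k).
Hypotheses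
  (d30 : d 3 0 = l0 ^+ 3 / (6%:R * k) + (q * l0 + p * m0) * (l0 * m0) / k ^+ 2)
  (d21 : d 2 1 = l0 ^+ 2 * l1 / (2%:R * k)
     + ((q * l1 + p * m1) * (l0 * m0) + (q * l0 + p * m0) * (l0 * m1 + l1 * m0)) / k ^+ 2)
  (d12 : d 1 2 = l0 * l1 ^+ 2 / (2%:R * k)
     + ((q * l0 + p * m0) * (l1 * m1) + (q * l1 + p * m1) * (l0 * m1 + l1 * m0)) / k ^+ 2)
  (d03 : d 0 3 = l1 ^+ 3 / (6%:R * k) + (q * l1 + p * m1) * (l1 * m1) / k ^+ 2).
Let e0 := m1 / del.
Let e1 := - m0 / del.
Hypothesis d40 : d 4 0 * e0 ^+ 4 + d 3 1 * (e0 ^+ 3 * e1) + d 2 2 * (e0 ^+ 2 * e1 ^+ 2)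
   + d 1 3 * (e0 * e1 ^+ 3) + d 0 4 * e1 ^+ 4 = 1 / (24%:R * k) + q / (6%:R * k ^+ 2).

Lemma frDE : frD = - (del / k) ^+ 2.
Proof. by rewrite /frD d20 d11 d02 /del; field. Qed.
Lemma frD_neq0 : frD != 0.
Proof. by rewrite frDE oppr_eq0 expf_eq0 /= mulf_neq0 // invr_neq0. Qed.
Lemma frL0E : frL0 = (q * l0 + p * m0) / k.
Proof. by rewrite /frL0 frDE d20 d11 d02 d30 d21 d12 /del; field; rewrite k0. Qed.
Lemma frL1E : frL1 = (q * l1 + p * m1) / k.
Proof. by rewrite /frL1 frDE d20 d11 d02 d21 d12 d03 /del; field; rewrite k0. Qed.
(** The terms in p and q form a multiple of the quadratic part, which subtracting frL Q
    removes. *)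
Lemma frTE : frT = l0 ^+ 3 / (6%:R * k).
Proof. by rewrite /frT frL0E d30 d20; field. Qed.
Hypothesis l00 : l0 != 0.
Lemma frT_neq0 : frT != 0.
Proof. by rewrite frTE mulf_neq0 ?expf_neq0 ?invr_neq0 ?mulf_neq0 ?pnatr_eq0. Qed.
Lemma frSE : frS = l1 / l0.
Proof. by rewrite /frS frTE frL0E frL1E d21 d20 d11; field; rewrite k0 l00. Qed.
Lemma frHE : frH = del / k.
Proof. by rewrite /frH frSE d11 d20 /del; field; rewrite k0 l00. Qed.
Lemma frH_neq0 : frH != 0.
Proof. by rewrite frHE mulf_neq0 ?invr_neq0. Qed.
Lemma frV0E : frV0 = l0 * e0.
Proof. by rewrite /frV0 frHE frSE d11 d20 /e0; field; rewrite k0 l00 del0. Qed.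
Lemma frV1E : frV1 = l0 * e1.
Proof. by rewrite /frV1 frHE d20 /e1; field; rewrite k0 del0. Qed.
Lemma frEE : frE = l0 ^+ 4 * (1 / (24%:R * k) + q / (6%:R * k ^+ 2)).
Proof. by rewrite /frE frV0E frV1E -d40; ring. Qed.
Lemma frlE : frl = l0.
Proof. by rewrite /frl frEE frTE frL0E frL1E frV0E frV1E /e0 /e1 /del; field; do ?[apply/andP; split]. Qed.
Lemma frKE : frK = k.
Proof. by rewrite /frK frlE frTE; field; rewrite k0 l00. Qed.
Lemma frBE i j : frB i j = (if i == 0 then (if j == 0 then m1 else - l1)
  else (if j == 0 then - m0 else l0)) / del.
Proof.
rewrite /frB frlE frV0E frV1E frSE frTE frHE /e0 /e1; case: eqP; case: eqP => _ _;
by field; rewrite ?k0 ?l00 ?del0.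
Qed.
Lemma frQE : frQ = q.
Proof. by rewrite /frQ frKE frL0E frL1E !frBE /= /del; field; do ?[apply/andP; split]. Qed.
Lemma frPE : frP = p.
Proof. by rewrite /frP frKE frL0E frL1E !frBE /= /del; field; do ?[apply/andP; split]. Qed.
End Formulas.

Lemma det2 (M : 'M[C]_2) : \det M = M 0 0 * M 1 1 - M 0 1 * M 1 0.
Proof.
rewrite (expand_det_row _ 0) sum2 /cofactor !det_mx11 !mxE /= expr0 mul1r expr1 mulN1r mulrN.
by congr (_ * M _ _ - _ * M _ _); apply: val_inj.
Qed.

Lemma mul2E (A B : 'M[C]_2) i j : (A *m B) i j = A i 0 * B 0 j + A i 1 * B 1 j.
Proof. by rewrite mxE sum2. Qed.

Lemma mx2P (A B : 'M[C]_2) : A 0 0 = B 0 0 -> A 0 1 = B 0 1 -> A 1 0 = B 1 0 -> A 1 1 = B 1 1 -> A = B.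
Proof.
move=> h1 h2 h3 h4; apply/matrixP => i j.
by case: (ord2P i) => ->; case: (ord2P j) => ->.
Qed.

Definition inv2 (M : 'M[C]_2) : 'M[C]_2 := \matrix_(i, j) ((if i == 0 then (if j == 0 then M 1 1 else - M 0 1)
  else (if j == 0 then - M 1 0 else M 0 0)) / (M 0 0 * M 1 1 - M 0 1 * M 1 0)).

Lemma inv2P (M : 'M[C]_2) : M 0 0 * M 1 1 - M 0 1 * M 1 0 != 0 -> M *m inv2 M = 1%:M.
Proof.
move=> h; have E (x y z : C) : z != 0 -> x = y * z -> x / z = y by move=> z0 ->; rewrite mulfK.
apply: mx2P; rewrite mul2E ![inv2 _ _ _]mxE [RHS]mxE /= !mulrA -mulrDl; apply: E => //;
rewrite ?mulr1n ?mulr0n ?mul1r ?mul0r; ring.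
Qed.

Lemma csub_mul (f : 'cV[C]_2 -> C) a (A M : 'M[C]_2) :
  csub f a (A *m M) = csub (fsub f a A) 0 M.
Proof.
rewrite /csub; have -> // : fsub f a (A *m M) = fsub (fsub f a A) 0 M.
by apply/funext => h; rewrite /fsub add0r mulmxA.
Qed.

Definition frBm (d : nat -> nat -> C) : 'M[C]_2 := \matrix_(i, j) frB d i j.

Section Surface.
Variables (S : graphed R) (p : 'cV[C]_3) (g : affine R) (G : nat -> nat -> C).
Hypothesis (hS : surface S) (hp : graph S p) (hn : normal4 S p g G).
Variable A0 : 'M[C]_2.
Let f := fn S.
Let a := coord_xy p.
Let A := adA g.
Let M := lkm S p g *m A0.
Let d := fc (csub f a A0).
Hypothesis uA0 : A0 \in unitmx.
Local Notation w := (fc (adw S p g)).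

Let hg : graphs_as S p g G. Proof. by case: (normal4_low hn). Qed.
Let lo : forall j k, (j + k < 2)%N -> G j k = 0. Proof. by case: (normal4_low hn). Qed.

Lemma adA_M : A0 = A *m M.
Proof. by rewrite /M mulmxA (adA_unit hS hp hg lo) mul1mx. Qed.

Lemma det_M : M 0 0 * M 1 1 - M 0 1 * M 1 0 != 0.
Proof.
rewrite -det2 -unitfE -unitmxE /M unitmx_mul uA0 andbT.
by have [] := mulmx1_unit (lk_adA hS hp hg lo).
Qed.

Lemma d_sub N j k : (j + k < N)%N -> d j k = bc (Np N (adw S p g) (Lx M) (Ly M)) j k.
Proof.
move=> h; rewrite /d adA_M csub_mul (@csubE _ (fsub f a A) 0 M _ N j k h) //.
by apply: holo_fsub; apply: holo_a hS hp.
Qed.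

Let B := inv2 M.

Lemma M_B : M *m B = 1%:M.
Proof. exact: inv2P det_M. Qed.

Lemma adA_B : A = A0 *m B.
Proof. by rewrite adA_M -mulmxA M_B mulmx1. Qed.

Lemma w40_sub : w 4 0 = bc (Np 5 (csub f a A0) (Lx B) (Ly B)) 4 0.
Proof.
rewrite /adw -/A -/f -/a adA_B csub_mul (@csubE _ (fsub f a A0) 0 B _ 5 4 0) //.
by apply: holo_fsub; apply: holo_a hS hp.
Qed.

(** The equations of low order, transformed from the adapted coordinates of g to
    arbitrary linear coordinates A0 by the matrix M. *)
Lemma frame_eqs :
  let l0 := M 0 0 in let l1 := M 0 1 in let m0 := M 1 0 in let m1 := M 1 1 in
  let k := kap g in let p := p3 g in let q := q3 g in
  let del := l0 * m1 - l1 * m0 in let e0 := m1 / del in let e1 := - m0 / del in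
 [/\ d 2 0 = l0 * m0 / k, d 1 1 = (l0 * m1 + l1 * m0) / k & d 0 2 = l1 * m1 / k] /\
 [/\ d 3 0 = l0 ^+ 3 / (6%:R * k) + (q * l0 + p * m0) * (l0 * m0) / k ^+ 2,
     d 2 1 = l0 ^+ 2 * l1 / (2%:R * k)
     + ((q * l1 + p * m1) * (l0 * m0) + (q * l0 + p * m0) * (l0 * m1 + l1 * m0)) / k ^+ 2,
     d 1 2 = l0 * l1 ^+ 2 / (2%:R * k)
     + ((q * l0 + p * m0) * (l1 * m1) + (q * l1 + p * m1) * (l0 * m1 + l1 * m0)) / k ^+ 2,
     d 0 3 = l1 ^+ 3 / (6%:R * k) + (q * l1 + p * m1) * (l1 * m1) / k ^+ 2 &
     d 4 0 * e0 ^+ 4 + d 3 1 * (e0 ^+ 3 * e1) + d 2 2 * (e0 ^+ 2 * e1 ^+ 2)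
   + d 1 3 * (e0 * e1 ^+ 3) + d 0 4 * e1 ^+ 4 = 1 / (24%:R * k) + q / (6%:R * k ^+ 2)].
Proof.
have [[w20 w02 w11] [w30 w21 w12 w03 w40]] := adapted_eqs hS hp hn.
have k0 := normal4_kap hS hp hn.
have e11 : w 1 1 = (kap g)^-1 by apply: (mulfI k0); rewrite w11 divff.
have e30 : w 3 0 = (6%:R * kap g)^-1 by apply: (mulfI k0); rewrite w30; field.
have e21 : w 2 1 = q3 g / kap g ^+ 2 by apply: (mulfI k0); rewrite w21 e11; field.
have e12 : w 1 2 = p3 g / kap g ^+ 2 by apply: (mulfI k0); rewrite w12 e11; field.
have e40 : w 4 0 = 1 / (24%:R * kap g) + q3 g / (6%:R * kap g ^+ 2).
  by apply: (mulfI k0); rewrite w40 e30; field.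
move=> l0 l1 m0 m1 k p' q' del e0 e1; split; split.
- rewrite (@d_sub 3) // sub20 w20 w02 e11 -/l0 -/m0 -/k; by field.
- rewrite (@d_sub 3) // sub11 w20 w02 e11 -/l0 -/l1 -/m0 -/m1 -/k; by field.
- rewrite (@d_sub 3) // sub02 w20 w02 e11 -/l1 -/m1 -/k; by field.
- rewrite (@d_sub 4) // sub30 e30 e21 e12 w03 -/l0 -/m0 -/k -/p' -/q'; by field.
- rewrite (@d_sub 4) // sub21 e30 e21 e12 w03 -/l0 -/l1 -/m0 -/m1 -/k -/p' -/q'; by field.
- rewrite (@d_sub 4) // sub12 e30 e21 e12 w03 -/l0 -/l1 -/m0 -/m1 -/k -/p' -/q'; by field.
- rewrite (@d_sub 4) // sub03 e30 e21 e12 w03 -/l1 -/m1 -/k -/p' -/q'; by field.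
- by rewrite -e40 w40_sub sub40 !(mxE matrix_key).
Qed.

Lemma frameT : [/\ frD d != 0, frT d = M 0 0 ^+ 3 / (6%:R * kap g) & kap g != 0].
Proof.
have k0 := normal4_kap hS hp hn.
have [[h1 h2 h3] [h4 h5 h6 h7 _]] := frame_eqs.
split=> //; first exact: (frD_neq0 k0 det_M h1 h2 h3).
exact: (frTE k0 det_M h1 h2 h3 h4 h5 h6).
Qed.

Lemma frame_M : frT d != 0 -> M 0 0 != 0.
Proof.
have [_ -> _] := frameT; apply: contraNneq => ->; by rewrite expr0n mul0r.
Qed.

(** The entries kap, p3, q3 and the adapted plane are rational functions of the four-jet. Uniqueness
    of the normal form and the holomorphic dependence of its coefficients both rest on
    this. *)
Lemma frameE : M 0 0 != 0 ->
  [/\ frT d != 0, frH d != 0 & frl d != 0] /\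
  [/\ kap g = frK d, p3 g = frP d, q3 g = frQ d & adA g = A0 *m frBm d].
Proof.
move=> l0; have k0 := normal4_kap hS hp hn.
have [[h1 h2 h3] [h4 h5 h6 h7 h8]] := frame_eqs.
split; split.
- exact: (frT_neq0 k0 det_M h1 h2 h3 h4 h5 h6 l0).
- exact: (frH_neq0 k0 det_M h1 h2 h3 h4 h5 h6 h7 l0).
- by rewrite (frlE k0 det_M h1 h2 h3 h4 h5 h6 h7 h8 l0).
- by rewrite (frKE k0 det_M h1 h2 h3 h4 h5 h6 h7 h8 l0).
- by rewrite (frPE k0 det_M h1 h2 h3 h4 h5 h6 h7 h8 l0).
- by rewrite (frQE k0 det_M h1 h2 h3 h4 h5 h6 h7 h8 l0).
- rewrite -/A {1}adA_B; congr (_ *m _); apply/matrixP => i j.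
  by rewrite !(mxE matrix_key) (frBE k0 det_M h1 h2 h3 h4 h5 h6 h7 h8 l0).
Qed.
End Surface.

(** Both normalizing maps are given by the same rational formulas; the coordinates of
    one serve as A0 for both, which makes the denominators nonzero. The coefficients
    then agree by induction on the order, the equations being triangular. *)
Lemma normal4_unique (S : graphed R) p g G g' G' : surface S -> graph S p ->
  normal4 S p g G -> normal4 S p g' G' -> g = g' /\ G = G'.
Proof.
move=> hS hp hn hn'.
have [hg lo] := normal4_low hn; have [hg' lo'] := normal4_low hn'.
have uA : adA g \in unitmx by have [] := mulmx1_unit (lk_adA hS hp hg lo).
have M1 : (lkm S p g *m adA g) 0 0 != 0.
  by rewrite (lk_adA hS hp hg lo) mxE eqxx oner_neq0.
have [[T0 _ _] [ek ep eq eA]] := frameE hS hp hn uA M1.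
have M1' := frame_M hS hp hn' uA T0.
have [_ [ek' ep' eq' eA']] := frameE hS hp hn' uA M1'.
have eqk : kap g = kap g' by rewrite ek ek'.
have eqp : p3 g = p3 g' by rewrite ep ep'.
have eqq : q3 g = q3 g' by rewrite eq eq'.
have eqA : adA g = adA g' by rewrite eA' {1}eA.
have eqM : lkm S p g = lkm S p g'.
  have := lk_adA hS hp hg' lo'; rewrite -eqA => h.
  by rewrite -[LHS]mul1mx -h -mulmxA (adA_unit hS hp hg lo) mulmx1.
have e3 (i : 'I_3) : g.1 i ord_max = g'.1 i ord_max by case: (ord3P i) => ->.
have e1 : g.1 = g'.1.
  have E (i : 'I_3) (j : 'I_2) : lk S p g i j = lk S p g' i j -> g.1 i (emb j) = g'.1 i (emb j).
    by rewrite /lk e3 => /addIr.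
  have L (i : 'I_3) (j : 'I_2) : lk S p g i j = lk S p g' i j.
    have Em (i' : 'I_2) : lk S p g (emb i') j = lk S p g' (emb i') j.
      by have := congr1 (fun X : 'M[C]_2 => X i' j) eqM; rewrite !(mxE matrix_key).
    case: (ord3P i) => ->; [exact: (Em 0)|exact: (Em 1)|].
    by rewrite (lk_max hS hp hg lo) (lk_max hS hp hg' lo').
  apply/matrixP => i j; case: (ord3P j) => ->; [exact: (E i 0)|exact: (E i 1)|exact: e3].
have e2 : g.2 = g'.2.
  have [_ h _] := hg; have [_ h' _] := hg'; move: h h'; rewrite /aff e1 => h h'.
  by apply: (addrI (g'.1 *m p)); rewrite h h'.
have eg : g = g' by case: g g' e1 e2 {hn hn' hg hg' lo lo' uA M1 T0 ek ep eq eA M1' ek' ep' eq' eA' eqk eqp eqq eqA eqM e3} => [? ?] [? ?] /= -> ->.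
split=> //; subst g'.
(* With a common normalizing map, the triangular equations determine the coefficients. *)
have fG : forall n j k, (j + k <= n)%N -> fc G j k = fc G' j k.
  elim=> [|n IH] j k hjk.
    have [-> ->] : j = 0%N /\ k = 0%N by lia.
    by rewrite !fcz // ?lo ?lo'.
  have [h2|h2] := ltnP (j + k) 2; first by rewrite !fcz // ?lo ?lo'.
  have := normal4_tri hS hp hn h2 (ltnSn _); rewrite (normal4_tri hS hp hn' h2 (ltnSn _)).
  rewrite [X in _ = _ + X -> _](eq_bigr (fun m : 'I_(j + k).+1 => \sum_(n' < (j + k).+1 | (m + n' < j + k)%N)
     fc G' m n' * bc ((bX R + bC (p3 g) * adW S p g (j + k).+1) ^+ m *
       (bY R + bC (q3 g) * adW S p g (j + k).+1) ^+ n') j k)); first by move=> /addIr.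
  move=> m _; apply: eq_bigr => n' hmn; rewrite IH //.
  by rewrite -ltnS; apply: leq_trans hmn hjk.
apply/funext => j; apply/funext => k; have := fG _ j k (leqnn _).
Local Transparent fc.
rewrite /fc => /mulIf; apply; rewrite invr_eq0 mulf_neq0 //; exact: fact_neq0.
Qed.
Local Opaque fc.

End Frame.

(** * Functions of the jets of surfaces of the branch *)
Section JetHolo.
Variable R : realType.
Notation C := (Cx R).
Notation BP := {poly {poly C}}.
Local Opaque partial holomorphic_at taylor_at hessian partials jeq.
Local Opaque bC bX bY bc bev cut fc.
Local Notation xx := (bX R).
Local Notation yy := (bY R).

Definition branch (S : graphed R) (p : 'cV[C]_3) : Prop := in_B21 S /\ graph S p.

Lemma jet_coord n i : exists k, forall (S : graphed R) p, jet n S p k 0 = coord_xy p i 0.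
Proof. by exists (lshift _ i) => S p; rewrite /jet col_mxEu. Qed.

Lemma jet_partial n j k : (j + k <= n)%N ->
  exists i, forall (S : graphed R) p, jet n S p i 0 = partials (fn S) j k (coord_xy p).
Proof.
move=> h.
have hj : (j < n.+1)%N by rewrite ltnS; apply: leq_trans (leq_addr _ _) h.
have hk : (k < n.+1)%N by rewrite ltnS; apply: leq_trans (leq_addl _ _) h.
have hx : ((Ordinal hj, Ordinal hk).1 + (Ordinal hj, Ordinal hk).2 <= n)%N by [].
pose x : jet_index n := exist _ (Ordinal hj, Ordinal hk) hx.
exists (rshift 2 (enum_rank x)) => S p; rewrite /jet col_mxEd mxE enum_rankK //.
Qed.

Lemma jet_caseP n (i : 'I_(2 + #|jet_index n|)) :
  (exists l, forall (S : graphed R) p, jet n S p i 0 = coord_xy p l 0) \/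
  (exists j k, (j + k <= n)%N /\ forall (S : graphed R) p, jet n S p i 0 = partials (fn S) j k (coord_xy p)).
Proof.
case: (split_ordP i) => l ->; first by left; exists l => S p; rewrite /jet col_mxEu.
right; exists (val (enum_val l : jet_index n)).1, (val (enum_val l : jet_index n)).2; split.
  by case: (enum_val l).
by move=> S p; rewrite /jet col_mxEd mxE.
Qed.

Section At.
Variables (n : nat) (S0 : graphed R) (p0 : 'cV[C]_3).
Implicit Types (f : graphed R -> 'cV[C]_3 -> C).

(** Jets of surfaces of the branch do not fill a neighbourhood in jet space; properties
    are only required along them. *)
Definition nearj (P : graphed R -> 'cV[C]_3 -> Prop) : Prop :=
  \forall z \near jet n S0 p0, forall S p, branch S p -> jet n S p = z -> P S p.

Lemma nearj_all (P : graphed R -> 'cV[C]_3 -> Prop) : (forall S p, branch S p -> P S p) -> nearj P.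
Proof. by move=> h; apply: filterE => z S p hb _; apply: h. Qed.

Lemma nearj_base (P : graphed R -> 'cV[C]_3 -> Prop) : nearj P ->
  forall S p, branch S p -> jet n S p = jet n S0 p0 -> P S p.
Proof. by move=> /nbhs_singleton; apply. Qed.

Lemma nearjS (P Q : graphed R -> 'cV[C]_3 -> Prop) :
  (forall S p, branch S p -> P S p -> Q S p) -> nearj P -> nearj Q.
Proof. by move=> h; apply: filterS => z hz S p hb hj; apply: h => //; apply: hz. Qed.

Lemma nearj2 (P Q T : graphed R -> 'cV[C]_3 -> Prop) :
  (forall S p, branch S p -> P S p -> Q S p -> T S p) -> nearj P -> nearj Q -> nearj T.
Proof. by move=> h; apply: filterS2 => z h1 h2 S p hb hj; apply: h => //; [apply: h1|apply: h2]. Qed.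

Definition jholo f : Prop := exists2 fh, holomorphic_at fh (jet n S0 p0) &
  nearj (fun S p => f S p = fh (jet n S p)).

Lemma jholo_base f fh : branch S0 p0 -> nearj (fun S p => f S p = fh (jet n S p)) -> f S0 p0 = fh (jet n S0 p0).
Proof. by move=> b0 h; apply: (nearj_base h). Qed.

Lemma jholo_eq f f' : nearj (fun S p => f S p = f' S p) -> jholo f -> jholo f'.
Proof.
move=> h [fh h1 h2]; exists fh => //; apply: nearj2 h h2.
by move=> S p _ <- ->.
Qed.
Lemma jholo_cst c : jholo (fun _ _ => c).
Proof. by exists (fun=> c); [exact: holo_cst|apply: nearj_all]. Qed.
Lemma jholoD f f' : jholo f -> jholo f' -> jholo (fun S p => f S p + f' S p).
Proof.
move=> [fh h1 h2] [fh' h1' h2']; exists (fun z => fh z + fh' z); first exact: holoD.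
by apply: nearj2 h2 h2' => S p _ -> ->.
Qed.
Lemma jholoM f f' : jholo f -> jholo f' -> jholo (fun S p => f S p * f' S p).
Proof.
move=> [fh h1 h2] [fh' h1' h2']; exists (fun z => fh z * fh' z); first exact: holoM.
by apply: nearj2 h2 h2' => S p _ -> ->.
Qed.
Lemma jholoN f : jholo f -> jholo (fun S p => - f S p).
Proof.
move=> [fh h1 h2]; exists (fun z => - fh z); first exact: holoN.
by apply: nearjS h2 => S p _ ->.
Qed.
Lemma jholoB f f' : jholo f -> jholo f' -> jholo (fun S p => f S p - f' S p).
Proof. by move=> h h'; apply: jholoD => //; apply: jholoN. Qed.
Lemma jholoX f k : jholo f -> jholo (fun S p => f S p ^+ k).
Proof.
move=> h; elim: k => [|k IH]; first exact: jholo_cst.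
have := jholoM h IH; apply: jholo_eq; apply: nearj_all => S p _; by rewrite exprS.
Qed.
Lemma jholoV f : branch S0 p0 -> f S0 p0 != 0 -> jholo f -> jholo (fun S p => (f S p)^-1).
Proof.
move=> b0 f0 [fh h1 h2]; exists (fun z => (fh z)^-1); last by apply: nearjS h2 => S p _ ->.
by apply: holoV => //; rewrite -(jholo_base b0 h2).
Qed.
Lemma jholo_nz f : branch S0 p0 -> f S0 p0 != 0 -> jholo f -> nearj (fun S p => f S p != 0).
Proof.
move=> b0 f0 [fh h1 h2]; rewrite (jholo_base b0 h2) in f0.
apply: nearj2 h2 (_ : nearj (fun S p => fh (jet n S p) != 0)) => [S p _ -> //|].
by have := holo_nz h1 f0; apply: filterS => z hz S p _ ->.
Qed.
Lemma jholo_sum I (s : seq I) (Pr : pred I) (F : I -> graphed R -> 'cV[C]_3 -> C) :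
  (forall i, Pr i -> jholo (F i)) -> jholo (fun S p => \sum_(i <- s | Pr i) F i S p).
Proof.
move=> h; elim: s => [|i s IH].
  by apply: jholo_eq (jholo_cst 0); apply: nearj_all => S p _; rewrite big_nil.
case hi : (Pr i).
  apply: jholo_eq (jholoD (h i hi) IH); apply: nearj_all => S p _; by rewrite big_cons hi.
by apply: jholo_eq IH; apply: nearj_all => S p _; rewrite big_cons hi.
Qed.
Lemma jholo_partial j k : (j + k <= n)%N -> jholo (fun S p => partials (fn S) j k (coord_xy p)).
Proof.
move=> /jet_partial[i hi]; exists (fun z => z i 0); first exact: holo_coord.
by apply: nearj_all => S p _; rewrite hi.
Qed.

(** Jets whose coefficients depend holomorphically on the jet of the surface. *)
Definition pjholo d (P : graphed R -> 'cV[C]_3 -> BP) : Prop :=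
  forall j k, (j + k <= d)%N -> jholo (fun S p => bc (P S p) j k).

Lemma pjholoD d P Q : pjholo d P -> pjholo d Q -> pjholo d (fun S p => P S p + Q S p).
Proof.
move=> h h' j k hjk; apply: jholo_eq (jholoD (h _ _ hjk) (h' _ _ hjk)).
by apply: nearj_all => S p _; rewrite bcD.
Qed.
Lemma pjholoM d P Q : pjholo d P -> pjholo d Q -> pjholo d (fun S p => P S p * Q S p).
Proof.
move=> h h' j k hjk; pose T S p := \sum_(i < j.+1) \sum_(l < k.+1) bc (P S p) i l * bc (Q S p) (j - i) (k - l).
apply: (@jholo_eq T); first by apply: nearj_all => S p _; rewrite bcM.
apply: jholo_sum => i _; apply: jholo_sum => l _; apply: jholoM; [apply: h|apply: h'];
by move: (ltn_ord i) (ltn_ord l); lia.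
Qed.
Lemma pjholo_cst d P : pjholo d (fun _ _ => P).
Proof. by move=> j k _; apply: jholo_cst. Qed.
Lemma pjholoX d P k : pjholo d P -> pjholo d (fun S p => P S p ^+ k).
Proof.
move=> h; elim: k => [|k IH]; first by move=> j l _; exact: (jholo_cst (bc 1 j l)).
move=> j l hjl; have := pjholoM h IH hjl; apply: jholo_eq; apply: nearj_all => S p _; by rewrite exprS.
Qed.
Lemma pjholoC d f : jholo f -> pjholo d (fun S p => bC (f S p)).
Proof.
move=> h j k _; case e : ((j == 0) && (k == 0))%N.
  by apply: jholo_eq h; apply: nearj_all => S p _; rewrite bc_CE e.
by apply: jholo_eq (jholo_cst 0); apply: nearj_all => S p _; rewrite bc_CE e.
Qed.

Definition mxjholo (A : graphed R -> 'cV[C]_3 -> 'M[C]_2) : Prop :=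
  forall i j, jholo (fun S p => A S p i j).

Lemma ordge_lin (A : 'M[C]_2) i j : ordge (i + j) (Lx A ^+ i * Ly A ^+ j).
Proof.
have ox : ordge 1 (Lx A) by apply: ordgeD; apply: ordgeC; [exact: ordge_bX|exact: ordge_bY].
have oy : ordge 1 (Ly A) by apply: ordgeD; apply: ordgeC; [exact: ordge_bX|exact: ordge_bY].
by apply: ordgeM; [have := @ordgeX _ 1 (Lx A) i ox|have := @ordgeX _ 1 (Ly A) j oy]; rewrite mul1n.
Qed.

Lemma jholo_csub A j k : mxjholo A -> (j + k <= n)%N ->
  jholo (fun S p => fc (csub (fn S) (coord_xy p) (A S p)) j k).
Proof.
move=> hA hjk.
pose T S p := \sum_(m < (j + k).+1) \sum_(l < (j + k).+1 | (m + l <= n)%N)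
  fc (fun a b => partials (fn S) a b (coord_xy p)) m l * bc (Lx (A S p) ^+ m * Ly (A S p) ^+ l) j k.
have L d : pjholo d (fun S p => Lx (A S p)).
  by apply: pjholoD; apply: pjholoM; try apply: pjholo_cst; apply: pjholoC; apply: hA.
have L' d : pjholo d (fun S p => Ly (A S p)).
  by apply: pjholoD; apply: pjholoM; try apply: pjholo_cst; apply: pjholoC; apply: hA.
apply: (@jholo_eq T).
  apply: nearj_all => S p [[[hS _] _] [hd _]].
  rewrite (@csubE _ _ _ _ (surface_holo hS hd) (j + k).+1 j k) // bc_Np.
  apply: eq_bigr => m _; rewrite [RHS](bigID (fun l : 'I__ => (m + l <= n)%N)) /=.
  rewrite [X in _ = _ + X]big1 ?addr0 // => l; rewrite -ltnNge => hl.
  by rewrite ordge_lin ?mulr0 //; apply: leq_ltn_trans hjk hl.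
apply: jholo_sum => m _; apply: jholo_sum => l hl; apply: jholoM.
  Local Transparent fc.
  by rewrite /fc; apply: jholoM; [apply: jholo_partial|apply: jholo_cst].
by apply: (pjholoM (d := j + k)) => //; apply: pjholoX.
Qed.
Local Opaque fc.

End At.

Lemma normP (S : graphed R) p : branch S p ->
  normal4 S p (phi S p) (fun j k => Icoef j k S p).
Proof.
move=> [hS hp]; have [g [G hn]] := in_B21_ex hS hp.
have := @xgetPex _ ((0, 0), fun _ _ => 0) [set gG | normal4 S p gG.1 gG.2].
by apply; exists (g, G).
Qed.

Lemma branch_surface (S : graphed R) p : branch S p -> surface S.
Proof. by case=> [[[]]]. Qed.
Lemma branch_graph (S : graphed R) p : branch S p -> graph S p.
Proof. by case. Qed.

Lemma normE (S : graphed R) p g G : branch S p -> normal4 S p g G ->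
  phi S p = g /\ forall j k, Icoef j k S p = G j k.
Proof.
move=> hb hn; have [h1 h2] := normal4_unique (branch_surface hb) (branch_graph hb) (normP hb) hn.
by split=> // j k; rewrite -h2.
Qed.

Section FrameFunctions.
Variables (n : nat) (S0 : graphed R) (p0 : 'cV[C]_3) (d : graphed R -> 'cV[C]_3 -> nat -> nat -> C).
Local Notation jh := (jholo n S0 p0).
Hypothesis (b0 : branch S0 p0) (hd : forall j k, (j + k <= 4)%N -> jh (fun S p => d S p j k)).
Hypotheses (nD : frD (d S0 p0) != 0) (nT : frT (d S0 p0) != 0) (nH : frH (d S0 p0) != 0)
  (nl : frl (d S0 p0) != 0).

Ltac jh_tac := repeat first [assumption | exact: (jholo_cst _ _ _ _) | (by apply: hd) |
  apply: jholoB | apply: jholoD | apply: jholoN | apply: jholoM | apply: jholoX ].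

Lemma frame_jholo : [/\ jh (fun S p => frT (d S p)), jh (fun S p => frK (d S p)),
  jh (fun S p => frP (d S p)), jh (fun S p => frQ (d S p)) &
  forall i j, jh (fun S p => frB (d S p) i j)].
Proof.
have hD : jh (fun S p => frD (d S p)) by rewrite /frD; jh_tac.
have hDV : jh (fun S p => (2%:R * frD (d S p))^-1).
  by apply: jholoV => //; [rewrite mulf_neq0 ?pnatr_eq0|jh_tac].
have hL0 : jh (fun S p => frL0 (d S p)) by rewrite /frL0; jh_tac.
have hL1 : jh (fun S p => frL1 (d S p)) by rewrite /frL1; jh_tac.
have hT : jh (fun S p => frT (d S p)) by rewrite /frT; jh_tac.
have hTV : jh (fun S p => (frT (d S p))^-1) by apply: jholoV.
have hS : jh (fun S p => frS (d S p)) by rewrite /frS; jh_tac.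
have hH : jh (fun S p => frH (d S p)) by rewrite /frH; jh_tac.
have hHV : jh (fun S p => (frH (d S p))^-1) by apply: jholoV.
have hV0 : jh (fun S p => frV0 (d S p)) by rewrite /frV0; jh_tac.
have hV1 : jh (fun S p => frV1 (d S p)) by rewrite /frV1; jh_tac.
have hE : jh (fun S p => frE (d S p)) by rewrite /frE; jh_tac.
have hl : jh (fun S p => frl (d S p)) by rewrite /frl; jh_tac.
have hlV : jh (fun S p => (frl (d S p))^-1) by apply: jholoV.
have hTV6 : jh (fun S p => (6%:R * frT (d S p))^-1).
  by apply: jholoV => //; [rewrite mulf_neq0 ?pnatr_eq0|jh_tac].
have hK : jh (fun S p => frK (d S p)) by rewrite /frK; jh_tac.
have hlH : jh (fun S p => (frl (d S p) ^+ 2 * frH (d S p))^-1).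
  by apply: jholoV => //; [rewrite mulf_neq0 ?expf_neq0|jh_tac].
have hB i j : jh (fun S p => frB (d S p) i j).
  rewrite /frB; case: (i == 0); case: (j == 0).
  - exact: jholoM hV0 hlV.
  - exact: jholoM (jholoM (jholoN hS) (jholoM (jholo_cst _ _ _ _) hT)) hlH.
  - exact: jholoM hV1 hlV.
  - exact: jholoM (jholoM (jholo_cst _ _ _ _) hT) hlH.
split=> //.
  exact: jholoM hK (jholoD (jholoM hL0 (hB 0 1)) (jholoM hL1 (hB 1 1))).
exact: jholoM hK (jholoD (jholoM hL0 (hB 0 0)) (jholoM hL1 (hB 1 0))).
Qed.
End FrameFunctions.

Section FrameHolo.
Variables (n : nat) (S0 : graphed R) (p0 : 'cV[C]_3).
Hypotheses (b0 : branch S0 p0) (n4 : (4 <= n)%N).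
Let A0 : 'M[C]_2 := adA (phi S0 p0).
Let d (S : graphed R) (p : 'cV[C]_3) := fc (csub (fn S) (coord_xy p) A0).
Local Notation jh := (jholo n S0 p0).

Lemma jholo_sub_coef j k : (j + k <= 4)%N -> jh (fun S p => d S p j k).
Proof.
by move=> h; apply: jholo_csub (leq_trans h n4) => // i l; apply: jholo_cst.
Qed.

Lemma frame_unit : A0 \in unitmx.
Proof.
have [hg lo] := normal4_low (normP b0).
by have [] := mulmx1_unit (lk_adA (branch_surface b0) (branch_graph b0) hg lo).
Qed.

Lemma frame_lead : (lkm S0 p0 (phi S0 p0) *m A0) 0 0 != 0.
Proof.
have [hg lo] := normal4_low (normP b0).
by rewrite (lk_adA (branch_surface b0) (branch_graph b0) hg lo) mxE eqxx oner_neq0.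
Qed.

Let base := frameE (branch_surface b0) (branch_graph b0) (normP b0) frame_unit frame_lead.
Let baseT := frameT (branch_surface b0) (branch_graph b0) (normP b0) frame_unit.

Lemma frame_entries_jholo : [/\ jh (fun S p => frT (d S p)), jh (fun S p => frK (d S p)),
  jh (fun S p => frP (d S p)), jh (fun S p => frQ (d S p)) &
  forall i j, jh (fun S p => frB (d S p) i j)].
Proof.
have [[nT nH nl] _] := base; have [nD _ _] := baseT.
apply: frame_jholo => //; exact: jholo_sub_coef.
Qed.

(** The adapted coordinates at the base point are kept fixed nearby, where the
    denominators of the rational formulas remain nonzero. *)
Lemma near_frame : nearj n S0 p0 (fun S p =>
  [/\ kap (phi S p) = frK (d S p), p3 (phi S p) = frP (d S p), q3 (phi S p) = frQ (d S p) &
      adA (phi S p) = A0 *m frBm (d S p)]).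
Proof.
have [T0 _ _] := base.1; have [frame_jT _ _ _ _] := frame_entries_jholo; have := jholo_nz b0 T0 frame_jT; apply: nearjS => S p hb hT'.
have hn := normP hb.
have m0 := frame_M (branch_surface hb) (branch_graph hb) hn frame_unit hT'.
by have [] := frameE (branch_surface hb) (branch_graph hb) hn frame_unit m0.
Qed.

Lemma jholo_kap : jh (fun S p => kap (phi S p)).
Proof. by have [_ fr_jK _ _ _] := frame_entries_jholo; apply: jholo_eq fr_jK; apply: nearjS near_frame => S p _ [-> _ _ _]. Qed.
Lemma jholo_p3 : jh (fun S p => p3 (phi S p)).
Proof. by have [_ _ fr_jP _ _] := frame_entries_jholo; apply: jholo_eq fr_jP; apply: nearjS near_frame => S p _ [_ -> _ _]. Qed.
Lemma jholo_q3 : jh (fun S p => q3 (phi S p)).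
Proof. by have [_ _ _ fr_jQ _] := frame_entries_jholo; apply: jholo_eq fr_jQ; apply: nearjS near_frame => S p _ [_ _ -> _]. Qed.
Lemma jholo_adA : mxjholo n S0 p0 (fun S p => adA (phi S p)).
Proof.
move=> i j; have [_ _ _ _ fr_jB] := frame_entries_jholo; apply: (@jholo_eq _ _ _ (fun S p => A0 i 0 * frB (d S p) 0 j + A0 i 1 * frB (d S p) 1 j)).
  by apply: nearjS near_frame => S p _ [_ _ _ ->]; rewrite mul2E !(mxE matrix_key).
by apply: jholoD; apply: jholoM; first [exact: jholo_cst|exact: fr_jB].
Qed.

Lemma jholo_adw j k : (j + k <= n)%N -> jh (fun S p => fc (adw S p (phi S p)) j k).
Proof. by move=> h; exact: jholo_csub jholo_adA h. Qed.

Lemma pjholo_adW N e : (e < N)%N -> (e <= n)%N -> pjholo n S0 p0 e (fun S p => adW S p (phi S p) N).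
Proof.
move=> hN he j k hjk.
have hjN : (j + k < N)%N by apply: leq_ltn_trans hjk hN.
have [h2|h2] := leqP 2 (j + k).
  apply: jholo_eq (jholo_adw (leq_trans hjk he)); apply: nearj_all => S p _.
  by rewrite bc_adW // fcutE.
by apply: jholo_eq (jholo_cst _ _ _ 0); apply: nearj_all => S p _; rewrite bc_adW // fcut0.
Qed.

(** Induction on the order in the triangular equations. *)
Lemma jholo_fcI j k : (j + k <= n)%N -> jh (fun S p => fc (fun j k => Icoef j k S p) j k).
Proof.
move: {2}(j + k)%N (leqnn (j + k)) => m; elim: m j k => [|m IH] j k hm hjk.
  have [-> ->] : j = 0%N /\ k = 0%N by lia.
  apply: jholo_eq (jholo_cst _ _ _ 0); apply: nearj_all => S p hb.
  by have [_ lo] := normal4_low (normP hb); rewrite fcz // lo.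
have [h2|h2] := leqP 2 (j + k); last first.
  apply: jholo_eq (jholo_cst _ _ _ 0); apply: nearj_all => S p hb.
  by have [_ lo] := normal4_low (normP hb); rewrite fcz // lo.
pose N := (j + k).+1.
pose T (S : graphed R) p := kap (phi S p) * fc (adw S p (phi S p)) j k -
  \sum_(m < N) \sum_(l < N | (m + l < j + k)%N) fc (fun j k => Icoef j k S p) m l *
    bc ((xx + bC (p3 (phi S p)) * adW S p (phi S p) N) ^+ m *
        (yy + bC (q3 (phi S p)) * adW S p (phi S p) N) ^+ l) j k.
apply: (@jholo_eq _ _ _ T).
  apply: nearj_all => S p hb; rewrite /T.
  rewrite (normal4_tri (branch_surface hb) (branch_graph hb) (normP hb) h2 (ltnSn _)) addrK //.
apply: jholoB; first by apply: jholoM; [exact: jholo_kap|exact: jholo_adw].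
apply: jholo_sum => i _; apply: jholo_sum => l hil; apply: jholoM.
  apply: IH; last by apply: leq_trans (ltnW hil) hjk.
  by rewrite -ltnS; apply: leq_trans hil hm.
have hW : pjholo n S0 p0 (j + k) (fun S p => adW S p (phi S p) N) by apply: pjholo_adW.
apply: (pjholoM (d := j + k)) => //; apply: pjholoX; apply: pjholoD; try exact: pjholo_cst;
apply: pjholoM hW; apply: pjholoC; [exact: jholo_p3|exact: jholo_q3].
Qed.

Lemma jholo_Icoef j k : (j + k <= n)%N -> jh (Icoef j k).
Proof.
move=> h; have := jholoM (jholo_cst n S0 p0 (j`!%:R * k`!%:R)) (jholo_fcI h); apply: jholo_eq.
apply: nearj_all => S p _.
Local Transparent fc.
by rewrite /fc mulrC divfK // mulf_neq0 // fact_neq0.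
Qed.
Local Opaque fc.
End FrameHolo.

Definition germ_invariant (f : graphed R -> 'cV[C]_3 -> C) : Prop :=
  forall g S p S' p', A3 g -> branch S p -> branch S' p' -> germ_map g S p S' p' -> f S' p' = f S p.

(** An affine equivalence turns a normal form of one germ into one of the other, and
    normal forms are unique. *)
Lemma Icoef_invariant j k : germ_invariant (Icoef j k).
Proof.
move=> g S p S' p' hg hb hb' hm.
by have [_ ->] := normE hb (germ_normal4 hg hm (normP hb')).
Qed.

(** The value at a jet does not depend on the surface having it, since near that jet f
    is a function of the jet. *)
Lemma diff_invariantP n f : (forall S p, branch S p -> jholo n S p f) -> germ_invariant f ->
  is_diff_invariant f.
Proof.
move=> hf hi.
pose Q z (y : graphed R * 'cV[C]_3) := branch y.1 y.2 /\ jet n y.1 y.2 = z.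
(* Away from the jets of the branch the value does not matter. *)
pose J z := match pselect (exists y, Q z y) with
  | left h => let y := projT1 (cid h) in f y.1 y.2 | right _ => 0 end.
have JE S p : branch S p -> J (jet n S p) = f S p.
  move=> hb; rewrite /J; case: pselect => [h|[]]; last by exists (S, p).
  case: (cid h) => -[S' p'] /= [hb' hj]; have [fh _ hn] := hf _ _ hb.
  by rewrite (nearj_base hn hb') // (nearj_base hn hb) // hj.
exists n, J; split; last by move=> S p h1 h2; rewrite JE.
split=> // [z [S [p [h1 h2 ->]]]|g S p S' p' hg h1 h1' h2 h2' hm _].
  have [fh hh hn] := hf S p (conj h1 h2); exists fh => //.
  move: hn; apply: filterS => z' hz hb'; split=> //.
  by have [S' [p' [k1 k2 e]]] := hb'; rewrite e JE // hz // e.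
split; first by exists S', p'.
by rewrite !JE //; apply: (hi g).
Qed.

End JetHolo.

(** * First order expansions *)
Section FirstOrder.
Variable R : realType.
Notation C := (Cx R).
Notation BP := {poly {poly C}}.
Local Notation pnt := Defs.point.
Local Opaque partial holomorphic_at taylor_at hessian partials jeq.
Local Opaque bC bX bY bc bev cut fc.
Local Notation xx := (bX R).
Local Notation yy := (bY R).

Definition dc (i : 'I_2) (P : BP) : C := if i == 0 then bc P 1 0 else bc P 0 1.
(** The value and the i-th partial derivative at the origin. Being defined by jets, the
    notion satisfies the rules of differentiation at once. *)
Definition dd (i : 'I_2) (f : 'cV[C]_2 -> C) (a b : C) : Prop :=
  exists P, [/\ jeq 2 f P, bc P 0 0 = a & dc i P = b].

Section Calculus.
Variable i : 'I_2.

Lemma dcD P Q : dc i (P + Q) = dc i P + dc i Q.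
Proof. by rewrite /dc !bcD; case: ifP. Qed.
Lemma dcN P : dc i (- P) = - dc i P.
Proof. by rewrite /dc !bcN; case: ifP. Qed.
Lemma dcC c : dc i (bC c) = 0.
Proof. by rewrite /dc !bc_CE /=; case: ifP. Qed.
Lemma bcM00 (P Q : BP) : bc (P * Q) 0 0 = bc P 0 0 * bc Q 0 0.
Proof. by rewrite bcM !big_ord_recl !big_ord0 !addr0. Qed.
Lemma dcM P Q : dc i (P * Q) = dc i P * bc Q 0 0 + bc P 0 0 * dc i Q.
Proof.
rewrite /dc !bcM; case: ifP => _; rewrite !big_ord_recl !big_ord0 /= /bump /= ?addr0;
by rewrite ?subnn ?subn0 addrC.
Qed.
Lemma dc_sum I (s : seq I) (Pr : pred I) (F : I -> BP) :
  dc i (\sum_(j <- s | Pr j) F j) = \sum_(j <- s | Pr j) dc i (F j).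
Proof. by rewrite /dc !bc_sum; case: ifP. Qed.

Lemma ddD f g a b a' b' : dd i f a b -> dd i g a' b' -> dd i (fun h => f h + g h) (a + a') (b + b').
Proof.
move=> [P [h1 <- <-]] [Q [h1' <- <-]]; exists (P + Q); split; [exact: jeqD|exact: bcD|exact: dcD].
Qed.
Lemma ddM f g a b a' b' : dd i f a b -> dd i g a' b' ->
  dd i (fun h => f h * g h) (a * a') (b * a' + a * b').
Proof.
move=> [P [h1 <- <-]] [Q [h1' <- <-]]; exists (P * Q); split; [exact: jeqM|exact: bcM00|exact: dcM].
Qed.
Lemma dd_cst c : dd i (fun=> c) c 0.
Proof. by exists (bC c); split; [exact: jeqC|rewrite bc_CE|exact: dcC]. Qed.
Lemma ddN f a b : dd i f a b -> dd i (fun h => - f h) (- a) (- b).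
Proof. by move=> [P [h1 <- <-]]; exists (- P); split; [exact: jeqN|exact: bcN|exact: dcN]. Qed.
Lemma ddZ c f a b : dd i f a b -> dd i (fun h => c * f h) (c * a) (c * b).
Proof. by move=> h; have := ddM (dd_cst c) h; rewrite mul0r add0r. Qed.
Lemma dd_sum I (s : seq I) (Pr : pred I) (F : I -> 'cV[C]_2 -> C) a b :
  (forall j, dd i (F j) (a j) (b j)) ->
  dd i (fun h => \sum_(j <- s | Pr j) F j h) (\sum_(j <- s | Pr j) a j) (\sum_(j <- s | Pr j) b j).
Proof.
move=> /choice[P hP]; exists (\sum_(j <- s | Pr j) P j); split.
- by apply: jeq_sum => j; case: (hP j).
- by rewrite bc_sum; apply: eq_bigr => j _; case: (hP j).
- by rewrite dc_sum; apply: eq_bigr => j _; case: (hP j).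
Qed.
Lemma dd_eq f g a b : (\forall h \near (0 : 'cV[C]_2), f h = g h) -> dd i f a b -> dd i g a b.
Proof. by move=> e [P [h1 h2 h3]]; exists P; split=> //; apply: jeq_eq h1. Qed.
Lemma dd_unique f a b a' b' : dd i f a b -> dd i f a' b' -> a = a' /\ b = b'.
Proof.
move=> [P [h1 <- <-]] [Q [h1' <- <-]]; have e := jet_unique h1 h1'.
by split; [apply: e|rewrite /dc; case: ifP => _; apply: e].
Qed.
Lemma dd_lip f a b : dd i f a b -> exists L r : R, [/\ 0 < r, 0 < L &
  forall rho h, 0 <= rho -> rho <= r -> inbox rho h -> nrm (f h - a) <= L * rho].
Proof.
move=> [P [h1 h2 _]]; apply: (jeq_lin (isT : (0 < 2)%N) (jeqB h1 (jeqC 2 a))).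
by rewrite bcB bc_CE /= h2 subrr.
Qed.

Lemma dd_near f a b (Q : C -> Prop) : dd i f a b -> nbhs a Q -> \forall h \near (0 : 'cV[C]_2), Q (f h).
Proof.
move=> /dd_lip[L [r [r0 L0 h]]] /nbhsC[e e0 he].
apply: (@inbox_nbhs R 2 0 (Num.min r (e / (2 * L)))); first by rewrite lt_min r0 divr_gt0 ?mulr_gt0.
move=> k hk; rewrite add0r; apply: he.
have m0 : 0 <= Num.min r (e / (2 * L)) by rewrite le_min ltW // divr_ge0 ?ltW // mulr_gt0.
apply: le_lt_trans (h _ _ m0 _ hk) _; first by rewrite ge_min lexx.
apply: (@le_lt_trans _ _ (L * (e / (2 * L)))); first by rewrite ler_wpM2l ?(ltW L0) // ge_min lexx orbT.
have -> : L * (e / (2 * L)) = e / 2 by field; rewrite gt_eqF.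
by rewrite ltr_pdivrMr // mulr2n mulrDr mulr1 ltrDl.
Qed.

Lemma dd_partial f a b : dd i f a b -> f 0 = a -> partial i f 0 = b.
Proof.
move=> [P [h1 h2 h3]] f0.
Local Transparent jeq partial.
have [B Bb] := bc_bound P.
pose Q := P - bC (bc P 0 0) - bC (bc P 1 0) * xx - bC (bc P 0 1) * yy.
have hQ : jeq 2 (fun h => f h - a - bc P 1 0 * h 0 0 - bc P 0 1 * h 1 0) 0.
  apply: (@jeq_mod _ 2 _ Q).
    move=> j k hjk; have -> : bc (0 : BP) j k = 0 by exact: bc0.
    rewrite /Q !bcB !bc_C !bc_CE bc_bX1 bc_bY1.
    by move: j k hjk => [|[|j]] [|[|k]] //= _; ring.
  rewrite -h2; apply: jeqB; last first.
    have := jeq_ev 2 (bC (bc P 0 1) * yy).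
    by under [X in jeq _ X]eq_fun do rewrite bevM bev_bC bev_bY.
  apply: jeqB; last first.
    have := jeq_ev 2 (bC (bc P 1 0) * xx).
    by under [X in jeq _ X]eq_fun do rewrite bevM bev_bC bev_bX.
  by apply: jeqB h1 _; apply: jeqC.
have [K [r [r0 K0 H]]] := hQ.
apply: (quad_derive r0 (K := K)) => t ht; rewrite add0r f0.
have := H (nrm t) (t *: delta_mx i 0) (nrm_ge0 t) ht.
have -> : bev 0 ((t *: delta_mx i 0 : 'cV[C]_2) 0 0) ((t *: delta_mx i 0 : 'cV[C]_2) 1 0) = 0 :> C.
  Local Transparent bev.
  by rewrite /bev !horner0.
rewrite subr0 => h; have {}h := h _.
have -> : f (t *: delta_mx i 0) - a - t * b = f (t *: delta_mx i 0) - a -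
  bc P 1 0 * (t *: delta_mx i 0 : 'cV[C]_2) 0 0 - bc P 0 1 * (t *: delta_mx i 0 : 'cV[C]_2) 1 0.
  rewrite -h3 /dc !mxE; case: (ord2P i) => -> /=; rewrite ?mulr1n ?mulr0n; ring.
apply: h => j; rewrite !mxE nrmM; case: eqP => _; rewrite ?nrm1 ?nrm0 ?mulr1 ?mulr0 //; exact: nrm_ge0.
Qed.
Local Opaque jeq partial bev.

Lemma dd_taylor f G : taylor_at f 0 (Defs.double G) -> dd i f (G 0 0)%N (if i == 0 then G 1%N 0%N else G 0%N 1%N).
Proof.
move=> hf; exists (bpoly 2 (fc G)); split.
- have := jeq_taylor 2 hf; rewrite (_ : (fun h => f (0 + h)) = f) //.
  by apply/funext => h; rewrite add0r.
- by rewrite bc_bpoly_lt // fc00.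
- by rewrite /dc !bc_bpoly_lt // fc10 fc01.
Qed.

Lemma taylor_shift (f : 'cV[C]_2 -> C) a G j k : taylor_at f a (Defs.double G) ->
  taylor_at (partials f j k) a (Defs.double (fun x y => G (x + j) (y + k))%N).
Proof.
move=> /(taylor_partials j k) h; congr (taylor_at _ _ _): h.
by apply/funext => m; rewrite /Defs.double !ffunE.
Qed.

Lemma dd_partials f G j k : taylor_at f 0 (Defs.double G) ->
  dd i (partials f j k) (G j k) (if i == 0 then G j.+1 k else G j k.+1).
Proof. by move=> /(taylor_shift j k)/dd_taylor; rewrite !add0n !add1n. Qed.

Lemma dd_coord l : dd i (fun h => h l 0) 0 (i == l)%:R.
Proof.
exists (if l == 0 then xx else yy); split.
- case: (ord2P l) => -> /=.
    by have := jeq_ev 2 xx; under [X in jeq _ X]eq_fun do rewrite bev_bX.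
  by have := jeq_ev 2 yy; under [X in jeq _ X]eq_fun do rewrite bev_bY.
- by case: ifP => _; rewrite ?bc_bX1 ?bc_bY1.
- by rewrite /dc; case: (ord2P l) => ->; case: (ord2P i) => -> /=; rewrite ?bc_bX1 ?bc_bY1.
Qed.

Lemma frechet_partial n (f : 'cV[C]_n -> C) a : holomorphic_at f a ->
  exists (K r : R), [/\ 0 < r, 0 <= K & forall rho h, 0 <= rho -> rho <= r -> inbox rho h ->
    nrm (f (a + h) - f a - \sum_m partial m f a * h m 0) <= K * rho ^+ 2].
Proof.
move=> /holo_frechet[l [K [r [r0 K0 h]]]]; exists K, r; split=> // rho k rho0 hr hk.
rewrite (eq_bigr (fun m => l m * k m 0)); first exact: h.
move=> m _; congr (_ * _).
Local Transparent partial.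
apply: (quad_derive r0 (K := K)) => t ht.
have := h (nrm t) (t *: delta_mx m 0) (nrm_ge0 t) ht.
rewrite (bigD1 m) //= big1 ?addr0; last first.
  by move=> j jm; rewrite !mxE eqxx andbT (negPf jm) !mulr0.
rewrite !mxE !eqxx mulr1 mulrC; apply => j; rewrite !mxE nrmM.
by case: eqP => _ /=; rewrite ?eqxx ?nrm1 ?nrm0 ?mulr1 ?mulr0 //; exact: nrm_ge0.
Qed.
Local Opaque partial.

(** The chain rule; the error terms of the outer function are quadratic. *)
Lemma dd_comp n (fh : 'cV[C]_n -> C) (z0 : 'cV[C]_n) (z : 'cV[C]_2 -> 'cV[C]_n) (b : 'I_n -> C) :
  holomorphic_at fh z0 -> (forall m, dd i (fun h => z h m 0) (z0 m 0) (b m)) ->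
  dd i (fun h => fh (z h)) (fh z0) (\sum_m partial m fh z0 * b m).
Proof.
move=> /frechet_partial[K [r [r0 K0 H]]] hz.
pose T h := fh z0 + \sum_m partial m fh z0 * (z h m 0 - z0 m 0).
have hT : dd i T (fh z0) (\sum_m partial m fh z0 * b m).
  have := ddD (dd_cst (fh z0)) (@dd_sum _ (index_enum 'I_n) xpredT
     (fun m h => partial m fh z0 * (z h m 0 - z0 m 0)) _ _
     (fun m => ddZ (partial m fh z0) (ddD (hz m) (ddN (dd_cst (z0 m 0)))))).
  rewrite add0r; under eq_bigr do rewrite subrr mulr0.
  by rewrite big1 // addr0; under [X in dd _ _ _ X]eq_bigr do rewrite subr0.
have [P [h1 h2 h3]] := hT; exists P; split=> //.
have hL m := dd_lip (hz m).
have /choice[L /choice[s hs]] := hL.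
have [e e0 he] := @fin_pos R n s (fun m => let: And3 h _ _ := hs m in h).
pose LL := 1 + \sum_m L m.
have L0 : 0 < LL by rewrite ltr_wpDr // sumr_ge0 // => m _; case: (hs m) => _ /ltW.
have LLm m : L m <= LL.
  rewrite /LL (bigD1 m) //= addrCA lerDl addr_ge0 // sumr_ge0 // => j _; by case: (hs j) => _ /ltW.
have e1 : (fun h => T h + (fh (z h) - T h)) = fun h => fh (z h).
  by apply/funext => h; rewrite addrC subrK.
rewrite -e1 -[P]addr0; apply: jeqD h1 _.
Local Transparent jeq bev.
exists (K * LL ^+ 2), (Num.min e (r / LL)); split=> [||rho h rho0].
- by rewrite lt_min e0 divr_gt0.
- by rewrite mulr_ge0 // exprn_ge0 // ltW.
rewrite le_min => /andP[re rr] hh; rewrite /bev !horner0 subr0.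
have hin : inbox (LL * rho) (z h - z0).
  move=> m; rewrite !mxE; have [_ _ Hm] := hs m.
  by apply: le_trans (Hm rho h rho0 (le_trans re (he m)) hh) _; rewrite ler_wpM2r.
have LLrho : LL * rho <= r by rewrite mulrC -ler_pdivlMr.
have := H (LL * rho) (z h - z0) (mulr_ge0 (ltW L0) rho0) LLrho hin.
have -> : z0 + (z h - z0) = z h by rewrite addrC subrK.
rewrite /T opprD addrA exprMn mulrA; under eq_bigr do rewrite !mxE.
by [].
Qed.
Local Opaque jeq bev.
End Calculus.

Lemma partial1_partials (F : 'cV[C]_2 -> C) a j k : holomorphic_at F a ->
  partial 1 (partials F j k) a = partials F j k.+1 a.
Proof.
move=> /taylor_of_partials h.
have := partials_taylor 0 1 (taylor_shift j k h); rewrite add0n add1n => <-.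
Local Transparent partials.
by [].
Qed.
Local Opaque partials.

Definition jet_dir n (S : graphed R) (p : 'cV[C]_3) (e : 'cV[C]_2) : 'cV[C]_(2 + #|jet_index n|) :=
  col_mx e (\col_i let jk := val (enum_val i : jet_index n) in
     partials (fn S) jk.1.+1 jk.2 (coord_xy p) * e 0 0 + partials (fn S) jk.1 jk.2.+1 (coord_xy p) * e 1 0).

Lemma jet_curve n i (S : graphed R) p (w : 'cV[C]_2 -> 'cV[C]_3) (e : 'cV[C]_2) :
  holomorphic_at (fn S) (coord_xy p) ->
  (forall l, dd i (fun h => coord_xy (w h) l 0) (coord_xy p l 0) (e l 0)) ->
  forall m, dd i (fun h => jet n S (w h) m 0) (jet n S p m 0) (jet_dir n S p e m 0).
Proof.
move=> hol hw m; case: (split_ordP m) => l ->.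
  rewrite /jet /jet_dir !col_mxEu; under [X in dd _ X]eq_fun do rewrite col_mxEu.
  exact: hw.
rewrite /jet /jet_dir !col_mxEd; under [X in dd _ X]eq_fun do rewrite col_mxEd mxE.
rewrite !mxE; move: (val (enum_val l : jet_index n)) => [j k] /=.
have := dd_comp (holo_partials j k hol) hw; rewrite sum2 partial1_partials //.
Qed.

Lemma near_vec n i (z : 'cV[C]_2 -> 'cV[C]_n) (z0 : 'cV[C]_n) b (Q : 'cV[C]_n -> Prop) :
  (forall m, dd i (fun h => z h m 0) (z0 m 0) (b m)) -> nbhs z0 Q ->
  \forall h \near (0 : 'cV[C]_2), Q (z h).
Proof.
move=> hz /nbhsV[e e0 he].
have hm m : exists r : R, 0 < r /\ forall k, inbox r k -> nrm (z k m 0 - z0 m 0) < e.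
  have hn : nbhs (z0 m 0) (fun x => nrm (x - z0 m 0) < e) by apply/nbhsC; exists e.
  have [r r0 hr] := nbhs_inbox (dd_near (hz m) hn); exists r; split=> // k hk.
  by have := hr k hk; rewrite add0r.
have /choice[r hr] := hm.
have [s s0 hs] := fin_pos (fun m => (hr m).1).
apply: (inbox_nbhs s0) => h hh; rewrite add0r; apply: he => m; apply: (hr m).2.
by move=> j; apply: le_trans (hh j) (hs m).
Qed.

Lemma dd_jholo n i f fh (S : graphed R) p w (e : 'cV[C]_2) : branch S p -> holomorphic_at fh (jet n S p) ->
  nearj n S p (fun S p => f S p = fh (jet n S p)) ->
  (forall l, dd i (fun h => coord_xy (w h) l 0) (coord_xy p l 0) (e l 0)) ->
  (\forall h \near (0 : 'cV[C]_2), graph S (w h)) ->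
  dd i (fun h => f S (w h)) (f S p) (\sum_m partial m fh (jet n S p) * jet_dir n S p e m 0).
Proof.
move=> hb hfh hn hw hg.
have hol : holomorphic_at (fn S) (coord_xy p).
  by have [hd _] := branch_graph hb; apply: surface_holo (branch_surface hb) hd.
have hj := jet_curve hol hw.
rewrite (jholo_base hb hn); apply: dd_eq (dd_comp hfh (hj n)).
have := near_vec (hj n) hn; apply: filterS2 hg => h hgh H.
by have e1 := H S (w h) (conj hb.1 hgh) erefl; rewrite e1.
Qed.

End FirstOrder.

(** * Invariant derivatives along a normalized surface *)
Section InvDeriv.
Variable R : realType.
Notation C := (Cx R).
Notation BP := {poly {poly C}}.
Local Notation pnt := Defs.point.
Local Opaque partial holomorphic_at taylor_at hessian partials jeq.
Local Opaque bC bX bY bc bev cut fc.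

Lemma germ_comp g1 g2 (S1 S2 S3 : graphed R) p1 p2 p3 : germ_map g1 S1 p1 S2 p2 ->
  germ_map g2 S2 p2 S3 p3 -> germ_map (affc g1 g2) S1 p1 S3 p3.
Proof.
move=> [e1 h1] [e2 h2]; split; first by rewrite aff_comp e1.
rewrite -e1 in h2; have := aff_near h2; apply: filterS2 h1 => w h1 h3.
by rewrite aff_comp h1.
Qed.

Lemma jet_proj n m : (n <= m)%N -> exists s : 'I_(2 + #|jet_index n|) -> 'I_(2 + #|jet_index m|),
  forall i (S : graphed R) p, jet n S p i 0 = jet m S p (s i) 0.
Proof.
move=> nm.
have H i : exists k, forall (S : graphed R) p, jet n S p i 0 = jet m S p k 0.
  have [[l hl]|[j [k [hjk hl]]]] := jet_caseP R i.
    by have [t ht] := jet_coord R m l; exists t => S p; rewrite hl ht.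
  have [t ht] := jet_partial R (leq_trans hjk nm).
  by exists t => S p; rewrite hl ht.
by have [s hs] := choice H; exists s.
Qed.

Section Projection.
Variables (n m : nat) (nm : (n <= m)%N) (S0 : graphed R) (p0 : 'cV[C]_3).

Lemma nearj_mono P : nearj n S0 p0 P -> nearj m S0 p0 P.
Proof.
have [s hs] := jet_proj nm => /nbhsV[e e0 h]; apply/nbhsV; exists e => // z hz S p hb hj.
by apply: (h (jet n S p)) => // i; rewrite !hs hj.
Qed.

Lemma jholo_mono f : jholo n S0 p0 f -> jholo m S0 p0 f.
Proof.
have [s hs] := jet_proj nm; move=> [fh h1 /nearj_mono h2].
pose lq := [tuple mpolyX C (mnm1 (s i)) | i < 2 + #|jet_index n|].
have E S p : polymap lq (jet m S p) = jet n S p.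
  by apply/matrixP => i j; rewrite ord1 mxE tnth_mktuple /ev mevalXU hs.
exists (fun z => fh (polymap lq z)); first by apply: holo_polymap; rewrite E.
by apply: nearjS h2 => S p _; rewrite E.
Qed.
End Projection.

Lemma normal_surface_ex (S : graphed R) p : branch S p ->
  exists S', [/\ branch S' 0, germ_map (phi S p) S p S' 0 &
    taylor_at (fn S') 0 (Defs.double (fun j k => Icoef j k S p))].
Proof.
move=> hb; have hn := normP hb; have [hg lo] := normal4_low hn.
have [[[_ [_ [e20 e11 e02] _]] _ _] _] := hn.
have [] := @normal_surface R S p (phi S p) (fun j k => Icoef j k S p) hb.1 hb.2 hg.
- exact: lo.
- by rewrite e20 e11 mul0r sub0r oppr_eq0 expr1n oner_neq0.
by move=> S' [h1 h2 h3 h4]; exists S'.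
Qed.

Section Normal.
Variables (S S' : graphed R) (p : 'cV[C]_3).
Hypotheses (hb : branch S p) (hb' : branch S' 0) (hm : germ_map (phi S p) S p S' 0).
Hypothesis ht : taylor_at (fn S') 0 (Defs.double (fun j k => Icoef j k S p)).
Local Notation g := (phi S p).
(** The parametrization of S near p by the normalized graph. *)
Definition curve (h : 'cV[C]_2) : 'cV[C]_3 := aff (affi (phi S p)) (pnt h (fn S' h)).

Let hg : A3 g. Proof. by have [[hg _ _] _] := normal4_low (normP hb). Qed.

Lemma normal_fn_near : \forall h \near (0 : 'cV[C]_2), normal_fn S p h = fn S' h.
Proof.
Local Transparent taylor_at.
have [r [M [r0 [_ h]]]] := ht; have [e e0 re] := pos_real r0.
apply: (@inbox_nbhs R 2 0 (e / 2)); first by rewrite divr_gt0.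
move=> k hk; rewrite add0r /normal_fn.
have hk' i : `|k i 0| < r.
  rewrite re nrm_ltP; apply: le_lt_trans (hk i) _.
  by rewrite ltr_pdivrMr // ltr_pMr //; lra.
have := h k hk'; rewrite add0r => hc; apply: cvg_lim hc.
exact: norm_hausdorff.
Qed.
Local Opaque taylor_at.

Lemma point00 : pnt 0 (fn S' 0) = 0.
Proof.
have := graph_point (branch_graph hb').
have -> : coord_xy (0 : 'cV[C]_3) = 0; last by move=> ->.
by apply/matrixP => i j; rewrite ord1 [RHS]mxE; case: (ord2P i) => ->; rewrite ?xy0 ?xy1 mxE.
Qed.

Lemma holo_fn' : holomorphic_at (fn S') 0.
Proof. by exists (Defs.double (fun j k => Icoef j k S p)). Qed.

Lemma curve_near P : nbhs p P -> \forall h \near (0 : 'cV[C]_2), P (curve h).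
Proof.
move=> hP; have [gp _] := hm.
have hP' : nbhs (aff (affi g) 0) P by rewrite -gp affK.
have := aff_near hP'; rewrite -point00 => h.
exact: point_near holo_fn' h.
Qed.

Lemma curve_germ : \forall h \near (0 : 'cV[C]_2),
  [/\ graph S (curve h), graph S' (pnt h (fn S' h)) & germ_map g S (curve h) S' (pnt h (fn S' h))].
Proof.
have hd : \forall h \near (0 : 'cV[C]_2), dom S' h.
  have [op _ _ _ _] := branch_surface hb'; apply: open_nbhs_nbhs; split=> //.
  have [] := branch_graph hb'.
  suff -> : coord_xy (0 : 'cV[C]_3) = 0 by [].
  by apply/matrixP => i j; rewrite ord1 [RHS]mxE; case: (ord2P i) => ->; rewrite ?xy0 ?xy1 mxE.
have := curve_near (near_near hm.2); apply: filterS2 hd => h hd hn.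
have g' : graph S' (pnt h (fn S' h)) by apply: graph_pt.
have gc : aff g (curve h) = pnt h (fn S' h) by rewrite affVK.
have [_ h2] := nbhs_singleton hn.
by split; [apply: h2; rewrite gc|exact: g'|split; [exact: gc|exact: hn]].
Qed.

(** The invariance of f transfers its values from S to the normalized surface, where the
    invariant derivative is an ordinary partial derivative. *)
Lemma inv_deriv_dd i f b : germ_invariant f ->
  dd i (fun h => f S' (pnt h (fn S' h))) (f S p) b ->
  inv_deriv i S (f S) p = b.
Proof.
move=> hi hdd; rewrite /inv_deriv; apply: (dd_partial (a := f S p)).
  apply: dd_eq hdd; have := normal_fn_near; apply: filterS2 curve_germ => h [h1 h2 h3] ->.
  by rewrite affiE -/(curve h); apply: (hi g) => //; split=> //; [case: hb|case: hb'].
by rewrite (nbhs_singleton normal_fn_near) affiE point00 -(proj1 hm) affK.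
Qed.

Lemma inv_deriv_dd' i f b : germ_invariant f ->
  dd i (fun h => f S (curve h)) (f S p) b -> inv_deriv i S (f S) p = b.
Proof.
move=> hi hdd; apply: inv_deriv_dd => //; apply: dd_eq hdd.
apply: filterS curve_germ => h [h1 h2 h3].
by apply/esym; apply: (hi g) => //; split=> //; [case: hb|case: hb'].
Qed.

(** The columns of the adapted plane are the directions, in the plane of x and y, in
    which the invariant derivatives differentiate. *)
Lemma dd_curve i l : dd i (fun h => coord_xy (curve h) l 0) (coord_xy p l 0) (adA g l i).
Proof.
have [[[_ [[e00 e10 e01] _ _]] _ _] _] := normP hb.
pose K := invmx g.1; pose l' := emb l.
have hf : dd i (fn S') 0 0.
  by have := dd_taylor i ht; rewrite /= e00 e10 e01 if_same.
have cE h : coord_xy (curve h) l 0 =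
    K l' 0 * h 0 0 + K l' 1 * h 1 0 + K l' ord_max * fn S' h + (affi g).2 l' 0.
  have : curve h l' 0 = K l' 0 * h 0 0 + K l' 1 * h 1 0 + K l' ord_max * fn S' h + (affi g).2 l' 0.
    by rewrite /curve affE point0 point1 point2.
  by rewrite /l'; case: (ord2P l) => ->; rewrite ?xy0 ?xy1.
have pE : coord_xy p l 0 = K l' 0 * 0 + K l' 1 * 0 + K l' ord_max * 0 + (affi g).2 l' 0.
  have := cE 0; rewrite /curve point00 -(proj1 hm) affK // => ->; rewrite !mxE.
  have [_ f0] := branch_graph hb'; move: f0; rewrite /coord_u mxE.
  have -> : coord_xy (0 : 'cV[C]_3) = 0.
    by apply/matrixP => i' j; rewrite ord1 [RHS]mxE; case: (ord2P i') => ->; rewrite ?xy0 ?xy1 mxE.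
  by move=> <-.
rewrite pE.
have -> : adA g l i = K l' 0 * (i == 0)%:R + K l' 1 * (i == 1)%:R + K l' ord_max * 0 + 0.
  rewrite mxE -/K -/l'; case: (ord2P i) => -> /=; rewrite ?mulr1n ?mulr0n; ring.
have h0 : dd i (fun h : 'cV[C]_2 => h 0 0) 0 (i == 0)%:R by exact: dd_coord.
have h1 : dd i (fun h : 'cV[C]_2 => h 1 0) 0 (i == 1)%:R by exact: dd_coord.
under [X in dd _ X]eq_fun do rewrite cE.
exact: (ddD (ddD (ddD (ddZ _ h0) (ddZ _ h1)) (ddZ _ hf)) (dd_cst _ _)).
Qed.

(** The chain rule along the curve of jets. *)
Lemma inv_deriv_jholo n i f fh : germ_invariant f -> holomorphic_at fh (jet n S p) ->
  nearj n S p (fun S p => f S p = fh (jet n S p)) ->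
  inv_deriv i S (f S) p =
    \sum_m partial m fh (jet n S p) * jet_dir n S p (\col_l adA g l i) m 0.
Proof.
move=> hi hfh hn; apply: inv_deriv_dd' => //; apply: dd_jholo => //.
  by move=> l; rewrite mxE; apply: dd_curve.
by apply: filterS curve_germ => h [].
Qed.
End Normal.

Lemma inv_deriv_invariant n i f : germ_invariant f -> (forall (S : graphed R) p, branch S p -> jholo n S p f) ->
  germ_invariant (fun S => inv_deriv i S (f S)).
Proof.
move=> hi hj g S p S2 p2 hg hb hb2 hm.
have [S' [hb' hm' ht']] := normal_surface_ex hb2.
have [fh h1 h2] := hj _ _ hb'.
have hdd : exists b, dd i (fun h => f S' (pnt h (fn S' h))) (f S' 0) b.
  have := dd_jholo (w := fun h => pnt h (fn S' h)) (e := delta_mx i 0) hb' h1 h2.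
  move=> H; eexists; apply: H.
    move=> l; under [X in dd _ X]eq_fun do rewrite coord_xy_point.
    have -> : coord_xy (0 : 'cV[C]_3) l 0 = 0 by case: (ord2P l) => ->; rewrite ?xy0 ?xy1 mxE.
    by rewrite mxE eqxx andbT eq_sym; apply: dd_coord.
  by have := curve_germ hb2 hb' hm' ht'; apply: filterS => h [].
have [b hdd'] := hdd.
have [hphi hI] := normE hb (germ_normal4 hg hm (normP hb2)).
have [[hg2 _ _] _] := normal4_low (normP hb2).
have e2 : f S' 0 = f S2 p2 by apply: (hi _ _ _ _ _ hg2 hb2 hb' hm').
have e1 : f S2 p2 = f S p by apply: (hi _ _ _ _ _ hg hb hb2 hm).
rewrite (inv_deriv_dd hb2 hb' hm' ht' (i := i) (b := b)) -?e2 //.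
rewrite (@inv_deriv_dd S S' p hb hb' _ _ i f b hi) -?e1 -?e2 //.
  by rewrite hphi; apply: germ_comp hm hm'.
congr (taylor_at _ _ _): ht'; apply/funext => m.
by rewrite /Defs.double hI.
Qed.

(** The derivative of the jet of order n involves the jet of order n + 1 and the adapted
    plane, both of which are holomorphic functions of the jet. *)
Lemma jholo_inv_deriv n i f : (4 <= n)%N -> germ_invariant f ->
  (forall (S : graphed R) p, branch S p -> jholo n S p f) ->
  forall (S : graphed R) p, branch S p -> jholo n.+1 S p (fun S => inv_deriv i S (f S)).
Proof.
move=> n4 hi hj S0 p0 hb0; have [fh h1 h2] := hj _ _ hb0.
have hn : nearj n S0 p0 (fun S p => holomorphic_at fh (jet n S p) /\
    nearj n S p (fun S p => f S p = fh (jet n S p))).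
  have := near_near h2; apply: filterS2 (holo_open h1) => z hz hz' S p _ e.
  by rewrite /nearj e.
have hn' := nearj_mono (leqnSn n) hn.
pose T (S : graphed R) p := \sum_m partial m fh (jet n S p) *
   jet_dir n S p (\col_l adA (phi S p) l i) m 0.
apply: (@jholo_eq _ _ _ _ T).
  apply: nearjS hn' => S p hb [k1 k2].
  have [S' [hb' hm' ht']] := normal_surface_ex hb.
  by rewrite (inv_deriv_jholo hb hb' hm' ht' i hi k1 k2).
apply: jholo_sum => m _; apply: jholoM.
  apply: (jholo_mono (leqnSn n)); exists (partial m fh); first exact: holo_partial.
  exact: nearj_all.
have hA := jholo_adA hb0 (leqW n4).
case: (split_ordP m) => l ->.
  apply: jholo_eq (hA l i); apply: nearj_all => S p _.
  by rewrite /jet_dir col_mxEu mxE.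
have hjk : ((val (enum_val l : jet_index n)).1 + (val (enum_val l : jet_index n)).2 <= n)%N.
  by case: (enum_val l).
apply: (@jholo_eq _ _ _ _ (fun S p =>
  partials (fn S) (val (enum_val l : jet_index n)).1.+1 (val (enum_val l : jet_index n)).2 (coord_xy p) * adA (phi S p) 0 i
  + partials (fn S) (val (enum_val l : jet_index n)).1 (val (enum_val l : jet_index n)).2.+1 (coord_xy p) * adA (phi S p) 1 i)).
  by apply: nearj_all => S p _; rewrite /jet_dir col_mxEd !mxE.
by apply: jholoD; apply: jholoM; first [exact: hA | apply: jholo_partial; rewrite ?addnS ?addSn ltnS].
Qed.

Definition jinv (f : graphed R -> 'cV[C]_3 -> C) : Prop :=
  germ_invariant f /\ exists n, (4 <= n)%N /\ forall (S : graphed R) p, branch S p -> jholo n S p f.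

Lemma jinv_Icoef j k : jinv (Icoef j k).
Proof.
split; first exact: Icoef_invariant.
exists (4 + (j + k))%N; split; first by rewrite leq_addr.
by move=> S p hb; apply: jholo_Icoef; rewrite ?leq_addr ?leq_addl.
Qed.

Lemma jinv_deriv i f : jinv f -> jinv (fun S => inv_deriv i S (f S)).
Proof.
move=> [h1 [n [n4 h2]]]; split; first exact: inv_deriv_invariant h2.
by exists n.+1; split; [exact: leqW|exact: jholo_inv_deriv].
Qed.

Lemma jinv_diff_invariant f : jinv f -> is_diff_invariant f.
Proof. by move=> [h1 [n [_ h2]]]; apply: diff_invariantP h2 h1. Qed.

Lemma jinv_derived s : jinv (@derived_generator R s).
Proof.
case: s => [[i a1] a2].
have h0 : jinv (generator i).
  by rewrite /generator; case: (ord3P i) => ->; rewrite (tnth_nth (Icoef 3 1)) /=; exact: jinv_Icoef.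
have h1 : jinv (fun S => iter a2 (inv_deriv 1 S) (generator i S)).
  by elim: (a2) => [//|a IH] /=; exact: (jinv_deriv 1 IH).
rewrite /derived_generator /=; elim: (a1) => [//|a IH] /=; exact: (jinv_deriv 0 IH).
Qed.

End InvDeriv.

(** * The recurrence for the coefficients *)
Section Recurrence.
Variable R : realType.
Notation C := (Cx R).
Notation BP := {poly {poly C}}.
Local Notation pnt := Defs.point.
Local Opaque partial holomorphic_at taylor_at hessian partials jeq.
Local Opaque bC bX bY bc bev cut fc.
Local Notation xx := (bX R).
Local Notation yy := (bY R).

Lemma fcE (G : nat -> nat -> C) j k : fc G j k = (j`!%:R * k`!%:R)^-1 * G j k.
Proof. Local Transparent fc. by rewrite /fc mulrC. Qed.
Local Opaque fc.

Definition TX N (G : nat -> nat -> C) : BP :=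
  \sum_(j < N) \sum_(k < N) bC (fc G j k) * (bC j%:R * xx ^+ j.-1) * yy ^+ k.
Definition TY N (G : nat -> nat -> C) : BP :=
  \sum_(j < N) \sum_(k < N) bC (fc G j k) * xx ^+ j * (bC k%:R * yy ^+ k.-1).

Lemma mulTX (A : comNzRingType) (c d u v : A) : c * (d * u) * v = c * (d * (u * v)).
Proof. ring. Qed.
Lemma mulTY (A : comNzRingType) (c d u v : A) : c * u * (d * v) = c * (d * (u * v)).
Proof. ring. Qed.
Lemma mulz (A : comNzRingType) (z u v : A) : z = 0 -> z * u * v = 0.
Proof. by move=> ->; rewrite !mul0r. Qed.
Lemma addz (A : comNzRingType) (z u v : A) : z = 0 -> u + z * v = u.
Proof. by move=> ->; rewrite mul0r addr0. Qed.
Lemma mulXS (A : comNzRingType) (c e P v Q : A) : e = 1 ->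
  (c + e) * (P * v) * Q = Q * (P * v) + P * (c * v * Q).
Proof. by move=> ->; ring. Qed.
Lemma mulX0 (A : comNzRingType) (c e P v u Q : A) : e = 1 -> c = 0 ->
  (c + e) * u * Q = Q * u + P * (c * v * Q).
Proof. by move=> -> ->; ring. Qed.

Lemma dropz (A : comNzRingType) (z u v : A) : z = 0 -> 0 + (u + z * v) = u.
Proof. by move=> ->; rewrite mul0r addr0 add0r. Qed.

Lemma lin10 (A : nzRingType) (e z x y : A) : e = 1 -> z = 0 -> e * x + z * y = x.
Proof. by move=> -> ->; rewrite mul1r mul0r addr0. Qed.
Lemma lin01 (A : nzRingType) (e z x y : A) : e = 1 -> z = 0 -> z * x + e * y = y.
Proof. by move=> -> ->; rewrite mul1r mul0r add0r. Qed.

Lemma bc_monoX (c d : C) m n j k : bc (bC c * (bC d * xx ^+ m) * yy ^+ n) j k =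
  c * d * ((j == m) && (k == n))%:R.
Proof. by rewrite mulTX !bc_C bc_XY mulrA. Qed.
Lemma bc_monoY (c d : C) m n j k : bc (bC c * xx ^+ m * (bC d * yy ^+ n)) j k =
  c * d * ((j == m) && (k == n))%:R.
Proof. by rewrite mulTY !bc_C bc_XY mulrA. Qed.

Lemma bc_TX N G j k : (j + k + 1 < N)%N -> bc (TX N G) j k = j.+1%:R * fc G j.+1 k.
Proof.
move=> h; have h1 : (j.+1 < N)%N by lia. have h2 : (k < N)%N by lia.
have E (m n : 'I_N) : bc (bC (fc G m n) * (bC m%:R * xx ^+ m.-1) * yy ^+ n) j k =
    fc G m n * m%:R * ((j == m.-1) && (k == n))%:R.
  exact: bc_monoX.
rewrite bc_sum (bigD1 (Ordinal h1)) //= [X in _ + X]big1 ?addr0; last first.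
  move=> m mj; rewrite bc_sum big1 // => n _; rewrite E.
  case: eqP => [e|]; last by rewrite mulr0.
  have -> : m = 0%N :> nat; last by rewrite mulr0 mul0r.
  by case: m mj e => [[|m] hm] //= /eqP mj e; case: mj; apply: val_inj; rewrite /= e.
rewrite bc_sum (bigD1 (Ordinal h2)) //= [X in _ + X]big1 ?addr0; last first.
  move=> n nk; apply: etrans (E (Ordinal h1) n) _.
  case: (k =P n) => [e|]; last by rewrite andbF mulr0.
  by case/eqP: nk; apply: val_inj.
by apply: etrans (E (Ordinal h1) (Ordinal h2)) _; rewrite /= !eqxx mulr1 mulrC.
Qed.

Lemma bc_TY N G j k : (j + k + 1 < N)%N -> bc (TY N G) j k = k.+1%:R * fc G j k.+1.
Proof.
move=> h; have h1 : (j < N)%N by lia. have h2 : (k.+1 < N)%N by lia.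
have E (m n : 'I_N) : bc (bC (fc G m n) * xx ^+ m * (bC n%:R * yy ^+ n.-1)) j k =
    fc G m n * n%:R * ((j == m) && (k == n.-1))%:R.
  exact: bc_monoY.
rewrite bc_sum (bigD1 (Ordinal h1)) //= [X in _ + X]big1 ?addr0; last first.
  move=> m mj; rewrite bc_sum big1 // => n _; rewrite E.
  case: (j =P m) => [e|]; last by rewrite mulr0.
  by case/eqP: mj; apply: val_inj.
rewrite bc_sum (bigD1 (Ordinal h2)) //= [X in _ + X]big1 ?addr0; last first.
  move=> n nk; apply: etrans (E (Ordinal h1) n) _.
  case: (k =P n.-1) => [e|]; last by rewrite andbF mulr0.
  have -> : n = 0%N :> nat; last by rewrite mulr0 mul0r.
  by case: n nk e => [[|n] hn] //= /eqP nk e; case: nk; apply: val_inj; rewrite /= e.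
by apply: etrans (E (Ordinal h1) (Ordinal h2)) _; rewrite /= !eqxx mulr1 mulrC.
Qed.

(** The coefficients of the products of W, the part of order at least two, with the
    partial derivatives. They appear because p3 and q3 vary in the equation between the
    jets of S and of its normal form. *)
Definition FFx (G : nat -> nat -> C) j k : C := \sum_(a < j.+1) \sum_(b < k.+1)
  fc (cut G) a b * ((j - a).+1%:R * fc G (j - a).+1 (k - b)).
Definition FFy (G : nat -> nat -> C) j k : C := \sum_(a < j.+1) \sum_(b < k.+1)
  fc (cut G) a b * ((k - b).+1%:R * fc G (j - a) (k - b).+1).

Lemma bc_FFx N G T j k : (forall j k, (j + k + 1 < N)%N -> bc T j k = j.+1%:R * fc G j.+1 k) ->
  (j + k < N)%N -> bc (Np N (cut G) xx yy * T) j k = FFx G j k.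
Proof.
move=> hT h; rewrite bcM; apply: eq_bigr => a _; apply: eq_bigr => b _.
have ha := ltn_ord a; have hb := ltn_ord b.
rewrite -bpoly_Np bc_bpoly_lt; last by lia.
have [h2|h2] := leqP 2 (a + b); last by rewrite fcut0 // !mul0r.
by rewrite hT //; lia.
Qed.

Lemma bc_FFy N G T j k : (forall j k, (j + k + 1 < N)%N -> bc T j k = k.+1%:R * fc G j k.+1) ->
  (j + k < N)%N -> bc (Np N (cut G) xx yy * T) j k = FFy G j k.
Proof.
move=> hT h; rewrite bcM; apply: eq_bigr => a _; apply: eq_bigr => b _.
have ha := ltn_ord a; have hb := ltn_ord b.
rewrite -bpoly_Np bc_bpoly_lt; last by lia.
have [h2|h2] := leqP 2 (a + b); last by rewrite fcut0 // !mul0r.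
by rewrite hT //; lia.
Qed.

Definition predk (F : nat -> nat -> C) j k : C := if k is k'.+1 then F j k' else 0.
Definition predj (F : nat -> nat -> C) j k : C := if j is j'.+1 then F j' k else 0.

Lemma bc_linTX N G T a b j k : (forall j k, (j + k + 1 < N)%N -> bc T j k = j.+1%:R * fc G j.+1 k) ->
  (j + k < N)%N -> bc ((bC a * xx + bC b * yy) * T) j k =
  a * (j%:R * fc G j k) + b * predk (fun j k => j.+1%:R * fc G j.+1 k) j k.
Proof.
move=> hT h; rewrite mulrDl bcD -!mulrA !bc_C bc_X bc_Y; congr (_ * _ + _ * _).
  by case: j h => [|j] h; [rewrite mul0r|rewrite hT //; lia].
by case: k h => [|k] h //=; rewrite hT //; lia.
Qed.

Lemma bc_linTY N G T c d j k : (forall j k, (j + k + 1 < N)%N -> bc T j k = k.+1%:R * fc G j k.+1) ->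
  (j + k < N)%N -> bc ((bC c * xx + bC d * yy) * T) j k =
  c * predj (fun j k => k.+1%:R * fc G j k.+1) j k + d * (k%:R * fc G j k).
Proof.
move=> hT h; rewrite mulrDl bcD -!mulrA !bc_C bc_X bc_Y; congr (_ * _ + _ * _).
  by case: j h => [|j] h //=; rewrite hT //; lia.
by case: k h => [|k] h; [rewrite mul0r|rewrite hT //; lia].
Qed.

Section PolyFirstOrder.
Variable i : 'I_2.
Definition pdd d (P : 'cV[C]_2 -> BP) (P0 P1 : BP) : Prop :=
  forall j k, (j + k <= d)%N -> dd i (fun h => bc (P h) j k) (bc P0 j k) (bc P1 j k).

Lemma dd_fun (f g : 'cV[C]_2 -> C) a b : f = g -> dd i f a b -> dd i g a b.
Proof. by move=> ->. Qed.

Lemma pddD d P P0 P1 Q Q0 Q1 : pdd d P P0 P1 -> pdd d Q Q0 Q1 ->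
  pdd d (fun h => P h + Q h) (P0 + Q0) (P1 + Q1).
Proof.
move=> h h' j k hjk; rewrite !bcD; apply: dd_fun (ddD (h _ _ hjk) (h' _ _ hjk)).
by apply/funext => x; rewrite bcD.
Qed.
Lemma pddM d P P0 P1 Q Q0 Q1 : pdd d P P0 P1 -> pdd d Q Q0 Q1 ->
  pdd d (fun h => P h * Q h) (P0 * Q0) (P1 * Q0 + P0 * Q1).
Proof.
move=> hP hQ j k hjk; rewrite bcD !bcM -big_split /=.
pose F h := \sum_(a < j.+1) \sum_(b < k.+1) bc (P h) a b * bc (Q h) (j - a) (k - b).
apply: (@dd_fun F); first by apply/funext => h; rewrite bcM.
apply: dd_sum => a; rewrite -big_split /=; apply: dd_sum => b.
by apply: ddM; [apply: hP|apply: hQ]; move: (ltn_ord a) (ltn_ord b); lia.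
Qed.
Lemma pdd_cst d P : pdd d (fun=> P) P 0.
Proof. by move=> j k _; rewrite bc0; apply: dd_cst. Qed.
Lemma pddC d f a b : dd i f a b -> pdd d (fun h => bC (f h)) (bC a) (bC b).
Proof.
move=> h j k _; rewrite !bc_CE; case e : ((j == 0) && (k == 0))%N.
  by apply: dd_fun h; apply/funext => x; rewrite bc_CE e.
by apply: dd_fun (dd_cst i 0); apply/funext => x; rewrite bc_CE e.
Qed.
Lemma pdd_eq d P P0 P1 Q1 : pdd d P P0 P1 -> P1 = Q1 -> pdd d P P0 Q1.
Proof. by move=> h <-. Qed.
Lemma pddL d f g a b a' b' (x y : BP) : dd i f a a' -> dd i g b b' ->
  pdd d (fun h => bC (f h) * x + bC (g h) * y) (bC a * x + bC b * y) (bC a' * x + bC b' * y).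
Proof.
move=> hf hg; apply: pdd_eq; first exact: pddD (pddM (@pddC d _ _ _ hf) (pdd_cst x)) (pddM (@pddC d _ _ _ hg) (pdd_cst y)).
by rewrite !mulr0 !addr0.
Qed.
Lemma pddX d P P0 P1 n : pdd d P P0 P1 -> pdd d (fun h => P h ^+ n) (P0 ^+ n) (bC n%:R * P0 ^+ n.-1 * P1).
Proof.
move=> h; elim: n => [|n IH].
  apply: (@pdd_eq d _ _ 0); last by apply/esym; exact: mulz (bC0 R).
  have e : (fun h => P h ^+ 0) = (fun=> 1) by apply/funext => x; exact: expr0.
  have e0 : P0 ^+ 0 = 1 := expr0 P0.
  by rewrite e e0; exact: (@pdd_cst d 1).
move=> j k hjk; rewrite (_ : bC n.+1%:R * P0 ^+ n.+1.-1 * P1 = P1 * P0 ^+ n + P0 * (bC n%:R * P0 ^+ n.-1 * P1)).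
  by rewrite exprS; apply: dd_fun (pddM h IH hjk); apply/funext => x; rewrite exprS.
rewrite -[n.+1%:R]natr1 bCD /=; case: n {IH} => [|n] /=.
  exact: mulX0 (bC1 R) (bC0 R).
rewrite exprS; exact: mulXS (bC1 R).
Qed.
Lemma pdd_sum d I (s : seq I) (F : I -> 'cV[C]_2 -> BP) F0 F1 : (forall j, pdd d (F j) (F0 j) (F1 j)) ->
  pdd d (fun h => \sum_(j <- s) F j h) (\sum_(j <- s) F0 j) (\sum_(j <- s) F1 j).
Proof.
move=> h j k hjk; rewrite !bc_sum.
apply: (@dd_fun (fun x => \sum_(l <- s) bc (F l x) j k)); first by apply/funext => x; rewrite bc_sum.
by apply: dd_sum => l; apply: h.
Qed.

(** The product rule for a substitution whose base point is the identity. *)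
Lemma pdd_Np N d (Gh : 'cV[C]_2 -> nat -> nat -> C) G0 G1 P P1 Q Q1 :
  (forall j k, dd i (fun h => Gh h j k) (G0 j k) (G1 j k)) ->
  pdd d P xx P1 -> pdd d Q yy Q1 ->
  pdd d (fun h => Np N (Gh h) (P h) (Q h)) (Np N G0 xx yy) (Np N G1 xx yy + P1 * TX N G0 + Q1 * TY N G0).
Proof.
move=> hG hP hQ.
have hf j k : dd i (fun h => fc (Gh h) j k) (fc G0 j k) (fc G1 j k).
  by rewrite !fcE; apply: dd_fun (ddZ _ (hG j k)); apply/funext => h; rewrite fcE.
have H (j k : 'I_N) := pddM (pddM (@pddC d _ _ _ (hf j k)) (pddX j hP)) (pddX k hQ).
apply: pdd_eq; first by apply: pdd_sum => j; apply: pdd_sum => k; apply: H.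
rewrite /Np /TX /TY !big_distrr -!big_split; apply: eq_bigr => j _.
rewrite !big_distrr -!big_split; apply: eq_bigr => k _ /=.
move: (bC _) (bC _) (bC _) (bC _) => u0 u1 u2 u3.
move: (xx ^+ j) (yy ^+ k) (xx ^+ j.-1) (yy ^+ k.-1) => v0 v1 v2 v3; ring.
Qed.
End PolyFirstOrder.

(** Moving the base point in the direction v changes the normal form; k', A', p', q' are
    the derivatives of kap, of the adapted plane, and of p3 and q3. *)
Definition recurs (v0 v1 : C) (I D : nat -> nat -> C) : Prop :=
  exists (k' : C) (A' : 'M[C]_2) (p' q' : C), forall j k, (2 <= j + k)%N ->
  k' * fc I j k + fc (fun j k => v0 * I j.+1 k + v1 * I j k.+1) j k
  + (A' 0 0 * (j%:R * fc I j k) + A' 0 1 * predk (fun j k => j.+1%:R * fc I j.+1 k) j k)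
  + (A' 1 0 * predj (fun j k => k.+1%:R * fc I j k.+1) j k + A' 1 1 * (k%:R * fc I j k))
  = fc D j k + p' * FFx I j k + q' * FFy I j k.

Section AtNormal.
Variables (S : graphed R) (I : nat -> nat -> C) (i : 'I_2).
Hypotheses (hb : branch S 0) (ht : taylor_at (fn S) 0 (Defs.double I)).
Hypothesis hI : normal4 S 0 (aff1 R) I.
Let P (h : 'cV[C]_2) : 'cV[C]_3 := pnt h (fn S h).

Let xy00 : coord_xy (0 : 'cV[C]_3) = 0.
Proof.
by apply/matrixP => i' j; rewrite ord1 [RHS]mxE; case: (ord2P i') => ->; rewrite ?xy0 ?xy1 mxE.
Qed.

Lemma graph_near : \forall h \near (0 : 'cV[C]_2), graph S (P h).
Proof.
have [op _ _ _ _] := branch_surface hb.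
have hd : dom S 0 by have [] := branch_graph hb; rewrite xy00.
have : \forall h \near (0 : 'cV[C]_2), dom S h by apply: open_nbhs_nbhs.
by apply: filterS => h; apply: graph_pt.
Qed.

Lemma jholo_dd n f : jholo n S 0 f -> exists b, dd i (fun h => f S (P h)) (f S 0) b.
Proof.
move=> [fh h1 h2]; eexists; apply: (dd_jholo (e := delta_mx i 0) hb h1 h2 _ graph_near).
move=> l; rewrite /P xy00 [X in dd _ _ X]mxE mxE eqxx andbT eq_sym.
by apply: dd_fun (dd_coord R i l); apply/funext => h; rewrite coord_xy_point.
Qed.

Lemma phi_0 : phi S 0 = aff1 R. Proof. by have [] := normE hb hI. Qed.
Lemma Icoef_0 j k : Icoef j k S 0 = I j k. Proof. by have [_ ->] := normE hb hI. Qed.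

Lemma adA_aff1 : adA (aff1 R) = 1%:M.
Proof.
apply/matrixP => a b; rewrite mxE /= invmx1 !mxE.
by case: (ord2P a) => ->; case: (ord2P b) => ->.
Qed.
Lemma kap_aff1 : kap (aff1 R) = 1. Proof. by rewrite /kap /= mxE eqxx. Qed.
Lemma p3_aff1 : p3 (aff1 R) = 0. Proof. by rewrite /p3 /= mxE. Qed.
Lemma q3_aff1 : q3 (aff1 R) = 0. Proof. by rewrite /q3 /= mxE. Qed.

Definition shI (j k : nat) : C := (i == 0)%:R * I j.+1 k + (i == 1)%:R * I j k.+1.

Variable D : nat -> nat -> C.
Hypothesis hD : forall j k, dd i (fun h => Icoef j k S (P h)) (I j k) (D j k).

(** The equation between the jets of S and of its normal form is differentiated along S
    at a point where the normalizing map is the identity. *)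
Lemma recurrence : recurs (i == 0)%:R (i == 1)%:R I D.
Proof.
have [k' hk] := jholo_dd (jholo_kap hb (leqnn 4)).
have [p' hp] := jholo_dd (jholo_p3 hb (leqnn 4)).
have [q' hq] := jholo_dd (jholo_q3 hb (leqnn 4)).
have hA (a : 'I_2 * 'I_2) := jholo_dd (jholo_adA hb (leqnn 4) a.1 a.2).
have [B hB] := choice hA.
pose A' : 'M[C]_2 := \matrix_(a, b) B (a, b).
have {}hB a b : dd i (fun h => adA (phi S (P h)) a b) ((1%:M : 'M[C]_2) a b) (A' a b).
  have e : A' a b = B (a, b) by rewrite mxE.
  by rewrite e -adA_aff1 -phi_0; exact: hB (a, b).
rewrite phi_0 kap_aff1 in hk; rewrite phi_0 p3_aff1 in hp; rewrite phi_0 q3_aff1 in hq.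
exists k', A', p', q' => j k h2; pose N := (j + k).+1.
have jkN : (j + k < N)%N by [].
have hL d : pdd i d (fun h => Lx (adA (phi S (P h)))) xx (Lx A').
  have e : bC ((1%:M : 'M[C]_2) 0 0) * xx + bC ((1%:M : 'M[C]_2) 0 1) * yy = xx.
    by rewrite !mxE; exact: (lin10 xx yy (bC1 R) (bC0 R)).
  have := @pddL i d _ _ _ _ _ _ xx yy (hB 0 0) (hB 0 1); rewrite e; exact.
have hL' d : pdd i d (fun h => Ly (adA (phi S (P h)))) yy (Ly A').
  have e : bC ((1%:M : 'M[C]_2) 1 0) * xx + bC ((1%:M : 'M[C]_2) 1 1) * yy = yy.
    by rewrite !mxE; exact: (lin01 xx yy (bC1 R) (bC0 R)).
  have := @pddL i d _ _ _ _ _ _ xx yy (hB 1 0) (hB 1 1); rewrite e; exact.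
have hc a b : dd i (fun h => partials (fn S) a b h) (I a b) (shI a b).
  have := dd_partials i a b ht; rewrite /shI; case: (ord2P i) => -> /=;
  by rewrite mulr1n mulr0n mul1r mul0r ?addr0 ?add0r.
have hw := pdd_Np N (d := j + k) hc (@hL (j + k)%N) (@hL' (j + k)%N).
set V := Np N shI xx yy + Lx A' * TX N I + Ly A' * TY N I in hw.
have hgn := graph_near.
(* The jet of S in the moving adapted coordinates, to first order. *)
have hW : pdd i (j + k) (fun h => adW S (P h) (phi S (P h)) N) (Np N (cut I) xx yy)
    (bpoly N (fun a b => if (2 <= a + b)%N then bc V a b else 0)).
  move=> a b hab; have abN : (a + b < N)%N by [].
  rewrite bc_bpoly_lt // -bpoly_Np bc_bpoly_lt //.
  case: ifP => h3; last first.
    have l2 : (a + b < 2)%N by rewrite ltnNge h3.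
    rewrite (fcut0 I l2); apply: dd_fun (dd_cst i (0 : C)); apply/funext => h.
    by rewrite bc_adW // fcut0.
  have := hw a b hab; rewrite fcutE // -bpoly_Np bc_bpoly_lt //; apply: dd_eq.
  apply: filterS hgn => h hg; rewrite bc_adW // fcutE // /adw.
  have hol := holo_a (branch_surface hb) hg.
  by rewrite (@csubE _ _ _ _ hol N a b abN) coord_xy_point.
have hl := ddM hk (hW j k (leqnn _)).
have z0 : xx + bC 0 * Np N (cut I) xx yy = xx := addz _ _ (bC0 R).
have z1 : yy + bC 0 * Np N (cut I) xx yy = yy := addz _ _ (bC0 R).
have hP := pddD (@pdd_cst i (j + k) xx) (pddM (@pddC i (j + k) _ _ _ hp) hW); rewrite z0 in hP.
have hQ := pddD (@pdd_cst i (j + k) yy) (pddM (@pddC i (j + k) _ _ _ hq) hW); rewrite z1 in hQ.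
have hr := pdd_Np N hD hP hQ (leqnn (j + k)).
rewrite !dropz ?bC0 // in hr.
have hlr : \forall h \near (0 : 'cV[C]_2), kap (phi S (P h)) * bc (adW S (P h) (phi S (P h)) N) j k =
   bc (Np N (fun j k => Icoef j k S (P h)) (xx + bC (p3 (phi S (P h))) * adW S (P h) (phi S (P h)) N)
        (yy + bC (q3 (phi S (P h))) * adW S (P h) (phi S (P h)) N)) j k.
  apply: filterS hgn => h hg; have hb' : branch S (P h) by split; [case: hb|].
  have [hg' lo'] := normal4_low (normP hb').
  by rewrite -(star (branch_surface hb') hg hg' lo' jkN) bc_C.
have [_ e] := dd_unique (dd_eq hlr hl) hr.
have w0 : bc (Np N (cut I) xx yy) j k = fc I j k by rewrite -bpoly_Np bc_bpoly_lt // fcutE.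
rewrite w0 mul1r bc_bpoly_lt // h2 /V !bcD in e.
rewrite /Lx /Ly (bc_linTX _ _ (@bc_TX N I) jkN) (bc_linTY _ _ (@bc_TY N I) jkN) in e.
rewrite -!(bpoly_Np N) !bc_bpoly_lt // !bpoly_Np in e.
rewrite -!mulrA !bc_C (bc_FFx (@bc_TX N I) jkN) (bc_FFy (@bc_TY N I) jkN) in e.
by rewrite -!addrA in e *.
Qed.


End AtNormal.
End Recurrence.

(** * The recurrence made explicit *)
Section Solve.
Variable R : realType.
Notation C := (Cx R).
Notation BP := {poly {poly C}}.
Local Notation pnt := Defs.point.
Local Opaque partial holomorphic_at taylor_at hessian partials jeq.
Local Opaque bC bX bY bc bev cut fc.
Local Notation xx := (bX R).
Local Notation yy := (bY R).

Definition normalized (I : nat -> nat -> C) : Prop :=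
  [/\ forall j k, (j + k < 2)%N -> I j k = 0,
   [/\ I 2%N 0%N = 0, I 1%N 1%N = 1 & I 0%N 2%N = 0],
   [/\ I 3%N 0%N = 1, I 2%N 1%N = 0, I 1%N 2%N = 0 & I 0%N 3%N = 0] & I 4%N 0%N = 1].

Lemma normal4_normalized S p g (I : nat -> nat -> C) : normal4 S p g I -> normalized I.
Proof.
move=> hn; have [_ lo] := normal4_low hn.
by have [[[_ [_ [h1 h2 h3] [h4 h5]]] h6 h7] h8] := hn; split.
Qed.

Section Algebra.
Variables (I D : nat -> nat -> C).
Hypothesis hI : normalized I.
Hypothesis hD : forall j k, (j + k <= 3)%N || ((j == 4%N) && (k == 0%N)) -> D j k = 0.

Let lo j k : (j + k < 2)%N -> fc I j k = 0.
Proof. by case: hI => h _ _ _ /h /fcz. Qed.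
Let cutlo j k : (j + k < 2)%N -> fc (cut I) j k = 0.
Proof. exact: fcut0. Qed.
Let cuthi j k : (2 <= j + k)%N -> fc (cut I) j k = fc I j k.
Proof. exact: fcutE. Qed.

Lemma fc_low : [/\ [/\ fc I 2 0 = 0, fc I 1 1 = 1 & fc I 0 2 = 0],
   [/\ fc I 3 0 = 6%:R^-1, fc I 2 1 = 0, fc I 1 2 = 0 & fc I 0 3 = 0] & fc I 4 0 = 24%:R^-1].
Proof.
case: hI => _ [h1 h2 h3] [h4 h5 h6 h7] h8.
rewrite !fcE h1 h2 h3 h4 h5 h6 h7 h8 !mulr0 !mulr1; split; split; rewrite ?invr1 //.
Qed.

Lemma FF2 j k : (j + k = 2)%N -> FFx I j k = 0 /\ FFy I j k = 0.
Proof.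
have [[f20 f11 f02] _ _] := fc_low.
move=> h; split; rewrite /FFx /FFy big1 // => a _; rewrite big1 // => b _;
have [ha hb] := (ltn_ord a, ltn_ord b);
(have [hab|hab] := leqP 2 (a + b); [|by rewrite cutlo // mul0r]);
by rewrite [X in _ * (_ * X)]lo ?mulr0 //; lia.
Qed.

Ltac ff_tac := rewrite !big_ord_recl !big_ord0 /= /bump /= ?subnE /=.

Lemma FF_low : [/\ FFx I 3 0 = 0, FFx I 2 1 = 0, FFx I 1 2 = 1, FFx I 0 3 = 0 & FFx I 4 0 = 0] /\
  [/\ FFy I 3 0 = 0, FFy I 2 1 = 1, FFy I 1 2 = 0, FFy I 0 3 = 0 & FFy I 4 0 = 6%:R^-1].
Proof.
have [[f20 f11 f02] [f30 f21 f12 f03] f40] := fc_low.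
have z00 := @cutlo 0 0 isT; have z10 := @cutlo 1 0 isT; have z01 := @cutlo 0 1 isT.
have y00 := @lo 0 0 isT; have y10 := @lo 1 0 isT; have y01 := @lo 0 1 isT.
have c20 : fc (cut I) 2 0 = 0 by rewrite cuthi.
have c11 : fc (cut I) 1 1 = 1 by rewrite cuthi.
have c02 : fc (cut I) 0 2 = 0 by rewrite cuthi.
have c30 : fc (cut I) 3 0 = 6%:R^-1 by rewrite cuthi.
have c21 : fc (cut I) 2 1 = 0 by rewrite cuthi.
have c12 : fc (cut I) 1 2 = 0 by rewrite cuthi.
have c03 : fc (cut I) 0 3 = 0 by rewrite cuthi.
split; split; rewrite /FFx /FFy; ff_tac;
rewrite ?z00 ?z10 ?z01 ?y00 ?y10 ?y01 ?c20 ?c11 ?c02 ?c30 ?c21 ?c12 ?c03 ?f20 ?f11 ?f02;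
rewrite ?f30 ?f21 ?f12 ?f03 ?f40 ?mulr0 ?mul0r ?addr0 ?add0r ?mul1r ?mulr1 //.
Qed.

Lemma fc_val4 : [/\ fc I 3 1 = I 3%N 1%N / 6%:R, fc I 2 2 = I 2%N 2%N / 4%:R, fc I 5 0 = I 5%N 0%N / 120%:R,
   fc I 1 3 = I 1%N 3%N / 6%:R & fc I 4 1 = I 4%N 1%N / 24%:R] /\ fc I 0 4 = I 0%N 4%N / 24%:R.
Proof.
have e (x : C) m n (a : nat) : (m`! * n`!)%N = a -> (m`!%:R * n`!%:R)^-1 * x = x / a%:R.
  by move=> <-; rewrite natrM mulrC.
by split; [split|]; rewrite fcE; apply: e.
Qed.

Lemma eq_of_sub0 (x y e : C) : e = 0 -> x - y = e -> x = y.
Proof. by move=> -> /eqP; rewrite subr_eq0 => /eqP. Qed.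

Section Values.
Variables (v0 v1 k' p' q' : C) (A : 'M[C]_2).
Hypothesis hR : forall j k, (2 <= j + k)%N ->
  k' * fc I j k + fc (fun j k => v0 * I j.+1 k + v1 * I j k.+1) j k
  + (A 0 0 * (j%:R * fc I j k) + A 0 1 * predk (fun j k => j.+1%:R * fc I j.+1 k) j k)
  + (A 1 0 * predj (fun j k => k.+1%:R * fc I j k.+1) j k + A 1 1 * (k%:R * fc I j k))
  = fc D j k + p' * FFx I j k + q' * FFy I j k.

Lemma fc_shift j k : fc (fun j k => v0 * I j.+1 k + v1 * I j k.+1) j k =
  v0 * (j.+1%:R * fc I j.+1 k) + v1 * (k.+1%:R * fc I j k.+1).
Proof.
rewrite !fcE !factS !natrM; have := fact_neq0 R j; have := fact_neq0 R k.
have := pnatr_eq0 C j.+1; have := pnatr_eq0 C k.+1.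
move: (j`!%:R) (k`!%:R) (j.+1%:R) (k.+1%:R) => a b c d /= d0 c0 b0 a0.
by field; rewrite a0 b0 c0 d0.
Qed.

(** The coefficients of order two and three, and that of x to the fourth, are constant.
    The corresponding eight equations determine the seven unknown entries, and the one
    left over gives a relation between the invariants of order four. *)
Lemma rec_values :
  [/\ A 1 0 = - v0 / 2%:R, A 0 1 = 0,
      A 0 0 = v0 * (4%:R * I 3%N 1%N - I 5%N 0%N + 1) + v1 * (2%:R * I 2%N 2%N - I 4%N 1%N + I 3%N 1%N),
      k' = - v0 - v1 * I 3%N 1%N - 3%:R * A 0 0 & A 1 1 = - k' - A 0 0] /\
  [/\ p' = v0 * I 2%N 2%N / 2%:R + v1 * I 1%N 3%N / 2%:R,
      q' = v0 * I 3%N 1%N / 2%:R + v1 * I 2%N 2%N / 2%:R &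
      v0 * I 1%N 3%N + v1 * I 0%N 4%N = 0].
Proof.
have [[f20 f11 f02] [f30 f21 f12 f03] f40] := fc_low.
have [[f31 f22 f50 f13 f41] f04] := fc_val4.
have [[x30 x21 x12 x03 x40] [y30 y21 y12 y03 y40]] := FF_low.
have dz j k : (j + k <= 3)%N || ((j == 4%N) && (k == 0%N)) -> fc D j k = 0.
  by move=> /hD /fcz.
have [a20 b20] := @FF2 2 0 erefl; have [a11 b11] := @FF2 1 1 erefl; have [a02 b02] := @FF2 0 2 erefl.
have := hR (isT : (2 <= 2 + 0)%N); have := hR (isT : (2 <= 1 + 1)%N); have := hR (isT : (2 <= 0 + 2)%N).
have := hR (isT : (2 <= 3 + 0)%N); have := hR (isT : (2 <= 2 + 1)%N); have := hR (isT : (2 <= 1 + 2)%N).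
have := hR (isT : (2 <= 0 + 3)%N); have := hR (isT : (2 <= 4 + 0)%N).
rewrite !fc_shift /= !dz // a20 b20 a11 b11 a02 b02 x30 x21 x12 x03 x40 y30 y21 y12 y03 y40.
rewrite f20 f11 f02 f30 f21 f12 f03 f40 f31 f22 f50 f13 f41 f04.
move: (I 3%N 1%N) (I 2%N 2%N) (I 5%N 0%N) (I 1%N 3%N) (I 4%N 1%N) (I 0%N 4%N) => I31 I22 I50 I13 I41 I04.
move: (A 0 0) (A 0 1) (A 1 0) (A 1 1) => A00 A01 A10 A11.
rewrite !(mulr0, mul0r, addr0, add0r, mulr1, mul1r) => e40 e03 e12 e21 e30 e02 e11 e20.
have hA01 : A01 = 0 by exact: e02.
have hA10 : A10 = - v0 / 2%:R.
  by apply: (eq_of_sub0 (e := 0)) => //; rewrite -e20; field.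
rewrite hA01 hA10 in e40 e03 e12 e21 e30 e11.
have hq : q' = v0 * I31 / 2%:R + v1 * I22 / 2%:R by rewrite -e21; field.
have hp : p' = v0 * I22 / 2%:R + v1 * I13 / 2%:R by rewrite -e12; field.
have hk : k' = - v0 - v1 * I31 - 3%:R * A00.
  apply: (eq_of_sub0 (e := 6%:R * 0)); first by rewrite mulr0.
  by rewrite -e30; field.
split; split=> //.
- rewrite hk hq in e40.
  apply/eqP; rewrite -subr_eq0; apply/eqP.
  apply: etrans (_ : 24%:R * ((v0 * I31 / 2%:R + v1 * I22 / 2%:R) / 6%:R - (v0 * I31 / 2%:R + v1 * I22 / 2%:R) / 6%:R) = 0).
    by rewrite -{1}e40; field.
  by rewrite subrr mulr0.
- by apply: (eq_of_sub0 (e := 0)) => //; rewrite -e11; ring.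
- by rewrite -[RHS](mulr0 6%:R) -e03; field.
Qed.

Lemma predj_fc j k : predj (fun j k => k.+1%:R * fc I j k.+1) j k =
  (j`!%:R * k`!%:R)^-1 * (j%:R * predj (fun j k => I j k.+1) j k).
Proof.
case: j => [|j] /=; first by rewrite mul0r mulr0.
rewrite fcE !factS !natrM; have := fact_neq0 R j; have := fact_neq0 R k.
have := pnatr_eq0 C k.+1; have := pnatr_eq0 C j.+1.
move: (j`!%:R) (k`!%:R) (k.+1%:R) (j.+1%:R) (I j k.+1) => a b c d x /= d0 c0 b0 a0.
by field; rewrite a0 b0 c0 d0.
Qed.

Lemma rec_formula j k : (2 <= j + k)%N ->
  D j k = v0 * I j.+1 k + v1 * I j k.+1 + (k' + j%:R * A 0 0 + k%:R * A 1 1) * I j k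
    + A 1 0 * (j%:R * predj (fun j k => I j k.+1) j k)
    - j`!%:R * k`!%:R * (p' * FFx I j k + q' * FFy I j k).
Proof.
move=> h; have := hR h; have [[_ -> _ _ _] _] := rec_values; rewrite mul0r addr0 predj_fc !fcE.
have := fact_neq0 R j; have := fact_neq0 R k.
move: (j`!%:R) (k`!%:R) (predj _ _ _) (FFx I j k) (FFy I j k) (I j k) => a b P X Y Ijk.
move: (D j k) (I j.+1 k) (I j k.+1) (j%:R) (k%:R) => Djk I1 I2 rj rk b0 a0 e.
have {}e : (a * b)^-1 * Djk = k' * ((a * b)^-1 * Ijk) + (a * b)^-1 * (v0 * I1 + v1 * I2) +
  A 0 0 * (rj * ((a * b)^-1 * Ijk)) +
  (A 1 0 * ((a * b)^-1 * (rj * P)) + A 1 1 * (rk * ((a * b)^-1 * Ijk))) - p' * X - q' * Y.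
  by rewrite e; ring.
have -> : Djk = (a * b) * ((a * b)^-1 * Djk) by field; rewrite a0 b0.
by rewrite e; field; rewrite a0 b0.
Qed.
End Values.

Local Notation I31 := (I 3%N 1%N).
Local Notation I22 := (I 2%N 2%N).
Local Notation I50 := (I 5%N 0%N).
Local Notation I41 := (I 4%N 1%N).
(** Up to sign, the derivatives in the directions x and y of the scale of x in the
    normalizing map. *)
Definition mu : C := I50 - 1 - 4%:R * I31.
Definition nu : C := I41 - I31 - 2%:R * I22.

Lemma rec_x : recurs 1 0 I D -> I 1%N 3%N = 0 /\ forall j k, (2 <= j + k)%N ->
  D j k = I j.+1 k + ((3%:R - j%:R - 2%:R * k%:R) * mu + k%:R - 1) * I j k
   - j%:R / 2%:R * predj (fun j k => I j k.+1) j k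
   - j`!%:R * k`!%:R * (I22 / 2%:R * FFx I j k + I31 / 2%:R * FFy I j k).
Proof.
move=> [k' [A [p' [q' hR]]]].
have [[h1 h2 h3 h4 h5] [h6 h7 h8]] := rec_values hR.
split; first by move: h8; rewrite mul1r mul0r addr0.
move=> j k h; rewrite (rec_formula hR h) h6 h7 h1 h5 h4 h3 /mu.
by move: (j`!%:R) (k`!%:R) (predj _ _ _) (FFx I j k) (FFy I j k) (j%:R) (k%:R) => a b P X Y rj rk; field.
Qed.

Lemma rec_y : I 1%N 3%N = 0 -> recurs 0 1 I D -> I 0%N 4%N = 0 /\ forall j k, (2 <= j + k)%N ->
  D j k = I j k.+1 + ((3%:R - j%:R - 2%:R * k%:R) * nu + (k%:R - 1) * I31) * I j k
   - j`!%:R * k`!%:R * (I22 / 2%:R * FFy I j k).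
Proof.
move=> h13 [k' [A [p' [q' hR]]]].
have [[h1 h2 h3 h4 h5] [h6 h7 h8]] := rec_values hR.
split; first by move: h8; rewrite mul1r mul0r add0r.
move=> j k h; rewrite (rec_formula hR h) h6 h7 h1 h5 h4 h3 h13 /nu.
by move: (j`!%:R) (k`!%:R) (predj _ _ _) (FFx I j k) (FFy I j k) (j%:R) (k%:R) => a b P X Y rj rk; field.
Qed.

End Algebra.

Lemma normal4_self (S : graphed R) I : branch S 0 -> taylor_at (fn S) 0 (Defs.double I) ->
  normalized I -> normal4 S 0 (aff1 R) I.
Proof.
move=> hb ht [lo [h1 h2 h3] [h4 h5 h6 h7] h8].
suff hg : graphs_as S 0 (aff1 R) I.
  by split=> //; split=> //; split=> //; split=> //; split; exact: lo.
split; [exact: A31|by rewrite aff_id|exists (fn S) => //].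
have [op _ _ _ _] := branch_surface hb.
have hd : dom S (coord_xy 0) by have [] := branch_graph hb.
have : \forall w \near (0 : 'cV[C]_3), dom S (coord_xy w).
  by apply: (xy_near (P := dom S)); apply: open_nbhs_nbhs.
apply: filterS => w hw; rewrite aff_id; split; first by case.
by move=> e; split.
Qed.

Lemma Icoef_normalized (S : graphed R) p : branch S p -> normalized (fun j k => Icoef j k S p).
Proof. by move=> /normP/normal4_normalized. Qed.

Lemma inv_deriv_recurs i (S : graphed R) p : branch S p ->
  recurs (i == 0)%:R (i == 1)%:R (fun j k => Icoef j k S p)
    (fun j k => inv_deriv i S (Icoef j k S) p).
Proof.
move=> hb; have [S' [hb' hm ht]] := normal_surface_ex hb.
have hn := Icoef_normalized hb; have hI := normal4_self hb' ht hn.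
apply: (recurrence hb' ht hI) => j k.
have hj : jholo (4 + (j + k)) S' 0 (Icoef j k) by apply: jholo_Icoef; rewrite ?leq_addr ?leq_addl.
have [b hd] := jholo_dd i hb' hj; rewrite (Icoef_0 hb' hI) in hd.
by rewrite (inv_deriv_dd hb hb' hm ht (Icoef_invariant j k) hd).
Qed.

Lemma inv_deriv_cst i j k (S : graphed R) p : branch S p ->
  (j + k <= 3)%N || ((j == 4%N) && (k == 0%N)) -> inv_deriv i S (Icoef j k S) p = 0.
Proof.
move=> hb hjk; have [S' [hb' hm ht]] := normal_surface_ex hb.
apply: (inv_deriv_dd hb hb' hm ht (Icoef_invariant j k)).
have [c hc] : exists c, forall (S : graphed R) p, branch S p -> Icoef j k S p = c.
  have [h0 [h1 h2 h3] [h4 h5 h6 h7] h8] := Icoef_normalized hb.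
  exists (Icoef j k S p) => S2 p2 /Icoef_normalized [g0 [g1 g2 g3] [g4 g5 g6 g7] g8].
  have [l|l] := ltnP (j + k) 2; first by rewrite h0 // g0.
  move: j k hjk l {hm ht} => [|[|[|[|[|j]]]]] [|[|[|[|k]]]] //= _ _; congruence.
rewrite (hc S p hb); have := dd_cst i c; apply: dd_eq.
apply: filterS (graph_near hb') => h hg; rewrite hc //; split=> //; by case: hb'.
Qed.

Lemma inv_deriv_x j k (S : graphed R) p : branch S p -> (2 <= j + k)%N ->
  let I j k := Icoef j k S p in
  inv_deriv 0 S (Icoef j k S) p = I j.+1 k + ((3%:R - j%:R - 2%:R * k%:R) * mu I + k%:R - 1) * I j k
   - j%:R / 2%:R * predj (fun j k => I j k.+1) j k
   - j`!%:R * k`!%:R * (I 2%N 2%N / 2%:R * FFx I j k + I 3%N 1%N / 2%:R * FFy I j k).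
Proof.
move=> hb h I; have hD := @inv_deriv_cst 0 _ _ S p hb.
have [_ e] := rec_x (Icoef_normalized hb) (fun j k => @inv_deriv_cst 0 j k S p hb) (inv_deriv_recurs 0 hb).
by rewrite (e j k h).
Qed.

(** The leftover equation in the direction x; in the direction y it gives the vanishing
    of the coefficient of y to the fourth. *)
Lemma Icoef_13 (S : graphed R) p : branch S p -> Icoef 1 3 S p = 0.
Proof.
move=> hb.
by have [] := rec_x (Icoef_normalized hb) (fun j k => @inv_deriv_cst 0 j k S p hb) (inv_deriv_recurs 0 hb).
Qed.

Lemma inv_deriv_y j k (S : graphed R) p : branch S p -> (2 <= j + k)%N ->
  let I j k := Icoef j k S p in
  inv_deriv 1 S (Icoef j k S) p = I j k.+1 + ((3%:R - j%:R - 2%:R * k%:R) * nu I + (k%:R - 1) * I 3%N 1%N) * I j k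
   - j`!%:R * k`!%:R * (I 2%N 2%N / 2%:R * FFy I j k).
Proof.
move=> hb h I.
have [_ e] := rec_y (Icoef_normalized hb) (fun j k => @inv_deriv_cst 1 j k S p hb)
   (Icoef_13 hb) (inv_deriv_recurs 1 hb).
by rewrite (e j k h).
Qed.

End Solve.

(** * Generation of the differential invariants *)
Section Generation.
Variable R : realType.
Notation C := (Cx R).
Local Notation pnt := Defs.point.
Local Opaque partial holomorphic_at taylor_at hessian partials jeq.
Local Opaque bC bX bY bc bev cut fc.

Definition normal_at (S : graphed R) p S' : Prop :=
  [/\ branch S' 0, germ_map (phi S p) S p S' 0 &
    taylor_at (fn S') 0 (Defs.double (fun j k => Icoef j k S p))].

Lemma inv_deriv_const i f c : germ_invariant f -> (forall (S : graphed R) p, branch S p -> f S p = c) ->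
  forall S p, branch S p -> inv_deriv i S (f S) p = 0.
Proof.
move=> hi hc S p hb; have [S' [hb' hm ht]] := normal_surface_ex hb.
apply: (inv_deriv_dd hb hb' hm ht hi); rewrite (hc S p hb).
have := dd_cst i c; apply: dd_eq; apply: filterS (graph_near hb') => h hg.
by rewrite hc //; split=> //; case: hb'.
Qed.

(** Induction on n: once a coefficient vanishes on all surfaces, its derivative in the
    direction y does, and in the recurrence only the next coefficient is left. *)
Lemma Icoef_0n n (S : graphed R) p : branch S p -> Icoef 0 n S p = 0.
Proof.
have [m] := ubnP n; elim: m n S p => // m IH n S p; rewrite ltnS => hn hb.
have [h0 [_ _ h2] [_ _ _ h3] _] := Icoef_normalized hb.
case: n hn => [|[|[|n]]] hn; [exact: h0|exact: h0|exact: h2|].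
have hd : inv_deriv 1 S (Icoef 0 n.+2 S) p = 0.
  by apply: (inv_deriv_const 1 (c := 0)) => //; [exact: Icoef_invariant|move=> S2 p2 hb2; exact: IH].
have e0 : Icoef 0 n.+2 S p = 0 by exact: IH.
have := @inv_deriv_y _ 0 n.+2 S p hb isT; cbv zeta beta; rewrite hd e0 mulr0 addr0.
have -> : FFy (fun j k => Icoef j k S p) 0 n.+2 = 0.
  rewrite /FFy big1 // => a _; rewrite big1 // => b _.
  have ha := ltn_ord a; have hb' := ltn_ord b.
  have [l|l] := ltnP (a + b) 2; first by rewrite fcut0 // mul0r.
  rewrite fcutE // fcz ?mul0r //.
  have -> : (a : nat) = 0%N by lia.
  by apply: IH => //; lia.
by rewrite !mulr0 subr0 => <-.
Qed.

(** Expressions rather than functions, because the derivative of an expression is found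
    by recursion on it. *)
Inductive gexpr := GC of C | GG of 'I_3 * nat * nat | GA of gexpr & gexpr | GM of gexpr & gexpr.

Fixpoint geval (e : gexpr) (S : graphed R) (p : 'cV[C]_3) : C := match e with
  | GC c => c | GG s => derived_generator s S p
  | GA e1 e2 => geval e1 S p + geval e2 S p | GM e1 e2 => geval e1 S p * geval e2 S p end.

Lemma geval_deriv e : exists e', forall S p S', branch S p -> normal_at S p S' ->
  dd 0 (fun h => geval e S' (pnt h (fn S' h))) (geval e S p) (geval e' S p).
Proof.
elim: e => [c|[[i a1] a2]|e1 [e1' h1] e2 [e2' h2]|e1 [e1' h1] e2 [e2' h2]].
- by exists (GC 0) => S p S' _ _; apply: dd_cst.
- exists (GG (i, a1.+1, a2)) => S p S' hb [hb' hm ht] /=.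
  have [hi [n [n4 hj]]] := jinv_derived R (i, a1, a2).
  have [b hd] := jholo_dd 0 hb' (hj _ _ hb').
  have [[hg _ _] _] := normal4_low (normP hb).
  have e0 := hi _ _ _ _ _ hg hb hb' hm; rewrite e0 in hd.
  by have e1 := inv_deriv_dd hb hb' hm ht hi hd; rewrite -e1 in hd; exact: hd.
- by exists (GA e1' e2') => S p S' hb hn; apply: ddD; [apply: h1|apply: h2].
exists (GA (GM e1' e2) (GM e1 e2')) => S p S' hb hn.
by apply: ddM; [apply: h1|apply: h2].
Qed.

Definition gen (f : graphed R -> 'cV[C]_3 -> C) : Prop :=
  exists e, forall S p, branch S p -> f S p = geval e S p.

Lemma gen_eq f f' : (forall S p, branch S p -> f S p = f' S p) -> gen f -> gen f'.
Proof. by move=> h [e he]; exists e => S p hb; rewrite -h // he. Qed.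
Lemma gen_cst c : gen (fun _ _ => c). Proof. by exists (GC c). Qed.
Lemma genD f f' : gen f -> gen f' -> gen (fun S p => f S p + f' S p).
Proof. by move=> [e h] [e' h']; exists (GA e e') => S p hb; rewrite h // h'. Qed.
Lemma genM f f' : gen f -> gen f' -> gen (fun S p => f S p * f' S p).
Proof. by move=> [e h] [e' h']; exists (GM e e') => S p hb; rewrite h // h'. Qed.
Lemma genN f : gen f -> gen (fun S p => - f S p).
Proof. by move=> [e h]; exists (GM (GC (- 1)) e) => S p hb; rewrite h //= mulN1r. Qed.
Lemma gen_sum I (s : seq I) (F : I -> graphed R -> 'cV[C]_3 -> C) :
  (forall i, gen (F i)) -> gen (fun S p => \sum_(i <- s) F i S p).
Proof.
move=> h; elim: s => [|i s IH].
  by apply: gen_eq (gen_cst 0) => S p _; rewrite big_nil.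
by apply: gen_eq (genD (h i) IH) => S p _; rewrite big_cons.
Qed.
Lemma gen_deriv f : germ_invariant f -> gen f -> gen (fun S => inv_deriv 0 S (f S)).
Proof.
move=> hi [e he]; have [e' he'] := geval_deriv e; exists e' => S p hb.
have [S' [hb' hm ht]] := normal_surface_ex hb.
have hn : normal_at S p S' by split.
apply: (inv_deriv_dd hb hb' hm ht hi).
have := he' _ _ _ hb hn; rewrite -he //; apply: dd_eq.
apply: filterS (graph_near hb') => h hg.
by rewrite he //; split=> //; case: hb'.
Qed.

Lemma gen_FF m j k : (forall a b, (a + b <= m)%N -> gen (Icoef a b)) -> (j + k <= m)%N ->
  gen (fun S p => FFx (fun a b => Icoef a b S p) j k) /\
  gen (fun S p => FFy (fun a b => Icoef a b S p) j k).
Proof.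
move=> h hjk.
have hf a b : (a + b <= m)%N -> gen (fun S p => fc (fun a b => Icoef a b S p) a b).
  by move=> hab; apply: gen_eq (genM (gen_cst _) (h a b hab)) => S p _; rewrite fcE.
split; apply: gen_sum => a; apply: gen_sum => b; have ha := ltn_ord a; have hb := ltn_ord b;
(have [l|l] := ltnP (a + b) 2;
  [by apply: gen_eq (gen_cst 0) => S p _; rewrite fcut0 // mul0r|]);
apply: genM; first [apply: genM; [exact: gen_cst|apply: hf; lia]
 | apply: gen_eq (hf a b _); [move=> S p _; rewrite fcutE //|lia]].
Qed.

Lemma gen_generator (i : 'I_3) : gen (generator i).
Proof. by exists (GG (i, 0%N, 0%N)). Qed.

(** The recurrence in the direction x expresses a coefficient through those of lower
    order and an invariant derivative, lowering the exponent of x; it stops at the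
    powers of y, whose coefficients vanish, and at the generators. *)
Lemma gen_Icoef j k : gen (Icoef j k).
Proof.
have g31 : gen (Icoef 3 1) by have := gen_generator 0; rewrite /generator (tnth_nth (Icoef 3 1)).
have g22 : gen (Icoef 2 2) by have := gen_generator 1; rewrite /generator (tnth_nth (Icoef 3 1)).
have g50 : gen (Icoef 5 0) by have := gen_generator ord_max; rewrite /generator (tnth_nth (Icoef 3 1)).
have cst (c : C) j' k' : (forall (S : graphed R) p, branch S p -> Icoef j' k' S p = c) -> gen (Icoef j' k').
  by move=> h; apply: gen_eq (gen_cst c) => S p hb; rewrite h.
have g0n n : gen (Icoef 0 n) by apply: (cst 0) => S p; exact: Icoef_0n.
suff H m : forall j k, (j + k <= m)%N -> gen (Icoef j k) by exact: (H (j + k)%N).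
elim: m => [|m IH] {}j {}k h.
  apply: (cst 0) => S p hb; have [h0 _ _ _] := Icoef_normalized hb.
  by apply: h0; apply: leq_ltn_trans h _.
have [l|l] := leqP (j + k) m; first exact: IH.
case: j h l => [|j] h l; first exact: g0n.
have [l4|l4] := ltnP m 4.
  have E (S : graphed R) p (hb : branch S p) := Icoef_normalized hb.
  move: j k h l l4 {g0n}; move: m {IH} => [|[|[|[|m]]]] // j k h l _.
  - by apply: (cst 0) => S p /E[h0 _ _ _]; apply: h0; lia.
  - case: j k h l => [|[|j]] [|[|k]] // _ _.
      by apply: (cst 1) => S p /E[? [? ? ?] ? ?].
    by apply: (cst 0) => S p /E[? [? ? ?] ? ?].
  - case: j k h l => [|[|[|j]]] [|[|[|k]]] // _ _.
    + by apply: (cst 0) => S p /E[? ? [? ? ? ?] ?].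
    + by apply: (cst 0) => S p /E[? ? [? ? ? ?] ?].
    by apply: (cst 1) => S p /E[? ? [? ? ? ?] ?].
  case: j k h l => [|[|[|[|j]]]] [|[|[|[|k]]]] // _ _.
    by apply: (cst 0) => S p; exact: Icoef_13.
  by apply: (cst 1) => S p /E[? ? ? ?].
have [/andP[/eqP j4 /eqP k0]|ne] := boolP ((j == 4) && (k == 0))%N; first by rewrite j4 k0.
have hjk : (2 <= j + k)%N by lia.
have hm : (j + k <= m)%N by lia.
have [hx hy] := gen_FF IH hm.
have gI := IH j k hm.
pose f (S : graphed R) p := inv_deriv 0 S (Icoef j k S) p
  + - (((3%:R - j%:R - 2%:R * k%:R) * (Icoef 5 0 S p + - 1 + - (4%:R * Icoef 3 1 S p)) + (k%:R - 1)) * Icoef j k S p)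
  + j%:R / 2%:R * predj (fun j k => Icoef j k.+1 S p) j k
  + j`!%:R * k`!%:R * (2%:R^-1 * Icoef 2 2 S p * FFx (fun j k => Icoef j k S p) j k
     + 2%:R^-1 * Icoef 3 1 S p * FFy (fun j k => Icoef j k S p) j k).
apply: (@gen_eq f).
  move=> S p hb; rewrite /f (inv_deriv_x hb hjk) /mu.
  by move: (FFx _ _ _) (FFy _ _ _) (predj _ _ _) => X Y P; ring.
apply: genD; first apply: genD; first apply: genD.
- exact: (gen_deriv (Icoef_invariant j k) gI).
- apply: genN; apply: genM gI; apply: genD (gen_cst _); apply: genM; first exact: gen_cst.
  by apply: genD; [apply: genD g50 (gen_cst _)|apply: genN; apply: genM g31; exact: gen_cst].
- apply: genM; first exact: gen_cst.
  case: (j) hm => [|j'] hm /=; first exact: gen_cst.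
  by apply: IH; lia.
apply: genM; first exact: gen_cst.
by apply: genD; [apply: genM hx|apply: genM hy]; apply: genM; first [exact: gen_cst|exact: g22|exact: g31].
Qed.

Fixpoint gbound (e : gexpr) : nat := match e with
  | GC _ => 0 | GG s => maxn s.1.2 s.2 | GA e1 e2 | GM e1 e2 => maxn (gbound e1) (gbound e2) end.

Section Polynomials.
Variable B : nat.
Definition gvar : finType := ('I_3 * 'I_B.+1 * 'I_B.+1)%type.
Definition gindex (i : 'I_#|gvar|) : 'I_3 * nat * nat :=
  let x := enum_val i in (x.1.1, x.1.2 : nat, x.2 : nat).
Fixpoint gpoly (e : gexpr) : mpoly #|gvar| C := match e with
  | GC c => mpolyC _ c
  | GG s => mpolyX C (mnm1 (enum_rank ((s.1.1, inord s.1.2, inord s.2) : gvar)))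
  | GA e1 e2 => gpoly e1 + gpoly e2 | GM e1 e2 => gpoly e1 * gpoly e2 end.

Lemma gpolyE e S p : (gbound e <= B)%N ->
  ev (gpoly e) (\col_i derived_generator (gindex i) S p) = geval e S p.
Proof.
elim: e => [c|[[i a1] a2]|e1 h1 e2 h2|e1 h1 e2 h2] /=.
- by rewrite /ev mevalC.
- rewrite geq_max => /andP[b1 b2]; rewrite /ev mevalXU mxE /gindex enum_rankK /=.
  by rewrite !inordK.
- by rewrite geq_max => /andP[b1 b2]; rewrite evD h1 // h2.
by rewrite geq_max => /andP[b1 b2]; rewrite evM h1 // h2.
Qed.
End Polynomials.

Lemma jet_zero n i : (forall (S : graphed R) p S', normal_at S p S' -> jet n S' 0 i 0 = 0) \/
  exists j k, (j + k <= n)%N /\ forall S p S', normal_at S p S' -> jet n S' 0 i 0 = Icoef j k S p.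
Proof.
have z l : coord_xy (0 : 'cV[C]_3) l 0 = 0 by case: (ord2P l) => ->; rewrite ?xy0 ?xy1 mxE.
have z0 : coord_xy (0 : 'cV[C]_3) = 0 by apply/matrixP => l l'; rewrite ord1 z mxE.
have [[l hl]|[j [k [hjk hl]]]] := jet_caseP R i.
  by left => S p S' _; rewrite hl z.
right; exists j, k; split=> // S p S' [_ _ ht].
by rewrite hl z0 (partials_taylor _ _ ht).
Qed.

(** By invariance the value of J at a jet is its value at the jet of the normal form,
    whose entries are polynomials in the derived generators. *)
Lemma diff_invariant_generated n (D : set (jet_space R n)) J : diff_invariant D J -> locally_generated D J.
Proof.
move=> [hsub hhol hinv] z0 hz0.
have [S0 [p0 [hS0 hp0 e0]]] := hsub _ hz0.
have hb0 : branch S0 p0 by split.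
have [S0' [hb0' hm0 ht0]] := normal_surface_ex hb0.
have hn0 : normal_at S0 p0 S0' by split.
have [[hg0 _ _] _] := normal4_low (normP hb0).
rewrite e0 in hz0.
have [hD1 _] := hinv _ _ _ _ _ hg0 hb0.1 hb0'.1 hb0.2 hb0'.2 hm0 hz0.
have [f1 hf1 hn1] := hhol _ hD1.
have /choice[E hE] : forall jk, exists e, forall S p, branch S p -> Icoef jk.1 jk.2 S p = geval e S p.
  by move=> [j k]; exact: gen_Icoef.
pose B := \max_(j < n.+1) \max_(k < n.+1) gbound (E (j : nat, k : nat)).
have hB j k : (j + k <= n)%N -> (gbound (E (j, k)) <= B)%N.
  move=> h; have hj : (j < n.+1)%N by lia.
  have hk : (k < n.+1)%N by lia.
  apply: leq_trans (leq_bigmax (Ordinal hj)) => /=.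
  by apply: leq_trans (leq_bigmax (Ordinal hk)).
pose v (S : graphed R) p := \col_i derived_generator (gindex (B := B) i) S p.
have /choice[q hq] : forall i : 'I_(2 + #|jet_index n|), exists q : mpoly #|gvar B| C,
    forall S p S', branch S p -> normal_at S p S' -> jet n S' 0 i 0 = ev q (v S p).
  move=> i; have [h|[j [k [hjk h]]]] := jet_zero i.
    by exists 0 => S p S' _ hn; rewrite (h _ _ _ hn) /ev meval0.
  exists (gpoly B (E (j, k))) => S p S' hb hn.
  by rewrite (h _ _ _ hn) gpolyE ?hB // -hE.
pose lq := [tuple q i | i < 2 + #|jet_index n|].
have hlq S p S' : branch S p -> normal_at S p S' -> polymap lq (v S p) = jet n S' 0.
  by move=> hb hn; apply/matrixP => i j; rewrite ord1 mxE tnth_mktuple -(hq i S p S').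
pose H := fun x => f1 (polymap lq x).
exists #|gvar B|, (@gindex B), [set x | holomorphic_at H x], H; split=> //.
  by rewrite openE => x /holo_open; rewrite /interior.
(* The jet of the normal form varies continuously with the jet of the surface. *)
have hc : \forall z \near z0, forall S p S', branch S p -> jet n S p = z -> normal_at S p S' ->
    (holomorphic_at f1 (jet n S' 0) /\ (branch_jets (jet n S' 0) -> D (jet n S' 0) /\ J (jet n S' 0) = f1 (jet n S' 0))).
  have hn : nbhs (jet n S0' 0) (fun z => holomorphic_at f1 z /\ (branch_jets z -> D z /\ J z = f1 z)).
    by apply: filterI => //; apply: holo_open.
  move: hn => /nbhsV[e e0' he].
  have hi i : nearj n S0 p0 (fun S p => forall S', normal_at S p S' -> nrm (jet n S' 0 i 0 - jet n S0' 0 i 0) < e).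
    have [h|[j [k [hjk h]]]] := jet_zero i.
      by apply: nearj_all => S p hb S' hn; rewrite (h _ _ _ hn) (h _ _ _ hn0) subrr nrm0.
    have hc : nearj n S0 p0 (fun S p => nrm (Icoef j k S p - Icoef j k S0 p0) < e).
      have [n4|n4] := leqP 4 n.
        have [fh hfh hnf] := jholo_Icoef hb0 n4 hjk.
        have [r r0 hr] := holo_cont hfh e0'.
        have hfr : nearj n S0 p0 (fun S p => nrm (fh (jet n S p) - fh (jet n S0 p0)) < e).
          by apply: (inbox_nbhs r0) => x hx S p _ ->; apply: hr.
        have hbase := jholo_base hb0 hnf; rewrite hbase.
        by apply: nearj2 hnf hfr => S p _ ->.
      apply: nearj_all => S p hb; suff -> : Icoef j k S p = Icoef j k S0 p0 by rewrite subrr nrm0.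
      have [h0 [h1 h2 h3] [h4 h5 h6 h7] _] := Icoef_normalized hb.
      have [g0 [g1 g2 g3] [g4 g5 g6 g7] _] := Icoef_normalized hb0.
      have [l|l] := ltnP (j + k) 2; first by rewrite h0 // g0.
      have l3 : (j + k <= 3)%N by apply: leq_trans hjk n4.
      by move: j k l l3 {hjk h} => [|[|[|[|j]]]] [|[|[|[|k]]]] //= _ _; congruence.
    apply: nearjS hc => S p hb hlt S' hn; by rewrite (h _ _ _ hn) (h _ _ _ hn0).
  have hall : \forall z \near jet n S0 p0, forall i S p, branch S p -> jet n S p = z ->
      forall S', normal_at S p S' -> nrm (jet n S' 0 i 0 - jet n S0' 0 i 0) < e.
    have /choice[r hr] : forall i, exists r : R, 0 < r /\ forall x, inbox r x -> forall S p, branch S p ->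
        jet n S p = jet n S0 p0 + x -> forall S', normal_at S p S' -> nrm (jet n S' 0 i 0 - jet n S0' 0 i 0) < e.
      by move=> i; have [r r0 h] := nbhs_inbox (hi i); exists r.
    have [s s0 hs] := fin_pos (fun m => (hr m).1).
    apply: (inbox_nbhs s0) => x hx i; apply: (hr i).2 => l; exact: le_trans (hx l) (hs i).
  rewrite e0; move: hall; apply: filterS => z hz S p S' hb hj hn.
  by apply: he => i; apply: (hz i S p).
have hD0 : \forall z \near z0, branch_jets z -> D z.
  rewrite e0; have [f0 _ h] := hhol _ hz0; move: h; apply: filterS => z h /h; by case.
move: hc hD0; apply: filterS2 => z hz hDz S p hS hp hj /=.
have hb : branch S p by split.
have [S' [hb' hm ht]] := normal_surface_ex hb; have hn : normal_at S p S' by split.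
have [k1 k2] := hz S p S' hb hj hn.
have [[hg _ _] _] := normal4_low (normP hb).
have hbz : branch_jets z by exists S, p.
have hDS : D (jet n S p) by rewrite hj; apply: hDz.
have [hD' hJ'] := hinv _ _ _ _ _ hg hb.1 hb'.1 hb.2 hb'.2 hm hDS.
have eq := hlq S p S' hb hn.
split; first by apply: holo_polymap; rewrite eq.
rewrite -hj -hJ' /H eq.
by have [] : D (jet n S' 0) /\ J (jet n S' 0) = f1 (jet n S' 0) by apply: k2; exists S', 0; case: hb'.
Qed.

Lemma FF_values (I : nat -> nat -> C) : normalized I ->
  [/\ FFx I 3 1 = 2%:R / 3%:R, FFy I 3 1 = 0, FFx I 2 2 = 0 & FFy I 2 2 = 0] /\
  [/\ FFx I 1 3 = 0, FFy I 1 3 = 0, FFy I 5 0 = 24%:R^-1, FFx I 4 1 = 5%:R / 24%:R &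
      FFy I 4 1 = I 3%N 1%N / 3%:R].
Proof.
move=> hI; have [[f20 f11 f02] [f30 f21 f12 f03] f40] := fc_low hI.
have [[f31 _ _ _ _] _] := fc_val4 I.
have lo j k : (j + k < 2)%N -> fc I j k = 0 by case: hI => h _ _ _ /h /fcz.
have z00 := @fcut0 R I 0 0 isT; have z10 := @fcut0 R I 1 0 isT; have z01 := @fcut0 R I 0 1 isT.
have y00 := lo 0%N 0%N isT; have y10 := lo 1%N 0%N isT; have y01 := lo 0%N 1%N isT.
have c20 : fc (cut I) 2 0 = 0 by rewrite fcutE.
have c11 : fc (cut I) 1 1 = 1 by rewrite fcutE.
have c02 : fc (cut I) 0 2 = 0 by rewrite fcutE.
have c30 : fc (cut I) 3 0 = 6%:R^-1 by rewrite fcutE.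
have c21 : fc (cut I) 2 1 = 0 by rewrite fcutE.
have c12 : fc (cut I) 1 2 = 0 by rewrite fcutE.
have c03 : fc (cut I) 0 3 = 0 by rewrite fcutE.
have c40 : fc (cut I) 4 0 = 24%:R^-1 by rewrite fcutE.
have c31 : fc (cut I) 3 1 = I 3%N 1%N / 6%:R by rewrite fcutE.
by split; split; rewrite /FFx /FFy !big_ord_recl !big_ord0 /= /bump /= ?subnE /=;
rewrite ?z00 ?z10 ?z01 ?y00 ?y10 ?y01 ?c20 ?c11 ?c02 ?c30 ?c21 ?c12 ?c03 ?c40 ?c31;
rewrite ?f20 ?f11 ?f02 ?f30 ?f21 ?f12 ?f03 ?f40 ?f31 ?mulr0 ?mul0r ?addr0 ?add0r //; field.
Qed.

Lemma I41_formula (S : graphed R) p : branch S p ->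
  Icoef 4 1 S p = - 8 * Icoef 3 1 S p ^+ 2 + 2 * Icoef 5 0 S p * Icoef 3 1 S p
    + inv_deriv 0 S (Icoef 3 1 S) p + 7 / 2 * Icoef 2 2 S p - 2 * Icoef 3 1 S p.
Proof.
move=> hb; have := @inv_deriv_x _ 3 1 S p hb isT; cbv zeta beta.
have [[-> -> _ _] _] := FF_values (Icoef_normalized hb); rewrite /mu /= => ->.
rewrite (_ : 3`! = 6)%N // (_ : 1`! = 1)%N //; by field.
Qed.
End Generation.

(** * Homogeneous surfaces *)
Section Homogeneous.
Variable R : realType.
Notation C := (Cx R).
Notation BP := {poly {poly C}}.
Local Notation pnt := Defs.point.
Local Opaque partial holomorphic_at taylor_at hessian partials jeq.
Local Opaque bC bX bY bc bev cut fc.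
Local Notation xx := (bX R).
Local Notation yy := (bY R).

Lemma quad_cst (f : R -> R) : (forall x, exists K r : R, 0 < r /\
    forall s, `|s| <= r -> `|f (x + s) - f x| <= K * s ^+ 2) -> forall x y, f x = f y.
Proof.
move=> h x y; apply: is_derive_0_is_cst => {x y} x.
have [K [r [r0 H]]] := h x.
suff hc : (fun s : R => s^-1 *: (f (s *: (1 : R) + x) - f x)) @ 0^' --> (0 : R).
  by apply: DeriveDef; [apply: cvgP hc|apply: cvg_lim hc; exact: norm_hausdorff].
move=> A /= /nbhs_ballP[e /= e0 HA].
have K0 : 0 < `|K| + 1 by rewrite ltr_wpDl.
apply/nbhs_ballP; exists (Num.min r (e / (`|K| + 1))) => /=; first by rewrite lt_min r0 divr_gt0.
move=> s; rewrite /ball /= sub0r normrN lt_min => /andP[sr se] s0; apply: HA.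
rewrite /ball /= sub0r normrN normrM normfV scaler1.
rewrite [s + x]addrC mulrC ltr_pdivrMr ?normr_gt0 //.
apply: le_lt_trans (H s (ltW sr)) _.
apply: (@le_lt_trans _ _ (`|K| * `|s| ^+ 2)); first by rewrite real_normK ?num_real // ler_wpM2r ?sqr_ge0 // ler_norm.
rewrite expr2 mulrA ltr_pM2r ?normr_gt0 //; move: se; rewrite ltr_pdivlMr // mulrC.
by apply: le_lt_trans; rewrite ler_wpM2r // lerDl.
Qed.

Lemma ReD (x y : C) : complex.Re (x - y) = complex.Re x - complex.Re y :> R.
Proof. by case: x => ? ?; case: y. Qed.
Lemma ImD (x y : C) : complex.Im (x - y) = complex.Im x - complex.Im y :> R.
Proof. by case: x => ? ?; case: y. Qed.

(** Extends a path from the unit interval to the line, so that the theorem about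
    functions with vanishing derivative on the whole line applies. *)
Definition clamp (t : R) : R := Num.max 0 (Num.min 1 t).
Lemma clamp_lip t s : `|clamp (t + s) - clamp t| <= `|s|.
Proof.
have [s0|s0] := lerP 0 s; rewrite ?(ger0_norm s0) ?(ltr0_norm s0) /clamp !maxEle !minEle;
case: (lerP 1 (t + s)) => ?; case: (lerP 1 t) => ?; rewrite ?ler01; case: (lerP 0 t) => ?;
by case: (lerP 0 (t + s)) => ?; rewrite ler_norml; apply/andP; split; lra.
Qed.
Lemma clamp01 t : 0 <= clamp t <= 1.
Proof. by rewrite /clamp le_max lexx /= ge_max ler01 ge_min lexx. Qed.

(** Along the segment, the real and imaginary parts have derivative zero. *)
Lemma flat_segment (f : 'cV[C]_2 -> C) (a h : 'cV[C]_2) :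
  (forall t : R, 0 <= t <= 1 -> exists K r : R, 0 < r /\ forall rho k, 0 <= rho -> rho <= r ->
     inbox rho k -> nrm (f (a + (t%:C%C : C) *: h + k) - f (a + (t%:C%C : C) *: h)) <= K * rho ^+ 2) ->
  f (a + h) = f a.
Proof.
move=> H.
pose g (t : R) : C := f (a + ((clamp t)%:C%C : C) *: h).
have hq (F : C -> R) : (forall x y, F (x - y) = F x - F y) -> (forall x, `|F x| <= nrm x) ->
    F (g 0) = F (g 1).
  move=> FD Fn; apply: (@quad_cst (fun t => F (g t))) => t.
  have [K [r [r0 hk]]] := H _ (clamp01 t).
  (* A step s of the parameter moves the point by at most B s. *)
  pose B := 1 + nrm (h 0 0) + nrm (h 1 0).
  have n0 := nrm_ge0 (h 0 0); have n1 := nrm_ge0 (h 1 0).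
  have B0 : 0 < B by rewrite /B; lra.
  exists (`|K| * B ^+ 2), (r / B); split=> [|s hs]; first by rewrite divr_gt0.
  rewrite -FD; apply: le_trans (Fn _) _; rewrite /g.
  have -> : a + ((clamp (t + s))%:C%C : C) *: h = a + ((clamp t)%:C%C : C) *: h +
      ((clamp (t + s) - clamp t)%:C%C : C) *: h.
    rewrite -addrA -scalerDl -rmorphD /= (_ : clamp t + _ = clamp (t + s)) //.
    by rewrite addrC subrK.
  have sB : B * `|s| <= r by rewrite mulrC -ler_pdivlMr.
  apply: le_trans (hk (B * `|s|) _ _ sB _) _; first by rewrite mulr_ge0 // ltW.
    move=> i; rewrite mxE nrmM; apply: (@le_trans _ _ (`|s| * nrm (h i 0))).
      rewrite ler_wpM2r ?nrm_ge0 //.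
      have -> : nrm (((clamp (t + s) - clamp t)%:C%C : C)) = `|clamp (t + s) - clamp t|.
        have [q|q] := lerP 0 (clamp (t + s) - clamp t); first by rewrite nrmR // ger0_norm.
        by rewrite -nrmN -rmorphN nrmR ?oppr_ge0 ?ltW // ltr0_norm.
      exact: clamp_lip.
    by rewrite mulrC ler_wpM2r // /B; case: (ord2P i) => ->; lra.
  rewrite exprMn real_normK ?num_real // mulrA ler_wpM2r ?sqr_ge0 // ler_wpM2r ?ler_norm //.
  by rewrite exprn_ge0 // ltW.
have g0 : g 0 = f a by rewrite /g /clamp min_r ?ler01 // max_r // scale0r addr0.
have g1 : g 1 = f (a + h) by rewrite /g /clamp min_r // max_r ?ler01 // scale1r.
have e1 := hq (fun x => complex.Re x) ReD (@nrm_re R).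
have e2 := hq (fun x => complex.Im x) ImD (@nrm_im R).
rewrite g0 g1 in e1 e2; move: e1 e2; case: (f a) => x y; case: (f (a + h)) => x' y' /= -> ->.
by [].
Qed.

Lemma jet_dir_lin n (S : graphed R) p (e : 'cV[C]_2) m :
  jet_dir n S p e m 0 = e 0 0 * jet_dir n S p (delta_mx 0 0) m 0 + e 1 0 * jet_dir n S p (delta_mx 1 0) m 0.
Proof.
case: (split_ordP m) => l ->; rewrite /jet_dir ?col_mxEu ?col_mxEd !mxE.
  by case: (ord2P l) => -> /=; rewrite ?mulr1n ?mulr0n ?mulr1 ?mulr0 ?addr0 ?add0r.
by rewrite /= ?mulr1n ?mulr0n ?mulr1 ?mulr0 ?addr0 ?add0r mulrC [X in _ + X]mulrC.
Qed.

(** The two invariant derivatives are derivatives in independent directions, so both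
    partial derivatives vanish, and the first order expansion has a quadratic error. *)
Lemma flat_invariant f (S : graphed R) p : branch S p -> jinv f ->
  (forall i, inv_deriv i S (f S) p = 0) -> exists K r : R, 0 < r /\ forall rho k, 0 <= rho -> rho <= r ->
   inbox rho k -> nrm (f S (pnt (coord_xy p + k) (fn S (coord_xy p + k))) - f S p) <= K * rho ^+ 2.
Proof.
move=> hb [hi [n [n4 hj]]] h0; have [fh h1 h2] := hj _ _ hb.
have [S' [hb' hm ht]] := normal_surface_ex hb.
pose L e := \sum_m partial m fh (jet n S p) * jet_dir n S p e m 0.
have Llin e : L e = e 0 0 * L (delta_mx 0 0) + e 1 0 * L (delta_mx 1 0).
  rewrite /L !mulr_sumr -big_split; apply: eq_bigr => m _.
  rewrite jet_dir_lin; move: (partial _ _ _) (jet_dir _ _ _ _ _ _) (jet_dir _ _ _ _ _ _) => u v w /=; ring.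
have LA i : L (\col_l adA (phi S p) l i) = 0.
  by rewrite -(h0 i) (inv_deriv_jholo hb hb' hm ht i hi h1 h2).
have [hg lo] := normal4_low (normP hb).
have AM := adA_unit (branch_surface hb) (branch_graph hb) hg lo.
have L0 l : L (delta_mx l 0) = 0.
  have e (M : 'M[C]_2) : adA (phi S p) *m M = 1%:M ->
      L (delta_mx l 0) = M 0 l * L (\col_j adA (phi S p) j 0) + M 1 l * L (\col_j adA (phi S p) j 1).
    move=> hM; have hMl j : adA (phi S p) j 0 * M 0 l + adA (phi S p) j 1 * M 1 l = (j == l)%:R.
      by have := congr1 (fun X : 'M[C]_2 => X j l) hM; rewrite mul2E [X in _ = X]mxE.
    rewrite [RHS](_ : _ = (adA (phi S p) 0 0 * M 0 l + adA (phi S p) 0 1 * M 1 l) * L (delta_mx 0 0)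
      + (adA (phi S p) 1 0 * M 0 l + adA (phi S p) 1 1 * M 1 l) * L (delta_mx 1 0)).
      by rewrite !hMl; case: (ord2P l) => -> /=; rewrite ?mulr1n ?mulr0n ?mul1r ?mul0r ?addr0 ?add0r.
    rewrite (Llin (\col_j adA (phi S p) j 0)) (Llin (\col_j adA (phi S p) j 1)) !mxE.
    move: (L _) (L _) => u v; ring.
  by rewrite (e _ AM) !LA !mulr0 addr0.
have xyk k : coord_xy (pnt (coord_xy p + k) (fn S (coord_xy p + k))) = coord_xy p + k.
  exact: coord_xy_point.
have hgr : \forall k \near (0 : 'cV[C]_2), graph S (pnt (coord_xy p + k) (fn S (coord_xy p + k))).
  have [op _ _ _ _] := branch_surface hb; have [hd _] := branch_graph hb.
  have /nbhs_inbox[r r0 hr] : nbhs (coord_xy p) (dom S) by apply: open_nbhs_nbhs.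
  by apply: (inbox_nbhs r0) => k hk; rewrite add0r; apply: graph_pt; apply: hr.
have hdd i : dd i (fun k => f S (pnt (coord_xy p + k) (fn S (coord_xy p + k)))) (f S p) 0.
  rewrite -(L0 i); apply: (dd_jholo hb h1 h2 _ hgr) => l.
  rewrite [X in dd _ _ _ X]mxE eqxx andbT eq_sym.
  have := ddD (dd_cst i (coord_xy p l 0)) (dd_coord R i l); rewrite addr0 add0r.
  by apply: dd_fun; apply/funext => k; rewrite xyk [RHS]mxE.
have [P [j0 c0 d0]] := hdd 0; have [Q [j1 _ d1']] := hdd 1.
have hj2 : jeq 2 (fun k => f S (pnt (coord_xy p + k) (fn S (coord_xy p + k)))) (bC (f S p)).
  have e := jet_unique j0 j1.
  apply: jeq_mod j0 => j k hjk; rewrite bc_CE.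
  have e01 : bc P 0 1 = 0 by rewrite e.
  by move: j k hjk => [|[|j]] [|[|k]] //= _.
Local Transparent jeq.
have [K [r [r0 K0 H]]] := hj2; exists K, r; split=> // rho k rho0 hr hk.
by have := H rho k rho0 hr hk; rewrite bev_bC.
Qed.
Local Opaque jeq.

(** Locally constant on the domain, which is connected. *)
Lemma flat_constant f (S : graphed R) : in_B21 S -> jinv f ->
  (forall p i, graph S p -> inv_deriv i S (f S) p = 0) ->
  forall p q, graph S p -> graph S q -> f S p = f S q.
Proof.
move=> hS hf h0.
have surf : surface S by case: hS => -[].
have [op cn _ _ _] := surf.
pose F a := f S (pnt a (fn S a)).
have loc a : dom S a -> \forall b \near a, dom S b /\ F b = F a.
  move=> ha; have /nbhs_inbox[r r0 hr] : nbhs a (dom S) by apply: open_nbhs_nbhs.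
  apply: (inbox_nbhs r0) => k hk; split; first exact: hr.
  apply: flat_segment => t /andP[t0 t1]; pose b := a + (t%:C%C : C) *: k.
  have hb : dom S b.
    apply: hr => i; rewrite mxE nrmM nrmR //.
    by apply: le_trans (hk i); rewrite ler_piMl ?nrm_ge0.
  have gb := graph_pt hb.
  have := flat_invariant (conj hS gb) hf (fun i => h0 _ i gb).
  by rewrite coord_xy_point.
move=> p q hp hq.
have [dp _] := hp; have [dq _] := hq.
suff : [set a | dom S a /\ F a = f S p] = dom S.
  move=> e; have : [set a | dom S a /\ F a = f S p] (coord_xy q) by rewrite e.
  by case=> _ e1; rewrite -e1 /F -(graph_point hq).
apply: cn.
- by exists (coord_xy p); split=> //; rewrite /F -(graph_point hp).
- exists [set a | dom S a /\ F a = f S p].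
    rewrite openE => a [ha e]; have := loc a ha; rewrite /interior; apply: filterS => b [hb e'].
    by split=> //; rewrite e' e.
  by apply/seteqP; split=> a; [case=> ha e; split|case].
- exists (~` [set a | dom S a /\ F a <> f S p]).
    apply: open_closedC; rewrite openE => a [ha e]; have := loc a ha; rewrite /interior.
    by apply: filterS => b [hb e']; split=> //; rewrite e'.
  apply/seteqP; split=> a.
    by case=> ha e; split=> // -[].
  by case=> ha hn; split=> //; apply: contrapT => hne; apply: hn.
Qed.

Lemma tangent_push g (S S' : graphed R) w w' t : surface S -> surface S' -> graph S w -> graph S' w' ->
  germ_map g S w S' w' -> tangent_plane S w t -> tangent_plane S' w' (g.1 *m t).
Proof.
move=> hS hS' hw hw' [gw hm] ht.
have [op _ _ _ _] := hS; have [hd _] := hw; have [hd' _] := hw'.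
pose a := coord_xy w.
pose al (h : 'cV[C]_2) : 'cV[C]_2 := a + h 0 0 *: coord_xy t.
have ha l : dd 0 (fun h => al h l 0) (a l 0) (coord_xy t l 0).
  have := ddD (dd_cst 0 (a l 0)) (ddZ (coord_xy t l 0) (dd_coord R 0 0)).
  rewrite mulr0 addr0 add0r eqxx mulr1; apply: dd_fun; apply/funext => h.
  by rewrite /al !mxE mulrC.
have hf : dd 0 (fun h => fn S (al h)) (fn S a) (coord_u t).
  have := dd_comp (surface_holo hS hd) ha; rewrite sum2 xy0 xy1.
  by have -> : coord_u t = partial 0 (fn S) a * t 0 0 + partial 1 (fn S) a * t 1 0 by exact: ht.
pose W h := pnt (al h) (fn S (al h)).
have hW i : dd 0 (fun h => W h i 0) (w i 0) (t i 0).
  case: (ord3P i) => ->.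
  - have := ha 0; rewrite /a !xy0; apply: dd_fun; apply/funext => h; by rewrite point0.
  - have := ha 1; rewrite /a !xy1; apply: dd_fun; apply/funext => h; by rewrite point1.
  have := hf; rewrite /coord_u (_ : fn S a = w ord_max 0); last by case: hw.
  by apply: dd_fun; apply/funext => h; rewrite point2.
have hgW i : dd 0 (fun h => aff g (W h) i 0) (w' i 0) ((g.1 *m t) i 0).
  have := ddD (ddD (ddD (ddZ (g.1 i 0) (hW 0)) (ddZ (g.1 i 1) (hW 1))) (ddZ (g.1 i ord_max) (hW ord_max))) (dd_cst 0 (g.2 i 0)).
  rewrite -affE gw addr0 [X in _ -> dd _ _ _ X]mxE sum3.
  by apply: dd_fun; apply/funext => h; rewrite affE.
have hxy l : dd 0 (fun h => coord_xy (aff g (W h)) l 0) (coord_xy w' l 0) (coord_xy (g.1 *m t) l 0).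
  case: (ord2P l) => ->; rewrite ?xy0 ?xy1.
    by apply: dd_fun (hgW 0); apply/funext => h; rewrite xy0.
  by apply: dd_fun (hgW 1); apply/funext => h; rewrite xy1.
have hf' := dd_comp (surface_holo hS' hd') hxy.
have hW0 : \forall h \near (0 : 'cV[C]_2), graph S' (aff g (W h)).
  have n1 : \forall h \near (0 : 'cV[C]_2), dom S (al h).
    by apply: (near_vec ha); apply: open_nbhs_nbhs.
  have n2 := near_vec hW hm; apply: filterS2 n1 n2 => h h1 [h2 _]; apply: h2; exact: graph_pt.
have e : \forall h \near (0 : 'cV[C]_2), fn S' (coord_xy (aff g (W h))) = aff g (W h) ord_max 0.
  by apply: filterS hW0 => h [_ <-].
have [_ E] := dd_unique (hgW ord_max) (dd_eq e hf').
by rewrite /tangent_plane /= /coord_u E sum2 xy0 xy1.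
Qed.

(** For a field tangent to a normalized graph, expanding the tangency condition in power
    series gives the recurrence with the matrix of the field in the place of the
    derivatives of the normalizing map, the surface itself being left unchanged. *)
Lemma field_recurs (F : 'cV[C]_2 -> C) I X : taylor_at F 0 (Defs.double I) -> normalized I ->
  (\forall h \near (0 : 'cV[C]_2), coord_u (aff X (pnt h (F h))) =
     partial 0 F h * aff X (pnt h (F h)) 0 0 + partial 1 F h * aff X (pnt h (F h)) 1 0) ->
  recurs (X.2 0 0) (X.2 1 0) I (fun _ _ => 0).
Proof.
move=> ht hI hX; have [lo _ _ _] := hI.
exists (- X.1 ord_max ord_max), (\matrix_(i, j) X.1 (emb i) (emb j)), (- X.1 0 ord_max), (- X.1 1 ord_max).
move=> j k h2; pose N := (j + k).+1; have jkN : (j + k < N)%N by [].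
pose W := Np N (cut I) xx yy.
have bcW a b : (a + b < N)%N -> bc W a b = fc (cut I) a b.
  by move=> hab; rewrite /W -bpoly_Np bc_bpoly_lt.
have shift0 (f : 'cV[C]_2 -> C) : (fun h => f (0 + h)) = f by apply/funext => h; rewrite add0r.
have hF : jeq N F W.
  have := jeq_taylor N ht; rewrite shift0; apply: jeq_mod => a b hab.
  rewrite bcW // bc_bpoly_lt //; have [l|l] := leqP 2 (a + b); first by rewrite fcutE.
  by rewrite fcut0 // lo // mul0r.
pose T0 := bpoly N (fc (fun x y => I (x + 1)%N (y + 0)%N)).
pose T1 := bpoly N (fc (fun x y => I (x + 0)%N (y + 1)%N)).
have h0 : jeq N (partial 0 F) T0.
  by have := jeq_taylor N (taylor_shift 1 0 ht); rewrite shift0.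
have h1 : jeq N (partial 1 F) T1.
  by have := jeq_taylor N (taylor_shift 0 1 ht); rewrite shift0.
have t0 a b : (a + b < N)%N -> bc T0 a b = a.+1%:R * fc I a.+1 b.
  move=> hab; rewrite /T0 bc_bpoly_lt //; have := fc_shift I 1 0 a b.
  rewrite mul1r mul0r addr0 => <-; rewrite !fcE addn1 addn0; by rewrite mul1r mul0r addr0.
have t1 a b : (a + b < N)%N -> bc T1 a b = b.+1%:R * fc I a b.+1.
  move=> hab; rewrite /T1 bc_bpoly_lt //; have := fc_shift I 0 1 a b.
  rewrite mul1r mul0r add0r => <-; rewrite !fcE addn1 addn0; by rewrite mul1r mul0r add0r.
pose c i := bC (X.1 i 0) * xx + bC (X.1 i 1) * yy + bC (X.1 i ord_max) * W + bC (X.2 i 0).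
have hc i : jeq N (fun h => aff X (pnt h (F h)) i 0) (c i).
  have := jeqD (jeqD (jeqD (jeq_ev N (bC (X.1 i 0) * xx)) (jeq_ev N (bC (X.1 i 1) * yy)))
     (jeqM (jeqC N (X.1 i ord_max)) hF)) (jeqC N (X.2 i 0)).
  congr (jeq _ _ _); apply/funext => h; rewrite affE point0 point1 point2.
  by rewrite (bevM (bC _)) (bevM (bC (X.1 i 1))) !bev_bC bev_bX bev_bY.
have hl : jeq N (fun h => coord_u (aff X (pnt h (F h)))) (T0 * c 0 + T1 * c 1).
  apply: jeq_eq (jeqD (jeqM h0 (hc 0)) (jeqM h1 (hc 1))); by apply: filterS hX => h ->.
have := jet_unique (hc ord_max) hl jkN.
rewrite mulrC [T1 * _]mulrC /c.
have nz : ((j == 0) && (k == 0))%N = false by apply/negbTE; lia.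
have nx : ((j == 1) && (k == 0))%N = false by apply/negbTE; lia.
have ny : ((j == 0) && (k == 1))%N = false by apply/negbTE; lia.
have cz (u : C) : bc (bC u) j k = 0 by rewrite bc_CE nz.
have xz (u : C) : bc (bC u * xx) j k = 0 by rewrite bc_C bc_bX1 nx mulr0.
have yz (u : C) : bc (bC u * yy) j k = 0 by rewrite bc_C bc_bY1 ny mulr0.
have D3 (u v w z T : BP) : (u + v + w + z) * T = (u + v) * T + w * T + z * T by rewrite !mulrDl.
have s0 a b : (a + b + 1 < N)%N -> bc T0 a b = a.+1%:R * fc I a.+1 b by move=> ?; apply: t0; lia.
have s1 a b : (a + b + 1 < N)%N -> bc T1 a b = b.+1%:R * fc I a b.+1 by move=> ?; apply: t1; lia.
rewrite !D3 !bcD -!(mulrA (bC _) W) cz xz yz !bc_C bcW // fcutE //.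
rewrite (bc_linTX _ _ s0 jkN) (bc_linTY _ _ s1 jkN) (bc_FFx s0 jkN) (bc_FFy s1 jkN) t0 // t1 //.
rewrite fc_shift [fc (fun _ _ => 0) j k]fcz //.
have mE (a b : 'I_2) : (\matrix_(i, j) X.1 (emb i) (emb j) : 'M[C]_2) a b = X.1 (emb a) (emb b) by rewrite mxE.
rewrite !mE /emb /=.
move: (predk _ _ _) (predj _ _ _) (FFx _ _ _) (FFy _ _ _) => u v X1 Y1.
rewrite !add0r addr0.
move: (X.1 ord_max ord_max) (X.1 0 0) (X.1 0 1) (X.1 1 0) (X.1 1 1) (X.1 0 ord_max) (X.1 1 ord_max).
by move=> m22 m00 m01 m10 m11 m02 m12 e; rewrite mulNr e; ring.
Qed.

(** Homogeneity provides a field tangent to S with any given tangent value at p; its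
    image under the normalizing map is tangent to the normalized surface. *)
Lemma homogeneous_recurs (S : graphed R) p (i : 'I_2) : branch S p -> homogeneous S ->
  recurs (i == 0)%:R (i == 1)%:R (fun j k => Icoef j k S p) (fun _ _ => 0).
Proof.
move=> hb hH; have [S' [hb' hm ht]] := normal_surface_ex hb.
have hI := Icoef_normalized hb; have [lo _ _ _] := hI.
have [[hg _ _] _] := normal4_low (normP hb).
pose g := phi S p.
pose e : 'cV[C]_3 := delta_mx (emb i) 0.
have he : tangent_plane S' 0 e.
  rewrite /tangent_plane /= /coord_u.
  have -> : coord_xy (0 : 'cV[C]_3) = 0.
    by apply/matrixP => i' j; rewrite ord1 [RHS]mxE; case: (ord2P i') => ->; rewrite ?xy0 ?xy1 mxE.
  have e0 : partial 0 (fn S') 0 = 0.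
    by have := partials_taylor 1 0 ht; rewrite lo.
  have e1 : partial 1 (fn S') 0 = 0.
    by have := partials_taylor 0 1 ht; rewrite lo.
  by rewrite e0 e1 !mul0r addr0 mxE emb_max.
have hmi := germ_inv hg hm.
have htg := tangent_push (branch_surface hb') (branch_surface hb) (branch_graph hb') (branch_graph hb) hmi he.
have [X hX Xp] := hH p (branch_graph hb) _ htg.
(* The field transported by the normalizing map. *)
pose X' : affine R := (g.1 *m X.1 *m (affi g).1, g.1 *m (X.1 *m (affi g).2 + X.2)).
have X'E v : aff X' v = g.1 *m aff X (aff (affi g) v).
  by rewrite /aff /= !mulmxDr !mulmxA addrA.
have X'0 : X'.2 = e.
  have := X'E 0; rewrite -(proj1 hm) affK // Xp (proj1 hm) /aff mulmx0 add0r => ->.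
  by rewrite /= mulmxA mulmxV // mul1mx.
have <- : X'.2 0 0 = (i == 0)%:R.
  by rewrite X'0 mxE eqxx andbT; case: (ord2P i) => ->.
have <- : X'.2 1 0 = (i == 1)%:R.
  by rewrite X'0 mxE eqxx andbT; case: (ord2P i) => ->.
apply: (field_recurs ht hI).
have := curve_germ hb hb' hm ht; apply: filterS => h [h1 h2 h3].
have := tangent_push (branch_surface hb) (branch_surface hb') h1 h2 h3 (hX _ h1).
have <- : aff X' (pnt h (fn S' h)) = (phi S p).1 *m aff X (curve S S' p h) by rewrite X'E.
by rewrite /tangent_plane /= coord_xy_point.
Qed.

End Homogeneous.

(** * The moduli space of homogeneous surfaces *)
Section Moduli.
Variable R : realType.
Notation C := (Cx R).
Local Notation pnt := Defs.point.
Local Opaque partial holomorphic_at taylor_at hessian partials jeq.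
Local Opaque bC bX bY bc bev cut fc.

Section AtPoint.
Variables (S : graphed R) (p : 'cV[C]_3).
Hypotheses (hb : branch S p) (hH : homogeneous S).
Local Notation I := (fun j k => Icoef j k S p).

Lemma hom_x j k : (2 <= j + k)%N ->
  0 = I j.+1 k + ((3%:R - j%:R - 2%:R * k%:R) * mu I + k%:R - 1) * I j k
   - j%:R / 2%:R * predj (fun j k => I j k.+1) j k
   - j`!%:R * k`!%:R * (I 2%N 2%N / 2%:R * FFx I j k + I 3%N 1%N / 2%:R * FFy I j k).
Proof.
move=> h; have := homogeneous_recurs 0 hb hH.
move=> /(rec_x (Icoef_normalized hb) (fun _ _ _ => erefl))[_ e].
exact: (e j k h).
Qed.

Lemma hom_y j k : (2 <= j + k)%N ->
  0 = I j k.+1 + ((3%:R - j%:R - 2%:R * k%:R) * nu I + (k%:R - 1) * I 3%N 1%N) * I j k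
   - j`!%:R * k`!%:R * (I 2%N 2%N / 2%:R * FFy I j k).
Proof.
move=> h; have := homogeneous_recurs 1 hb hH.
move=> /(rec_y (Icoef_normalized hb) (fun _ _ _ => erefl) (Icoef_13 hb))[_ e].
exact: (e j k h).
Qed.

(** The recurrence determines the derivatives from the coefficients, and the tangent
    field gives the same recurrence with derivatives zero. *)
Lemma homogeneous_inv_deriv i j k : inv_deriv i S (Icoef j k S) p = 0.
Proof.
have [l|l] := ltnP (j + k) 2; first by apply: inv_deriv_cst => //; apply/orP; left; lia.
case: (ord2P i) => ->; first by rewrite (inv_deriv_x hb l) -(hom_x l).
by rewrite (inv_deriv_y hb l) -(hom_y l).
Qed.
End AtPoint.

Lemma homogeneous_Icoef (S : graphed R) j k p q : in_B21 S -> homogeneous S -> graph S p -> graph S q ->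
  Icoef j k S p = Icoef j k S q.
Proof.
move=> hS hH hp hq; apply: (flat_constant hS (jinv_Icoef R j k)) => // p' i hp'.
by apply: homogeneous_inv_deriv.
Qed.

(** Assuming b nonzero, a = 3n allows one to express b and e through m and n, and the
    last equation then forces 3m = 1 and n = 0. *)
Lemma moduli_elim (a b c d e m n : C) : m = c - 1 - 4%:R * a -> n = d - a - 2%:R * b ->
  d = 2%:R * m * a + 7%:R / 2%:R * b -> e = (3%:R * m - 1) * b -> e = 2%:R * n * a ->
  b * (a - 3%:R * n) = 0 -> 3%:R * m * d + 2%:R * e + 4%:R * a ^+ 2 - (2%:R * n + a) * c = 0 ->
  b = 0.
Proof.
move=> hm hn h1 h2 h3 h4 h5; apply/eqP; apply: contraT => b0.
have nz (k : nat) : k.+1%:R != 0 :> C by rewrite pnatr_eq0.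
have {}h4 : a = 3%:R * n by apply/eqP; rewrite -subr_eq0; move/eqP: h4; rewrite mulf_eq0 (negPf b0).
have hd : d = 4%:R * n + 2%:R * b.
  have e0 : d = n + a + 2%:R * b by rewrite hn; ring.
  by rewrite e0 h4; ring.
have e1 : 3%:R * b = (8%:R - 12%:R * m) * n.
  apply/eqP; rewrite -subr_eq0; apply/eqP.
  have := h1; rewrite hd h4 => /eqP; rewrite -subr_eq0 => /eqP h.
  have -> : 3%:R * b - (8%:R - 12%:R * m) * n = (- 2%:R) * (4%:R * n + 2%:R * b - (2%:R * m * (3%:R * n) + 7%:R / 2%:R * b)) by field.
  by rewrite h mulr0.
have n0 : n != 0.
  by apply: contraNneq b0 => n0; move: e1; rewrite n0 mulr0 => /eqP; rewrite mulf_eq0 (negPf (nz 2)).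
have e2 : 18%:R * n = (8%:R - 12%:R * m) * (3%:R * m - 1).
  apply: (mulIf n0); have -> : 18%:R * n * n = 3%:R * e by rewrite h3 h4; ring.
  by rewrite h2 mulrCA e1; ring.
have hc : c = m + 1 + 12%:R * n by rewrite hm h4; ring.
have e3 : 23%:R * m - 24%:R * m ^+ 2 - 5%:R - 12%:R * n = 0.
  apply: (mulIf n0); rewrite mul0r.
  have -> : (23%:R * m - 24%:R * m ^+ 2 - 5%:R - 12%:R * n) * n =
     3%:R * m * d + 2%:R * e + 4%:R * a ^+ 2 - (2%:R * n + a) * c
      - 2%:R * m * (3%:R * b - (8%:R - 12%:R * m) * n).
    by rewrite hd h3 h4 hc; ring.
  by rewrite h5 e1 subrr mulr0 subr0.
have m3 : 3%:R * m = 1.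
  apply/eqP; rewrite -subr_eq0; apply/eqP.
  have -> : 3%:R * m - 1 = - 3%:R * (23%:R * m - 24%:R * m ^+ 2 - 5%:R - 12%:R * n)
      - 2%:R * (18%:R * n - (8%:R - 12%:R * m) * (3%:R * m - 1)) by ring.
  by rewrite e3 e2 subrr !mulr0 subr0.
move: e2; rewrite m3 subrr mulr0 => /eqP; rewrite mulf_eq0 (negPf n0) orbF.
by rewrite (negPf (nz 17)).
Qed.

Lemma moduli_lines (a b c d e : C) : b = 0 -> e = 0 -> a = 0 /\ d = 0 \/ d = a /\ c = 3%:R / 2%:R + 4%:R * a ->
  moduli_equations a b c d e.
Proof.
by move=> -> -> [[-> ->]|[-> ->]]; rewrite /moduli_equations; split; split; field.
Qed.

(** The recurrences of order four in both directions give the first four equations. The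
    two expressions of the coefficient with exponents (5, 1) give one more relation,
    which forces the coefficient with exponents (2, 2) to vanish. *)
Lemma homogeneous_moduli (S : graphed R) p : branch S p -> homogeneous S ->
  moduli_variety (moduli_point S p).
Proof.
move=> hb hH.
exists (Icoef 3 1 S p), (Icoef 2 2 S p), (Icoef 5 0 S p), (Icoef 4 1 S p), (Icoef 3 2 S p).
split=> //.
pose I j k := Icoef j k S p; have hI := Icoef_normalized hb.
have [[x31 y31 x22 y22] [x13 y13 y50 x41 y41]] := FF_values hI.
have i13 := Icoef_13 hb; have i04 := Icoef_0n 4 hb.
have E1 := @hom_x S p hb hH 3 1 isT. have E2 := @hom_x S p hb hH 2 2 isT.
have E3 := @hom_y S p hb hH 3 1 isT. have E4 := @hom_y S p hb hH 2 2 isT.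
have E5 := @hom_x S p hb hH 1 3 isT. have E6 := @hom_y S p hb hH 5 0 isT.
have E7 := @hom_x S p hb hH 4 1 isT.
rewrite x31 y31 /mu /= in E1; rewrite x22 y22 /mu /= in E2; rewrite y31 /nu /= in E3.
rewrite y22 /nu /= in E4; rewrite x13 y13 /mu /= in E5; rewrite y50 /nu /= in E6.
rewrite x41 y41 /mu /= in E7.
have f : [/\ 1`! = 1%N, 2`! = 2%N, 3`! = 6%N, 4`! = 24%N & 5`! = 120%N] by [].
have f0 : 0`! = 1%N by []. case: f => f1 f2 f3 f4 f5.
rewrite ?f0 ?f1 ?f2 ?f3 ?f4 ?f5 i13 ?i04 in E1 E2 E3 E4 E5 E6 E7.
move: E1 E2 E3 E4 E5 E6 E7; clear.
move: (Icoef 3 1 S p) (Icoef 2 2 S p) (Icoef 5 0 S p) (Icoef 4 1 S p) (Icoef 3 2 S p) (Icoef 2 3 S p) (Icoef 5 1 S p).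
move=> a b c d e i23 i51 E1 E2 E3 E4 E5 E6 E7.
pose m := c - 1 - 4%:R * a; pose n := d - a - 2%:R * b.
have h1 : d = 2%:R * m * a + 7%:R / 2%:R * b by apply: (eq_of_sub0 (esym E1)); rewrite /m; field.
have h2 : e = (3%:R * m - 1) * b by apply: (eq_of_sub0 (esym E2)); rewrite /m; field.
have h3 : e = 2%:R * n * a by apply: (eq_of_sub0 (esym E3)); rewrite /n; field.
have i0 : i23 = 0 by apply: (eq_of_sub0 (esym E5)); field.
have h4 : b * (a - 3%:R * n) = 0.
  by apply: (eq_of_sub0 (esym E4)); rewrite i0 /n; field.
have h5 : 3%:R * m * d + 2%:R * e + 4%:R * a ^+ 2 - (2%:R * n + a) * c = 0.
  have e67 := etrans (esym E6) E7; move/eqP: e67; rewrite -subr_eq0 => /eqP e67.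
  by apply: (eq_of_sub0 e67); rewrite /m /n; field.
have b0 := moduli_elim (erefl m) (erefl n) h1 h2 h3 h4 h5.
have e0 : e = 0 by rewrite h2 b0 mulr0.
apply: (moduli_lines b0 e0).
have two0 : 2%:R != 0 :> C by rewrite pnatr_eq0.
have : n * a = 0 by apply: (mulfI two0); rewrite mulr0 mulrA -h3.
rewrite b0 mulr0 addr0 in h1.
move=> /eqP; rewrite mulf_eq0 => /orP[|] /eqP z; last by left; split=> //; rewrite h1 z mulr0.
have da : d = a by apply: (eq_of_sub0 z); rewrite /n b0; ring.
have [a0|a0] := eqVneq a 0; first by left; rewrite a0 in da.
right; split=> //.
have m2 : 2%:R * m = 1 by apply: (mulIf a0); rewrite mul1r -h1.
have -> : c = m + 1 + 4%:R * a by rewrite /m; ring.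
have -> : m = 1 / 2%:R by apply: (mulfI two0); rewrite m2; field.
by field.
Qed.

(** With vanishing derivatives the recurrence in the direction x determines all
    coefficients from the generators. Equal coefficients mean equal normalized germs. *)
Lemma moduli_equiv (S S' : graphed R) p p' : branch S p -> homogeneous S -> branch S' p' -> homogeneous S' ->
  germ_equiv S p S' p' <-> moduli_point S p = moduli_point S' p'.
Proof.
move=> hb hH hb' hH'; split.
  move=> [g hg hm]; have e j k := Icoef_invariant j k hg hb hb' hm.
  by rewrite /moduli_point !e.
move=> hmp.
have mp (T : graphed R) q (i : 'I_5) : moduli_point T q i 0 =
    tnth [tuple Icoef 3 1 T q; Icoef 2 2 T q; Icoef 5 0 T q; Icoef 4 1 T q; Icoef 3 2 T q] i.
  by rewrite mxE.
have m (i : 'I_5) := congr1 (fun v : 'cV[C]_5 => v i 0) hmp.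
have e31 : Icoef 3 1 S p = Icoef 3 1 S' p'.
  by have := m (@Ordinal 5 0 isT); rewrite !mp !(tnth_nth 0).
have e22 : Icoef 2 2 S p = Icoef 2 2 S' p'.
  by have := m (@Ordinal 5 1 isT); rewrite !mp !(tnth_nth 0).
have e50 : Icoef 5 0 S p = Icoef 5 0 S' p'.
  by have := m (@Ordinal 5 2 isT); rewrite !mp !(tnth_nth 0).
have hI := Icoef_normalized hb; have hI' := Icoef_normalized hb'.
have E n : forall j k, (j + k <= n)%N -> Icoef j k S p = Icoef j k S' p'.
  elim: n => [|n IH] j k h.
    by case: hI => h0 _ _ _; case: hI' => h0' _ _ _; rewrite h0 ?h0' //; lia.
  have [l|l] := leqP (j + k) n; first exact: IH.
  case: j h l => [|j] h l; first by rewrite !Icoef_0n.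
  have [l4|l4] := ltnP n 4.
    have [h0 [h1 h2 h3] [h4 h5 h6 h7] h8] := hI; have [g0 [g1 g2 g3] [g4 g5 g6 g7] g8] := hI'.
    have i13 := Icoef_13 hb; have i13' := Icoef_13 hb'.
    have [l2|l2] := ltnP (j.+1 + k) 2; first by rewrite h0 ?g0.
    have l5 : (j.+1 + k <= 4)%N by lia.
    by move: j k l2 l5 {h l} => [|[|[|[|j]]]] [|[|[|[|k]]]] //= _ _; congruence.
  have [/andP[/eqP j4 /eqP k0]|ne] := boolP ((j == 4) && (k == 0))%N; first by rewrite j4 k0.
  have hjk : (2 <= j + k)%N by lia.
  have hm : (j + k <= n)%N by lia.
  have e1 := hom_x hb hH hjk; have e2 := hom_x hb' hH' hjk.
  have ef a b : (a + b <= n)%N -> fc (fun j k => Icoef j k S p) a b = fc (fun j k => Icoef j k S' p') a b.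
    by move=> hab; rewrite !fcE IH.
  have eX : FFx (fun j k => Icoef j k S p) j k = FFx (fun j k => Icoef j k S' p') j k.
    apply: eq_bigr => a _; apply: eq_bigr => b _; have ha := ltn_ord a; have hb2 := ltn_ord b.
    have [l2|l2] := ltnP (a + b) 2; first by rewrite !fcut0 // !mul0r.
    by rewrite !fcutE // !ef //; lia.
  have eY : FFy (fun j k => Icoef j k S p) j k = FFy (fun j k => Icoef j k S' p') j k.
    apply: eq_bigr => a _; apply: eq_bigr => b _; have ha := ltn_ord a; have hb2 := ltn_ord b.
    have [l2|l2] := ltnP (a + b) 2; first by rewrite !fcut0 // !mul0r.
    by rewrite !fcutE // !ef //; lia.
  have eP : predj (fun j k => Icoef j k.+1 S p) j k = predj (fun j k => Icoef j k.+1 S' p') j k.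
    by case: (j) hm => [|j'] hm //=; apply: IH; lia.
  have ejk := IH j k hm.
  rewrite eX eY eP ejk e31 e22 /mu e50 e31 in e1; rewrite /mu in e2.
  have := etrans (esym e1) e2.
  by rewrite -!addrA => /addIr.
have EI : (fun j k => Icoef j k S p) = (fun j k => Icoef j k S' p').
  by apply/funext => j; apply/funext => k; apply: (E (j + k)%N).
have [S1 [b1 m1 t1]] := normal_surface_ex hb; have [S1' [b1' m1' t1']] := normal_surface_ex hb'.
have [[hg _ _] _] := normal4_low (normP hb); have [[hg' _ _] _] := normal4_low (normP hb').
have n1 := normal_fn_near t1; have n1' := normal_fn_near t1'.
have en : normal_fn S p = normal_fn S' p' by apply/funext => h; rewrite /normal_fn EI.
have z0 : coord_xy (0 : 'cV[C]_3) = 0.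
  by apply/matrixP => i' j; rewrite ord1 [RHS]mxE; case: (ord2P i') => ->; rewrite ?xy0 ?xy1 mxE.
have nd (T : graphed R) : branch T 0 -> nbhs (0 : 'cV[C]_2) (dom T).
  move=> hT; have [op _ _ _ _] := branch_surface hT; apply: open_nbhs_nbhs; split=> //.
  by have [] := branch_graph hT; rewrite z0.
have h1 : germ_map (aff1 R) S1 0 S1' 0.
  split; first by rewrite aff_id.
  have hn : nbhs (coord_xy (0 : 'cV[C]_3)) (fun h => [/\ dom S1 h, dom S1' h & fn S1 h = fn S1' h]).
    rewrite z0; move: (nd _ b1) (nd _ b1') n1 n1'; rewrite en => d1 d1' f1 f1'.
    near=> h; split; [by near: h|by near: h|].
    have <- : normal_fn S' p' h = fn S1 h by near: h.
    by near: h.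
  have := xy_near hn; apply: filterS => w [k1 k2 k3]; rewrite aff_id.
  by split=> -[_ e]; split=> //; rewrite e k3.
exists (affc (phi S p) (affc (aff1 R) (affi (phi S' p')))); first by apply: A3c => //; apply: A3c; [exact: A31|exact: A3i].
exact: germ_comp m1 (germ_comp h1 (germ_inv hg' m1')).
Unshelve. all: by end_near.
Qed.

End Moduli.

(** * The dimension of the moduli space *)
Section Dimension.
Variable R : realType.
Notation C := (Cx R).
Notation mp := (mpoly 5 C).
Implicit Types (v : 'cV[C]_5) (Z : set 'cV[C]_5).

Definition o5 k (h : (k < 5)%N) : 'I_5 := Ordinal h.
Local Notation c0 := (@o5 0 isT).
Local Notation c1 := (@o5 1 isT).
Local Notation c2 := (@o5 2 isT).
Local Notation c3 := (@o5 3 isT).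
Local Notation c4 := (@o5 4 isT).
Local Notation X i := (mpolyX C (mnm1 i) : mp).
Local Notation mev v q := (meval (fun i => v i 0) q).

Lemma ord5P (i : 'I_5) : [\/ i = c0, i = c1 | [\/ i = c2, i = c3 | i = c4]].
Proof.
case: i => [[|[|[|[|[|k]]]]] h] //.
- by apply: Or31; apply: val_inj.
- by apply: Or32; apply: val_inj.
- by apply: Or33; apply: Or31; apply: val_inj.
- by apply: Or33; apply: Or32; apply: val_inj.
by apply: Or33; apply: Or33; apply: val_inj.
Qed.

(** With n = d - a - 2 b, if b were nonzero the fourth equation would give a = 3 n, the
    first would make b a multiple of n, and the last would become n^3 = 0 up to a
    factor. *)
Lemma moduli_equations_lines (a b c d e : C) : moduli_equations a b c d e <->
  [/\ b = 0, e = 0, d = a & a * (c - 3%:R / 2%:R - 4%:R * a) = 0].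
Proof.
split; last first.
  case=> h1 h2 h3 /eqP; rewrite mulf_eq0 => /orP[|] /eqP h4.
    by apply: moduli_lines => //; left; rewrite h3.
  apply: moduli_lines => //; right; split=> //; apply: (eq_of_sub0 h4); ring.
case=> -[E1 E2 E3 E4] [_ _ F].
pose m := c - 1 - 4%:R * a; pose n := d - a - 2%:R * b.
have h1 : d = 2%:R * m * a + 7%:R / 2%:R * b by apply: (eq_of_sub0 (esym E1)); rewrite /m; field.
have h2 : e = (3%:R * m - 1) * b by apply: (eq_of_sub0 (esym E3)); rewrite /m; ring.
have h3 : e = 2%:R * n * a by apply: (eq_of_sub0 (esym E2)); rewrite /n; ring.
have h4 : b * (a - 3%:R * n) = 0 by apply: (eq_of_sub0 (esym E4)); rewrite /n; ring.
have nz (k : nat) : k.+1%:R != 0 :> C by rewrite pnatr_eq0.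
have b0 : b = 0.
  apply/eqP; apply: contraT => b0.
  have {}h4 : a = 3%:R * n by apply/eqP; rewrite -subr_eq0; move/eqP: h4; rewrite mulf_eq0 (negPf b0).
  have hd : d = 4%:R * n + 2%:R * b.
    have e0 : d = n + a + 2%:R * b by rewrite /n; ring.
    by rewrite e0 h4; ring.
  have e1 : 3%:R * b = (8%:R - 12%:R * m) * n.
    apply/eqP; rewrite -subr_eq0; apply/eqP.
    have := h1; rewrite hd h4 => /eqP; rewrite -subr_eq0 => /eqP h.
    have -> : 3%:R * b - (8%:R - 12%:R * m) * n = (- 2%:R) * (4%:R * n + 2%:R * b - (2%:R * m * (3%:R * n) + 7%:R / 2%:R * b)) by field.
    by rewrite h mulr0.
  have hc : c = m + 1 + 12%:R * n.
    have e0' : c = m + 1 + 4%:R * a by rewrite /m; ring.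
    by rewrite e0' h4; ring.
  have k1 : - 16 * a ^+ 2 + 4 * a * c + 3 * b - 6 * a = 2%:R * n.
    have e' : - 16 * a ^+ 2 + 4 * a * c + 3 * b - 6 * a - 2%:R * n =
      - 16 * a ^+ 2 + 4 * a * c + (8%:R - 12%:R * m) * n - 6 * a - 2%:R * n by rewrite -e1; ring.
    by apply/eqP; rewrite -subr_eq0 e' hc h4; apply/eqP; ring.
  have k2 : - 32 * a ^+ 2 + 8 * a * c + 6 * b - 13 * a = n.
    have -> : 6 * b = 2%:R * (3%:R * b) by ring.
    by rewrite e1 hc h4; ring.
  have n0 : n = 0.
    apply/eqP; move: F; rewrite k1 k2 h4 => /esym/eqP.
    by rewrite !mulf_eq0 oppr_eq0 mulf_eq0 !(negPf (nz _)) /= !orbb.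
  by move: e1; rewrite n0 mulr0 => /eqP; rewrite mulf_eq0 (negPf (nz 2)) (negPf b0).
have e0 : e = 0 by rewrite h2 b0 mulr0.
have two0 : 2%:R != 0 :> C by rewrite pnatr_eq0.
have : n * a = 0 by apply: (mulfI two0); rewrite mulr0 mulrA -h3.
rewrite b0 mulr0 addr0 in h1.
move=> /eqP; rewrite mulf_eq0 => /orP[|] /eqP z; last first.
  by split=> //; rewrite ?h1 z ?mulr0 ?mul0r.
have da : d = a by apply: (eq_of_sub0 z); rewrite /n b0; ring.
split=> //; apply: (mulfI two0); rewrite mulr0; apply: (eq_of_sub0 (esym (etrans (esym (subrr d)) (congr1 (fun x => x - d) h1)))).
by rewrite da /m; field.
Qed.

Definition line1 : set 'cV[C]_5 := [set v | [/\ v c0 0 = 0, v c1 0 = 0, v c3 0 = 0 & v c4 0 = 0]].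
Definition line2 : set 'cV[C]_5 := [set v | [/\ v c1 0 = 0, v c4 0 = 0, v c3 0 = v c0 0 &
  v c2 0 = 3%:R / 2%:R + 4%:R * v c0 0]].

Lemma col5E (a b c d e : C) v : v = \col_i tnth [tuple a; b; c; d; e] i <->
  [/\ v c0 0 = a, v c1 0 = b, v c2 0 = c & v c3 0 = d /\ v c4 0 = e].
Proof.
split; first by move=> ->; split; rewrite ?mxE //; split; rewrite mxE.
case=> h0 h1 h2 [h3 h4]; apply/matrixP => i j; rewrite ord1 mxE.
by case: (ord5P i) => [->|->|[->|->|->]]; rewrite (tnth_nth 0).
Qed.

Lemma moduli_varietyE : @moduli_variety R = line1 `|` line2.
Proof.
apply/seteqP; split=> v.
  case=> a [b [c [d [e [/col5E[h0 h1 h2 [h3 h4]] /moduli_equations_lines[k1 k2 k3 /eqP]]]]]].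
  rewrite mulf_eq0 => /orP[|] /eqP k4; [left|right].
    by split; rewrite ?h0 ?h1 ?h3 ?h4 ?k1 ?k2 ?k3.
  by split; rewrite ?h0 ?h1 ?h2 ?h3 ?h4 ?k1 ?k2 ?k3 //; apply: (eq_of_sub0 k4); ring.
move=> h; exists (v c0 0), (v c1 0), (v c2 0), (v c3 0), (v c4 0); split; first by apply/col5E.
apply/moduli_equations_lines; case: h => -[h1 h2 h3 h4]; split=> //.
- by rewrite h1 h3.
- by rewrite h1 mul0r.
- by rewrite h4; apply: etrans (mulr0 (v c0 0)); congr (_ * _); ring.
Qed.

Lemma closed_polys (s : seq mp) Z : (forall v, Z v <-> forall q, q \in s -> mev v q = 0) ->
  zariski_closed Z.
Proof.
move=> h; exists [set` s]; apply/seteqP; split=> v.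
  by move=> /h k q /= hq; apply: k.
by move=> k; apply/h => q hq; apply: k.
Qed.

Ltac mev_tac := rewrite /= ?mevalB ?mevalD ?mevalM ?mevalC ?mevalZ ?mevalXU.

Lemma line1_closed : zariski_closed line1.
Proof.
apply: (@closed_polys [:: X c0; X c1; X c3; X c4]) => v; split.
  case=> h0 h1 h3 h4 q; rewrite !inE => /or4P[] /eqP ->; mev_tac => //.
by move=> h; split; [have := h (X c0)|have := h (X c1)|have := h (X c3)|have := h (X c4)];
  rewrite !inE eqxx ?orbT mevalXU; apply.
Qed.

Lemma line2_closed : zariski_closed line2.
Proof.
pose q2 : mp := X c2 - mpolyC 5 (3%:R / 2%:R) - mpolyC 5 4%:R * X c0.
have e2 v : mev v q2 = v c2 0 - 3%:R / 2%:R - 4%:R * v c0 0 by rewrite /q2; mev_tac.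
pose q3 : mp := X c3 - X c0.
have e3 v : mev v q3 = v c3 0 - v c0 0 by rewrite /q3; mev_tac.
apply: (@closed_polys [:: X c1; X c4; q3; q2]) => v; split.
  case=> h1 h4 h3 h2 q; rewrite !inE => /or4P[] /eqP ->; rewrite ?mevalXU // ?e3 ?e2 ?h3 ?subrr //.
  by rewrite h2; ring.
move=> h; split.
- by have := h (X c1); rewrite !inE eqxx mevalXU; apply.
- by have := h (X c4); rewrite !inE eqxx ?orbT mevalXU; apply.
- by apply/eqP; rewrite -subr_eq0 -e3 h // !inE eqxx !orbT.
by apply: (eq_of_sub0 (h q2 _)); [rewrite !inE eqxx !orbT|rewrite e2; ring].
Qed.

Lemma closed1 (x : 'cV[C]_5) : zariski_closed [set x].
Proof.
apply: (@closed_polys [seq X i - mpolyC 5 (x i 0) | i <- enum 'I_5]) => v; split.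
  by move=> -> q /mapP[i _ ->]; rewrite mevalB mevalXU mevalC subrr.
move=> h; apply/matrixP => i j; rewrite ord1; apply/eqP; rewrite -subr_eq0; apply/eqP.
by have := h (X i - mpolyC 5 (x i 0)); rewrite mevalB mevalXU mevalC; apply; apply: map_f; rewrite mem_enum.
Qed.

(** The products of the equations of the two sets. *)
Lemma closedU Z Z' : zariski_closed Z -> zariski_closed Z' -> zariski_closed (Z `|` Z').
Proof.
move=> [P ->] [Q ->]; exists [set q | exists a b, [/\ P a, Q b & q = a * b]].
apply/seteqP; split=> v.
  case=> h q [a [b [ha hb ->]]]; rewrite mevalM.
    by rewrite (h a ha) mul0r.
  by rewrite (h b hb) mulr0.
move=> h; have [|/existsNP[a /not_implyP[ha /eqP na]]] := pselect (forall q, P q -> mev v q = 0); first by left.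
right=> b hb; have := h (a * b); rewrite mevalM => /(_ _)/eqP; rewrite mulf_eq0 (negPf na) => k.
by apply/eqP; apply: k; exists a, b.
Qed.

Lemma closed0 : zariski_closed (set0 : set 'cV[C]_5).
Proof.
apply: (@closed_polys [:: 1]) => v; split=> // /(_ 1); rewrite inE eqxx meval1 => /(_ isT)/eqP.
by rewrite oner_eq0.
Qed.

Section Line.
Variables (u w : 'cV[C]_5).
Definition pline (t : C) : 'cV[C]_5 := u + t *: w.

Lemma line_poly (q : mp) : exists Q : {poly C}, forall t, Q.[t] = mev (pline t) q.
Proof.
exists (\sum_(m <- msupp q) (mcoeff m q)%:P * \prod_i ((u i 0)%:P + (w i 0)%:P * 'X) ^+ m i) => t.
rewrite mevalE horner_sum; apply: eq_bigr => m _; rewrite hornerM hornerC; congr (_ * _).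
rewrite horner_prod; apply: eq_bigr => i _.
by rewrite horner_exp !hornerE !mxE mulrC.
Qed.

Lemma infinite_roots (Q : {poly C}) : (forall t, Q.[t] = 0) -> Q = 0.
Proof.
move=> h; apply/eqP; apply: contraT => nz.
have := max_poly_roots nz (_ : all (root Q) [seq i%:R | i <- iota 0 (size Q)]).
rewrite size_map size_iota ltnn; apply.
  by apply/allP => x _; apply/rootP; apply: h.
rewrite map_inj_uniq ?iota_uniq // => i j /eqP; by rewrite eqr_nat => /eqP.
Qed.

Lemma closed_on_line Z : zariski_closed Z -> (exists t, ~ Z (pline t)) ->
  exists2 Q : {poly C}, Q != 0 & forall t, Z (pline t) -> root Q t.
Proof.
move=> [P ->] [t0 /existsNP[q /not_implyP[hq nq]]]; have [Q hQ] := line_poly q.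
exists Q; last by move=> t ht; apply/rootP; rewrite hQ; apply: ht.
by apply: contra_notN nq => /eqP Q0; rewrite -hQ Q0 horner0.
Qed.

(** A line covered by two closed sets, neither of which contains it, would consist of
    the roots of a nonzero polynomial. *)
Lemma line_irreducible : zariski_irreducible (range pline).
Proof.
split; first by exists (pline 0), 0.
move=> A B hA hB h.
have [|nA] := pselect (range pline `<=` A); first by left.
have [|nB] := pselect (range pline `<=` B); first by right.
have ex D : ~ range pline `<=` D -> exists t, ~ D (pline t).
  move=> /existsNP[x /not_implyP[[t _ <-] nx]]; by exists t.
have [Q1 nz1 h1] := closed_on_line hA (ex _ nA); have [Q2 nz2 h2] := closed_on_line hB (ex _ nB).
have : Q1 * Q2 = 0.
  apply: infinite_roots => t; rewrite hornerM.
  by case: (h (pline t)) => [|/h1/rootP ->|/h2/rootP ->]; [exists t|rewrite mul0r|rewrite mulr0].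
by move=> /eqP; rewrite mulf_eq0 (negPf nz1) (negPf nz2).
Qed.

Lemma finite_irreducible (s : seq C) Z : zariski_irreducible Z -> (forall v, Z v -> exists2 t, t \in s & v = pline t) ->
  exists x, Z `<=` [set x].
Proof.
elim: s Z => [|t s IH] Z hZ h.
  by have [[v /h[t]]] := hZ.
have [ne irr] := hZ.
pose F (s : seq C) : set 'cV[C]_5 := [set v | exists2 t, t \in s & v = pline t].
have cF r : zariski_closed (F r).
  elim: r => [|t' r IHr].
    rewrite (_ : F [::] = set0); first exact: closed0.
    by apply/seteqP; split=> v // -[].
  rewrite (_ : F (t' :: r) = [set pline t'] `|` F r); first exact: closedU (closed1 _) IHr.
  apply/seteqP; split=> v.
    by case=> x; rewrite inE => /orP[/eqP ->|xr] ->; [left|right; exists x].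
  by case=> [->|[x xr ->]]; [exists t'; rewrite ?mem_head|exists x; rewrite ?inE ?xr ?orbT].
have [] := irr _ _ (closed1 (pline t)) (cF s).
- move=> v /h[x]; rewrite inE => /orP[/eqP ->|xs] ->; [by left|by right; exists x].
- by move=> h1; exists (pline t).
by move=> h1; apply: IH => // v /h1.
Qed.

(** A closed subset missing a point of the line is finite; if irreducible it is then a
    point. *)
Lemma no_chain_in_line Z0 Z1 Z2 : zariski_irreducible Z0 -> zariski_irreducible Z1 -> zariski_closed Z1 ->
  Z2 `<=` range pline -> Z0 `<` Z1 -> Z1 `<` Z2 -> False.
Proof.
move=> [[y hy] _] i1 hc h2; rewrite !properEneq => -[n01 s01] [n12 s12].
have [v [hv nv]] : exists v, Z2 v /\ ~ Z1 v.
  apply: contrapT => hn; case/eqP: n12; apply/seteqP; split=> // v hv.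
  by apply: contrapT => nv; apply: hn; exists v.
have [t _ et] := h2 _ hv.
have nt : exists t, ~ Z1 (pline t) by exists t; rewrite et.
have [Q nz hQ] := closed_on_line hc nt.
have [rs hrs] := closed_field_poly_normal Q.
have [|x hx] := @finite_irreducible rs Z1 i1.
  move=> z hz; have [t' _ e'] := h2 _ (s12 _ hz); exists t' => //.
  have rt : root Q t' by apply: hQ; rewrite e'.
  by move: rt; rewrite hrs rootZ ?lead_coef_eq0 // root_prod_XsubC.
case/eqP: n01; apply/seteqP; split=> // z hz.
by rewrite (hx _ hz) -(hx _ (s01 _ hy)).
Qed.

End Line.

Definition e2 : 'cV[C]_5 := \col_i tnth [tuple 0; 0; 1; 0; 0] i.
Definition u2 : 'cV[C]_5 := \col_i tnth [tuple 0; 0; 3%:R / 2%:R; 0; 0] i.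
Definition w2 : 'cV[C]_5 := \col_i tnth [tuple 1; 0; 4%:R; 1; 0] i.

Lemma line1E : line1 = range (pline 0 e2).
Proof.
apply/seteqP; split=> v.
  move=> [h0 h1 h3 h4]; exists (v c2 0) => //; apply/matrixP => i j; rewrite ord1 !mxE (tnth_nth 0).
  by case: (ord5P i) => [->|->|[->|->|->]]; rewrite ?h0 ?h1 ?h3 ?h4 /= ?mulr0 ?mulr1 add0r.
by move=> [t _ <-]; split; rewrite !mxE (tnth_nth 0) /= mulr0 addr0.
Qed.

Lemma line2E : line2 = range (pline u2 w2).
Proof.
apply/seteqP; split=> v.
  move=> [h1 h4 h3 h2]; exists (v c0 0) => //; apply/matrixP => i j; rewrite ord1 !mxE !(tnth_nth 0).
  case: (ord5P i) => [->|->|[->|->|->]]; rewrite ?h1 ?h4 ?h3 ?h2 /= ?mulr0 ?mulr1 ?add0r //.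
  by congr (_ + _); rewrite mulrC.
by move=> [t _ <-]; split; rewrite !mxE !(tnth_nth 0) /= ?mulr0 ?mulr1 ?add0r //; congr (_ + _); rewrite mulrC.
Qed.

(** The variety is the union of two lines: a point and a line form a chain, and the
    largest member of any chain lies in one of the lines. *)
Lemma moduli_dim : variety_of_dim (@moduli_variety R) 1.
Proof.
split; first by rewrite moduli_varietyE; exact: closedU line1_closed line2_closed.
- exists (fun i => if i is 0%N then [set 0] else line1); split=> [[|[|i]]|[|i]] // _.
  + split; first exact: closed1.
      split; first by exists 0.
      by move=> A B _ _ h; have [hA|hB] := h 0 erefl; [left|right] => x ->.
    by rewrite moduli_varietyE => x ->; left; split; rewrite mxE.
  + split; first exact: line1_closed.
      by rewrite line1E; exact: line_irreducible.
    by rewrite moduli_varietyE => x; left.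
  rewrite properEneq; split; last by move=> x ->; split; rewrite mxE.
  apply/eqP => /seteqP[_ h]; have := h e2; rewrite line1E => k.
  have : [set 0] e2 by apply: k; exists 1; rewrite /pline ?add0r ?scale1r.
  by move=> /matrixP/(_ c2 0)/eqP; rewrite !mxE (tnth_nth 0) /= oner_eq0.
move=> [Z [hZ hlt]].
have [k0 i0 _] := hZ 0%N isT; have [k1 i1 _] := hZ 1%N isT; have [_ i2 s2] := hZ 2 isT.
have lt01 := hlt 0%N isT; have lt12 := hlt 1%N isT.
rewrite moduli_varietyE in s2.
have [s|s] := i2.2 _ _ line1_closed line2_closed s2.
  by rewrite line1E in s; apply: (no_chain_in_line i0 i1 k1 s lt01 lt12).
by rewrite line2E in s; apply: (no_chain_in_line i0 i1 k1 s lt01 lt12).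
Qed.

End Dimension.

(** * Functions of x alone *)
Section OneVariable.
Variable R : realType.
Notation C := (Cx R).
Notation BP := {poly {poly C}}.
Local Notation pnt := Defs.point.
Implicit Types (al be : C -> C) (h : 'cV[C]_2).

(** A function of x as a function on the plane, where holomorphy and jets are defined. *)
Definition xf al : 'cV[C]_2 -> C := fun h => al (h 0 0).

Definition xd al (j : nat) h : C := partials (xf al) j 0 h.

Lemma partial0_cst (i : 'I_2) : partial i (fun=> 0 : C) = fun=> 0.
Proof.
apply/funext => a; apply: (@quad_derive R 2 _ a _ 0 0 1) => // t _.
by rewrite mulr0 !subrr nrm0 mul0r.
Qed.

Lemma partial1_xf al : partial 1 (xf al) = fun=> 0.
Proof.
apply/funext => a; apply: (@quad_derive R 2 _ a _ 0 0 1) => // t _.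
have e : (a + t *: delta_mx 1 0) 0 0 = a 0 0 by rewrite !mxE /= mulr0n mulr0 addr0.
by rewrite /xf e mulr0 !subrr nrm0 mul0r.
Qed.

Lemma partials_xf al j k h : partials (xf al) j k.+1 h = 0.
Proof.
rewrite /partials iterSr partial1_xf.
have e n (i : 'I_2) : iter n (partial i) (fun=> 0 : C) = fun=> 0.
  by elim: n => //= n ->; exact: partial0_cst.
by rewrite !e.
Qed.

Local Opaque partial holomorphic_at taylor_at partials jeq.
Local Opaque bC bX bY bc bev.

Lemma jeq_xf al h N : holomorphic_at (xf al) h -> exists P : BP,
  jeq N (fun k => al (h 0 0 + k 0 0)) P /\ forall j k, (j < N)%N -> (k < N)%N ->
    bc P j k = if k == 0%N then xd al j h / j`!%:R else 0.
Proof.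
move=> /taylor_of_partials/(jeq_taylor N) hj; eexists; split.
  by apply: (jeq_eq _ hj); apply: filterE => k; rewrite /xf mxE.
move=> j k hjN hkN; rewrite bc_bpoly hjN hkN /=.
case: k hkN => [|k] _; first by rewrite fact0 mulr1.
by rewrite partials_xf mul0r.
Qed.

Lemma bcM_xf (P Q : BP) N j k : (forall j k, (j < N)%N -> (k < N)%N -> k != 0%N -> bc P j k = 0) ->
  (j < N)%N -> (k < N)%N -> bc (P * Q) j k = \sum_(i < j.+1) bc P i 0 * bc Q (j - i) k.
Proof.
move=> h hj hk; rewrite bcM; apply: eq_bigr => i _; rewrite big_ord_recl /= subn0 big1 ?addr0 // => l _.
rewrite h ?mul0r //; first exact: leq_trans (ltn_ord i) hj.
by rewrite /bump /=; apply: leq_trans hk; rewrite ltnS; exact: ltn_ord.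
Qed.

Definition pser (c : nat -> C) (x l : C) : Prop := nlim (fun N => \sum_(n < N) c n * x ^+ n) l.

Definition xser (c : nat -> C) : {ffun 'I_2 -> nat} -> C :=
  Defs.double (fun j k => if k == 0%N then j`!%:R * c j else 0).

Lemma xser_sum c h N : (0 < N)%N -> taylor_sum (xser c) h N = \sum_(n < N) c n * h 0 0 ^+ n.
Proof.
case: N => // N _; rewrite /taylor_sum.
pose f (m : {ffun 'I_2 -> 'I_N.+1}) : 'I_N.+1 * 'I_N.+1 := (m 0, m 1).
pose g (p : 'I_N.+1 * 'I_N.+1) : {ffun 'I_2 -> 'I_N.+1} := [ffun i => if i == 0 then p.1 else p.2].
rewrite (reindex g) /=; last first.
  exists f => [[a b] _|m _]; first by rewrite /f /g !ffunE.
  by apply/ffunP => i; rewrite /g /f ffunE; case: (ord2P i) => ->.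
transitivity (\sum_(j < N.+1) \sum_(k < N.+1) (if k == 0 then c j * h 0 0 ^+ j else 0)).
  rewrite [RHS]pair_bigA; apply: eq_bigr => -[a b] _ /=.
  rewrite /xser /Defs.double !ffunE /= -(inj_eq val_inj) /=; case: eqP => hb; last by rewrite mul0r.
  have lo : lift ord0 ord0 = 1 :> 'I_2 by apply: val_inj.
  rewrite big_ord_recl big_ord1 lo /g !ffunE /= hb expr0 fact0 divr1 mulr1.
  have f0 : (a`!%:R : C) != 0 by rewrite pnatr_eq0 -lt0n fact_gt0.
  by field.
by apply: eq_bigr => j _; rewrite big_ord_recl /= big1 ?addr0.
Qed.

Lemma xser_lim c h l : pser c (h 0 0) l <-> nlim (taylor_sum (xser c) h) l.
Proof.
by split=> H e /H[N HN]; exists N.+1 => n hn; [rewrite xser_sum|rewrite -xser_sum]; do ?apply: HN;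
  rewrite ?(leq_trans _ hn) ?(ltnW hn).
Qed.

Lemma pser_ex (c : nat -> C) (B K : R) : 0 < K -> (forall n, nrm (c n) <= B * K ^+ n) ->
  exists al, [/\ taylor_at (xf al) 0 (xser c), \forall h \near (0 : 'cV[C]_2), pser c ((h : 'cV[C]_2) 0 0) (xf al h) &
   \forall h \near (0 : 'cV[C]_2),
     pser (fun n => n.+1%:R * c n.+1) ((h : 'cV[C]_2) 0 0) (partial 0 (xf al) h)].
Proof.
move=> K0 hc.
have B0 : 0 <= B by have := hc 0%N; rewrite expr0 mulr1; apply: le_trans; exact: nrm_ge0.
have hb m : nrm (xser c m) * \prod_i (K^-1 ^+ m i / (m i)`!%:R) <= B.
  rewrite /xser /Defs.double; case: eqP => [e|_]; last by rewrite nrm0 mul0r.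
  have lo : lift ord0 ord0 = 1 :> 'I_2 by apply: val_inj.
  rewrite big_ord_recl big_ord1 lo e expr0 fact0 divr1 mulr1 nrmM nrm_nat.
  have f0 : ((m 0)`!%:R : R) != 0 by rewrite pnatr_eq0 -lt0n fact_gt0.
  have -> : (m 0)`!%:R * nrm (c (m 0)) * (K^-1 ^+ m 0 / (m 0)`!%:R) = nrm (c (m 0)) * K^-1 ^+ m 0 by field.
  rewrite exprVn -ler_pdivlMr ?invr_gt0 ?exprn_gt0 // invrK; exact: hc.
have K1 : 0 < K^-1 by rewrite invr_gt0.
have [hp _] := tpoly_cauchy K1 hb.
have K2 : 0 < K^-1 / 2 by rewrite divr_gt0.
have [F hF] := plim_ex (ltW K2) hp.
(* The sum of the series depends on x only, and is read off on the axis. *)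
pose al x := F (vec2 x 0).
have hal h : inbox (K^-1 / 2) h -> nlim (taylor_sum (xser c) h) (al (h 0 0)).
  move=> hh; apply/xser_lim.
  have hv : inbox (K^-1 / 2) (vec2 (h 0 0) 0).
    by move=> i; rewrite mxE; case: ifP => _; [exact: hh|rewrite nrm0 ltW].
  have := hF _ hv; under [X in nlim X]eq_fun do rewrite ev_tpoly.
  by move=> /xser_lim; rewrite mxE.
have ht : taylor_at (xf al) 0 (xser c).
  Transparent taylor_at.
  exists ((K^-1 / 2)%:C%C : C), (B%:C%C : C); split; first by rewrite (rc_lt 0).
  split=> [m|h hh]; last first.
    rewrite add0r; apply/cvgC; apply: hal => i; rewrite ltW // -nrm_ltP; exact: hh.
  Opaque taylor_at.
  have -> : \prod_i (((K^-1 / 2)%:C%C : C) ^+ m i / (m i)`!%:R) = (\prod_i ((K^-1 / 2) ^+ m i / (m i)`!%:R))%:C%C.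
    rewrite rmorph_prod; apply: eq_bigr => i _; move: (K^-1 / 2) => s.
    by rewrite rmorphM rmorphXn fmorphV rmorph_nat.
  rewrite nrmE -rmorphM rc_le; apply: le_trans (hb m); apply: ler_wpM2l; first exact: nrm_ge0.
  apply: ler_prod => i _; rewrite divr_ge0 ?exprn_ge0 ?(ltW K2) //= ler_wpM2r ?invr_ge0 //.
  by apply: lerXn2r; rewrite ?nnegrE ?(ltW K2) ?(ltW K1) // ler_pdivrMr // ler_peMr ?(ltW K1) //; lra.
exists al; split=> //.
  by apply: (inbox_nbhs K2) => h hh; apply/xser_lim; rewrite add0r; exact: hal.
have [r r0 [B' [_ hl _]]] := taylor_poly (taylor_partial 0 ht).
apply: (inbox_nbhs r0) => h hh; have := hl _ hh; under [X in nlim X]eq_fun do rewrite ev_tpoly.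
have -> : (fun m => xser c (shiftm 0 m)) = xser (fun n => n.+1%:R * c n.+1).
  apply/funext => m; rewrite /xser /Defs.double /shiftm !ffunE /= addn0; case: eqP => // _.
  by rewrite addn1 factS natrM -!mulrA mulrCA.
by move=> /xser_lim; rewrite add0r.
Qed.

Lemma pser_unique c x l l' : pser c x l -> pser c x l' -> l = l'.
Proof. exact: nlim_unique. Qed.

Lemma pserD c d x l k : pser c x l -> pser d x k -> pser (fun n => c n + d n) x (l + k).
Proof.
move=> hc hd; have := nlimD hc hd; rewrite /pser.
move=> h e /h[N HN]; exists N => n /HN; rewrite -big_split /=.
by under [X in _ -> nrm (X - _) < _]eq_bigr do rewrite mulrDl.
Qed.

Lemma pserZ a c x l : pser c x l -> pser (fun n => a * c n) x (a * l).
Proof.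
move=> hc; have := nlimZ a hc; rewrite /pser.
by under eq_fun do rewrite mulr_sumr; under eq_fun do under eq_bigr do rewrite mulrA.
Qed.

Lemma pserX c x l : pser c x l -> pser (fun n => if n is n'.+1 then c n' else 0) x (x * l).
Proof.
move=> hc e e0; have [N HN] := nlimZ x hc e0; exists N.+1 => -[//|n] hn.
rewrite big_ord_recl mul0r add0r; have := HN n hn; rewrite mulr_sumr.
by under eq_bigr do rewrite mulrCA -exprS.
Qed.

Lemma pser_mono m x : pser (fun n => (n == m)%:R) x (x ^+ m).
Proof.
move=> e e0; exists m.+1 => n hn; rewrite (bigD1 (Ordinal hn)) //= eqxx mul1r big1 ?addr0 ?subrr ?nrm0 //.
by move=> i; rewrite -(inj_eq val_inj) /= => /negPf ->; rewrite mul0r.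
Qed.

Lemma xd_ser al c j : taylor_at (xf al) 0 (xser c) -> xd al j 0 = j`!%:R * c j.
Proof. by move=> h; rewrite /xd (partials_taylor _ _ h) eqxx. Qed.

End OneVariable.

(** * Normal forms of ruled surfaces *)
Section Ruled.
Variable R : realType.
Notation C := (Cx R).
Notation BP := {poly {poly C}}.
Local Notation pnt := Defs.point.

Lemma xd0 (al : C -> C) h : xd al 0 h = al (h 0 0).
Proof. by []. Qed.

Local Opaque partial holomorphic_at taylor_at hessian partials jeq.
Local Opaque bC bX bY bc bev xd.
Local Notation xx := (bX R).
Local Notation yy := (bY R).

Definition ruled_fn (al be : C -> C) (h : 'cV[C]_2) : C := al (h 0 0) + h 1 0 * be (h 0 0).

Lemma holo_shift (f : 'cV[C]_2 -> C) a : holomorphic_at f a -> holomorphic_at (fun k => f (a + k)) 0.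
Proof.
move=> hf; have := @holo_polymap R 2 2 f (shiftp a) 0; rewrite polymap_shift addr0 => /(_ hf).
by under eq_fun do rewrite polymap_shift.
Qed.

Lemma holo_xf (al : C -> C) a : holomorphic_at (xf al) a -> holomorphic_at (fun k : 'cV[C]_2 => al (a 0 0 + k 0 0)) 0.
Proof.
move=> /holo_shift; rewrite /xf => h.
by have -> : (fun k : 'cV[C]_2 => al (a 0 0 + k 0 0)) = (fun k => al ((a + k) 0 0)) by apply/funext => k; rewrite mxE.
Qed.

Lemma jeqx N : jeq N (fun k : 'cV[C]_2 => k 0 0) xx.
Proof. by have := jeq_ev N xx; under eq_fun do rewrite bev_bX. Qed.

Lemma jeqy N : jeq N (fun k : 'cV[C]_2 => k 1 0) yy.
Proof. by have := jeq_ev N yy; under eq_fun do rewrite bev_bY. Qed.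

Section Coefs.
Variables (A B : nat -> C) (a b : nat -> C) (G : nat -> nat -> C).
Local Notation n3 := (B 1%N * A 3%N - 3%:R / 2%:R * A 2%N * B 2%N).
Local Notation n4 := (A 4%N * B 1%N ^+ 2 - 2%:R * A 2%N * B 3%N * B 1%N - 2%:R * B 2%N * n3).
Hypotheses (B1 : B 1%N != 0) (N3 : n3 != 0) (N4 : n4 != 0).
Local Notation c := (A 2%N / (2%:R * B 1%N)).
Local Notation q := (B 2%N / (2%:R * B 1%N)).
Local Notation lam := (B 1%N ^+ 2 / n3).
Hypothesis hb : forall i, (i < 5)%N -> b i = (B 1%N)^-1 * (B i / i`!%:R - if i == 0%N then B 0%N else 0).
Hypothesis ha : forall i, (i < 5)%N -> a i = lam / B 1%N * (A i / i`!%:R - (if i == 0%N then A 0%N else 0)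
  - (if i == 1%N then A 1%N else 0) - c * (if i is i'.+1 then B i' / i'`!%:R - (if i' == 0%N then B 0%N else 0) else 0)).
Hypothesis E : forall j k, (j < 5)%N -> (k < 5)%N -> (j + k < 5)%N ->
  G j k / (j`!%:R * k`!%:R) + q * (\sum_(i < j.+1) b i * (G (j - i)%N k / ((j - i)`!%:R * k`!%:R))) =
  (if k == 0%N then a j else 0) + (if k == 1%N then b j else 0).

Lemma ruled_coefs :
  [/\ [/\ G 0%N 0%N = 0, G 1%N 0%N = 0 & G 0%N 1%N = 0],
      [/\ G 2%N 0%N = 0, G 1%N 1%N = 1 & G 0%N 2%N = 0] &
      G 2%N 1%N = 0 /\ G 1%N 2%N = 0] /\
  [/\ G 3%N 0%N = 1, G 0%N 3%N = 0 & G 4%N 0%N != 0].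
Proof.
have f : [/\ 0`! = 1, 1`! = 1, 2`! = 2, 3`! = 6 & 4`! = 24]%N by [].
have two0 : 2%:R != 0 :> C by rewrite pnatr_eq0.
have six0 : 6%:R != 0 :> C by rewrite pnatr_eq0.
have hA3 : A 3%N = (n3 + 3%:R / 2%:R * A 2%N * B 2%N) / B 1%N by field.
move: ha N3 N4 hA3; set n := n3 => ha' N3' N4' hA3.
have b0 : b 0%N = 0 by rewrite hb //= divr1 subrr mulr0.
have b1 : b 1%N = 1 by rewrite hb //= divr1 subr0 mulVf.
have b2 : b 2%N = q by rewrite hb //= subr0; case: f => _ _ -> _ _; field.
have a0 : a 0%N = 0 by rewrite ha' //= divr1 subrr !subr0 mulr0 subrr mulr0.
have a1 : a 1%N = 0 by rewrite ha' //= !divr1 subr0 !subrr mulr0 subrr mulr0.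
have a2 : a 2%N = 0.
  rewrite ha' //= !subr0 !divr1; case: f => _ _ -> _ _.
  by apply: etrans (mulr0 (lam / B 1%N)); congr (_ * _); field.
have a3 : a 3%N = 6%:R^-1.
  by rewrite ha' //= !subr0; case: f => _ _ -> -> _; rewrite hA3; field; rewrite ?N3' ?B1.
have a4 : 24%:R * a 4%N = (A 4%N * B 1%N ^+ 2 - 2%:R * A 2%N * B 3%N * B 1%N) / (n * B 1%N).
  by rewrite ha' //= !subr0; case: f => _ _ _ -> ->; field; rewrite ?N3' ?B1.
have e00 : G 0%N 0%N = 0.
  by have := @E 0%N 0%N isT isT isT; rewrite big_ord1 b0 a0 !mul0r mulr0 !addr0 /= mulr1 divr1.
have e01 : G 0%N 1%N = 0.
  by have := @E 0%N 1%N isT isT isT; rewrite big_ord1 b0 !mul0r mulr0 !addr0 /= mulr1 divr1.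
have e02 : G 0%N 2%N = 0.
  have := @E 0%N 2%N isT isT isT; rewrite big_ord1 b0 !mul0r mulr0 !addr0 /= => /eqP.
  by rewrite mulf_eq0 invr_eq0 mul1r pnatr_eq0 orbF => /eqP.
have e03 : G 0%N 3%N = 0.
  have := @E 0%N 3%N isT isT isT; rewrite big_ord1 b0 !mul0r mulr0 !addr0 /= => /eqP.
  by rewrite mulf_eq0 invr_eq0 mul1r pnatr_eq0 orbF => /eqP.
have e10 : G 1%N 0%N = 0.
  by have := @E 1%N 0%N isT isT isT; rewrite !big_ord_recl big_ord0 /= e00 b0 a1 !mul0r mulr0 !addr0 mulr0 addr0 mulr1 divr1.
have e11 : G 1%N 1%N = 1.
  by have := @E 1%N 1%N isT isT isT; rewrite !big_ord_recl big_ord0 /= e01 b0 b1 !mul0r mulr0 !addr0 mulr0 addr0 add0r mulr1 divr1.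
have e12 : G 1%N 2%N = 0.
  have := @E 1%N 2%N isT isT isT; rewrite !big_ord_recl big_ord0 /= e02 b0 !mul0r mulr0 !addr0 mulr0 addr0 => /eqP.
  by rewrite mulf_eq0 invr_eq0 mul1r pnatr_eq0 orbF => /eqP.
have e20 : G 2%N 0%N = 0.
  have := @E 2%N 0%N isT isT isT; rewrite !big_ord_recl big_ord0 /= e10 e00 b0 a2 !mul0r !mulr0 !addr0 mulr0 addr0 => /eqP.
  by rewrite mulf_eq0 invr_eq0 mulr1 pnatr_eq0 orbF => /eqP.
have e21 : G 2%N 1%N = 0.
  have := @E 2%N 1%N isT isT isT; rewrite !big_ord_recl big_ord0 /= /bump /= subnn e11 e01 b0 b2 b1.
  case: f => -> -> -> _ _; rewrite !mul0r mulr0 !add0r !addr0 !mul1r divr1 mulr1 => /eqP.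
  by rewrite -subr_eq0 addrK mulf_eq0 invr_eq0 (negPf two0) orbF => /eqP.
have e30 : G 3%N 0%N = 1.
  have := @E 3%N 0%N isT isT isT; rewrite !big_ord_recl big_ord0 /= e20 e10 e00 b0 a3 !mul0r !mulr0 !addr0 mulr0 addr0.
  by case: f => -> _ _ -> _; rewrite mulr1 => h; rewrite -[LHS](divfK six0) h mulVf.
have e40 : G 4%N 0%N = (A 4%N * B 1%N ^+ 2 - 2%:R * A 2%N * B 3%N * B 1%N - 2%:R * B 2%N * n) / (n * B 1%N).
  have := @E 4%N 0%N isT isT isT; rewrite !big_ord_recl big_ord0 /= /bump /= e30 e20 e10 e00 b0 b1 !mul0r !mulr0 !addr0.
  case: f => -> _ _ _ ->; rewrite !mulr1 => h.
  have n24 : 24%:R != 0 :> C by rewrite pnatr_eq0.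
  have {}h : G 4%N 0%N = 24%:R * a 4%N - 24%:R * q * 6%:R^-1.
    by rewrite -h (_ : (4 - (1 + 0))`! = 6)%N //; field.
  rewrite h a4; field; by rewrite N3' B1.
by split=> //; split=> //; rewrite e40 mulf_neq0 ?invr_neq0 ?mulf_neq0.
Qed.
End Coefs.

Definition mx3 (r0 r1 r2 : C * C * C) : 'M[C]_3 := \matrix_(i, j)
  let r := if i == 0 then r0 else if i == 1 then r1 else r2 in
  if j == 0 then r.1.1 else if j == 1 then r.1.2 else r.2.

Lemma aff_at (m : 'M[C]_3) p w i : aff (m, - (m *m p)) w i 0 =
  m i 0 * (w 0 0 - p 0 0) + m i 1 * (w 1 0 - p 1 0) + m i ord_max * (w ord_max 0 - p ord_max 0).
Proof. by rewrite affE /= [(- _ : 'cV[C]_3) i 0]mxE [(m *m p) i 0]mxE sum3; ring. Qed.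

Lemma ruled_den_neq0 (be : C -> C) (h0 : 'cV[C]_2) q d : holomorphic_at (xf be) h0 ->
  \forall h \near h0, 1 + q * ((be ((h : 'cV[C]_2) 0 0) - be (h0 0 0)) / d) != 0.
Proof.
move=> hb; pose f h := 1 + q * ((xf be h - be (h0 0 0)) / d).
have hf : holomorphic_at f h0.
  have h1 := holoM (holoD hb (holo_cst (- be (h0 0 0)) h0)) (holo_cst d^-1 h0).
  exact: holoD (holo_cst 1 h0) (holoM (holo_cst q h0) h1).
by apply: (holo_nz hf); rewrite /f /xf subrr mul0r mulr0 addr0 oner_neq0.
Qed.

(** A function affine in y stays so, up to division by a function of x, under the affine
    maps that keep the ruling. The shear y + c x removes x squared, adding q u to y
    removes x squared y, and the scale lam makes the coefficient of x cubed equal to 1.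
    So the normal form at each point is a quotient of explicit functions of x, affine in
    y. *)
Lemma ruled_normal (al be : C -> C) (S : graphed R) p :
  open (dom S) -> fn S = ruled_fn al be -> graph S p ->
  let h0 := coord_xy p in holomorphic_at (xf al) h0 -> holomorphic_at (xf be) h0 ->
  let A j := xd al j h0 + h0 1 0 * xd be j h0 in let B j := xd be j h0 in
  let n3 := B 1%N * A 3%N - 3%:R / 2%:R * A 2%N * B 2%N in
  B 1%N != 0 -> n3 != 0 ->
  A 4%N * B 1%N ^+ 2 - 2%:R * A 2%N * B 3%N * B 1%N - 2%:R * B 2%N * n3 != 0 ->
  exists g G, normal3 S p g G /\ G 4%N 0%N != 0.
Proof.
move=> oD hF gp h0 hal hbe A B n3 B1 N3 N4.
have [hdp hup] := gp.
pose x0 := h0 0 0; pose y0 := h0 1 0.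
pose c := A 2%N / (2%:R * B 1%N); pose q := B 2%N / (2%:R * B 1%N); pose lam := B 1%N ^+ 2 / n3.
have lam0 : lam != 0 by rewrite mulf_neq0 ?expf_neq0 ?invr_neq0.
pose b3 (x : C) := (be x - B 0%N) / B 1%N.
(* The expansion of the graph at p, without its terms of order at most two. *)
pose num (k : 'cV[C]_2) := lam * (al (x0 + k 0 0) + y0 * be (x0 + k 0 0) - A 0%N - k 0 0 * A 1%N
  - c * (k 0 0 * (be (x0 + k 0 0) - B 0%N))) / B 1%N.
pose den (k : 'cV[C]_2) := 1 + q * b3 (x0 + k 0 0).
pose Phi k := (num k + k 1 0 * b3 (x0 + k 0 0)) / den k.
have B0E : B 0%N = be x0 by rewrite /B xd0.
have A0E : A 0%N = al x0 + y0 * be x0 by rewrite /A !xd0.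
have hA j : xd al j h0 / j`!%:R + y0 * (xd be j h0 / j`!%:R) = A j / j`!%:R by rewrite /A mulrDl mulrA.
have hB j : xd be j h0 = B j by [].
clearbody A B.
have den0 : den 0 != 0 by rewrite /den /b3 mxE addr0 -B0E subrr mul0r mulr0 addr0 oner_neq0.
have ha := holo_xf hal; have hb := holo_xf hbe; rewrite -/x0 in ha hb.
have hx := holo_coord 0 (0 : 'cV[C]_2); have hy := holo_coord 1 (0 : 'cV[C]_2).
have hcst (e : C) := holo_cst e (0 : 'cV[C]_2).
have hb3 : holomorphic_at (fun k : 'cV[C]_2 => b3 (x0 + k 0 0)) 0.
  exact: holoM (holoB hb (hcst _)) (hcst _).
have hnum : holomorphic_at num 0.
  apply: holoM (hcst _); apply: holoM; first exact: hcst.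
  apply: holoB; last exact: holoM (hcst _) (holoM hx (holoB hb (hcst _))).
  apply: holoB (holoM hx (hcst _)); apply: holoB (hcst _).
  exact: holoD ha (holoM (hcst _) hb).
have hden : holomorphic_at den 0 by exact: holoD (hcst 1) (holoM (hcst q) hb3).
have hPhi : holomorphic_at Phi 0 by exact: holoM (holoD hnum (holoM hy hb3)) (holoV hden den0).
pose G j k := partials Phi j k 0.
have tPhi : taylor_at Phi 0 (Defs.double G) := taylor_of_partials hPhi.
have [Pa [ja ca]] := jeq_xf 5 hal; have [Pb [jb cb]] := jeq_xf 5 hbe; rewrite -/x0 in ja jb.
pose PB : BP := bC (B 1%N)^-1 * (Pb - bC (B 0%N)).
pose PA : BP := bC (lam / B 1%N) * (Pa + bC y0 * Pb - bC (A 0%N) - xx * bC (A 1%N)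
  - bC c * (xx * (Pb - bC (B 0%N)))).
have jB : jeq 5 (fun k => b3 (x0 + k 0 0)) PB.
  have := jeqM (jeqC 5 (B 1%N)^-1) (jeqB jb (jeqC 5 (B 0%N))).
  by apply: jeq_eq; apply: filterE => k; rewrite /b3 mulrC.
have jA : jeq 5 num PA.
  have := jeqM (jeqC 5 (lam / B 1%N)) (jeqB (jeqB (jeqB (jeqD ja (jeqM (jeqC 5 y0) jb)) (jeqC 5 (A 0%N)))
    (jeqM (jeqx 5) (jeqC 5 (A 1%N)))) (jeqM (jeqC 5 c) (jeqM (jeqx 5) (jeqB jb (jeqC 5 (B 0%N)))))).
  by apply: jeq_eq; apply: filterE => k; rewrite /num [RHS]mulrAC.
have bB j k : (j < 5)%N -> (k < 5)%N -> bc PB j k =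
    if k == 0%N then (B 1%N)^-1 * (B j / j`!%:R - if j == 0%N then B 0%N else 0) else 0.
  move=> hj hk; rewrite /PB bc_C bcB cb // bc_CE.
  by case: k hk => [|k] _ /=; rewrite ?andbT ?hB // andbF subr0 mulr0.
pose b j := bc PB j 0; pose a j := bc PA j 0.
have hbb j : (j < 5)%N -> b j = (B 1%N)^-1 * (B j / j`!%:R - if j == 0%N then B 0%N else 0).
  by move=> hj; rewrite /b bB.
have bA j k : (j < 5)%N -> (k < 5)%N -> bc PA j k = if k == 0%N then
    lam / B 1%N * (A j / j`!%:R - (if j == 0%N then A 0%N else 0)
  - (if j == 1%N then A 1%N else 0) - c * (if j is j'.+1 then B j' / j'`!%:R - (if j' == 0%N then B 0%N else 0) else 0)) else 0.
  move=> hj hk; rewrite /PA bc_C !bcB bcD bc_C ca // cb // bc_CE !bc_X bc_C bc_X.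
  case: k hk => [|k] hk; last first.
    rewrite !andbF; case: j hj => [|j] hj; first by rewrite !mulr0 !subr0 addr0 mulr0.
    by rewrite bc_CE bcB bc_CE cb ?(ltnW hj) // !andbF !subr0 !mulr0 subr0 addr0 mulr0.
  case: j hj => [|[|j]] hj; rewrite ?bc_CE ?bcB ?bc_CE ?cb ?(ltnW hj) //=; congr (_ * _).
  - by rewrite hA !mulr0.
  - by rewrite hA hB.
  by rewrite hA hB ?subr0.
have jE := jeqM (jeqD (jeqC 5 1) (jeqM (jeqC 5 q) jB)) (jeq_taylor 5 tPhi).
have jE' := jeqD jA (jeqM (jeqy 5) jB).
have near0 : \forall k \near (0 : 'cV[C]_2), (1 + q * b3 (x0 + (k : 'cV[C]_2) 0 0)) * Phi (0 + k) = num k + k 1 0 * b3 (x0 + k 0 0).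
  have := holo_nz hden den0; apply: filterS => k nk.
  by rewrite add0r /Phi mulrC divfK.
have E0 := jet_unique (jeq_eq near0 jE) jE'.
have E : forall j k, (j < 5)%N -> (k < 5)%N -> (j + k < 5)%N ->
  G j k / (j`!%:R * k`!%:R) + q * (\sum_(i < j.+1) b i * (G (j - i)%N k / ((j - i)`!%:R * k`!%:R))) =
  (if k == 0%N then a j else 0) + (if k == 1%N then b j else 0).
  move=> j k hj hk hjk; have := E0 j k hjk.
  have e1 (P : BP) : bc (bC 1 * P) j k = bc P j k by rewrite bc_C mul1r.
  rewrite (bcD PA) mulrDl (bcD (bC 1 * _)) e1 -mulrA bc_C (@bcM_xf _ PB _ 5 j k) //; last by move=> i l hi hl nl; rewrite bB // (negPf nl).
  rewrite bc_bpoly hj hk /=.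
  have -> : \sum_(i < j.+1) bc PB i 0 * bc (bpoly 5 (fun j k => G j k / (j`!%:R * k`!%:R))) (j - i) k =
    \sum_(i < j.+1) b i * (G (j - i)%N k / ((j - i)`!%:R * k`!%:R)).
    by apply: eq_bigr => i _; rewrite bc_bpoly hk (leq_ltn_trans (leq_subr _ _) hj).
  move=> ->; rewrite bA // bc_Y; congr (_ + _); first by rewrite /a bA.
  case: k hk {hjk e1} => [|[|k]] hk //.
  by rewrite bB // (ltnW hk).
have [[low1 low2 low3] [g30 g03 g40]] : _ :=
  @ruled_coefs A B a b G B1 N3 N4 hbb (fun i hi => bA i 0%N hi isT) E.
(* The composite of the shears and dilations, in closed form. *)
pose M := mx3 (1, 0, 0) (lam * (c - q * A 1%N / B 1%N), lam * (1 - q * B 0%N / B 1%N), lam * q / B 1%N)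
  (- lam * A 1%N / B 1%N, - lam * B 0%N / B 1%N, lam / B 1%N).
pose N := mx3 (1, 0, 0) (- c, lam^-1, - q / lam) (A 1%N - B 0%N * c, B 0%N / lam, (B 1%N - B 0%N * q) / lam).
have hMN : M *m N = 1%:M.
  apply/matrixP => i j; rewrite !mxE sum3 !mxE.
  case: (ord3P i) => ->; case: (ord3P j) => -> /=; rewrite /c /q; field; by rewrite ?lam0 ?B1.
pose g : affine R := (M, - (M *m p)).
have gE w i := aff_at M p w i; rewrite -/g in gE.
have p0E : p 0 0 = x0 by rewrite /x0 /h0 xy0.
have p1E : p 1 0 = y0 by rewrite /y0 /h0 xy1.
have p2E : p ord_max 0 = A 0%N by rewrite A0E /x0 /y0 -[p ord_max 0]/(coord_u p) hup hF.
exists g, G; split; last exact: g40.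
split; [|exact: g30|exact: g03].
split; last by split; [exact: low1|exact: low2|exact: low3].
split.
- by case/mulmx1_unit: hMN.
- by apply/matrixP => i j; rewrite ord1 gE !subrr !mulr0 !addr0 mxE.
exists Phi; first exact: tPhi.
have nD : \forall w \near p, dom S (coord_xy w) by apply: xy_near; apply: open_nbhs_nbhs.
have nz : \forall w \near p, 1 + q * b3 (coord_xy w 0 0) != 0.
  by have := xy_near (ruled_den_neq0 q (B 1%N) hbe); apply: filterS => w; rewrite -B0E.
apply: filterS2 nD nz => w dw nw.
have gX : aff g w 0 0 = w 0 0 - x0 by rewrite gE !mxE /= p0E; ring.
pose U := (w ord_max 0 - A 0%N - A 1%N * (w 0 0 - x0) - B 0%N * (w 1 0 - y0)) / B 1%N.
have gU : aff g w ord_max 0 = lam * U by rewrite gE !mxE /= p0E p1E p2E /U; field.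
have gY : aff g w 1 0 = lam * (w 1 0 - y0 + c * (w 0 0 - x0) + q * U).
  by rewrite gE !mxE /= p0E p1E p2E /U /c /q; field.
have xE : x0 + (w 0 0 - x0) = w 0 0 by ring.
have dE : den (coord_xy (aff g w)) = 1 + q * b3 (w 0 0) by rewrite /den xy0 gX xE.
rewrite xy0 in nw.
have key : lam * U * (1 + q * b3 (w 0 0)) - (num (coord_xy (aff g w)) + aff g w 1 0 * b3 (w 0 0)) =
  lam / B 1%N * (w ord_max 0 - (al (w 0 0) + w 1 0 * be (w 0 0))).
  by rewrite /num xy0 gX xE gY /b3 /U; field.
have uE : coord_u (aff g w) = Phi (coord_xy (aff g w)) <-> w ord_max 0 = al (w 0 0) + w 1 0 * be (w 0 0).
  rewrite /Phi dE xy0 xy1 gX xE -[coord_u _]/(aff g w ord_max 0) gU; split=> h.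
    apply/eqP; rewrite -subr_eq0; move/eqP: key; rewrite h divfK // subrr eq_sym mulf_eq0.
    by rewrite mulf_eq0 (negPf lam0) invr_eq0 (negPf B1).
  by apply: (canRL (mulfK nw)); apply/eqP; rewrite -subr_eq0 key h subrr mulr0.
rewrite uE /graph /= hF /ruled_fn !xy0 !xy1; split; first by case.
by move=> h; split.
Qed.
End Ruled.

(** * Homogeneous ruled surfaces *)
Section Model.
Variable R : realType.
Notation C := (Cx R).
Notation BP := {poly {poly C}}.
Local Notation pnt := Defs.point.

Lemma partials10 (F : 'cV[C]_2 -> C) h : partials F 1 0 h = partial 0 F h.
Proof. by []. Qed.

Lemma partials01 (F : 'cV[C]_2 -> C) h : partials F 0 1 h = partial 1 F h.
Proof. by []. Qed.

Lemma holo_xd (al : C -> C) j h : holomorphic_at (xf al) h -> holomorphic_at (xd al j) h.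
Proof. exact: holo_partials. Qed.

Local Opaque partial holomorphic_at taylor_at hessian partials jeq.
Local Opaque bC bX bY bc bev xd.
Local Notation xx := (bX R).
Local Notation yy := (bY R).

Lemma holo_ruled (al be : C -> C) h : holomorphic_at (xf al) h -> holomorphic_at (xf be) h ->
  holomorphic_at (ruled_fn al be) h.
Proof. by move=> ha hb; exact: holoD ha (holoM (holo_coord 1 h) hb). Qed.

Lemma ruled_partials (al be : C -> C) h : holomorphic_at (xf al) h -> holomorphic_at (xf be) h ->
  forall j, [/\ partials (ruled_fn al be) j 0 h = xd al j h + h 1 0 * xd be j h,
    partials (ruled_fn al be) j 1 h = xd be j h &
    forall k, partials (ruled_fn al be) j k.+2 h = 0].
Proof.
move=> ha hb j.
have E k : partials (ruled_fn al be) j k h / (j`!%:R * k`!%:R) =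
    (if k == 0%N then xd al j h / j`!%:R + h 1 0 * (xd be j h / j`!%:R) else 0) +
    (if k == 1%N then xd be j h / j`!%:R else 0).
  have hjN : (j < (j + k).+1)%N by rewrite ltnS leq_addr.
  have hkN : (k < (j + k).+1)%N by rewrite ltnS leq_addl.
  have [Pa [ja ca]] := jeq_xf (j + k).+1 ha; have [Pb [jb cb]] := jeq_xf (j + k).+1 hb.
  have j1 := jeqD ja (jeqM (jeqD (jeqC (j + k).+1 (h 1 0)) (jeqy R (j + k).+1)) jb).
  have j2 := jeq_taylor (j + k).+1 (taylor_of_partials (holo_ruled ha hb)).
  have e12 : \forall u \near (0 : 'cV[C]_2), ruled_fn al be (h + u) =
      al (h 0 0 + (u : 'cV[C]_2) 0 0) + (h 1 0 + u 1 0) * be (h 0 0 + u 0 0).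
    by apply: filterE => u; rewrite /ruled_fn !mxE.
  have := jet_unique (jeq_eq e12 j2) j1 (ltnSn (j + k)).
  rewrite bc_bpoly hjN hkN /= => ->; rewrite (bcD Pa) mulrDl (bcD (bC _ * _)) bc_C bc_Y ca // cb //.
  clear j1 j2 e12 ca ja jb; case: k hjN hkN cb => [|[|k]] hjN hkN cb /=.
  - by rewrite !addr0.
  - by rewrite mulr0 !add0r cb.
  by rewrite mulr0 !add0r cb ?(ltnW hkN).
have f0 n : (n`!%:R : C) != 0 by rewrite pnatr_eq0 -lt0n fact_gt0.
split=> [||k].
- have := E 0%N; rewrite /= mulr1 addr0 mulrA -mulrDl => /(mulIf (invr_neq0 (f0 j))) //.
- by have := E 1%N; rewrite /= mulr1 add0r => /(mulIf (invr_neq0 (f0 j))).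
have := E k.+2; rewrite /= addr0 => /eqP; rewrite mulf_eq0 invr_eq0 mulf_eq0 !(negPf (f0 _)) !orbF.
by move/eqP.
Qed.

Lemma hess_nz (a b c : C) : b = 0 -> c != 0 -> a * b - c ^+ 2 != 0.
Proof. by move=> -> c0; rewrite mulr0 sub0r oppr_eq0 expf_neq0. Qed.

Lemma ruled_normalized (I : nat -> nat -> C) (a b : nat -> C) :
  (forall j k, I j k = if k == 0%N then a j else if k == 1%N then b j else 0) ->
  [/\ a 0%N = 0, a 1%N = 0, a 2%N = 0, a 3%N = 1 & a 4%N = 1] ->
  [/\ b 0%N = 0, b 1%N = 1 & b 2%N = 0] -> normalized I.
Proof.
move=> hI [a0 a1 a2 a3 a4] [b0 b1 b2]; split; last by rewrite hI.
- by move=> [|[|j]] [|[|k]] // _; rewrite hI.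
- by rewrite !hI.
by rewrite !hI.
Qed.

Lemma lin_exchange (k l s s' a b a' b' : C) :
  s * (k * a + l * b) + s' * (k * a' + l * b') = k * (s * a + s' * a') + l * (s * b + s' * b').
Proof. ring. Qed.

Lemma lin_tangent (k l s s' : C) (v w : 'cV[C]_3) :
  v ord_max 0 = k * v 0 0 + l * v 1 0 -> w ord_max 0 = k * w 0 0 + l * w 1 0 ->
  (s *: v + s' *: w) ord_max 0 = k * (s *: v + s' *: w) 0 0 + l * (s *: v + s' *: w) 1 0.
Proof. by move=> h1 h2; rewrite !mxE h1 h2; exact: lin_exchange. Qed.

Definition tangent_at (al be : C -> C) (X : affine R) (h : 'cV[C]_2) : Prop :=
  let v := aff X (pnt h (ruled_fn al be h)) in
  v ord_max 0 = (xd al 1 h + h 1 0 * xd be 1 h) * v 0 0 + be (h 0 0) * v 1 0.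

Lemma affE_lin (X Y : affine R) s t w :
  aff (s *: X.1 + t *: Y.1, s *: X.2 + t *: Y.2) w = s *: aff X w + t *: aff Y w.
Proof. by rewrite /aff /= mulmxDl -!scalemxAl !scalerDr addrACA. Qed.

(** The conditions required of a homogeneous surface of the branch are open, given that
    the coefficient of y cubed vanishes for ruled surfaces; so they hold on a small
    polydisc. At the origin the Taylor coefficients are already normalized and are the
    invariants. *)
Lemma ruled_model (al be : C -> C) (X Y : affine R) :
  holomorphic_at (xf al) 0 -> holomorphic_at (xf be) 0 ->
  [/\ xd al 0 0 = 0, xd al 1 0 = 0, xd al 2 0 = 0, xd al 3 0 = 1 & xd al 4 0 = 1] ->
  [/\ xd be 0 0 = 0, xd be 1 0 = 1 & xd be 2 0 = 0] ->
  (\forall h \near (0 : 'cV[C]_2), tangent_at al be X h) ->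
  (\forall h \near (0 : 'cV[C]_2), tangent_at al be Y h) ->
  X.2 0 0 * Y.2 1 0 - X.2 1 0 * Y.2 0 0 != 0 ->
  exists (S : graphed R) p, [/\ in_B21 S, homogeneous S, graph S p &
    moduli_point S p = \col_i tnth [tuple xd be 3 0; 0; xd al 5 0; xd be 4 0; 0] i].
Proof.
move=> ha hb [a0 a1 a2 a3 a4] [b0 b1 b2] hX hY nXY.
pose F := ruled_fn al be.
have hF : holomorphic_at F 0 := holo_ruled ha hb.
(* The quantities that the normal form at a point requires to be nonzero. *)
pose A j (h : 'cV[C]_2) := xd al j h + h 1 0 * xd be j h.
pose n3 h := xd be 1 h * A 3%N h - 3%:R / 2%:R * A 2%N h * xd be 2 h.
pose n4 h := A 4%N h * xd be 1 h ^+ 2 - 2%:R * A 2%N h * xd be 3 h * xd be 1 h - 2%:R * xd be 2 h * n3 h.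
pose D h := aff X (pnt h (F h)) 0 0 * aff Y (pnt h (F h)) 1 0 - aff X (pnt h (F h)) 1 0 * aff Y (pnt h (F h)) 0 0.
have hcst (e : C) := holo_cst e (0 : 'cV[C]_2).
have hy := holo_coord 1 (0 : 'cV[C]_2); have hx := holo_coord 0 (0 : 'cV[C]_2).
have dal j := holo_xd j ha; have dbe j := holo_xd j hb.
have hA j : holomorphic_at (A j) 0 by exact: holoD (dal j) (holoM hy (dbe j)).
have h3 : holomorphic_at n3 0.
  exact: holoB (holoM (dbe 1%N) (hA 3%N)) (holoM (holoM (hcst _) (hA 2%N)) (dbe 2%N)).
have sq (f : 'cV[C]_2 -> C) : holomorphic_at f 0 -> holomorphic_at (fun h => f h ^+ 2) 0.
  by move=> hf; have := holoM hf hf; under eq_fun do rewrite -expr2.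
have h4 : holomorphic_at n4 0.
  apply: holoB; last exact: holoM (holoM (hcst _) (dbe 2%N)) h3.
  apply: holoB; first exact: holoM (hA 4%N) (sq _ (dbe 1%N)).
  exact: holoM (holoM (holoM (hcst _) (hA 2%N)) (dbe 3%N)) (dbe 1%N).
have haff (Z : affine R) i : holomorphic_at (fun h => aff Z (pnt h (F h)) i 0) 0.
  have := holoD (holoD (holoD (holoM (hcst (Z.1 i 0)) hx) (holoM (hcst (Z.1 i 1)) hy))
    (holoM (hcst (Z.1 i ord_max)) hF)) (hcst (Z.2 i 0)).
  have -> : (fun h => aff Z (pnt h (F h)) i 0) = (fun h : 'cV[C]_2 =>
     Z.1 i 0 * h 0 0 + Z.1 i 1 * h 1 0 + Z.1 i ord_max * F h + Z.2 i 0) => //.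
  by apply/funext => h; rewrite affE point0 point1 point2.
have hD : holomorphic_at D 0 by exact: holoB (holoM (haff X 0) (haff Y 1)) (holoM (haff X 1) (haff Y 0)).
have A0 j : A j 0 = xd al j 0 by rewrite /A mxE mul0r addr0.
have al0 : al 0 = 0 by have := a0; rewrite xd0 mxE.
have F0 : F 0 = 0 by rewrite /F /ruled_fn !mxE mul0r addr0.
have p00 : pnt 0 (F 0) = 0 by rewrite F0; apply: cv3P; rewrite ?point0 ?point1 ?point2 !mxE.
have n30 : n3 0 = 1 by rewrite /n3 !A0 a2 a3 b1 b2; ring.
have z3 : n3 0 != 0 by rewrite n30 oner_neq0.
have z4 : n4 0 != 0 by rewrite /n4 n30 !A0 a2 a4 b1 b2 (_ : _ - _ = 1) ?oner_neq0 //; ring.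
have zb : xd be 1 0 != 0 by rewrite b1 oner_neq0.
have zD : D 0 != 0 by rewrite /D p00 !affE !mxE !mulr0 !add0r.
pose Q h := ((tangent_at al be X h /\ tangent_at al be Y h) /\
  (holomorphic_at (xf al) h /\ holomorphic_at (xf be) h)) /\
  ((n3 h != 0 /\ n4 h != 0) /\ (D h != 0 /\ xd be 1 h != 0)).
have nQ : nbhs (0 : 'cV[C]_2) Q.
  apply: filterI; apply: filterI; apply: filterI.
  - exact: hX.
  - exact: hY.
  - exact: holo_open ha.
  - exact: holo_open hb.
  - exact: holo_nz h3 z3.
  - exact: holo_nz h4 z4.
  - exact: holo_nz hD zD.
  exact: holo_nz (dbe 1%N) zb.
have [r r0 hr] := nbhs_inbox nQ.
pose S : graphed R := Graphed (obox r) F.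
have inS h : obox r h -> inbox r h by move=> hh i; exact: ltW (hh i).
have hal h : obox r h -> holomorphic_at (xf al) h by move=> /inS/hr; rewrite add0r => -[[_ []]].
have hbe h : obox r h -> holomorphic_at (xf be) h by move=> /inS/hr; rewrite add0r => -[[_ []]].
have hb1 h : obox r h -> xd be 1 h != 0 by move=> /inS/hr; rewrite add0r => -[_ [_ []]].
have hD' h : obox r h -> D h != 0 by move=> /inS/hr; rewrite add0r => -[_ [_ []]].
have hn3 h : obox r h -> n3 h != 0 by move=> /inS/hr; rewrite add0r => -[_ [[]]].
have hn4 h : obox r h -> n4 h != 0 by move=> /inS/hr; rewrite add0r => -[_ [[]]].
have tX h : obox r h -> tangent_at al be X h by move=> /inS/hr; rewrite add0r => -[[[]]].
have tY h : obox r h -> tangent_at al be Y h by move=> /inS/hr; rewrite add0r => -[[[]]].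
have ob0 : obox r 0 by move=> i; rewrite mxE nrm0.
have sS : surface S.
  split; [exact: obox_open|exact: obox_connected|by exists 0|by move=> h hh; apply: holo_ruled; [exact: hal|exact: hbe]|].
  move=> h hh; rewrite hessianE /=; have P := ruled_partials (hal h hh) (hbe h hh).
  have [_ _ p02] := P 0%N; have [_ p11 _] := P 1%N.
  by apply: (hess_nz _ (p02 0%N)); rewrite p11; exact: hb1.
have nS p : graph S p -> exists g G, normal3 S p g G /\ G 4%N 0%N != 0.
  move=> gp; have [dp _] := gp.
  exact: (@ruled_normal R al be S p (@obox_open R r) erefl gp (hal _ dp) (hbe _ dp) (hb1 _ dp) (hn3 _ dp) (hn4 _ dp)).
have bS : in_B21 S.
  split; last exact: nS.
  split; first exact: sS.
  by move=> p /nS[g [G [[n2 e1 e2] _]]]; exists g, G; split; [exact: n2|rewrite e1 oner_neq0|exact: e2].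
have xy00 : coord_xy (0 : 'cV[C]_3) = 0 by rewrite -p00 coord_xy_point.
have g0 : graph S 0 by split; rewrite /= xy00 // F0 /coord_u mxE.
have slope h : obox r h -> partial 0 F h = A 1%N h /\ partial 1 F h = be (h 0 0).
  move=> hh; have P := ruled_partials (hal h hh) (hbe h hh).
  by have [e1 _ _] := P 1%N; have [_ e2 _] := P 0%N; rewrite -partials10 -partials01 e1 e2 xd0.
have tf (Z : affine R) : (forall h, obox r h -> tangent_at al be Z h) -> tangent_field S Z.
  move=> hZ p gp; have [dp _] := gp; have [s1 s2] := slope _ dp; rewrite /tangent_plane /= s1 s2.
  by have := hZ _ dp; rewrite /tangent_at -/F -[pnt _ (F _)](graph_point gp).
have hom : homogeneous S.
  move=> p gp t; have [dp _] := gp; have [s1 s2] := slope _ dp; rewrite /tangent_plane /= s1 s2 => ht.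
  have hDp := hD' _ dp; have tXp := tX _ dp; have tYp := tY _ dp.
  rewrite /D /tangent_at -/F -[pnt _ (F _)](graph_point gp) in hDp tXp tYp.
  set v := aff X p in hDp tXp; set w := aff Y p in hDp tYp.
  pose d := v 0 0 * w 1 0 - v 1 0 * w 0 0.
  pose s := (t 0 0 * w 1 0 - t 1 0 * w 0 0) / d; pose s' := (v 0 0 * t 1 0 - v 1 0 * t 0 0) / d.
  have d0 : d != 0 by [].
  have k0 : s * v 0 0 + s' * w 0 0 = t 0 0 by rewrite /s /s' /d; field.
  have k1 : s * v 1 0 + s' * w 1 0 = t 1 0 by rewrite /s /s' /d; field.
  exists (s *: X.1 + s' *: Y.1, s *: X.2 + s' *: Y.2).
    apply: tf => h hh; rewrite /tangent_at affE_lin.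
    exact: lin_tangent (tX h hh) (tY h hh).
  have e i : aff (s *: X.1 + s' *: Y.1, s *: X.2 + s' *: Y.2) p i 0 = s * v i 0 + s' * w i 0.
    by rewrite affE_lin -/v -/w [LHS]mxE [(s *: v) i 0]mxE [(s' *: w) i 0]mxE.
  apply: cv3P; rewrite e //.
  move: e => _; rewrite -[t ord_max 0]/(coord_u t) ht -k0 -k1 tXp tYp /A.
  exact: lin_exchange.
exists S, 0; split; [exact: bS|exact: hom|exact: g0|].
have P := ruled_partials ha hb.
have I j k : partials F j k 0 = if k == 0%N then xd al j 0 else if k == 1%N then xd be j 0 else 0.
  have [e0 e1 e2] := P j; case: k => [|[|k]] /=; [|exact: e1|exact: e2].
  by rewrite e0 mxE mul0r addr0.
have nI : normalized (fun j k => partials F j k 0).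
  exact: (ruled_normalized I (And5 a0 a1 a2 a3 a4) (And3 b0 b1 b2)).
have br : branch S 0 by split.
have [_ hI] := normE br (normal4_self br (taylor_of_partials hF) nI).
by apply/matrixP => i j; rewrite /moduli_point !mxE !hI !I.
Qed.
End Model.

(** * Two families of models *)
Section Models.
Variable R : realType.
Notation C := (Cx R).
Notation BP := {poly {poly C}}.
Local Notation pnt := Defs.point.

Lemma xd1 (al : C -> C) h : xd al 1 h = partial 0 (xf al) h.
Proof. by []. Qed.

Lemma taylor_holo n (f : 'cV[C]_n -> C) a c : taylor_at f a c -> holomorphic_at f a.
Proof. by exists c. Qed.

Local Opaque partial holomorphic_at taylor_at hessian partials jeq.
Local Opaque bC bX bY bc bev xd.
Local Notation xx := (bX R).
Local Notation yy := (bY R).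

Lemma xd_jet (F : C -> C) (P : BP) h j : holomorphic_at (xf F) h ->
  jeq j.+1 (fun k => F (h 0 0 + k 0 0)) P -> xd F j h = j`!%:R * bc P j 0.
Proof.
move=> hF hP; have [Q [hQ hc]] := jeq_xf j.+1 hF.
have f0 : (j`!%:R : C) != 0 by rewrite pnatr_eq0 -lt0n fact_gt0.
have := jet_unique hP hQ (ltac:(by rewrite addn0) : (j + 0 < j.+1)%N).
by rewrite hc // => ->; rewrite /= mulrC divfK.
Qed.

Lemma near_translate (P : 'cV[C]_2 -> Prop) (h : 'cV[C]_2) : (\forall k \near h, P k) ->
  \forall k \near (0 : 'cV[C]_2), P (h + k : 'cV[C]_2).
Proof.
move=> /nbhs_inbox[r r0 H]; apply: (inbox_nbhs r0) => k hk; rewrite add0r; exact: H.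
Qed.

Section Rules.
Variables (f g F : C -> C) (h : 'cV[C]_2).
Hypotheses (hf : holomorphic_at (xf f) h) (hg : holomorphic_at (xf g) h) (hF : holomorphic_at (xf F) h).

Lemma xd_mul j : (\forall k \near h, xf F k = xf f k * xf g k) ->
  xd F j h = j`!%:R * \sum_(i < j.+1) (xd f i h / i`!%:R) * (xd g (j - i)%N h / (j - i)`!%:R).
Proof.
move=> /near_translate e.
have [P [hP cP]] := jeq_xf j.+1 hf; have [Q [hQ cQ]] := jeq_xf j.+1 hg.
have e' : \forall k \near (0 : 'cV[C]_2), f (h 0 0 + (k : 'cV[C]_2) 0 0) * g (h 0 0 + k 0 0) = F (h 0 0 + k 0 0).
  by apply: filterS e => k; rewrite /xf mxE.
rewrite (xd_jet hF (jeq_eq e' (jeqM hP hQ))) (@bcM_xf _ P Q j.+1) //; last first.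
  by move=> i k hi hk nk; rewrite cP // (negPf nk).
congr (_ * _); apply: eq_bigr => i _; rewrite cP // cQ //.
by rewrite ltnS leq_subr.
Qed.

Lemma xd_lin j (p q : C) : (\forall k \near h, xf F k = p * xf f k + q * xf g k) ->
  xd F j h = p * xd f j h + q * xd g j h.
Proof.
move=> /near_translate e.
have [P [hP cP]] := jeq_xf j.+1 hf; have [Q [hQ cQ]] := jeq_xf j.+1 hg.
have e' : \forall k \near (0 : 'cV[C]_2), p * f (h 0 0 + (k : 'cV[C]_2) 0 0) + q * g (h 0 0 + k 0 0) = F (h 0 0 + k 0 0).
  by apply: filterS e => k; rewrite /xf mxE.
rewrite (xd_jet hF (jeq_eq e' (jeqD (jeqM (jeqC _ p) hP) (jeqM (jeqC _ q) hQ)))) bcD !bc_C cP // cQ //=.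
have f0 : (j`!%:R : C) != 0 by rewrite pnatr_eq0 -lt0n fact_gt0.
by field.
Qed.
End Rules.

Lemma holo_id h : holomorphic_at (xf (fun x : C => x)) h.
Proof. exact: holo_coord. Qed.

Lemma xd_id (h : 'cV[C]_2) j : xd (fun x : C => x) j h = if j == 0%N then h 0 0 else (j == 1%N)%:R.
Proof.
have e : \forall k \near (0 : 'cV[C]_2), h 0 0 + (k : 'cV[C]_2) 0 0 * 1 = h 0 0 + k 0 0.
  by apply: filterE => k; rewrite mulr1.
rewrite (xd_jet (holo_id h) (jeq_eq e (jeqD (jeqC _ (h 0 0)) (jeqM (jeqx R _) (jeqC _ 1))))) bcD bc_X !bc_CE.
have f1 : 1`! = 1%N by [].
by case: j => [|[|j]] /=; rewrite ?bc_CE /= ?f1 ?addr0 ?add0r ?mul1r ?mulr0.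
Qed.

Definition aff3 (r0 r1 r2 : C * C * C) (b : C * C * C) : affine R :=
  (mx3 r0 r1 r2, \col_i (if i == 0 then b.1.1 else if i == 1 then b.1.2 else b.2)).

Section First.
Variable m : C.

(** The coefficients of f from that of x cubed on, by the equation (1 - m x) f' = x^2 /
    2 + (1 - 3 m) f. *)
Fixpoint lseq (k : nat) : C := if k is k'.+1 then (m * k'%:R + 1) / (k'.+4)%:R * lseq k' else 6%:R^-1.
Definition lcoef (n : nat) : C := if (n < 3)%N then 0 else lseq (n - 3).

Lemma lcoef_bound n : nrm (lcoef n) <= 1 * (nrm m + 1) ^+ n.
Proof.
have K1 : 1 <= nrm m + 1 by rewrite lerDr nrm_ge0.
have K0 : 0 <= nrm m + 1 by apply: le_trans K1.
have h k : nrm (lseq k) <= (nrm m + 1) ^+ k.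
  elim: k => [|k IH] /=; first by rewrite nrmV nrm_nat expr0 invf_le1 ?ler1n ?ltr0n.
  rewrite nrmM exprS; apply: ler_pM; rewrite ?nrm_ge0 //.
  rewrite nrmM nrmV nrm_nat ler_pdivrMr ?ltr0n //; apply: le_trans (nrmD _ _) _.
  rewrite nrmM nrm_nat nrm1 mulrDl mul1r; apply: lerD; last by rewrite ler1n.
  by apply: ler_wpM2l; rewrite ?nrm_ge0 // ler_nat; lia.
rewrite mul1r /lcoef; case: ltnP => hn; first by rewrite nrm0 exprn_ge0.
apply: le_trans (h _) _; apply: ler_weXn2l => //; exact: leq_subr.
Qed.

Lemma lcoef_rec n : n.+1%:R * lcoef n.+1 - m * (if n is n'.+1 then n'.+1%:R * lcoef n'.+1 else 0) =
  2%:R^-1 * (n == 2%N)%:R + (1 - 3%:R * m) * lcoef n.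
Proof.
have nz k : (k.+1%:R : C) != 0 by rewrite pnatr_eq0.
case: n => [|[|[|n]]]; rewrite /lcoef /= ?mulr0 ?subrr ?addr0 ?subr0 //.
  by have := nz 5%N; have := nz 1%N => *; rewrite mulr1; field.
rewrite (_ : n.+3 - 3 = n)%N ?add0r; last by lia.
have := nz n.+3; rewrite -[n.+4%:R]/((n.+3).+1%:R); move: (lseq n) => l.
have e k : (k.+1%:R : C) = k%:R + 1 by rewrite -addn1 natrD.
rewrite !e; move: (n%:R : C) => t h; field; exact: h.
Qed.

(** The equation satisfied by f is the condition that an affine field with value (1, 0,
    0) at the origin be tangent to u = x y + f(x); the other field is a shear along the
    ruling. *)
Lemma first_model : exists (S : graphed R) p, [/\ in_B21 S, homogeneous S, graph S p &
    moduli_point S p = \col_i tnth [tuple 0; 0; m + 1; 0; 0] i].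
Proof.
have K0 : 0 < nrm m + 1 by apply: ltr_wpDl; rewrite ?nrm_ge0 ?ltr01.
have [f [tf pf pf']] := pser_ex K0 lcoef_bound.
have hf : holomorphic_at (xf f) 0 := taylor_holo tf.
have xf_ j : xd f j 0 = j`!%:R * lcoef j := xd_ser j tf.
have ode : \forall h \near (0 : 'cV[C]_2), (1 - m * (h : 'cV[C]_2) 0 0) * xd f 1 h =
   h 0 0 ^+ 2 / 2%:R + (1 - 3%:R * m) * f (h 0 0).
  apply: filterS2 pf pf' => h h1 h2.
  have e1 := pserD h2 (pserZ (- m) (pserX h2)).
  have e2 := pserD (pserZ 2%:R^-1 (@pser_mono R 2 (h 0 0))) (pserZ (1 - 3%:R * m) h1).
  have : xd f 1 h + - m * (h 0 0 * xd f 1 h) = 2%:R^-1 * h 0 0 ^+ 2 + (1 - 3%:R * m) * f (h 0 0).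
    rewrite xd1; apply: pser_unique e2; move: e1; congr pser; apply/funext => n.
    by rewrite -lcoef_rec mulNr.
  by rewrite [_ / _]mulrC => <-; ring.
pose X := aff3 (0, 0, 0) (0, 0, 0) (1, 0, 0) (0, 1, 0).
pose Y := aff3 (- m, 0, 0) (- 2%:R^-1, 1 - 2%:R * m, 0) (0, 1, 1 - 3%:R * m) (1, 0, 0).
have aX w : [/\ aff X w 0 0 = 0, aff X w 1 0 = 1 & aff X w ord_max 0 = w 0 0].
  by rewrite !affE !mxE /=; split; ring.
have aY w : [/\ aff Y w 0 0 = 1 - m * w 0 0, aff Y w 1 0 = - w 0 0 / 2%:R + (1 - 2%:R * m) * w 1 0 &
    aff Y w ord_max 0 = w 1 0 + (1 - 3%:R * m) * w ord_max 0].
  by rewrite !affE !mxE /=; split; ring.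
have ab := @ruled_model R f (fun x => x) X Y hf (holo_id 0).
have [|||||S [p [h1 h2 h3 h4]]] := ab _ _ _ _.
- have [f3 f4] : 3`! = 6%N /\ 4`! = 24%N by [].
  by rewrite !xf_ /lcoef /= f3 f4; split; rewrite ?mulr0 //; field.
- by rewrite !xd_id /= mxE.
- apply: filterE => h; rewrite /tangent_at; have [-> -> ->] := aX (pnt h (ruled_fn f id h)).
  by rewrite point0 mulr0 add0r mulr1.
- apply: filterS ode => h e; rewrite /tangent_at; have [-> -> ->] := aY (pnt h (ruled_fn f id h)).
  rewrite point0 point1 point2 xd_id /= mulr1.
  have e' : (xd f 1 h + h 1 0) * (1 - m * h 0 0) =
    h 0 0 ^+ 2 / 2%:R + (1 - 3%:R * m) * f (h 0 0) + h 1 0 * (1 - m * h 0 0) by rewrite -e; ring.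
  by rewrite e' /ruled_fn; field.
- by rewrite !mxE /= mulr0 mul1r sub0r oppr_eq0 oner_neq0.
exists S, p; split=> //; rewrite h4 !xd_id xf_ /lcoef /=.
have -> : 5`!%:R * ((m * 1%:R + 1) / 5%:R * ((m * 0%:R + 1) / 4%:R * 6%:R^-1)) = m + 1 :> C.
  have -> : 5`! = 120%N by [].
  by field.
by [].
Qed.
End First.

Section Second.
Variable a : C.
Hypothesis a0 : a != 0.

(** The coefficients of the solution, with value (0, 1) at 0, of the linear system (2 -
    x) w1' = - w1 + 2 w2, (2 - x) w2' = - a w1. *)
Fixpoint wseq (n : nat) : C * C := if n is n'.+1 then
  (((n'%:R - 1) * (wseq n').1 + 2%:R * (wseq n').2) / (2%:R * n'.+1%:R),
   (n'%:R * (wseq n').2 - a * (wseq n').1) / (2%:R * n'.+1%:R)) else (0, 1).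

Lemma wseq_bound n : nrm (wseq n).1 <= 1 * (nrm a + 2%:R) ^+ n /\ nrm (wseq n).2 <= 1 * (nrm a + 2%:R) ^+ n.
Proof.
have A0 := nrm_ge0 a.
have K0 : 0 <= nrm a + 2%:R by rewrite addr_ge0.
rewrite !mul1r; elim: n => [|n [IH1 IH2]]; first by rewrite nrm0 nrm1 expr0.
have P0 : 0 <= (nrm a + 2%:R) ^+ n by rewrite exprn_ge0.
set P := (_ ^+ n) in IH1 IH2 P0 *; rewrite exprS -/P /=.
have n0 : 0 <= n%:R :> R by rewrite ler0n.
have d0 : 0 < 2%:R * (n.+1%:R : R) by rewrite mulr_gt0 ?ltr0n.
have nd : nrm (2%:R * n.+1%:R : C) = 2%:R * n.+1%:R by rewrite nrmM !nrm_nat.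
have E : n.+1%:R = n%:R + 1 :> R by rewrite -addn1 natrD.
have p1 := mulr_ge0 P0 n0; have p2 := mulr_ge0 P0 A0; have p3 := mulr_ge0 p1 A0.
split; rewrite nrmM nrmV nd ler_pdivrMr //.
  apply: le_trans (nrmD _ _) _; rewrite !nrmM nrm_nat.
  have h1 : nrm (n%:R - 1 : C) <= n%:R + 1.
    by apply: le_trans (nrmD _ _) _; rewrite nrmN nrm1 nrm_nat.
  have h2 : nrm (n%:R - 1 : C) * nrm (wseq n).1 <= (n%:R + 1) * P by apply: ler_pM; rewrite ?nrm_ge0.
  by rewrite E; nra.
apply: le_trans (nrmD _ _) _; rewrite nrmN !nrmM nrm_nat.
have h2 : nrm a * nrm (wseq n).1 <= nrm a * P by apply: ler_wpM2l.
have h3 : n%:R * nrm (wseq n).2 <= n%:R * P by apply: ler_wpM2l.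
by rewrite E; nra.
Qed.

Definition wnum n := (wseq n).1.
Definition wden n := (wseq n).2.

Lemma shift_deriv (u : nat -> C) n : (if n is n'.+1 then n'.+1%:R * u n'.+1 else 0) = n%:R * u n.
Proof. by case: n => //; rewrite mul0r. Qed.

Lemma wseq_rec n :
  2%:R * (n.+1%:R * wnum n.+1) + - 1 * (n%:R * wnum n) = - 1 * wnum n + 2%:R * wden n /\
  2%:R * (n.+1%:R * wden n.+1) + - 1 * (n%:R * wden n) = - a * wnum n.
Proof.
have nz k : (k.+1%:R : C) != 0 by rewrite pnatr_eq0.
rewrite /wnum /wden /=; have := nz n; have := nz 1%N => *.
by split; field.
Qed.

Lemma wseq_low : [/\ [/\ wnum 0 = 0, wnum 1 = 1 & wnum 2 = 0],
   [/\ wnum 3 = - a / 12%:R, wnum 4 = - a / 24%:R & wnum 5 = - 3%:R / 160%:R * a + a ^+ 2 / 480%:R],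
   [/\ wden 0 = 1, wden 1 = 0 & wden 2 = - a / 4%:R] & wden 3 = - a / 12%:R /\ wden 4 = - a / 32%:R + a ^+ 2 / 96%:R].
Proof. by rewrite /wnum /wden /=; split; split; field. Qed.

Lemma leibniz1 (u v : nat -> C) :
  1`!%:R * (\sum_(i < 2) u i / i`!%:R * (v (1 - i)%N / (1 - i)`!%:R)) = u 0%N * v 1%N + u 1%N * v 0%N.
Proof.
have f1 : 1`! = 1%N by [].
by rewrite big_ord_recl big_ord1 /= /bump /= subn0 subnn f1 fact0 !divr1 mul1r.
Qed.

Lemma quotient_low (u : nat -> C) :
  (forall j, wnum j = \sum_(i < j.+1) (u i / i`!%:R) * wden (j - i)) ->
  [/\ u 0%N = 0, u 1%N = 1 & u 2%N = 0] /\ [/\ u 3%N = a, u 4%N = a & u 5%N = 3%:R / 2%:R * a + 4%:R * a ^+ 2].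
Proof.
move=> E; have [[e0 e1 e2] [e3 e4 e5] [d0 d1 d2] [d3 d4]] := wseq_low.
have [f1 f2 f3 f4 f5] : [/\ 1`! = 1, 2`! = 2, 3`! = 6, 4`! = 24 & 5`! = 120]%N by [].
have k0 : u 0%N = 0 by have := E 0%N; rewrite big_ord1 e0 fact0 divr1 subnn d0 mulr1 => <-.
have k1 : u 1%N = 1.
  have := E 1%N; rewrite !big_ord_recl big_ord0 /= /bump /= ?subnn ?subn0 f1 k0 mul0r mul0r add0r addr0.
  by rewrite d0 e1 divr1 mulr1 => <-.
have k2 : u 2%N = 0.
  have := E 2%N; rewrite !big_ord_recl big_ord0 /= /bump /= f1 f2 k0 k1 -[(2 - (1 + 0))%N]/1%N -[(2 - (1 + (1 + 0)))%N]/0%N.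
  rewrite d0 d1 e2 => h; have two0 : 2%:R != 0 :> C by rewrite pnatr_eq0.
  by rewrite -[LHS](divfK two0) (_ : u 2%N / 2%:R = 0) ?mul0r // h; ring.
have k3 : u 3%N = a.
  have := E 3%N; rewrite !big_ord_recl big_ord0 /= /bump /= f1 f2 f3 k0 k1 k2.
  rewrite -[(3 - (1 + 0))%N]/2%N -[(3 - (1 + (1 + 0)))%N]/1%N -[(3 - (1 + (1 + (1 + 0))))%N]/0%N.
  rewrite d0 d2 e3 => h; have six0 : 6%:R != 0 :> C by rewrite pnatr_eq0.
  have {}h : u 3%N / 6%:R = - a / 12%:R + a / 4%:R by rewrite h; field.
  by rewrite -[LHS](divfK six0) h; field.
have k4 : u 4%N = a.
  have := E 4%N; rewrite !big_ord_recl big_ord0 /= /bump /= f1 f2 f3 f4 k0 k1 k2 k3.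
  rewrite -[(4 - (1 + 0))%N]/3%N -[(4 - (1 + (1 + 0)))%N]/2%N -[(4 - (1 + (1 + (1 + 0))))%N]/1%N -[(4 - (1 + (1 + (1 + (1 + 0)))))%N]/0%N.
  rewrite d0 d1 d3 e4 => h; have z : 24%:R != 0 :> C by rewrite pnatr_eq0.
  have {}h : u 4%N / 24%:R = - a / 24%:R + a / 12%:R by rewrite h; field.
  by rewrite -[LHS](divfK z) h; field.
split=> //; split=> //.
have := E 5%N; rewrite !big_ord_recl big_ord0 /= /bump /= f1 f2 f3 f4 f5 k0 k1 k2 k3 k4.
rewrite -[(5 - (1 + 0))%N]/4%N -[(5 - (1 + (1 + 0)))%N]/3%N -[(5 - (1 + (1 + (1 + 0))))%N]/2%N.
rewrite -[(5 - (1 + (1 + (1 + (1 + 0)))))%N]/1%N -[(5 - (1 + (1 + (1 + (1 + (1 + 0))))))%N]/0%N.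
rewrite d0 d1 d2 d4 e5 => h; have z : 120%:R != 0 :> C by rewrite pnatr_eq0.
have {}h : u 5%N / 120%:R = - 3%:R / 160%:R * a + a ^+ 2 / 480%:R - a / 6%:R * (- a / 4%:R) + a / 32%:R - a ^+ 2 / 96%:R.
  by rewrite h; field.
by rewrite -[LHS](divfK z) h; field.
Qed.

Lemma riccati (x k k' w w' : C) : 2%:R * (k * w' + k' * w) + - 1 * (x * (k * w' + k' * w)) = - 1 * (k * w) + 2%:R * w ->
  2%:R * w' + - 1 * (x * w') = - a * (k * w) -> w != 0 -> (2%:R - x) * k' = a * k ^+ 2 - k + 2%:R.
Proof.
move=> E1 E2 nz; apply: (mulIf nz).
have -> : (2%:R - x) * k' * w = 2%:R * (k * w' + k' * w) + - 1 * (x * (k * w' + k' * w)) -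
    k * (2%:R * w' + - 1 * (x * w')) by ring.
by rewrite E1 E2; ring.
Qed.

(** The Riccati equation for k is the tangency condition of the first of the two fields. *)
Lemma riccati_tangent (x y k k' : C) (u := a^-1 * k - a^-1 * x + y * k) :
  (2%:R - x) * k' = a * k ^+ 2 - k + 2%:R ->
  u / 2%:R - y = (a^-1 * k' - a^-1 + y * k') * (x / 2%:R - 1) + k * (x / 2%:R + a / 2%:R * u).
Proof.
move=> e.
have -> : (a^-1 * k' - a^-1 + y * k') * (x / 2%:R - 1) =
  - (a^-1 + y) / 2%:R * ((2%:R - x) * k') - a^-1 * (x / 2%:R - 1) by field.
by rewrite e /u; field.
Qed.

Lemma vertical_tangent (x y k d : C) :
  - x - a * (a^-1 * k - a^-1 * x + y * k) = d * 0 + k * (- 1 - a * y).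
Proof. by field. Qed.

Lemma second_model : exists (S : graphed R) p, [/\ in_B21 S, homogeneous S, graph S p &
    moduli_point S p = \col_i tnth [tuple a; 0; 3%:R / 2%:R + 4%:R * a; a; 0] i].
Proof.
have K0 : 0 < nrm a + 2%:R by apply: ltr_wpDl; rewrite ?nrm_ge0.
have [w1 [t1 p1 q1]] := @pser_ex R wnum 1 _ K0 (fun n => (wseq_bound n).1).
have [w2 [t2 p2 q2]] := @pser_ex R wden 1 _ K0 (fun n => (wseq_bound n).2).
have h1 : holomorphic_at (xf w1) 0 := taylor_holo t1.
have h2 : holomorphic_at (xf w2) 0 := taylor_holo t2.
have x1 j : xd w1 j 0 = j`!%:R * wnum j := xd_ser j t1.
have x2 j : xd w2 j 0 = j`!%:R * wden j := xd_ser j t2.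
have [[e0 e1 e2] [e3 e4 e5] [d0 d1 d2] [d3 d4]] := wseq_low.
pose k x := w1 x / w2 x; pose al x := a^-1 * k x - a^-1 * x.
have nw0 : xf w2 0 != 0.
  have := x2 0%N; rewrite xd0 => e; rewrite /xf mxE; move: e; rewrite mxE => ->.
  by rewrite d0 mulr1 oner_neq0.
have hk h : holomorphic_at (xf w1) h -> holomorphic_at (xf w2) h -> xf w2 h != 0 -> holomorphic_at (xf k) h.
  by move=> k1 k2 nz; exact: holoM k1 (holoV k2 nz).
have hal h : holomorphic_at (xf k) h -> holomorphic_at (xf al) h.
  by move=> kh; exact: holoB (holoM (holo_cst a^-1 h) kh) (holoM (holo_cst a^-1 h) (holo_id h)).
have xal j h : holomorphic_at (xf k) h -> xd al j h = a^-1 * xd k j h - a^-1 * xd (fun x => x) j h.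
  move=> kh; rewrite -mulNr; apply: (xd_lin kh (holo_id h) (hal h kh)).
  by apply: filterE => u; rewrite /xf /al mulNr.
have mulk h : xf w2 h != 0 -> holomorphic_at (xf w2) h -> \forall u \near h, xf w1 u = xf k u * xf w2 u.
  by move=> nz k2; apply: filterS (holo_nz k2 nz) => u nu; rewrite /xf /k divfK.
have hk0 : holomorphic_at (xf k) 0 by exact: hk.
have ode : \forall h \near (0 : 'cV[C]_2), (2%:R - (h : 'cV[C]_2) 0 0) * xd k 1 h =
    a * k (h 0 0) ^+ 2 - k (h 0 0) + 2%:R.
  pose Q (h : 'cV[C]_2) := (((pser wnum (h 0 0) (xf w1 h) /\ pser (fun n => n.+1%:R * wnum n.+1) (h 0 0) (partial 0 (xf w1) h)) /\
    (pser wden (h 0 0) (xf w2 h) /\ pser (fun n => n.+1%:R * wden n.+1) (h 0 0) (partial 0 (xf w2) h))) /\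
    ((holomorphic_at (xf w1) h /\ holomorphic_at (xf w2) h))) /\ xf w2 h != 0.
  have nQ : nbhs (0 : 'cV[C]_2) Q.
    apply: filterI; last exact: holo_nz h2 nw0.
    apply: filterI; apply: filterI; [exact: filterI p1 q1|exact: filterI p2 q2|exact: holo_open h1|exact: holo_open h2].
  apply: filterS nQ => h [[[[a1 b1] [a2 b2]] [k1 k2]] nz].
  have r1 := pserD (pserZ 2%:R b1) (pserZ (- 1) (pserX b1)).
  have s1 := pserD (pserZ (- 1) a1) (pserZ 2%:R a2).
  have r2 := pserD (pserZ 2%:R b2) (pserZ (- 1) (pserX b2)).
  have s2 := pserZ (- a) a1.
  have E1 : 2%:R * xd w1 1 h + - 1 * (h 0 0 * xd w1 1 h) = - 1 * w1 (h 0 0) + 2%:R * w2 (h 0 0).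
    rewrite xd1; apply: pser_unique s1; move: r1; congr pser; apply/funext => n.
    by rewrite shift_deriv; have [<- _] := wseq_rec n.
  have E2 : 2%:R * xd w2 1 h + - 1 * (h 0 0 * xd w2 1 h) = - a * w1 (h 0 0).
    rewrite xd1; apply: pser_unique s2; move: r2; congr pser; apply/funext => n.
    by rewrite shift_deriv; have [_ <-] := wseq_rec n.
  have := xd_mul (hk h k1 k2 nz) k2 k1 1 (mulk h nz k2).
  rewrite (leibniz1 (fun i => xd k i h) (fun i => xd w2 i h)) !xd0 => E3.
  have w1E : w1 (h 0 0) = k (h 0 0) * w2 (h 0 0) by rewrite /k divfK.
  by move: E1 E2; rewrite E3 w1E => E1 E2; exact: riccati E1 E2 nz.
have E j := xd_mul hk0 h2 h1 j (mulk 0 nw0 h2).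
have [[k0 k1 k2] [k3 k4 k5]] : [/\ xd k 0 0 = 0, xd k 1 0 = 1 & xd k 2 0 = 0] /\
    [/\ xd k 3 0 = a, xd k 4 0 = a & xd k 5 0 = 3%:R / 2%:R * a + 4%:R * a ^+ 2].
  apply: (@quotient_low (fun i => xd k i 0)) => j.
  have nz i : (i`!%:R : C) != 0 by rewrite pnatr_eq0 -lt0n fact_gt0.
  apply: (mulfI (nz j)); rewrite -x1 E; congr (_ * _); apply: eq_bigr => i _; rewrite x2; congr (_ * _).
  by rewrite mulrC mulKf.
have A0 j : xd al j 0 = a^-1 * xd k j 0 - a^-1 * (j == 1%N)%:R.
  by rewrite (xal _ _ hk0) xd_id; case: j => [|j] //=; rewrite mxE.
pose X := aff3 (2%:R^-1, 0, 0) (2%:R^-1, 0, a / 2%:R) (0, - 1, 2%:R^-1) (- 1, 0, 0).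
pose Y := aff3 (0, 0, 0) (0, - a, 0) (- 1, 0, - a) (0, - 1, 0).
have aX w : [/\ aff X w 0 0 = w 0 0 / 2%:R - 1, aff X w 1 0 = w 0 0 / 2%:R + a / 2%:R * w ord_max 0 &
    aff X w ord_max 0 = w ord_max 0 / 2%:R - w 1 0].
  by rewrite !affE !mxE /=; split; ring.
have aY w : [/\ aff Y w 0 0 = 0, aff Y w 1 0 = - 1 - a * w 1 0 & aff Y w ord_max 0 = - w 0 0 - a * w ord_max 0].
  by rewrite !affE !mxE /=; split; ring.
have [|||||S [p [g1 g2 g3 g4]]] := @ruled_model R al k X Y (hal 0 hk0) hk0.
- rewrite !A0 k0 k1 k2 k3 k4 /=; split; by rewrite ?mulr0 ?subr0 ?mulVf // mulr1 subrr.
- by [].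
- apply: filterS (filterI ode (holo_open hk0)) => h [e kh].
  rewrite /tangent_at; have [-> -> ->] := aX (pnt h (ruled_fn al k h)).
  rewrite point0 point1 point2 (xal _ _ kh) xd_id /= mulr1.
  exact: riccati_tangent e.
- apply: filterE => h; rewrite /tangent_at; have [-> -> ->] := aY (pnt h (ruled_fn al k h)).
  rewrite point0 point1 point2; exact: vertical_tangent.
- by rewrite !mxE /= mul0r subr0 mulN1r opprK oner_neq0.
exists S, p; split=> //; rewrite g4 k3 k4 A0 k5 /= mulr0 subr0.
have -> : a^-1 * (3%:R / 2%:R * a + 4%:R * a ^+ 2) = 3%:R / 2%:R + 4%:R * a by field.
by [].
Qed.
End Second.

(** The first family covers the line where all invariants but the third vanish, the
    second family the other line outside their intersection. *)
Lemma moduli_models (v : 'cV[C]_5) : moduli_variety v -> exists (S : graphed R) p,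
  [/\ in_B21 S, homogeneous S, graph S p & moduli_point S p = v].
Proof.
have first c : v = \col_i tnth [tuple 0; 0; c; 0; 0] i -> exists (S : graphed R) p,
    [/\ in_B21 S, homogeneous S, graph S p & moduli_point S p = v].
  by move=> ->; have := first_model (c - 1); rewrite subrK.
rewrite moduli_varietyE => -[[h0 h1 h3 h4]|[h1 h4 h3 h2]].
  by apply: (first (v (o5 (isT : (2 < 5)%N)) 0)); apply/col5E.
have [z|nz] := eqVneq (v (o5 (isT : (0 < 5)%N)) 0) 0.
  by apply: (first (v (o5 (isT : (2 < 5)%N)) 0)); apply/col5E; rewrite h3 z.
have [S [p [b1 b2 b3 b4]]] := second_model nz; exists S, p; split=> //.
by rewrite b4; apply/esym/col5E.
Qed.
End Models.

Theorem theorem1p2 (R : realType) :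
  (* (1) *)
  ((forall (S : graphed R) (p : 'cV[Cx R]_3), in_B21 S -> graph S p ->
      exists! gG : affine R * (nat -> nat -> Cx R), normal4 S p gG.1 gG.2) /\
   (forall j k : nat, (4 <= j + k)%N -> is_diff_invariant (@Icoef R j k))) /\
  (* (2) *)
  [/\ (forall s : 'I_3 * nat * nat,
         is_diff_invariant (@derived_generator R s)),
      (forall (n : nat) (D : set (jet_space R n)) (J : jet_space R n -> Cx R),
         diff_invariant D J -> locally_generated D J) &
      (forall (S : graphed R) (p : 'cV[Cx R]_3), in_B21 S -> graph S p ->
         Icoef 4 1 S p = - 8 * Icoef 3 1 S p ^+ 2 + 2 * Icoef 5 0 S p * Icoef 3 1 S p
           + inv_deriv 0 S (Icoef 3 1 S) p + 7 / 2 * Icoef 2 2 S p - 2 * Icoef 3 1 S p)] /\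
  (* (3) *)
  [/\ (forall (S : graphed R), in_B21 S -> homogeneous S ->
         (forall (j k : nat) (p q : 'cV[Cx R]_3), graph S p -> graph S q ->
            Icoef j k S p = Icoef j k S q) /\
         (forall p : 'cV[Cx R]_3, graph S p ->
            moduli_variety (moduli_point S p))),
      (forall (S S' : graphed R) (p p' : 'cV[Cx R]_3),
         in_B21 S -> homogeneous S -> graph S p ->
         in_B21 S' -> homogeneous S' -> graph S' p' ->
         (germ_equiv S p S' p' <-> moduli_point S p = moduli_point S' p')),
      (forall v : 'cV[Cx R]_5, moduli_variety v ->
         exists (S : graphed R) (p : 'cV[Cx R]_3),
           [/\ in_B21 S, homogeneous S, graph S p & moduli_point S p = v]) &
      variety_of_dim (@moduli_variety R) 1].
Proof.
split; [split|split].
- move=> S p hb hp; have [g [G n]] := in_B21_ex hb hp.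
  exists (g, G); split=> // -[g' G'] n'.
  by have [-> ->] := normal4_unique (branch_surface (conj hb hp)) hp n n'.
- by move=> j k _; exact: jinv_diff_invariant (jinv_Icoef R j k).
- split.
  + by move=> s; exact: jinv_diff_invariant (jinv_derived R s).
  + exact: diff_invariant_generated.
  + by move=> S p hb hp; apply: I41_formula.
split.
- move=> S hb hH; split=> [j k p q hp hq|p hp].
    exact: homogeneous_Icoef.
  by apply: homogeneous_moduli.
- by move=> S S' p p' hb hH hp hb' hH' hp'; apply: moduli_equiv.
- exact: moduli_models.
- exact: moduli_dim.
Qed.
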